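(* Let $M$ be a closed smooth manifold of real dimension $2n$. (1) If there are an almost-complex structure $J_M$ on $M$ and an almost-complex structure $\hat{J}$ on $\mathbb{R}^{2n+2}$ such that there is a pseudo-holomorphic embedding $f:(M,J_M)\hookrightarrow(\mathbb{R}^{2n+2},\hat{J})$, then $M$ is parallelizable. (2) If $M$ is parallelizable and $M$ smoothly embeds into $\mathbb{R}^{2n+2}$, then there exist an almost-complex structure $J_M$ on $M$ and an almost-complex structure $\hat{J}$ on $\mathbb{R}^{2n+2}$ for which there is a pseudo-holomorphic embedding $f:(M,J_M)\hookrightarrow(\mathbb{R}^{2n+2},\hat{J})$.
   Context: An almost-complex structure on a smooth manifold $M$ is a smooth bundle automorphism $J_M:TM\to TM$ with $J_M^2=-\mathrm{id}$; it is not required to be integrable. The pair $(M,J_M)$ is called an almost-complex manifold. A smooth embedding $f:M\hookrightarrow N$ between almost-complex manifolds $(M,J_M)$ and $(N,J_N)$ is a pseudo-holomorphic embedding if $Tf\circ J_M=J_N\circ Tf$. A smooth manifold is parallelizable if its tangent bundle is trivial. In the paper the manifolds $M$ under study are closed (compact without boundary). *)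

(* Defs.v *)
From HB Require Import structures.
From mathcomp Require Import all_boot all_order all_algebra.
From mathcomp Require Import all_classical all_reals all_analysis.
Import Order.TTheory GRing.Theory Num.Theory.
Import numFieldNormedType.Exports.

Set Implicit Arguments.
Unset Strict Implicit.
Unset Printing Implicit Defensive.

Local Open Scope classical_set_scope.
Local Open Scope ring_scope.

(* In finite dimension the differential ['d f x] depends on x in a C^k way iff
   each of its values ['d f x v] does, so no topology on linear maps is needed.
   U is meant to be open. *)
Fixpoint Ck_on (R : realType) (V W : normedModType R) (k : nat) (U : set V)
    (f : V -> W) : Prop :=
  if k is k'.+1 then
    (forall x, U x -> differentiable f x) /\
    (forall v : V, Ck_on k' U (fun x => 'd f x v))
  else forall x, U x -> {for x, continuous f}.

Definition smooth_on (R : realType) (V W : normedModType R) (U : set V)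
  (f : V -> W) : Prop := forall k, Ck_on k U f.

(* A smooth manifold without boundary, given by an atlas which need not be
   maximal. [chart i] is meaningful on [dom i] only and [chart_inv i] on the
   image of [dom i] only. M may be empty (then the atlas has no chart at all)
   or disconnected. *)
Record manifold (R : realType) (m : nat) := Manifold {
  carrier :> topologicalType ;
  mfd_hausdorff : hausdorff_space carrier ;
  mfd_countable : @second_countable carrier ;
  index : Type ;
  dom : index -> set carrier ;
  chart : index -> carrier -> 'rV[R]_m ;
  chart_inv : index -> 'rV[R]_m -> carrier ;
  dom_open : forall i, open (dom i) ;
  dom_cover : forall p, exists i, dom i p ;
  codom_open : forall i, open (chart i @` dom i) ;
  chartK : forall i, {in dom i, cancel (chart i) (chart_inv i)} ;
  chart_continuous : forall i p, dom i p -> {for p, continuous (chart i)} ;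
  chart_inv_continuous : forall i x, (chart i @` dom i) x ->
    {for x, continuous (chart_inv i)} ;
  chart_compat : forall i j,
    smooth_on (chart i @` (dom i `&` dom j)) (chart j \o chart_inv i)
}.

Arguments dom {R m M} : rename.
Arguments chart {R m M} : rename.
Arguments chart_inv {R m M} : rename.
Arguments index {R m} M : rename.

Definition closed_manifold (R : realType) (m : nat) (M : manifold R m) : Prop :=
  compact [set: M].

Record smooth_map (R : realType) (m k : nat) (M : manifold R m)
    (N : manifold R k) := SmoothMap {
  smooth_fun :> M -> N ;
  smooth_fun_continuous : continuous smooth_fun ;
  smooth_fun_smooth : forall (i : index M) (j : index N),
    smooth_on (chart i @` (dom i `&` smooth_fun @^-1` dom j))
              (chart j \o smooth_fun \o chart_inv i)
}.

Section Tangent.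
Context {R : realType} {m : nat} {M : manifold R m}.

(* A tangent vector at p is the family of its coordinates in all charts around
   p, related by the differentials of the transition maps; coordinates in the
   other charts are set to 0. *)
Definition is_tangent (p : M) (v : index M -> 'rV[R]_m) : Prop :=
  (forall i, ~ dom i p -> v i = 0) /\
  (forall i j, dom i p -> dom j p ->
     v j = 'd (chart j \o chart_inv i) (chart i p) (v i)).

Definition tangent_pred (p : M) : pred (index M -> 'rV[R]_m) :=
  fun v => `[< is_tangent p v >].

Record tangent (p : M) := Tangent {
  tcoord :> index M -> 'rV[R]_m ;
  tcoordP : tangent_pred p tcoord
}.

HB.instance Definition _ (p : M) := [isSub for @tcoord p].
HB.instance Definition _ (p : M) := [Choice of tangent p by <:].

Lemma tangent_submod_closed (p : M) : submod_closed (tangent_pred p).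
Proof.
split.
  apply/asboolP; split=> // i j _ _; by rewrite /GRing.zero /= linear0.
move=> a u v /asboolP[u0 uE] /asboolP[v0 vE]; apply/asboolP; split.
  move=> i hi; transitivity (a *: u i + v i) => //.
  by rewrite u0 // v0 // scaler0 addr0.
move=> i j hi hj; transitivity (a *: u j + v j) => //.
by rewrite (uE i j hi hj) (vE i j hi hj) -linearP.
Qed.

HB.instance Definition _ (p : M) :=
  GRing.SubChoice_isSubLmodule.Build R (index M -> 'rV[R]_m) (tangent_pred p)
    (tangent p) (GRing.submod_closed_semi (tangent_submod_closed p)).

End Tangent.

Lemma near_eq_is_diff (R : realType) (V W : normedModType R) (f g : V -> W) x :
  (\forall y \near x, f y = g y) -> differentiable g x ->
  differentiable f x /\ 'd f x = 'd g x :> (V -> W).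
Proof.
move=> fg dg.
have fgx : f x = g x by exact: nbhs_singleton fg.
have E : f \o shift x = cst (f x) + 'd g x +o_ (0 : V) id.
  have /eqaddoP H := diff_locally dg.
  apply/eqaddoP => e e0; have {}H := H e e0.
  near=> h.
  have -> : (f \o shift x - (cst (f x) + 'd g x)) h =
            (g \o shift x - (cst (g x) + 'd g x)) h.
    rewrite !fctE /= fgx; congr (_ - _); near: h.
    have : (shift x h @[h --> (0:V)]) --> x.
      by rewrite -[X in _ --> X]add0r; apply: cvgD => //; exact: cvg_cst.
    by move=> /(_ _ fg).
  by near: h.
have dfE : 'd f x = 'd g x :> (V -> W).
  by apply: diff_unique => //; exact: diff_continuous.
split=> //; apply/diff_locallyP; split; first by rewrite dfE; exact: diff_continuous.
by rewrite dfE.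
Unshelve. all: by end_near. Qed.

Lemma diff_near_comp (R : realType) (U V W : normedModType R) (f : U -> V)
    (g : V -> W) (h : U -> W) x y : f x = y ->
  (\forall z \near x, h z = g (f z)) ->
  differentiable f x -> differentiable g y ->
  forall v, 'd h x v = 'd g y ('d f x v).
Proof.
move=> <- E df dg v.
have [_ H] := near_eq_is_diff E (differentiable_comp df dg).
by rewrite H diff_comp.
Qed.

Section Charts.
Context {R : realType} {m : nat} {M : manifold R m}.
Implicit Types (p : M) (i : index M).

Lemma chart_invK i p : dom i p -> chart_inv i (chart i p) = p.
Proof. by move=> ip; rewrite chartK ?inE. Qed.

Lemma near_chartK i p : dom i p ->
  \forall x \near chart i p, chart i (chart_inv i x) = x.
Proof.
move=> ip; have : nbhs (chart i p) (chart i @` dom i).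
  by apply: open_nbhs_nbhs; split; [exact: codom_open|exists p].
by apply: filterS => _ [q iq <-]; rewrite chart_invK.
Qed.

Lemma near_chart_inv i p (A : set M) : dom i p -> nbhs p A ->
  \forall x \near chart i p, A (chart_inv i x).
Proof.
move=> ip Ap; apply: (chart_inv_continuous (i := i)); first by exists p.
by rewrite chart_invK.
Qed.

Lemma near_dom i p : dom i p -> nbhs p (dom i).
Proof. by move=> ip; apply: open_nbhs_nbhs; split=> //; exact: dom_open. Qed.

Lemma transition_differentiable i j p : dom i p -> dom j p ->
  differentiable (chart j \o chart_inv i) (chart i p).
Proof.
by move=> ip jp; have [+ _] := chart_compat i j 1; apply; exists p.
Qed.

End Charts.

Section TangentMap.
Context {R : realType} {m k : nat} {M : manifold R m} {N : manifold R k}.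
Variable f : smooth_map M N.

Lemma local_differentiable (i : index M) (j : index N) p :
  dom i p -> dom j (f p) ->
  differentiable (chart j \o f \o chart_inv i) (chart i p).
Proof.
by move=> ip jp; have [+ _] := smooth_fun_smooth f i j 1; apply; exists p.
Qed.

Definition push_coord (p : M) (i : index M) (u : 'rV[R]_m) (j : index N) :
    'rV[R]_k :=
  if `[< dom j (f p) >] then 'd (chart j \o f \o chart_inv i) (chart i p) u
  else 0.

Lemma push_tangent (p : M) (i : index M) (u : 'rV[R]_m) : dom i p ->
  tangent_pred (f p) (push_coord p i u).
Proof.
move=> ip; apply/asboolP; split=> [j nj|j l jp lp].
  by rewrite /push_coord asboolF.
rewrite /push_coord !asboolT //.
apply: (diff_near_comp (f := chart j \o f \o chart_inv i)
  (g := chart l \o chart_inv j)).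
- by rewrite /= chart_invK.
- have := near_chart_inv ip (smooth_fun_continuous (near_dom jp)).
  by apply: filterS => x /= jx; rewrite chart_invK.
- exact: local_differentiable.
- exact: transition_differentiable.
Qed.

(* Defined through some chart around p; independent of it by [tangent_mapE]. *)
Definition tangent_map (p : M) (v : tangent p) : tangent (f p) :=
  let ci := cid (dom_cover p) in
  Tangent (push_tangent (v (projT1 ci)) (projT2 ci)).

Lemma tangent_mapE (p : M) (v : tangent p) (i : index M) (j : index N) :
  dom i p -> dom j (f p) ->
  tangent_map v j = 'd (chart j \o f \o chart_inv i) (chart i p) (v i).
Proof.
move=> ip jp; rewrite /tangent_map /=; case: cid => l lp /=.
rewrite /push_coord asboolT //.
have /asboolP[_ /(_ i l ip lp) ->] := tcoordP v.
symmetry; apply: (diff_near_comp (f := chart l \o chart_inv i)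
  (g := chart j \o f \o chart_inv l)).
- by rewrite /= chart_invK.
- have := near_chart_inv ip (near_dom lp).
  by apply: filterS => x /= lx; rewrite chart_invK.
- exact: transition_differentiable.
- exact: local_differentiable.
Qed.

(* With continuity of f, the second clause makes f a homeomorphism onto its
   image with the subspace topology. *)
Definition smooth_embedding : Prop :=
  [/\ injective f,
      (forall U, open U -> exists2 V, open V & f @` U = range f `&` V) &
      forall p : M, injective (@tangent_map p)].

End TangentMap.

Lemma tangent_coord_unique (R : realType) (m : nat) (M : manifold R m) (p : M)
    (i : index M) (u : 'rV[R]_m) :
  dom i p -> exists! v : tangent p, v i = u.
Proof.
move=> ip.
have idS : forall i j : index M, smooth_on (chart i @` (dom i `&` id @^-1` dom j))
    (chart j \o id \o chart_inv i) by move=> i' j'; exact: chart_compat.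
pose I := @SmoothMap R m m M M id (fun x A => id) idS.
have H := @push_tangent R m m M M I p i u ip.
exists (Tangent H); split=> [|v vi].
  rewrite /= /push_coord asboolT //=.
  have [_ ->] := near_eq_is_diff (g := @id 'rV[R]_m) (near_chartK ip) (ex_diff (f:=id)).
  by rewrite diff_val.
apply/val_inj/funext => j /=; rewrite /push_coord; case: asboolP => [jp|njp].
  by have /asboolP[_ /(_ i j ip jp) ->] := tcoordP v; rewrite vi.
by have /asboolP[/(_ j njp) ->] := tcoordP v.
Qed.

Lemma smooth_on_cst (R : realType) (V W : normedModType R) (U : set V) (a : W) :
  smooth_on U (cst a : V -> W).
Proof.
move=> k; elim: k a => [|k IH] a /=; first by move=> x _; exact: cst_continuous.
split=> [x _|v]; first exact: differentiable_cst.
rewrite (_ : (fun x => _) = cst 0); first exact: IH.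
by apply/funext => x; rewrite diff_cst.
Qed.

Lemma smooth_on_id (R : realType) (V : normedModType R) (U : set V) :
  smooth_on U (@id V).
Proof.
case=> [|k] /=; first by move=> x _ A.
split=> [x _|v]; first exact: ex_diff.
rewrite (_ : (fun x => _) = cst v); first exact: smooth_on_cst.
by apply/funext => x; rewrite diff_val.
Qed.

Lemma rV_second_countable (R : realType) m : @second_countable 'rV[R]_m.
Proof.
pose B (cn : 'rV[rat]_m * nat) : set 'rV[R]_m :=
  ball (map_mx ratr cn.1 : 'rV[R]_m) (cn.2.+1%:R^-1).
exists (range B); first exact: card_le_trans (card_image_le _ _) (countableP _).
split.
  by move=> _ [cn _ <-]; exact: ball_open.
move=> x A /nbhs_ballP[e /= e0 eA].
have [n hn] : exists n, n.+1%:R^-1 < e / 2 :> R.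
  have := @near_infty_natSinv_lt R (PosNum (divr_gt0 e0 (ltr0Sn R 1))).
  by move=> [N _ hN]; exists N; exact: (hN N (leqnn N)).
have n0 : 0 < n.+1%:R^-1 :> R by rewrite invr_gt0.
have hq (i j : _) : exists q : rat, ball (x i j) n.+1%:R^-1 (ratr q : R).
  have [r [/= h1 [q _ h2]]] := @dense_rat R (ball (x i j) n.+1%:R^-1)
    (ex_intro _ (x i j) (ballxx _ n0)) (ball_open _ _).
  by exists q; rewrite h2.
pose c : 'rV[rat]_m := \matrix_(i, j) projT1 (cid (hq i j)).
have xc : ball x n.+1%:R^-1 (map_mx ratr c : 'rV[R]_m).
  by split=> // i j; rewrite !mxE; case: cid.
exists (B (c, n)).
  by split; [exists (c, n)|exact: ball_sym].
move=> y /= By; apply: eA; rewrite [e]splitr.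
apply: (@ball_triangle _ _ (map_mx ratr c : 'rV[R]_m)).
  by apply: le_ball xc; exact: ltW.
by apply: le_ball By; exact: ltW.
Qed.


Definition euclidean (R : realType) (m : nat) : manifold R m.
Proof.
refine (@Manifold R m 'rV[R]_m (@norm_hausdorff _ _) (@rV_second_countable R m)
  unit (fun=> setT) (fun=> id) (fun=> id) _ _ _ _ _ _ _).
- by move=> _; exact: openT.
- by move=> p; exists tt.
- by move=> _; rewrite image_id; exact: openT.
- by move=> _ p _.
- by move=> _ p _ A.
- by move=> _ p _ A.
- by move=> _ _; exact: smooth_on_id.
Defined.

(* [e i p] and [e' i p] are the coordinates, in local trivialisations over the
   chart domains, of the fibres over p of two bundles over M. The fibrewise map
   phi is smooth when its local expressions (x, u) |-> (x, F (x, u)) are. *)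
Definition smooth_fibrewise (R : realType) (m r s : nat) (M : manifold R m)
    (E E' : M -> Type)
    (e : index M -> forall p, E p -> 'rV[R]_r)
    (e' : index M -> forall p, E' p -> 'rV[R]_s)
    (phi : forall p, E p -> E' p) : Prop :=
  forall i : index M, exists2 F : 'rV[R]_m * 'rV[R]_r -> 'rV[R]_s,
    smooth_on ((chart i @` dom i) `*` setT) F &
    forall p, dom i p -> forall v : E p,
      e' i p (phi p v) = F (chart i p, e i p v).

Section Bundle.
Context {R : realType} {m : nat} (M : manifold R m).

Definition tangent_coord (i : index M) (p : M) (v : tangent p) : 'rV[R]_m := v i.

Definition trivial_coord (i : index M) (p : M) (u : 'rV[R]_m) : 'rV[R]_m := u.

Record almost_complex := AlmostComplex {
  acs :> forall p : M, {linear tangent p -> tangent p} ;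
  acs_smooth : smooth_fibrewise tangent_coord tangent_coord acs ;
  acs_sqr : forall (p : M) (v : tangent p), acs p (acs p v) = - v
}.

Definition parallelizable : Prop :=
  exists (Phi : forall p : M, {linear tangent p -> 'rV[R]_m})
         (Psi : forall p : M, 'rV[R]_m -> tangent p),
    [/\ forall p, cancel (Phi p) (Psi p),
        forall p, cancel (Psi p) (Phi p),
        smooth_fibrewise tangent_coord trivial_coord Phi &
        smooth_fibrewise trivial_coord tangent_coord Psi].

End Bundle.

Definition pseudo_holomorphic_embedding (R : realType) (m k : nat)
    (M : manifold R m) (N : manifold R k)
    (JM : almost_complex M) (JN : almost_complex N) (f : smooth_map M N) :=
  smooth_embedding f /\
  forall (p : M) (v : tangent p),
    tangent_map f (JM p v) = JN (f p) (tangent_map f v).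

(* Main.v *)
(** Matrices act on row vectors; [Q] is the orthogonal projection onto the normal
    spaces of [f(M)] in R^(m+2).

    A complex structure [K] on the normal planes yields a nowhere zero normal field
    [nu]: the line bundle on R^(m+2) that is the normal bundle near [f(M)], and is
    trivialised elsewhere by the tautological section [y - f(pi y)], is transported
    along the segments [t f(p)].

    (1) A holomorphic [f] gives [K = J Q]. Trivialising [J] along the same segments
    turns [nu] into a map from [M] to R^(m+2) minus 0, which is null-homotopic by
    Sard. So the complex line of [nu] is carried to a constant one, and a complement
    of the latter trivialises the tangent bundle.

    (2) A tangent frame orients the normal planes, hence [K] and [nu]. As [nu] is
    null-homotopic, [nu K] becomes a map [h] from [M] to R^(m+1) minus 0, homotopic to
    [- h] by rotation through a frame vector. Then [h] is null-homotopic: the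
    preimages of a direction are collected in one chart, where [h] is deformed to
    [z |-> z ^ d] or its conjugate, and [d <> 0] is impossible since a reflection,
    isotopic to [- 1] as m is even, reverses the degree of ([h], normal coordinate)
    on a tube around [f(M)] (degrees enter through the divergence form of
    [det (jac S)]). So a product of matrices close to 1 carries a constant plane to
    the normal planes; its factors are smoothed and cut off, and after a shear the
    constant complex structure is conjugated to one preserving the tangent spaces. *)
From HB Require Import structures.
From mathcomp Require Import all_boot all_order all_algebra.
From mathcomp Require Import fingroup perm.
From mathcomp Require Import all_classical all_reals all_analysis.
From mathcomp Require Import ring lra.
Require Import Defs.
Import Order.TTheory GRing.Theory Num.Theory.
Import numFieldNormedType.Exports.
Set Implicit Arguments.
Unset Strict Implicit.
Unset Printing Implicit Defensive.
Local Open Scope classical_set_scope.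
Local Open Scope ring_scope.

(** * Calculus of C^k maps between normed spaces *)

Section CkRules.
Context {R : realType}.
Implicit Types (U V W : normedModType R).

(** The obstacle in (2) is global: the almost-complex structure has to live on all of R^(m+2), so a
    field of invertible matrices known along f(M) must be extended with invertible values. This is
    why homotopies are cut into factors [1 + A] with [A] small: such a factor stays invertible when
    [A] is approximated by a smooth map or multiplied by a cutoff function. The homotopies kill the
    classical obstructions. The normal planes form a complex line bundle whose Chern class is
    restricted from R^(m+2), where it vanishes; this is the reason for a nowhere zero [nu]. The
    direction of [nu] is a map to a sphere of dimension m + 1, null-homotopic for dimension reasons;
    that of [nu K], once [nu] is straightened, is a map to a sphere of dimension m, where the
    obstruction is a degree. As m is even, [h] and [- h] have opposite degrees, so a homotopy
    between them forces degree zero. M may be disconnected, so zeros lying in different pieces are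
    first separated by open and closed sets. Degrees are compared on a tube because R^(m+2) provides
    global coordinates for the divergence identity. *)

Lemma Ck_sub V W k (A B : set V) (f : V -> W) :
 A `<=` B -> Ck_on k B f -> Ck_on k A f.
elim:k f => [|k IH] f AB /=; first by move=>cf x /AB /cf.
by move=> [df Hf]; split=> [x /AB /df//|v]; apply:IH.
Qed.

Lemma Ck_onS V W k (A : set V) (f : V -> W) : Ck_on k.+1 A f -> Ck_on k A f.
elim:k f => [|k IH] f.
 by move=> [df _] x /df; exact:differentiable_continuous.
by move=> [df Hf]; split=> // v; apply:IH; exact:Hf.
Qed.

Lemma Ck_on0 V W k (A : set V) (f : V -> W) :
 Ck_on k A f -> forall x, A x -> {for x, continuous f}.
by elim:k => // k IH /Ck_onS. Qed.

Lemma Ck_ext V W k (A : set V) (f g : V -> W) : open A ->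
 (forall x, A x -> f x = g x) -> Ck_on k A g -> Ck_on k A f.
move=>oA; elim:k f g => [|k IH] f g fg.
 move=>cg x Ax; have : g @ x --> g x by exact:cg.
 rewrite -(fg x Ax); apply:cvg_trans; apply:near_eq_cvg.
 by near=> y; rewrite fg//; near: y; exact:open_nbhs_nbhs.
have H x : A x -> \forall y \near x, f y = g y.
 by move=>Ax; near=> y; rewrite fg//; near: y; exact:open_nbhs_nbhs.
move=> [dg Hg]; split=> [x Ax|v].
 by have [] := near_eq_is_diff (H x Ax) (dg x Ax).
apply:IH (Hg v) => x Ax.
by have [_ ->] := near_eq_is_diff (H x Ax) (dg x Ax).
Unshelve. all: by end_near. Qed.

Lemma Ck_cst V W k (A : set V) (a : W) : Ck_on k A (cst a : V -> W).
exact:smooth_on_cst. Qed.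

Lemma CkD V W k (A : set V) (f g : V -> W) : open A ->
 Ck_on k A f -> Ck_on k A g -> Ck_on k A (fun x => f x + g x).
move=>oA; elim:k f g => [|k IH] f g.
 by move=>cf cg x Ax; apply:continuousD; [exact:cf|exact:cg].
move=> [df Hf] [dg Hg]; split=> [x Ax|v].
 by apply:differentiableD; [exact:df|exact:dg].
apply:Ck_ext (IH _ _ (Hf v) (Hg v)) => // x Ax.
by rewrite diffD//; [exact:df|exact:dg].
Qed.

Lemma Ck_sum V W k (A : set V) (I : Type) (s : seq I) (P : pred I)
  (f : I -> V -> W) : open A ->
 (forall i, P i -> Ck_on k A (f i)) -> Ck_on k A (fun x => \sum_(i <- s | P i) f i x).
move=>oA Hf; elim:s => [|i s IH].
 apply:Ck_ext (Ck_cst k A 0) => // x _; by rewrite big_nil.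
case Pi: (P i).
 apply:Ck_ext (CkD oA (Hf i Pi) IH) => // x _; by rewrite big_cons Pi.
by apply:Ck_ext IH => // x _; rewrite big_cons Pi.
Qed.

Lemma Ck_linl V W U k (A : set V) (f : V -> W) (L : {linear W -> U}) :
 open A -> continuous L -> Ck_on k A f -> Ck_on k A (fun x => L (f x)).
move=>oA cL; elim:k f => [|k IH] f.
 by move=>cf x Ax; apply:continuous_comp; [exact:cf|exact:cL].
move=> [df Hf]; split=> [x Ax|v].
 by apply:differentiable_comp; [exact:df|exact:linear_differentiable].
apply:Ck_ext (IH _ (Hf v)) => // x Ax.
rewrite (@diff_comp _ _ _ _ f L) ?diff_lin//=; first exact:df.
exact:linear_differentiable.
Qed.

Lemma Ck_linr V W U k (A : set W) (f : W -> U) (L : {linear V -> W}) :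
 open A -> continuous L -> Ck_on k A f -> Ck_on k (L @^-1` A) (fun x => f (L x)).
move=>oA cL.
have oLA : open (L @^-1` A) by apply:open_comp => // x _; exact:cL.
elim:k f => [|k IH] f.
 by move=>cf x Ax; apply:continuous_comp; [exact:cL|exact:cf].
move=> [df Hf]; split=> [x Ax|v].
 by apply:differentiable_comp; [exact:linear_differentiable|exact:df].
apply:Ck_ext (IH _ (Hf (L v))) => // x Ax.
rewrite (@diff_comp _ _ _ _ L f) ?diff_lin//=; last exact:df.
exact:linear_differentiable.
Qed.

(** Leibniz rule: the derivative is a sum of two values of [b], each with one argument of lower
    class, so the induction runs on both arguments at once. *)
Lemma Ck_bilin V W U (T : normedModType R) k (A : set V) (b : {bilinear W -> U -> T})
  (f : V -> W) (g : V -> U) : open A -> continuous (fun p => b p.1 p.2) ->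
 Ck_on k A f -> Ck_on k A g -> Ck_on k A (fun x => b (f x) (g x)).
move=>oA cb; elim:k f g => [|k IH] f g.
 move=>cf cg x Ax.
 apply:(@continuous_comp _ _ _ (fun x => (f x, g x)) (fun p => b p.1 p.2)).
  by apply:cvg_pair; [exact:cf|exact:cg].
 exact:cb.
move=> /[dup] /Ck_onS Ff [df Hf] /[dup] /Ck_onS Fg [dg Hg].
have E : (fun x => b (f x) (g x)) = (fun p => b p.1 p.2) \o (fun x => (f x, g x)) by [].
split=> [x Ax|v].
 rewrite E; apply:differentiable_comp; last exact:differentiable_bilin.
 by apply:differentiable_pair; [exact:df|exact:dg].
apply:Ck_ext (CkD oA (IH _ _ Ff (Hg v)) (IH _ _ (Hf v) Fg)) => // x Ax.
have D : differentiable (fun x => (f x, g x)) x.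
 by apply:differentiable_pair; [exact:df|exact:dg].
rewrite E diff_comp//; last exact:differentiable_bilin.
by rewrite diff_bilin// diff_pair//; [exact:df|exact:dg].
Qed.

Lemma scale_is_bilinear V :
 bilinear_for (GRing.Scale.Law.clone _ _ *:%R _) (GRing.Scale.Law.clone _ _ *:%R _)
  (@GRing.scale R V).
split=> [u'|u] a x y /=; first by rewrite scalerDl scalerA.
by rewrite scalerDr !scalerA mulrC.
Qed.
HB.instance Definition _ V := bilinear_isBilinear.Build R R V V _ _
 (@GRing.scale R V) (scale_is_bilinear V).

Lemma CkZ V W k (A : set V) (a : V -> R) (g : V -> W) : open A ->
 Ck_on k A a -> Ck_on k A g -> Ck_on k A (fun x => a x *: g x).
by move=>oA; apply:Ck_bilin => //; exact:scale_continuous. Qed.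

Lemma CkM V k (A : set V) (a b : V -> R) : open A ->
 Ck_on k A a -> Ck_on k A b -> Ck_on k A (fun x => a x * b x).
by move=>oA; apply:Ck_bilin => //; exact:mul_continuous. Qed.

Lemma CkN V W k (A : set V) (f : V -> W) : open A ->
 Ck_on k A f -> Ck_on k A (fun x => - f x).
by move=>oA; apply:Ck_linl => //; exact:opp_continuous. Qed.

Lemma CkB V W k (A : set V) (f g : V -> W) : open A ->
 Ck_on k A f -> Ck_on k A g -> Ck_on k A (fun x => f x - g x).
by move=>oA Hf Hg; apply:CkD => //; exact:CkN. Qed.

Lemma Ck_prod V k (A : set V) (I : Type) (s : seq I) (P : pred I)
  (f : I -> V -> R) : open A ->
 (forall i, P i -> Ck_on k A (f i)) -> Ck_on k A (fun x => \prod_(i <- s | P i) f i x).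
move=>oA Hf; elim:s => [|i s IH].
 apply:Ck_ext (Ck_cst k A (1 : R)) => // x _; by rewrite big_nil.
case Pi: (P i).
 apply:Ck_ext (CkM oA (Hf i Pi) IH) => // x _; by rewrite big_cons Pi.
by apply:Ck_ext IH => // x _; rewrite big_cons Pi.
Qed.

Lemma Ck_inv V k (A : set V) (a : V -> R) : open A -> (forall x, A x -> a x != 0) ->
 Ck_on k A a -> Ck_on k A (fun x => (a x)^-1).
move=>oA a0; elim:k a a0 => [|k IH] a a0.
 by move=>ca x Ax; apply:continuousV; [exact:a0|exact:ca].
move=> /[dup] /Ck_onS Fa [da Ha]; split=> [x Ax|v].
 by apply:differentiableV; [exact:da|exact:a0].
have Q := IH _ a0 Fa.
apply:Ck_ext (CkN oA (CkM oA (CkM oA Q Q) (Ha v))) => // x Ax.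
rewrite diffV//; [|exact:da|exact:a0].
by rewrite /= -exprVn expr2 scaleNr.
Qed.

Lemma Ck_pair V W U k (A : set V) (f : V -> W) (g : V -> U) : open A ->
 Ck_on k A f -> Ck_on k A g -> Ck_on k A (fun x => (f x, g x)).
move=>oA; elim:k f g => [|k IH] f g.
 by move=>cf cg x Ax; apply:cvg_pair; [exact:cf|exact:cg].
move=> [df Hf] [dg Hg]; split=> [x Ax|v].
 by apply:differentiable_pair; [exact:df|exact:dg].
apply:Ck_ext (IH _ _ (Hf v) (Hg v)) => // x Ax.
by rewrite diff_pair//; [exact:df|exact:dg].
Qed.
End CkRules.

(** * Finite bases and composition of C^k maps *)

Section Basis.
Context {R : realType}.

(** [Ck_on] differentiates in fixed directions, whereas the chain rule yields ['d g (f x)] in the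
    moving direction ['d f x v]. Finitely many continuous coordinates rewrite it as a finite sum
    over fixed directions, and [Ck_comp] becomes an induction. *)
Definition has_basis (V : normedModType R) := exists (I : finType)
 (c : I -> {linear V -> R}) (e : I -> V),
 (forall i, continuous (c i)) /\ (forall v, v = \sum_i c i v *: e i).

Lemma has_basis_mx m n : has_basis 'M[R]_(m, n).
pose L i (M : 'M[R]_(m, n)) := M i.1 i.2.
have Llin i : linear (L i) by move=>a u v; rewrite /L !mxE.
pose c i : {linear 'M[R]_(m, n) -> R} :=
 HB.pack (L i) (GRing.isLinear.Build _ _ _ _ _ (Llin i)).
exists ('I_m * 'I_n)%type, c, (fun i => delta_mx i.1 i.2); split.
 by move=>i; exact:coord_continuous.
move=>v; rewrite {1}[v]matrix_sum_delta pair_big /=.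
exact:eq_bigr.
Qed.

Lemma has_basisR : has_basis R.
exists unit, (fun=> idfun), (fun=> 1); split=> [_ x A //|v].
by rewrite big_const card_unit /= addr0 /GRing.scale /= mulr1.
Qed.

Lemma has_basis_prod (V W : normedModType R) :
 has_basis V -> has_basis W -> has_basis (V * W)%type.
move=> [I [c [e [cc ce]]]] [J [d [g [dc dg]]]].
pose L i p := match i with inl i => c i p.1 | inr j => d j p.2 end.
have Llin i : linear (L i) by case:i => i a u v; rewrite /L /= linearP.
pose c' i : {linear (V * W)%type -> R} :=
 HB.pack (L i) (GRing.isLinear.Build _ _ _ _ _ (Llin i)).
exists (I + J)%type, c', (fun i => match i with inl i => (e i, 0) | inr j => (0, g j) end).
split.
 case=> i x.
  apply:continuous_comp; [exact:cvg_fst|exact:cc].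
 by apply:continuous_comp; [exact:cvg_snd|exact:dc].
move=> [v w]; rewrite big_sumType /=.
rewrite (_ : (v, w) = (v, 0) + (0, w)); last by congr pair; rewrite ?addr0 ?add0r.
congr (_ + _).
 rewrite {1}[v]ce; elim/big_ind2: _ => // [x1 x2 y1 y2 <- <-|i _].
  by congr pair; rewrite addr0.
 by congr pair; rewrite scaler0.
rewrite {1}[w]dg; elim/big_ind2: _ => // [x1 x2 y1 y2 <- <-|i _].
 by congr pair; rewrite addr0.
by congr pair; rewrite scaler0.
Qed.

Lemma Ck_comp (V W U : normedModType R) k (A : set V) (B : set W)
  (f : V -> W) (g : W -> U) : has_basis W -> open A -> open B ->
 (forall x, A x -> B (f x)) -> Ck_on k A f -> Ck_on k B g ->
 Ck_on k A (fun x => g (f x)).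
move=> [I [c [e [cc ce]]]] oA oB AB; elim:k g => [|k IH] g.
 by move=>cf cg x Ax; apply:continuous_comp; [exact:cf|exact/cg/AB].
move=> /[dup] /Ck_onS Ff [df Hf] [dg Hg]; split=> [x Ax|v].
 by apply:differentiable_comp; [exact:df|exact/dg/AB].
have S : Ck_on k A (fun x => \sum_i c i ('d f x v) *: 'd g (f x) (e i)).
 apply:Ck_sum => // i _; apply:CkZ => //.
  by apply:Ck_linl => //; exact:Hf.
 exact:(IH (fun y => 'd g y (e i)) Ff (Hg (e i))).
apply:Ck_ext S => // x Ax.
rewrite (@diff_comp _ _ _ _ f g)//=; [|exact:df|exact/dg/AB].
rewrite {1}['d f x v]ce linear_sum; apply:eq_bigr => i _.
by rewrite linearZ.
Qed.
End Basis.

#[local] Hint Resolve openT has_basis_mx : core.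
#[local] Hint Extern 0 (has_basis _) => exact:has_basisR : core.
#[local] Hint Extern 0 (Ck_on _ _ _) => (exact:Ck_cst || exact:smooth_on_id) : core.

(** * Norms, limits and smoothness of matrix expressions *)

Section MxNorm.
Context {R : realType}.

Lemma mx_norm_le m n (A : 'M[R]_(m, n)) (e : R) : 0 <= e ->
 (forall i j, `|A i j| <= e) -> `|A| <= e.
move=>e0 H; rewrite /Num.Def.normr /= mx_normrE.
exact:bigmax_le => // -[i j] _; exact:H.
Qed.

Lemma entry_le m n (A : 'M[R]_(m, n)) i j : `|A i j| <= `|A|.
rewrite [leRHS]/Num.Def.normr /= mx_normrE.
exact:(@le_bigmax _ _ _ _ _ (i, j)).
Qed.

Lemma norm_mulmx m n p (A : 'M[R]_(m, n)) (B : 'M[R]_(n, p)) :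
 `|A *m B| <= n%:R * (`|A| * `|B|).
apply:mx_norm_le => [|i j]; first by rewrite !mulr_ge0.
rewrite mxE (le_trans (ler_norm_sum _ _ _))//.
apply:(@le_trans _ _ (\sum_(k < n) `|A| * `|B|)).
 by apply:ler_sum => k _; rewrite normrM ler_pM// entry_le.
by rewrite sumr_const card_ord mulr_natl.
Qed.

Lemma cvg_mx (T : Type) (F : set_system T) {FF : Filter F} m n
  (f : T -> 'M[R]_(m, n)) (l : 'M[R]_(m, n)) :
 (forall i j, f x i j @[x --> F] --> l i j) -> f x @[x --> F] --> l.
move=>H; apply/cvgrPdist_le => /= e e0; near=> x.
apply:mx_norm_le; first exact:ltW.
move=>i j; rewrite !mxE; move: i j; near: x.
apply:filter_forall => i; apply:filter_forall => j.
by have /cvgrPdist_le /(_ e e0) := H i j.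
Unshelve. all: by end_near. Qed.

Lemma cvg_coord (T : Type) (F : set_system T) {FF : Filter F} m n
  (f : T -> 'M[R]_(m, n)) (l : 'M[R]_(m, n)) i j :
 f x @[x --> F] --> l -> f x i j @[x --> F] --> l i j.
move=>H; apply:(@cvg_comp _ _ _ f (fun M : 'M[R]_(m, n) => M i j) F (nbhs l)) => //.
exact:coord_continuous.
Qed.

Lemma cvg_sumr (T : Type) (F : set_system T) {FF : Filter F} (I : Type) (s : seq I)
  (P : pred I) (V : normedModType R) (f : I -> T -> V) (l : I -> V) :
 (forall i, P i -> f i x @[x --> F] --> l i) ->
 (\sum_(i <- s | P i) f i x) @[x --> F] --> \sum_(i <- s | P i) l i.
move=>H; elim:s => [|i s IH].
 by rewrite big_nil; under eq_fun do rewrite big_nil; exact:cvg_cst.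
rewrite big_cons; under eq_fun do rewrite big_cons.
by case:ifP => [Pi|//]; apply:cvgD => //; exact:H.
Qed.

Lemma cvg_prodr (T : Type) (F : set_system T) {FF : Filter F} (I : Type) (s : seq I)
  (P : pred I) (f : I -> T -> R) (l : I -> R) :
 (forall i, P i -> f i x @[x --> F] --> l i) ->
 (\prod_(i <- s | P i) f i x) @[x --> F] --> \prod_(i <- s | P i) l i.
move=>H; elim:s => [|i s IH].
 by rewrite big_nil; under eq_fun do rewrite big_nil; exact:cvg_cst.
rewrite big_cons; under eq_fun do rewrite big_cons.
by case:ifP => [Pi|//]; apply:cvgM => //; exact:H.
Qed.

Lemma cvg_mulmx (T : Type) (F : set_system T) {FF : Filter F} m n p
  (f : T -> 'M[R]_(m, n)) (g : T -> 'M[R]_(n, p)) (a : 'M[R]_(m, n)) (b : 'M[R]_(n, p)) :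
 f x @[x --> F] --> a -> g x @[x --> F] --> b ->
 f x *m g x @[x --> F] --> a *m b.
move=>fa gb; apply:cvg_mx => i j; rewrite mxE.
under eq_fun do rewrite mxE.
by apply:cvg_sumr => k _; apply:cvgM; exact:cvg_coord.
Qed.

Lemma cvg_trmx (T : Type) (F : set_system T) {FF : Filter F} m n
  (f : T -> 'M[R]_(m, n)) (a : 'M[R]_(m, n)) :
 f x @[x --> F] --> a -> (f x)^T @[x --> F] --> a^T.
move=>fa; apply:cvg_mx => i j; rewrite mxE; under eq_fun do rewrite mxE.
exact:cvg_coord.
Qed.

Lemma cvg_row_mx (T : Type) (F : set_system T) {FF : Filter F} m n p
  (f : T -> 'M[R]_(m, n)) (g : T -> 'M[R]_(m, p)) (a : 'M[R]_(m, n)) (b : 'M[R]_(m, p)) :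
 f x @[x --> F] --> a -> g x @[x --> F] --> b ->
 row_mx (f x) (g x) @[x --> F] --> row_mx a b.
move=>fa gb; apply:cvg_mx => i j; rewrite mxE; under eq_fun do rewrite mxE.
by case:(fintype.split j) => k; exact:cvg_coord.
Qed.

Lemma cvg_col_mx (T : Type) (F : set_system T) {FF : Filter F} m n p
  (f : T -> 'M[R]_(m, n)) (g : T -> 'M[R]_(p, n)) (a : 'M[R]_(m, n)) (b : 'M[R]_(p, n)) :
 f x @[x --> F] --> a -> g x @[x --> F] --> b ->
 col_mx (f x) (g x) @[x --> F] --> col_mx a b.
move=>fa gb; apply:cvg_mx => i j; rewrite mxE; under eq_fun do rewrite mxE.
by case:(fintype.split i) => k; exact:cvg_coord.
Qed.

Lemma cvg_det (T : Type) (F : set_system T) {FF : Filter F} n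
  (f : T -> 'M[R]_n) (a : 'M[R]_n) : f x @[x --> F] --> a -> \det (f x) @[x --> F] --> \det a.
move=>fa; rewrite /determinant; apply:cvg_sumr => s _.
apply:cvgM; first exact:cvg_cst.
by apply:cvg_prodr => i _; exact:cvg_coord.
Qed.

Lemma invmxE n (A : 'M[R]_n) : A \in unitmx -> invmx A = (\det A)^-1 *: \adj A.
by move=>uA; rewrite /invmx uA. Qed.

Lemma cvg_invmx (T : Type) (F : set_system T) {FF : Filter F} n
  (f : T -> 'M[R]_n) (a : 'M[R]_n) : a \in unitmx ->
 f x @[x --> F] --> a -> invmx (f x) @[x --> F] --> invmx a.
move=>ua fa; have da : \det a != 0 by rewrite -unitfE -unitmxE.
have dfa := cvg_det fa.
rewrite invmxE//.
apply:cvg_trans.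
 apply:near_eq_cvg; near=> x; rewrite invmxE// unitmxE unitfE.
 near: x; apply:(cvgr_neq0 (\det a)); [exact:dfa|exact:da].
apply:cvgZ; first by apply:cvgV; [exact:da|exact:dfa].
apply:cvg_mx => i j; rewrite mxE; under eq_fun do rewrite mxE.
apply:cvgM; first exact:cvg_cst.
apply:cvg_det; apply:cvg_mx => k l; rewrite !mxE.
by under eq_fun do rewrite !mxE; exact:cvg_coord.
Unshelve. all: by end_near. Qed.
End MxNorm.
Section MxSmooth.
Context {R : realType}.
Implicit Types (V : normedModType R).

Lemma Ck_mxP V k (A : set V) m n (f : V -> 'M[R]_(m, n)) : open A ->
 (forall i j, Ck_on k A (fun x => f x i j)) -> Ck_on k A f.
move=>oA H.
have S : Ck_on k A (fun x => \sum_i \sum_j f x i j *: (delta_mx i j : 'M[R]_(m, n))).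
 apply:Ck_sum => // i _; apply:Ck_sum => // j _.
 exact:CkZ.
by apply:Ck_ext S => // x _; exact:matrix_sum_delta.
Qed.

Definition mx_entry m n i j (M : 'M[R]_(m, n)) : R := M i j.
Lemma mx_entry_linear m n i j : linear (@mx_entry m n i j).
by move=>a u v; rewrite /mx_entry !mxE. Qed.

HB.instance Definition _ m n i j :=
 GRing.isLinear.Build R 'M[R]_(m, n) R *:%R (@mx_entry m n i j)
  (@mx_entry_linear m n i j).

Lemma Ck_entry V k (A : set V) m n (f : V -> 'M[R]_(m, n)) i j : open A ->
 Ck_on k A f -> Ck_on k A (fun x => f x i j).
move=>oA; apply:(@Ck_linl _ _ _ _ _ _ _ (@mx_entry m n i j)) => //.
exact:coord_continuous.
Qed.

Lemma Ck_mulmx V k (A : set V) m n p (f : V -> 'M[R]_(m, n))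
  (g : V -> 'M[R]_(n, p)) : open A ->
 Ck_on k A f -> Ck_on k A g -> Ck_on k A (fun x => f x *m g x).
move=>oA Hf Hg; apply:Ck_mxP => // i j.
apply:(@Ck_ext _ _ _ _ _ _ (fun x => \sum_k f x i k * g x k j)) => //.
 by move=>x _; rewrite mxE.
by apply:Ck_sum => // l _; apply:CkM => //; exact:Ck_entry.
Qed.

Lemma Ck_trmx V k (A : set V) m n (f : V -> 'M[R]_(m, n)) : open A ->
 Ck_on k A f -> Ck_on k A (fun x => (f x)^T).
move=>oA Hf; apply:Ck_mxP => // i j.
apply:(@Ck_ext _ _ _ _ _ _ (fun x => f x j i)) => //.
 by move=>x _; rewrite mxE.
exact:Ck_entry.
Qed.

Lemma Ck_row_mx V k (A : set V) m n p (f : V -> 'M[R]_(m, n))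
  (g : V -> 'M[R]_(m, p)) : open A ->
 Ck_on k A f -> Ck_on k A g -> Ck_on k A (fun x => row_mx (f x) (g x)).
move=>oA Hf Hg; apply:Ck_mxP => // i j.
apply:(@Ck_ext _ _ _ _ _ _
 (fun x => match fintype.split j with inl l => f x i l | inr l => g x i l end)) => //.
 by move=>x _; rewrite mxE.
by case:(fintype.split j) => l; exact:Ck_entry.
Qed.

Lemma Ck_col_mx V k (A : set V) m n p (f : V -> 'M[R]_(m, n))
  (g : V -> 'M[R]_(p, n)) : open A ->
 Ck_on k A f -> Ck_on k A g -> Ck_on k A (fun x => col_mx (f x) (g x)).
move=>oA Hf Hg; apply:Ck_mxP => // i j.
apply:(@Ck_ext _ _ _ _ _ _
 (fun x => match fintype.split i with inl l => f x l j | inr l => g x l j end)) => //.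
 by move=>x _; rewrite mxE.
by case:(fintype.split i) => l; exact:Ck_entry.
Qed.

Lemma Ck_lsubmx V k (A : set V) m n p (f : V -> 'M[R]_(m, n + p)) : open A ->
 Ck_on k A f -> Ck_on k A (fun x => lsubmx (f x)).
move=>oA Hf; apply:Ck_mxP => // i j.
apply:(@Ck_ext _ _ _ _ _ _ (fun x => f x i (lshift p j))) => //.
 by move=>x _; rewrite mxE.
exact:Ck_entry.
Qed.

Lemma Ck_rsubmx V k (A : set V) m n p (f : V -> 'M[R]_(m, n + p)) : open A ->
 Ck_on k A f -> Ck_on k A (fun x => rsubmx (f x)).
move=>oA Hf; apply:Ck_mxP => // i j.
apply:(@Ck_ext _ _ _ _ _ _ (fun x => f x i (rshift n j))) => //.
 by move=>x _; rewrite mxE.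
exact:Ck_entry.
Qed.

Lemma Ck_det V k (A : set V) n (f : V -> 'M[R]_n) : open A ->
 Ck_on k A f -> Ck_on k A (fun x => \det (f x)).
move=>oA Hf; apply:Ck_sum => // s _.
apply:CkM => //.
by apply:Ck_prod => // i _; exact:Ck_entry.
Qed.

Lemma Ck_invmx V k (A : set V) n (f : V -> 'M[R]_n) : open A ->
 (forall x, A x -> f x \in unitmx) ->
 Ck_on k A f -> Ck_on k A (fun x => invmx (f x)).
move=>oA uf Hf.
apply:(@Ck_ext _ _ _ _ _ _ (fun x => (\det (f x))^-1 *: \adj (f x))) => //.
 by move=>x Ax; rewrite invmxE// uf.
apply:CkZ => //.
 apply:Ck_inv => //; last exact:Ck_det.
 by move=>x /uf; rewrite unitmxE unitfE.
apply:Ck_mxP => // i j.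
apply:(@Ck_ext _ _ _ _ _ _ (fun x => (-1) ^+ (j + i) *
  \det (row' j (col' i (f x))))) => //; first by move=>x _; rewrite mxE.
apply:CkM => //.
apply:Ck_det => //; apply:Ck_mxP => // a b.
apply:(@Ck_ext _ _ _ _ _ _ (fun x => f x (lift j a) (lift i b))) => //.
 by move=>x _; rewrite !mxE.
exact:Ck_entry.
Qed.
End MxSmooth.

(** * Differentials through epsilon estimates *)

Section DiffEps.
Context {R : realType}.
Implicit Types (V W : normedModType R).

Lemma diff_eps V W (f : V -> W) x : differentiable f x -> forall e : R, 0 < e ->
 \forall h \near (0 : V), `|f (h + x) - f x - 'd f x h| <= e * `|h|.
move=> /diff_locally /eqaddoP H e e0; have := H e e0.
apply:filterS => h; congr (`|_| <= _).
by rewrite !fctE opprD addrA.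
Qed.

Lemma diff_epsI V W (f : V -> W) x (L : {linear V -> W}) : continuous L ->
 (forall e : R, 0 < e -> \forall h \near (0 : V), `|f (h + x) - f x - L h| <= e * `|h|) ->
 differentiable f x /\ 'd f x = L :> (V -> W).
move=>cL H.
have E : f \o shift x = cst (f x) + L +o_ 0 id.
 apply/eqaddoP => e e0; have := H e e0.
 apply:filterS => h; congr (`|_| <= _).
 by rewrite !fctE /= opprD addrA.
have D : 'd f x = L :> (V -> W) by exact:diff_unique.
by split=> //; apply/diff_locallyP; split; rewrite D.
Qed.

Lemma diff_near0 V W (f : V -> W) x (C : R) : f x = 0 ->
 (\forall y \near x, `|f y| <= C * `|y - x| ^+ 2) ->
 differentiable f x /\ 'd f x = 0 :> (V -> W).
move=>fx0 H; pose Z : {linear V -> W} := \0.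
have [] := @diff_epsI V W f x Z.
- exact:cst_continuous.
- move=>e e0; have C1 : 0 < `|C| + 1 by rewrite ltr_wpDl.
 near=> h; rewrite fx0 !subr0.
 have : `|f (h + x)| <= C * `|h + x - x| ^+ 2.
  near: h; have : h + x @[h --> (0:V)] --> x.
   by rewrite -[X in _ --> X]add0r; apply:cvgD => //; exact:cvg_cst.
  by move=> /(_ _ H).
 rewrite addrK => /le_trans; apply; rewrite expr2 mulrA ler_wpM2r//.
 apply:(@le_trans _ _ ((`|C| + 1) * `|h|)).
  by rewrite ler_wpM2r// (le_trans (ler_norm _))// lerDl.
 rewrite -ler_pdivlMl//; near: h.
 by apply:nbhs0_le; rewrite mulr_gt0// invr_gt0.
- by move=>df ->; split.
Unshelve. all: by end_near. Qed.
End DiffEps.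

(** * Flat functions and bump functions *)

Section Bump.
Context {R : realType}.

(** The functions t^-k exp(-1/t), extended by 0: the derivative of each is a combination of others,
    so all are shown to be smooth by one induction. *)
Definition flat k (t : R) : R := if 0 < t then t^-1 ^+ k * expR (- t^-1) else 0.

Lemma flat_ge0 k t : 0 <= flat k t.
rewrite /flat; case:ifP => // t0.
by rewrite mulr_ge0// exprn_ge0// invr_ge0 ltW.
Qed.

Lemma flat_le k t : flat k t <= (k.+2)`!%:R * t ^+ 2.
rewrite /flat; case:ifP => [t0|_]; last by rewrite mulr_ge0// sqr_ge0.
have ti0 : 0 < t^-1 by rewrite invr_gt0.
rewrite expRN ler_pdivrMr ?expR_gt0//.
(* The factorial comes from the term of degree k + 2 of the exponential series at 1/t; the two
   surplus powers leave the factor t^2 that gives differentiability at 0. *)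
have := expR_ge1Dxn k.+1 (ltW ti0) => H.
apply:(@le_trans _ _ ((k.+2)`!%:R * t ^+ 2 * (t^-1 ^+ k.+2 / (k.+2)`!%:R))); last first.
 apply:ler_wpM2l; first by rewrite mulr_ge0// sqr_ge0.
 by apply:le_trans H; rewrite lerDr.
rewrite mulrC mulrA divfK//.
by rewrite -[k.+2]addn2 exprD -mulrA -exprMn mulVf ?gt_eqF// expr1n mulr1.
Qed.

Lemma flat_diff k t : differentiable (flat k) t /\
 forall v, 'd (flat k) t v = v * (flat k.+2 t - k%:R * flat k.+1 t).
have [t0|t0|t0] := ltgtP t 0.
- have E : \forall s \near t, flat k s = cst 0 s.
  by near=> s; rewrite /flat ltNge (_ : s <= 0)//; near: s; exact:lt_le_nbhsl.
 have [df dE] := near_eq_is_diff E (differentiable_cst _ _).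
 split=> // v; rewrite dE diff_cst /flat !ltNge (ltW t0)/=.
 by rewrite mulr0 subr0 mulr0.
- have E : \forall s \near t, flat k s = (fun s : R => s^-1 ^+ k * expR (- s^-1)) s.
  by near=> s; rewrite /flat (_ : 0 < s)//; near: s; exact:lt_nbhsr.
 have tn0 : t != 0 by rewrite gt_eqF.
 have D1 : is_derive t 1 (fun s : R => s^-1) (- t ^- 2).
  by apply:is_derive_eq (is_deriveV tn0 (is_derive_id t 1)) _; rewrite scaler1.
 have D2 : is_derive t 1 (fun s : R => s^-1 ^+ k) (k%:R * t^-1 ^+ k.-1 * - t ^- 2).
  have H := @is_deriveX R R (fun s : R => s^-1) k t 1 _ D1.
  rewrite exprfctE in H; apply:(is_derive_eq H).
  by rewrite /GRing.scale /= mulr_natl.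
 have D3 : is_derive t 1 (fun s : R => expR (- s^-1)) (expR (- t^-1) * t ^- 2).
  apply:(is_derive_eq (is_derive1_comp (is_derive_expR _) (is_deriveN D1))).
  by rewrite opprK.
 have D := is_deriveM D2 D3.
 have df : differentiable (fun s : R => s^-1 ^+ k * expR (- s^-1)) t.
  by apply/derivable1_diffP; apply:@ex_derive.
 have [df' dE] := near_eq_is_diff E df.
 split=> // v; rewrite dE diff1E// derive1E (@derive_val _ _ _ _ _ _ _ D).
 rewrite /flat t0 /GRing.scale; congr (_ * _).
 rewrite -exprVn !exprS; case:k {E D2 D df df' dE} => [|k] /=; first by rewrite /=; ring.
 by rewrite !exprS; ring.
- rewrite t0 {t0}.
 have [||df dE] := @diff_near0 R R R (flat k) 0 ((k.+2)`!%:R).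
 + by rewrite /flat ltxx.
 + near=> s; rewrite subr0 ger0_norm ?flat_ge0//.
  by rewrite (le_trans (flat_le _ _))// real_normK// num_real.
 + split=> // v; rewrite dE /flat ltxx.
  by rewrite mulr0 subr0 mulr0.
Unshelve. all: by end_near. Qed.

Lemma flat_smooth k A : smooth_on A (flat k).
move=>j; apply:(@Ck_sub _ _ _ _ _ setT) => //.
elim:j k => [|j IH] k.
 by move=>x _; apply:differentiable_continuous; have [] := flat_diff k x.
split=> [x _|v]; first by have [] := flat_diff k x.
have S : Ck_on j setT (fun x => v * (flat k.+2 x - k%:R * flat k.+1 x)).
 apply:CkM; [exact:openT|exact:Ck_cst|].
 apply:CkB; [exact:openT|exact:IH|].
 exact:CkM; exact:IH.
apply:Ck_ext S => //.
by move=>x _; have [_ ->] := flat_diff k x.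
Qed.

Lemma flat0_gt0 t : (0 < flat 0 t) = (0 < t).
by rewrite /flat; case:ifP => t0; rewrite// expr0 mul1r expR_gt0.
Qed.

(** A product over coordinates rather than a function of the norm: the norm is the sup norm, so the
    product is smooth and still lives exactly on a ball. *)
Definition bump n (c : 'rV[R]_n) (e : R) (x : 'rV[R]_n) : R :=
 \prod_j flat 0 (e ^+ 2 - (x 0 j - c 0 j) ^+ 2).
Lemma bump_ge0 n c e (x : 'rV_n) : 0 <= bump c e x.
by apply:prodr_ge0 => j _; exact:flat_ge0. Qed.

Lemma bump_gt0 n c e (x : 'rV_n) : 0 < e -> (0 < bump c e x) = (`|x - c| < e).
move=>e0; have sq s : (0 < e ^+ 2 - s ^+ 2) = (`|s| < e).
 by rewrite subr_gt0 -[s ^+ 2]real_normK ?num_real// ltr_sqr ?nnegrE// ltW.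
apply/idP/idP => [H|H].
 rewrite /Num.Def.normr /= mx_normrE; apply:bigmax_lt => // -[i j] _.
 rewrite ord1 !mxE -sq -flat0_gt0 lt_def flat_ge0 andbT.
 apply:contraTN H => /eqP fj; rewrite /bump (bigD1 j)//= fj mul0r.
 by rewrite ltxx.
apply:prodr_gt0 => j _; rewrite flat0_gt0 sq (le_lt_trans _ H)//.
by have := entry_le (x - c) 0 j; rewrite !mxE.
Qed.

Lemma bump_smooth n (c : 'rV_n) e A : smooth_on A (bump c e).
move=>k; apply:(@Ck_sub _ _ _ _ _ setT) => //.
apply:Ck_prod => //.
move=>j _; apply:(@Ck_comp _ _ _ _ _ _ setT _ (flat 0)) => //.
- have H : Ck_on k setT (fun x : 'rV_n => x 0 j - c 0 j).
  apply:CkB; [exact:openT| |exact:Ck_cst].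
  exact:Ck_entry.
 apply:CkB; [exact:openT|exact:Ck_cst|].
 apply:Ck_ext (CkM _ H H); [exact:openT| |exact:openT].
 by move=>x _; rewrite expr2.
- exact:flat_smooth.
Qed.
End Bump.

(** * Jacobian matrices *)

Section Jacobian.
Context {R : realType}.

(** Row convention: vectors multiply from the left, so the chain rule reads
    [jac f x *m jac g (f x)]. *)
Definition jac m n (f : 'rV[R]_m -> 'rV[R]_n) x : 'M[R]_(m, n) := lin1_mx ('d f x).
Lemma jacE m n (f : 'rV_m -> 'rV_n) x v : 'd f x v = v *m jac f x.
by rewrite mul_rV_lin1. Qed.

Lemma jac_entry m n (f : 'rV_m -> 'rV_n) x i j :
 jac f x i j = 'd f x (delta_mx 0 i) 0 j.
by rewrite jacE -rowE [RHS]mxE. Qed.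

Lemma Ck_jac m n k (A : set 'rV_m) (f : 'rV_m -> 'rV_n) : open A ->
 Ck_on k.+1 A f -> Ck_on k A (jac f).
move=>oA [df Hf]; apply:Ck_mxP => // i j.
have := Ck_entry 0 j oA (Hf (delta_mx 0 i)).
by apply:Ck_ext => // x Ax; rewrite jac_entry.
Qed.

Lemma mul_mx_cont m n p (M : 'M[R]_(n, p)) :
 continuous (fun v : 'M[R]_(m, n) => v *m M).
move=>v; apply:(@cvg_mulmx R _ (nbhs v) _ m n p id (fun=> M)); first exact:cvg_id.
exact:cvg_cst.
Qed.
End Jacobian.

Global Opaque jac.

(** * Mean value inequality and symmetry of second derivatives *)

Section MeanValue.
Context {R : realType}.

Lemma line_diff (V W : normedModType R) (f : V -> W) (x v : V) (t : R) :
 differentiable f (x + t *: v) ->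
 is_derive t 1 (fun s : R => f (x + s *: v)) ('d f (x + t *: v) v).
move=>df; have Hl : is_diff t (fun s : R => x + s *: v) (fun s => s *: v).
 have H : is_diff t (cst x + ( *:%R ^~ v) : R -> V) (0 + ( *:%R ^~ v)) by apply:is_diffD.
 by rewrite add0r in H.
have Hf : is_diff (x + t *: v) f ('d f (x + t *: v)) by exact:DiffDef.
have H := @is_diff_comp R R V W (fun s : R => x + s *: v) _ f _ t Hl Hf.
apply:DeriveDef; first exact:diff_derivable.
rewrite deriveE//.
have -> : 'd (fun s : R => f (x + s *: v)) t = (fun s : R => 'd f (x + t *: v) (s *: v)) :> (_ -> _).
 exact:diff_val.
by rewrite scale1r.
Qed.

Lemma mvt_entry (V : normedModType R) m n (f : V -> 'M[R]_(m, n)) (x v : V) i j :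
 (forall t : R, 0 <= t <= 1 -> differentiable f (x + t *: v)) ->
 exists2 t : R, 0 <= t <= 1 & (f (x + v) - f x) i j = 'd f (x + t *: v) v i j.
move=>df.
have H (t : R) : 0 <= t <= 1 ->
  is_derive t 1 (fun s : R => f (x + s *: v) i j) ('d f (x + t *: v) v i j).
 move=> /df dft; pose g : V -> R := fun y => f y i j.
 have [dg gE] : differentiable g (x + t *: v) /\
    'd g (x + t *: v) = (fun w => 'd f (x + t *: v) w i j) :> (_ -> _).
  have dm := @linear_differentiable R _ _ (@mx_entry R m n i j) (f (x + t *: v))
    (coord_continuous (j := j)).
  split; first exact:(differentiable_comp dft dm).
  rewrite (_ : g = (@mx_entry R m n i j) \o f)// diff_comp// diff_lin//.
  exact:coord_continuous.
 have := @line_diff _ _ g x v t dg.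
 by rewrite gE.
have [||t ti E] := @MVT_segment R (fun s : R => f (x + s *: v) i j)
 (fun t => 'd f (x + t *: v) v i j) 0 1 ler01.
- by move=>t; rewrite in_itv /= => /andP[t0 t1]; apply:H; rewrite !ltW.
- apply:derivable_within_continuous => t; rewrite in_itv /= => t01.
 by apply:ex_derive; exact:H.
exists t; first by rewrite in_itv in ti.
by rewrite subr0 mulr1 scale1r scale0r addr0 in E; rewrite !mxE.
Qed.

Lemma mvt_le (V : normedModType R) m n (f : V -> 'M[R]_(m, n)) (x v : V) (C : R) :
 (forall t : R, 0 <= t <= 1 -> differentiable f (x + t *: v)) ->
 (forall t : R, 0 <= t <= 1 -> `|'d f (x + t *: v) v| <= C) ->
 `|f (x + v) - f x| <= C.
move=>df HC; have C0 : 0 <= C by apply:le_trans (HC 0 _); rewrite ?lexx ?ler01.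
apply:mx_norm_le => // i j; have [t t01 ->] := mvt_entry i j df.
exact:le_trans (entry_le _ _ _) (HC t t01).
Qed.

(** The second difference [S t] is symmetric in u and v, while differentiability at x of y ->
    ['d f y u] already gives S t = t^2 D u v + o(t^2). Comparing the two expansions yields the
    symmetry. *)
Lemma Schwarz (V : normedModType R) (f : V -> R) (A : set V) x u v :
 open A -> Ck_on 2 A f -> A x ->
 'd (fun y => 'd f y u) x v = 'd (fun y => 'd f y v) x u.
move=>oA [df Hf] Ax.
pose D w := 'd (fun y => 'd f y w) x.
pose C := (`|u| + `|v|) *+ 2.
pose S t := f (x + t *: u + t *: v) - f (x + t *: u) - f (x + t *: v) + f x.
have key : forall (u v : V) e, 0 < e ->
  \forall t \near 0^'+,
   `|f (x + t *: u + t *: v) - f (x + t *: u) - f (x + t *: v) + f x - t ^+ 2 * D u v|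
    <= e * (t ^+ 2 * ((`|u| + `|v|) *+ 2)).
 move=> {S C} {}u {}v e e0.
 have [dgu _] := Hf u.
 have HD := diff_eps (dgu x Ax) e0.
 have /nbhs_ballP[r1 /= r10 B1] := HD.
 have /nbhs_ballP[r2 /= r20 B2] : nbhs x A by exact:open_nbhs_nbhs.
 pose M := `|u| + `|v| + 1.
 have M0 : 0 < M by rewrite ltr_wpDl// addr_ge0.
 near=> t.
 have t0 : 0 < t by near: t; exact:nbhs_right_gt.
 have tM : t * M < Num.min r1 r2.
  rewrite -ltr_pdivlMr//; near: t; apply:nbhs_right_lt.
  by rewrite divr_gt0// lt_min r10.
 have [tM1 tM2] : t * M < r1 /\ t * M < r2.
  by move: tM; rewrite lt_min => /andP.
 have small (a b : R) : 0 <= a <= 1 -> 0 <= b <= 1 -> `|a *: (t *: u) + b *: (t *: v)| < t * M.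
  move=> /andP[a0 a1] /andP[b0 b1]; apply:le_lt_trans (ler_normD _ _) _.
  rewrite !normrZ !ger0_norm ?(ltW t0)//.
  apply:(@le_lt_trans _ _ (t * (`|u| + `|v|))); last by rewrite ltr_pM2l// ltrDl.
  by rewrite mulrDr lerD// ler_piMl// mulr_ge0// ltW.
 have inA (a b : R) : 0 <= a <= 1 -> 0 <= b <= 1 -> A (x + (a *: (t *: u) + b *: (t *: v))).
  move=>ha hb; apply:B2; rewrite -ball_normE /= opprD addrA subrr sub0r normrN.
  exact:lt_trans (small _ _ ha hb) tM2.
 have I01 : 0 <= (0 : R) <= 1 by rewrite lexx ler01.
 have I11 : 0 <= (1 : R) <= 1 by rewrite lexx ler01.
 (* The second difference is [phi 1 - phi 0], so the mean value theorem turns it into one difference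
    of first derivatives in direction u, to which [HD] applies twice. *)
 pose phi s := f ((x + t *: v) + s *: (t *: u)) - f (x + s *: (t *: u)).
 pose dphi s := 'd f ((x + t *: v) + s *: (t *: u)) (t *: u) - 'd f (x + s *: (t *: u)) (t *: u).
 have dp (s : R) : 0 <= s <= 1 -> is_derive s 1 phi (dphi s).
  move=>hs; apply:is_deriveB; apply:line_diff; apply:df.
   have := inA s 1 hs I11; rewrite scale1r.
   by congr (A _); rewrite -addrA; congr (_ + _); rewrite addrC.
  by have := inA s 0 hs I01; rewrite scale0r addr0.
 have [||s si E] := @MVT_segment R phi dphi 0 1 ler01.
 - by move=>s; rewrite in_itv /= => /andP[s0 s1]; apply:dp; rewrite !ltW.
 - apply:derivable_within_continuous => s; rewrite in_itv /= => s01.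
  by apply:ex_derive; exact:dp.
 rewrite in_itv /= in si; rewrite subr0 mulr1 in E.
 have E1 : f (x + t *: u + t *: v) - f (x + t *: u) - f (x + t *: v) + f x = dphi s.
  rewrite -E /phi !scale1r !scale0r !addr0 (addrAC x (t *: v) (t *: u)).
  by ring.
 have lin w : 'd f w (t *: u) = t * 'd f w u by rewrite linearZ.
 rewrite E1 /dphi !lin.
 pose h1 := s *: (t *: u) + t *: v; pose h2 := s *: (t *: u).
 have h1s : `|h1| < r1.
  by have := small s 1 si I11; rewrite scale1r => /lt_trans; apply.
 have h2s : `|h2| < r1.
  by have := small s 0 si I01; rewrite scale0r addr0 => /lt_trans; apply.
 have /= := B1 h1; rewrite -ball_normE /= sub0r normrN => /(_ h1s) e1.
 have /= := B1 h2; rewrite -ball_normE /= sub0r normrN => /(_ h2s) e2.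
 have -> : x + t *: v + s *: (t *: u) = h1 + x by rewrite /h1 -addrA addrC [t *: v + _]addrC.
 have -> : x + s *: (t *: u) = h2 + x by rewrite addrC.
 have Dlin : D u h1 = D u h2 + t * D u v by rewrite /h1 linearD; congr (_ + _); rewrite linearZ.
 have -> : t * 'd f (h1 + x) u - t * 'd f (h2 + x) u - t ^+ 2 * D u v =
  t * (('d f (h1 + x) u - 'd f x u - D u h1) - ('d f (h2 + x) u - 'd f x u - D u h2)).
  by rewrite Dlin; ring.
 rewrite normrM (ger0_norm (ltW t0)).
 apply:(@le_trans _ _ (t * (e * `|h1| + e * `|h2|))).
  rewrite ler_pM2l// (le_trans (ler_normB _ _))// lerD//.
 rewrite -mulrDr mulrCA ler_pM2l// expr2 -mulrA ler_pM2l//.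
 have b1 : `|h1| <= t * (`|u| + `|v|).
  apply:le_trans (ler_normD _ _) _; rewrite !normrZ !ger0_norm ?(ltW t0)//; last by case/andP: si.
  by rewrite mulrDr lerD// ler_piMl// ?mulr_ge0 ?(ltW t0)//; case/andP: si.
 have b2 : `|h2| <= t * (`|u| + `|v|).
  rewrite !normrZ !ger0_norm ?(ltW t0)//; last by case/andP: si.
  apply:(@le_trans _ _ (t * `|u|)); first by rewrite ler_piMl// ?mulr_ge0 ?(ltW t0)//; case/andP: si.
  by rewrite ler_pM2l// lerDl.
 by rewrite mulrnAr mulr2n lerD.
apply/eqP; rewrite -subr_eq0 -normr_eq0; apply/eqP/le_anti; rewrite normr_ge0 andbT.
apply/ler_addgt0Pr => e e0; rewrite add0r.
have e'0 : 0 < e / (C + C + 1).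
 by rewrite divr_gt0// ltr_wpDl// addr_ge0// mulrn_wge0// addr_ge0.
near (0 : R)^'+ => t.
have H1 : `|S t - t ^+ 2 * D u v| <= e / (C + C + 1) * (t ^+ 2 * C).
 by near: t; exact:(key u v _ e'0).
have H2 : `|S t - t ^+ 2 * D v u| <= e / (C + C + 1) * (t ^+ 2 * C).
 have -> : S t = f (x + t *: v + t *: u) - f (x + t *: v) - f (x + t *: u) + f x.
  by rewrite /S [x + t *: v + _]addrAC; ring.
 near: t; have := key v u _ e'0.
 by rewrite (_ : (`|v| + `|u|) *+ 2 = C)// /C addrC.
have t20 : 0 < t ^+ 2 by rewrite exprn_gt0.
rewrite -(ler_pM2l t20) -{1}(ger0_norm (ltW t20)) -normrM.
have -> : t ^+ 2 * ('d (fun y => 'd f y u) x v - 'd (fun y => 'd f y v) x u) =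
 (S t - t ^+ 2 * D v u) - (S t - t ^+ 2 * D u v) by rewrite /D; ring.
apply:le_trans (ler_normB _ _) _; apply:le_trans (lerD H2 H1) _.
rewrite -mulrDr -mulrDr mulrCA ler_pM2l// -mulrA ger_pMr// mulrC ler_pdivrMr ?mul1r ?lerDl//.
by rewrite ltr_wpDl// addr_ge0// mulrn_wge0// addr_ge0.
Unshelve. all: by end_near. Qed.
End MeanValue.

(** * Inverse function theorem *)

Section InverseFunction.
Context {R : realType}.

Lemma inj_unitmx n (A : 'M[R]_n) : (forall v : 'rV_n, v *m A = 0 -> v = 0) -> A \in unitmx.
move=>H; rewrite -row_free_unit -kermx_eq0; apply/eqP/row_matrixP => i.
by rewrite row0; apply:H; rewrite -row_mul mulmx_ker row0.
Qed.

Lemma norm_sub_cont (V : normedModType R) (x : V) : continuous (fun y => `|y - x|).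
move=>y; have H : z - x @[z --> y] --> y - x by apply:cvgB; [exact:cvg_id|exact:cvg_cst].
exact:cvg_norm H.
Qed.

Lemma cball_compact n (x : 'rV_n) (s : R) :
 compact [set y : 'rV_n | `|y - x| <= s].
apply:bounded_closed_compact.
 exists (s + `|x|); split; first exact:num_real.
 move=>M sM y /= ys; rewrite (le_trans _ (ltW sM))//.
 by rewrite -[y](subrK x) (le_trans (ler_normD _ _))// lerD2r.
rewrite [X in closed X](_ : _ = (fun y => `|y - x|) @^-1` [set t | t <= s])//.
apply:closed_comp; last exact:closed_le.
by move=>y _; exact:norm_sub_cont.
Qed.

Lemma open_ball (V : normedModType R) (x : V) (r : R) : open [set y | `|y - x| < r].
rewrite [X in open X](_ : _ = (fun y => `|y - x|) @^-1` [set t | t < r])//.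
apply:open_comp; last exact:open_lt.
by move=>y _; exact:norm_sub_cont.
Qed.

Lemma nbhs_ballE (V : normedModType R) (x : V) (A : set V) :
 nbhs x A <-> exists2 r : R, 0 < r & forall y, `|y - x| < r -> A y.
split=> [/nbhs_ballP[r r0 H]|[r r0 H]].
 by exists r => // y yr; apply:H; rewrite -ball_normE /= distrC.
by apply/nbhs_ballP; exists r => // y; rewrite -ball_normE /= distrC; exact:H.
Qed.

Lemma convex_ball (V : normedModType R) (x a b : V) (r t : R) :
 `|a - x| < r -> `|b - x| < r -> 0 <= t <= 1 -> `|a + t *: (b - a) - x| < r.
move=>ar br /andP[t0 t1].
have -> : a + t *: (b - a) - x = (1 - t) *: (a - x) + t *: (b - x).
 rewrite addrAC (_ : b - a = (b - x) - (a - x)); last by rewrite opprB addrA subrK.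
 by rewrite scalerBr scalerBl scale1r addrA addrAC.
have [->|tn0] := eqVneq t 0; first by rewrite subr0 scale1r scale0r addr0.
rewrite (le_lt_trans (ler_normD _ _))// !normrZ !ger0_norm ?subr_ge0//.
have -> : r = (1 - t) * r + t * r by ring.
by rewrite ler_ltD ?ler_wpM2l ?subr_ge0 ?(ltW ar)// ltr_pM2l// lt_def tn0.
Qed.

(* A map k close to the identity, i.e. with k - id a contraction by 1/2. *)
Lemma near_id_surj n (h : 'rV_n -> 'rV_n) x1 (s : R) y : 0 < s ->
 (forall a b, `|a - x1| <= s -> `|b - x1| <= s ->
   `|(h b - b) - (h a - a)| <= 2^-1 * `|b - a|) ->
 (forall a, `|a - x1| <= s -> {for a, continuous h}) ->
 `|y - h x1| < s / 10 -> exists2 x, `|x - x1| < s & h x = y.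
move=>s0 Hh ch yx1.
have bd a b : `|a - x1| <= s -> `|b - x1| <= s -> `|b - a| <= 2 * `|h b - h a|.
 move=> /Hh H /H {}H.
 have : `|b - a| <= `|h b - h a| + 2^-1 * `|b - a|.
  apply:le_trans (lerD (lexx _) H); apply:le_trans (ler_normB _ _).
  suff <- : b - a = (h b - h a) - ((h b - b) - (h a - a)) by [].
  by apply/rowP => i; rewrite !mxE; ring.
 by have := normr_ge0 (b - a); lra.
have [|||c cK cmin] := @EVT_min_rV R n (fun x => `|h x - y|) [set x | `|x - x1| <= s].
- by exists x1 => /=; rewrite subrr normr0 ltW.
- exact:cball_compact.
- apply:continuous_in_subspaceT => x; rewrite inE /= => xs.
 have c : h z @[z --> x] --> h x by exact:(ch x xs).
 have H : h z - y @[z --> x] --> h x - y by exact:(cvgB c (cvg_cst _)).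
 exact:cvg_norm H.
rewrite inE /= in cK.
have x1K : `|x1 - x1| <= s by rewrite subrr normr0 ltW.
have c1 : `|h c - y| <= `|h x1 - y| by apply:cmin; rewrite inE.
rewrite distrC in yx1.
have c2 : `|c - x1| <= 4 * (s / 10).
 apply:le_trans (bd _ _ x1K cK) _.
 have : `|h c - h x1| <= `|h c - y| + `|h x1 - y|.
  by rewrite (distrC (h x1) y); exact:ler_distD.
 by lra.
exists c; first by apply:le_lt_trans c2 _; lra.
(* Newton step from the minimiser [c] of the distance to [y]. The tenth leaves room for it: [c] is
   within 4s/10 of x1 and the step has length at most s/10. The contraction halves the distance, so
   by minimality the distance is 0. *)
pose x' := c + (y - h c).
have x'K : `|x' - x1| <= s.
 rewrite /x' addrAC (le_trans (ler_normD _ _))//.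
 by rewrite (distrC y); lra.
have m1 : `|h c - y| <= `|h x' - y| by apply:cmin; rewrite inE.
have := Hh _ _ cK x'K.
have -> : h x' - x' - (h c - c) = h x' - y.
 by rewrite /x'; apply/rowP => i; rewrite !mxE; ring.
rewrite {2}/x' addrAC subrr add0r distrC => m2.
apply/eqP; rewrite -subr_eq0 -normr_eq0; apply/eqP/le_anti.
rewrite normr_ge0 andbT; move: m1 m2; rewrite (distrC (h x')) (distrC (h c)).
by have := normr_ge0 (y - h c); lra.
Qed.

(** Normalising by the inverse of the Jacobian at x0 gives a map [h] close to the identity, to which
    [near_id_surj] applies at every point of a small ball; this makes the image open. The inverse is
    Lipschitz, hence differentiable, and its class is then raised step by step. *)
Lemma ift n (f : 'rV[R]_n -> 'rV_n) (O : set 'rV_n) x0 :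
 open O -> O x0 -> smooth_on O f -> jac f x0 \in unitmx ->
 exists B : set 'rV_n, [/\ open B, B x0, B `<=` O,
  forall x, B x -> jac f x \in unitmx &
  exists g : 'rV_n -> 'rV_n, [/\ open (f @` B),
   smooth_on (f @` B) g & forall x, B x -> g (f x) = x]].
move=>oO Ox0 sf u0; pose M := invmx (jac f x0); pose h x := f x *m M.
pose E x := jac f x *m M - 1%:M.
have [df _] := sf 1%N.
have cE : {for x0, continuous E}.
 have c1 : jac f x @[x --> x0] --> jac f x0 by exact:(Ck_on0 (Ck_jac oO (sf 1%N))).
 exact:(cvgB (cvg_mulmx c1 (cvg_cst _)) (cvg_cst _)).
(* The factor n.+1 absorbs the loss of n in [norm_mulmx], so that [E x] acts with norm at most
   1/2. *)
have /nbhs_ballE[r r0 Hr] : nbhs x0 [set x | O x /\ `|E x| < (2 * n.+1%:R)^-1].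
 apply:filterI; first exact:open_nbhs_nbhs.
 apply:(cvgr_norm_lt _ cE); rewrite /E mulmxV// subrr normr0.
 by rewrite invr_gt0 mulr_gt0.
pose B : set 'rV_n := [set x | `|x - x0| < r].
have BO x : B x -> O x by move=> /Hr [].
have nE x (v : 'rV_n) : B x -> `|v *m E x| <= 2^-1 * `|v|.
 move=> /Hr [_ Ex]; apply:le_trans (norm_mulmx _ _) _.
 rewrite mulrCA [leRHS]mulrC ler_wpM2l//.
 apply:(@le_trans _ _ (n.+1%:R * (2 * n.+1%:R)^-1)).
  by rewrite ler_pM// ?ler_nat// ltW.
 by rewrite invfM mulrCA divff ?mulr1// pnatr_eq0.
have vE x (v : 'rV_n) : v *m E x = v *m jac f x *m M - v.
 by rewrite /E mulmxBr mulmx1 mulmxA.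
have uB x : B x -> jac f x \in unitmx.
 move=>Bx; apply:inj_unitmx => v v0; have := nE x v Bx.
 rewrite (vE x v) v0 mul0mx sub0r normrN => H.
 apply/eqP; rewrite -normr_eq0; apply/eqP/le_anti; rewrite normr_ge0 andbT.
 by move: H; lra.
have dh x : B x -> differentiable (fun y => h y - y) x /\
   forall v, 'd (fun y => h y - y) x v = v *m E x.
 move=>Bx; have dfx := df x (BO x Bx).
 pose Mr : {linear 'rV_n -> 'rV_n} := mulmxr M.
 have cM : continuous Mr by exact:mul_mx_cont.
 have dM y : differentiable Mr y by exact:linear_differentiable.
 have dhx : differentiable h x by apply:(@differentiable_comp _ _ _ _ f Mr).
 have hE v : 'd h x v = v *m jac f x *m M.
  have E1 := congr1 (fun F => F v) (diff_comp dfx (dM (f x))).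
  have E2 := congr1 (fun F => F ('d f x v)) (diff_lin (f x) cM).
  by apply:etrans E1 _; apply:etrans E2 _; rewrite jacE.
 have di : differentiable (@id 'rV_n) x by exact:ex_diff.
 split; first exact:differentiableB.
 move=>v; have idE : 'd (@id 'rV_n) x v = v by rewrite diff_val.
 have E1 := congr1 (fun F => F v) (diffB dhx di).
 apply:etrans E1 _; apply:etrans (_ : _ = 'd h x v - 'd (@id 'rV_n) x v) _ => //.
 exact:etrans (congr2 (fun a b => a - b) (hE v) idE) (esym (vE x v)).
have contr a b : B a -> B b -> `|(h b - b) - (h a - a)| <= 2^-1 * `|b - a|.
 move=>Ba Bb; rewrite -{1 2}[b](subrK a) [b - a + a]addrC.
 apply:(@mvt_le _ _ _ _ (fun y => h y - y)) => t t01.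
  by have [] := dh _ (convex_ball Ba Bb t01).
 by have [_ ->] := dh _ (convex_ball Ba Bb t01); apply/nE/convex_ball.
have hf x : f x = h x *m jac f x0 by rewrite /h mulmxKV.
have bd a b : B a -> B b -> `|b - a| <= 2 * `|h b - h a|.
 move=>Ba Bb; have H := contr a b Ba Bb.
 have : `|b - a| <= `|h b - h a| + `|(h b - b) - (h a - a)|.
  apply:le_trans (ler_normB _ _).
  suff <- : b - a = (h b - h a) - ((h b - b) - (h a - a)) by [].
  by apply/rowP => i; rewrite !mxE; ring.
 by have := normr_ge0 (b - a); lra.
have injf a b : B a -> B b -> f a = f b -> a = b.
 move=>Ba Bb ab; have := bd a b Ba Bb.
 rewrite /h ab subrr normr0 mulr0 => H.
 by apply/esym/eqP; rewrite -subr_eq0 -normr_eq0; apply/eqP/le_anti; rewrite H normr_ge0.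
have oB : open B by exact:open_ball.
have oI : open (f @` B).
 rewrite openE => _ [x1 Bx1 <-].
 have /nbhs_ballE[s s0 Hs] : nbhs x1 B by exact:open_nbhs_nbhs.
 have H : nbhs (f x1) [set y | `|y *m M - h x1| < (s / 2) / 10].
  have c : y *m M - h x1 @[y --> f x1] --> f x1 *m M - h x1.
   by exact:(cvgB (@mul_mx_cont _ _ _ _ M (f x1)) (cvg_cst _)).
  have := cvgr_norm_lt _ c; apply.
  by rewrite subrr normr0 !divr_gt0.
 move: H; apply:filterS => y /= Hy.
 have s2 a : `|a - x1| <= s / 2 -> B a.
  by move=>H; apply:Hs; apply:le_lt_trans H _; rewrite ltr_pdivrMr// ltr_pMr// ltr1n.
 have [||||x xs hx] := @near_id_surj n h x1 (s / 2) (y *m M).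
 - by rewrite divr_gt0.
 - by move=>a b /s2 Ba /s2 Bb; exact:contr.
 - move=>a /s2 Ba.
  have c1 : f z @[z --> a] --> f a by apply:differentiable_continuous; exact/df/BO.
  exact:(cvg_mulmx c1 (cvg_cst _)).
 - by [].
 exists x; first by apply:s2; exact:ltW.
 by rewrite hf hx mulmxKV.
pose g y := xget x0 [set x | B x /\ f x = y].
have gK x : B x -> g (f x) = x.
 move=>Bx; rewrite /g; case:xgetP => [z _ [Bz fz]|/(_ x)]; last by case.
 exact:injf.
exists B; split; [exact:oB|by rewrite /B /= subrr normr0|exact:BO|exact:uB|].
exists g; split; [exact:oI| |exact:gK].
have lipg y y' : (f @` B) y -> (f @` B) y' -> `|g y' - g y| <= (2 * n%:R * `|M|) * `|y' - y|.
 move=> [x Bx <-] [x' Bx' <-]; rewrite !gK//.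
 apply:le_trans (bd _ _ Bx Bx') _.
 rewrite /h -mulmxBl -!mulrA ler_wpM2l// [`|M| * _]mulrC.
 exact:norm_mulmx.
have dg y : (f @` B) y -> differentiable g y /\
  forall v, 'd g y v = v *m invmx (jac f (g y)).
 move=>Iy; have [x Bx xy] := Iy; have gy : g y = x by rewrite -xy gK.
 pose N := invmx (jac f x); pose Nr : {linear 'rV_n -> 'rV_n} := mulmxr N.
 have cN : continuous Nr by exact:mul_mx_cont.
 pose C := 2 * n%:R * `|M|.
 have C0 : 0 <= C by rewrite !mulr_ge0.
 have [|dgy dE] := @diff_epsI R _ _ g y Nr cN; last first.
 - by split => // v; rewrite dE gy.
 - move=>e e0.
  pose e' := e / ((n%:R * `|N|) * C + 1).
  have P0 : 0 < (n%:R * `|N|) * C + 1 by rewrite ltr_wpDl// !mulr_ge0.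
  have e'0 : 0 < e' by rewrite divr_gt0.
  have /nbhs_ballE[d d0 Hd] := diff_eps (df x (BO x Bx)) e'0.
  have /nbhs_ballE[d' d'0 Hd'] : nbhs y (f @` B) by exact:open_nbhs_nbhs.
  apply/nbhs_ballE; exists (Num.min d' (d / (C + 1))).
   by rewrite lt_min d'0 divr_gt0// ltr_wpDl.
  move=>k; rewrite subr0 lt_min => /andP[kd' kd].
  have Iky : (f @` B) (k + y) by apply:Hd'; rewrite addrK.
  pose u := g (k + y) - g y.
  have uk : `|u| <= C * `|k|.
   by have := lipg _ _ Iy Iky; rewrite addrK.
  have ud : `|u| < d.
   apply:le_lt_trans uk _; apply:(@le_lt_trans _ _ ((C + 1) * `|k|)).
    by rewrite ler_wpM2r// lerDl.
   by rewrite mulrC -ltr_pdivlMr// ltr_wpDl.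
  have := Hd u; rewrite subr0 => /(_ ud).
  have -> : f (u + x) = k + y.
   rewrite /u gy subrK; have [x' Bx' <-] := Iky; by rewrite gK.
  rewrite xy addrK jacE => H.
  have -> : g (k + y) - g y - Nr k = - ((k - u *m jac f x) *m N).
   rewrite mulmxBl mulmxK ?uB// opprB /u.
   by [].
  rewrite normrN; apply:le_trans (norm_mulmx _ _) _.
  apply:le_trans.
   apply:ler_wpM2l; first exact:ler0n.
   apply:ler_wpM2r; first exact:normr_ge0.
   exact:le_trans H (ler_wpM2l (ltW e'0) uk).
  rewrite (_ : n%:R * _ = e' * (n%:R * `|N| * C) * `|k|); last by ring.
  rewrite ler_wpM2r// /e' mulrAC ler_pdivrMr// ler_wpM2l ?ltW// ltrDl.
  by [].
(* Bootstrap: the differential of [g] is a smooth expression in [g] itself, so class C^k gives class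
   C^(k+1). *)
elim=> [|k IH].
 by move=>y Iy; apply:differentiable_continuous; have [] := dg y Iy.
split=> [y Iy|v]; first by have [] := dg y Iy.
apply:(@Ck_ext _ _ _ _ _ _ (fun y => v *m invmx (jac f (g y)))) => //.
 by move=>y Iy; have [_ ->] := dg y Iy.
apply:Ck_mulmx => //.
apply:(@Ck_comp _ _ _ _ k _ B g (fun x => invmx (jac f x))) => //.
- exact:has_basis_mx.
- by move=> _ [x Bx <-]; rewrite gK.
- apply:Ck_invmx => //; apply:(Ck_sub (B := O)) => //.
 exact:Ck_jac.
Qed.
End InverseFunction.

(** * Partitions of unity and smooth approximation on a compact set *)

Section PartitionOfUnity.
Context {R : realType}.

(** Bumps around the centres of a finite subcover, divided by their sum on the open set where that
    sum is positive. *)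
Lemma smooth_pou n (K : set 'rV_n) (delta : 'rV_n -> R) :
 compact K -> (forall z, 0 < delta z) ->
 exists (s : seq 'rV_n) (b : 'rV_n -> 'rV_n -> R) (O : set 'rV_n),
  [/\ open O, K `<=` O, forall z, z \in s -> K z,
   forall z, smooth_on O (b z) &
   (forall z x, 0 <= b z x /\ (b z x != 0 -> `|x - z| < delta z)) /\
   (forall x, O x -> \sum_(z <- s) b z x = 1)].
move=>cK d0; have cc := cK; rewrite compact_cover in cc.
pose F z := [set y : 'rV_n | `|y - z| < delta z].
have oF z : K z -> open (F z) by move=> _; exact:open_ball.
have KF : K `<=` cover K F by move=>x Kx; exists x => //=; rewrite /F /= subrr normr0.
have [D DK cov] := cc _ K F oF KF.
pose s := finmap.enum_fset D.
pose tot x := \sum_(z <- s) bump z (delta z) x.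
pose O := [set x | 0 < tot x].
have st A : smooth_on A tot.
 move=>k; apply:(@Ck_sub _ _ _ _ _ setT) => //.
 apply:Ck_sum => //.
 by move=>z _; exact:bump_smooth.
have oO : open O.
 rewrite (_ : O = tot @^-1` [set t | 0 < t])//.
 apply:open_comp; last exact:open_gt.
 by move=>x _; exact:(Ck_on0 (st setT 0%N)).
exists s, (fun z x => bump z (delta z) x / tot x), O; split => //.
- move=>x /cov [z /= zD xz]; rewrite /O /= /tot (big_rem z)//=.
 by rewrite ltr_wpDr ?bump_gt0// sumr_ge0// => y _; exact:bump_ge0.
- by move=>z zD; have /DK := zD; rewrite inE.
- move=>z k; apply:CkM => //; first exact:bump_smooth.
 apply:Ck_inv => //; last exact:st.
 by move=>x /lt0r_neq0.
split=> [z x|x Ox].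
 have t0 : 0 <= tot x by apply:sumr_ge0 => y _; exact:bump_ge0.
 split; first by rewrite divr_ge0// bump_ge0.
 rewrite mulf_eq0 negb_or => /andP[bx _].
 by rewrite -bump_gt0// lt_def bx bump_ge0.
by rewrite -mulr_suml divff// lt0r_neq0.
Qed.

(** At each point the approximation is a convex combination of values [g z] at centres so close that
    [g] has moved by less than e/2. *)
Lemma smooth_approx n (K : set 'rV_n) p q (g : 'rV_n -> 'M[R]_(p, q)) (e : R) :
 compact K -> (forall x, K x -> {for x, continuous g}) -> 0 < e ->
 exists (O : set 'rV_n) (g' : 'rV_n -> 'M[R]_(p, q)),
  [/\ open O, K `<=` O, smooth_on O g' & forall x, K x -> `|g' x - g x| <= e].
move=>cK cg e0.
have H z : exists d : R, 0 < d /\ (K z -> forall y, `|y - z| < d -> `|g y - g z| < e / 2).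
 have [Kz|nKz] := pselect (K z); last by exists 1.
 have e20 : 0 < e / 2 by rewrite divr_gt0.
 have c : g y @[y --> z] --> g z by exact:cg.
 have /cvgrPdistC_lt /(_ _ e20) /nbhs_ballE[d d0 Hd] := c.
 by exists d.
pose d z := projT1 (cid (H z)).
have dP z := projT2 (cid (H z)).
have [s [b [U [oO KO sK sb [b0 b1]]]]] := smooth_pou cK (fun z => (dP z).1).
exists U, (fun x => \sum_(z <- s) b z x *: g z); split => //.
 move=>k; apply:Ck_sum => // z _; apply:CkZ => //; exact:sb.
move=>x Kx; rewrite -[g x]scale1r -(b1 x (KO x Kx)) scaler_suml -sumrB.
apply:(@le_trans _ _ (\sum_(z <- s) b z x * e)); last first.
 by rewrite -mulr_suml b1 ?mul1r//; exact:KO.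
rewrite big_seq [leRHS]big_seq.
apply:le_trans (ler_norm_sum _ _ _) _; apply:ler_sum => z zs.
rewrite -scalerBr normrZ ger0_norm; last by have [] := b0 z x.
have [-> |bn0] := eqVneq (b z x) 0; first by rewrite !mul0r.
have [bge bd] := b0 z x; rewrite ler_wpM2l// distrC ltW//.
have := (dP z).2 (sK z zs) x (bd bn0) => /lt_le_trans; apply.
by rewrite ler_pdivrMr// ler_pMr// ler1n.
Qed.
End PartitionOfUnity.

Lemma cvg_fst_comp {T S U : topologicalType} (f : T -> U) (t : T) (s : S) :
 {for t, continuous f} -> f z.1 @[z --> (t, s)] --> f t.
by move=>cf; apply:cvg_comp; [exact:cvg_fst|exact:cf]. Qed.

Lemma cvg_snd_comp {T S U : topologicalType} (f : S -> U) (t : T) (s : S) :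
 {for s, continuous f} -> f z.2 @[z --> (t, s)] --> f s.
by move=>cf; apply:cvg_comp; [exact:cvg_snd|exact:cf]. Qed.

Lemma compc {T U V : topologicalType} (f : T -> U) (g : U -> V) :
 continuous f -> continuous g -> continuous (fun x => g (f x)).
move=>cf cg x; apply:cvg_comp; first exact:cf.
exact:cg.
Qed.

(** * Uniform subdivision of time *)

Section UniformSteps.
Context {R : realType} {T : topologicalType}.
Hypothesis Tc : compact [set: T].

(** Lebesgue number argument on the compact product of [0,1] and T: [G t t' p] measures a change
    between two times and vanishes on the diagonal, so it is uniformly small for close times. *)
Lemma unif_steps m n (G : R -> R -> T -> 'M[R]_(m, n)) (e : R) :
 continuous (fun z : R * R * T => G z.1.1 z.1.2 z.2) -> (forall t p, G t t p = 0) ->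
 0 < e -> exists N : nat, forall i p, (i < N.+1)%N ->
  `|G (i%:R / N.+1%:R) (i.+1%:R / N.+1%:R) p| < e.
move=>cG G0 e0.
pose K : set (R * T) := [set z | 0 <= z.1 <= 1].
have cK : compact K.
 rewrite (_ : K = `[0, 1]%classic `*` [set: T]).
  by apply:compact_setX => //; exact:segment_compact.
 by apply/seteqP; split => -[t p] /=; rewrite in_itv //= => -[].
have /compact_near_coveringP := cK => /(_ R 0^'+
  (fun d z => forall t', `|t' - z.1| < d -> `|G z.1 t' z.2| < e)) H.
have {}H : \forall d \near 0^'+, K `<=`
  (fun z => forall t', `|t' - z.1| < d -> `|G z.1 t' z.2| < e).
 apply:H => -[t p] _.
 have c := cG (t, t, p).
 have : \forall z \near ((t, t, p) : R * R * T), `|G z.1.1 z.1.2 z.2| < e.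
  by apply:(cvgr_norm_lt _ c); rewrite G0 normr0.
 case=> -[A B] /= [[[A1 A2] /= [A1t A2t] A12] Bp] AB.
 have /nbhs_ballE[r1 r10 H1] := A1t; have /nbhs_ballE[r2 r20 H2] := A2t.
 exists ([set z | `|z.1 - t| < Num.min r1 (r2 / 2) /\ B z.2], [set d | d < r2 / 2]) => /=.
  split.
   exists ([set s | `|s - t| < Num.min r1 (r2 / 2)], B) => /=.
    split => //; apply/nbhs_ballE; exists (Num.min r1 (r2 / 2)) => //.
    by rewrite lt_min r10 divr_gt0.
   by move=> [s q].
  by apply:nbhs_right_lt; rewrite divr_gt0.
 move=> [[s q] d] /= [[sr Bq] dr] t' t'd.
 move: sr; rewrite lt_min => /andP[sr1 sr2].
 apply:(AB (s, t', q)); split => //=; apply:A12; split => /=; first exact:H1.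
 apply:H2; rewrite -[t' - t](subrKA s) (le_lt_trans (ler_normD _ _))//.
 by rewrite (splitr r2) ltrD// (lt_trans t'd).
have [d d0 Hd] : exists2 d : R, 0 < d & K `<=`
  (fun z => forall t', `|t' - z.1| < d -> `|G z.1 t' z.2| < e).
 near (0 : R)^'+ => d; exists d; first by near: d; exact:nbhs_right_gt.
 by near: d.
have [N _ HN] := @near_infty_natSinv_lt R (PosNum d0).
exists N => i p iN.
apply:(Hd (i%:R / N.+1%:R, p)) => /=.
 rewrite /K /= divr_ge0//= ler_pdivrMr// mul1r ler_nat.
 exact:ltnW.
rewrite -mulrBl -natr1 addrAC subrr add0r mul1r ger0_norm//.
exact:(HN N (leqnn N)).
Unshelve. all: by end_near. Qed.
End UniformSteps.

(** * Homotopies of nowhere zero maps *)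

Section Homotopy.
Context {R : realType} {T : topologicalType} {k : nat}.
Implicit Types u v w : T -> 'rV[R]_k.

(** Time runs over all of R, so that a homotopy is a continuous map on a full product; [clamp]
    extends homotopies given on [0,1] only. *)
Definition homot u v := exists H : R -> T -> 'rV[R]_k,
 [/\ continuous (fun z : R * T => H z.1 z.2), forall t p, H t p != 0,
   forall p, H 0 p = u p & forall p, H 1 p = v p].
Definition clamp (t : R) : R := Num.max 0 (Num.min 1 t).

Lemma clamp_cont : continuous clamp.
move=>t; apply:continuous_max; first exact:cst_continuous.
by apply:continuous_min; [exact:cst_continuous|exact:id].
Qed.

Lemma clamp01 t : 0 <= clamp t <= 1.
by rewrite /clamp le_max lexx ge_max ler01 ge_min lexx. Qed.
Lemma clampE t : 0 <= t <= 1 -> clamp t = t.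
by move=> /andP[t0 t1]; rewrite /clamp min_r// max_r. Qed.
Lemma clamp_le0 t : t <= 0 -> clamp t = 0.
by move=>t0; rewrite /clamp min_r ?max_l// (le_trans t0)// ler01. Qed.
Lemma clamp_ge1 t : 1 <= t -> clamp t = 1.
by move=>t1; rewrite /clamp min_l// max_r. Qed.

Lemma reparam_cont (f : R -> R) (W : topologicalType) (H : R -> T -> W) :
 continuous f -> continuous (fun z : R * T => H z.1 z.2) ->
 continuous (fun z : R * T => H (f z.1) z.2).
move=>cf cH [t p]; apply:(@continuous_comp _ _ _ (fun z : R * T => (f z.1, z.2)) (fun z => H z.1 z.2)).
 have c1 := @cvg_fst_comp _ _ _ f t p (cf t).
 have c2 : z.2 @[z --> (t, p)] --> p by exact:cvg_snd.
 exact:(cvg_pair c1 c2).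
exact:cH.
Qed.

Lemma homotI u v (H : R -> T -> 'rV_k) :
 continuous (fun z : R * T => H z.1 z.2) ->
 (forall t p, 0 <= t <= 1 -> H t p != 0) ->
 (forall p, H 0 p = u p) -> (forall p, H 1 p = v p) -> homot u v.
move=>cH H0 Hu Hv; exists (fun t p => H (clamp t) p); split.
- by apply:reparam_cont => //; exact:clamp_cont.
- by move=>t p; apply:H0; exact:clamp01.
- by move=>p; rewrite clamp_le0.
- by move=>p; rewrite clamp_ge1.
Qed.

Lemma homot_sym u v : homot u v -> homot v u.
move=> [H [cH H0 Hu Hv]]; exists (fun t p => H (1 - t) p); split => //.
- apply:(@reparam_cont (fun t => 1 - t)) => // t.
 exact:(cvgB (cvg_cst _) (@cvg_id _ (nbhs t))).
- by move=>p; rewrite subr0.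
- by move=>p; rewrite subrr.
Qed.

(** At every time one of the two clamped homotopies equals v, so subtracting v from their sum
    concatenates them in a single continuous formula. *)
Lemma homot_trans v u w : homot u v -> homot v w -> homot u w.
move=> [H [cH H0 Hu Hv]] [K [cK K0 Kv Kw]].
apply:(@homotI u w (fun t p => H (clamp (2 * t)) p + K (clamp (2 * t - 1)) p - v p)).
- have cv : continuous (fun z : R * T => v z.2).
  rewrite (_ : (fun z => _) = (fun z : R * T => H 1 z.2)); last first.
   by apply/funext => z; rewrite Hv.
  by apply:(@reparam_cont (fun=> 1)) => //; exact:cst_continuous.
 move=>z; apply:cvgB; last exact:cv.
 have c2 : continuous (fun t : R => 2 * t).
  by move=>t; exact:(cvgM (cvg_cst _) (@cvg_id _ (nbhs t))).
 apply:cvgD.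
  by apply:(@reparam_cont (fun t => clamp (2 * t))) => //; apply:compc => //; exact:clamp_cont.
 apply:(@reparam_cont (fun t => clamp (2 * t - 1))) => //.
 apply:compc; last exact:clamp_cont.
 by move=>t; exact:(cvgB (c2 t) (cvg_cst _)).
- move=>t p _; have [t2|t2] := leP (2 * t) 1.
  by rewrite [clamp (_ - 1)]clamp_le0 ?subr_le0// Kv addrK.
 by rewrite [clamp (2 * t)]clamp_ge1 ?ltW// Hv addrAC subrr add0r.
- by move=>p; rewrite mulr0 sub0r !clamp_le0// Kv addrK.
- move=>p; rewrite mulr1 !clamp_ge1 ?Hv 1?addrAC ?subrr ?add0r//; by lra.
Qed.

Lemma homot_line u v : continuous u -> continuous v ->
 (forall p t, 0 <= t <= 1 -> (1 - t) *: u p + t *: v p != 0) -> homot u v.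
move=>cu cv H; apply:(@homotI u v (fun t p => (1 - t) *: u p + t *: v p)).
- have c1 w : continuous w -> continuous (fun z : R * T => w z.2).
  by move=>cw [t p]; exact:(@cvg_snd_comp _ _ _ w t p (cw p)).
 move=> [t p]; have f1 : z.1 @[z --> (t, p)] --> t by exact:cvg_fst.
 have := cvgD (cvgZ (cvgB (cvg_cst (1 : R)) f1) (c1 u cu (t, p))) (cvgZ f1 (c1 v cv (t, p))).
 exact.
- by move=>t p /H.
- by move=>p; rewrite subr0 scale1r scale0r addr0.
- by move=>p; rewrite subrr scale1r scale0r add0r.
Qed.

Lemma homot_continuousl u v : homot u v -> continuous u.
move=> [H [cH _ Hu _]] p.
rewrite (_ : u = (fun p => H 0 p)); last by apply/funext => q; rewrite Hu.
apply:(@continuous_comp _ _ _ (fun p => (0, p)) (fun z : R * T => H z.1 z.2)).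
 exact:(cvg_pair (@cvg_cst _ 0 _ (nbhs p) _) (@cvg_id _ (nbhs p))).
exact:cH.
Qed.

Lemma homot_neq0l u v : homot u v -> forall p, u p != 0.
by move=> [H [_ H0 Hu _]] p; rewrite -Hu. Qed.

Lemma homot_ext u u' v v' : (forall p, u' p = u p) -> (forall p, v' p = v p) ->
 homot u v -> homot u' v'.
by move=> /funext -> /funext ->. Qed.
End Homotopy.

Lemma homot_comp {R : realType} (T S : topologicalType) k (f : S -> T)
  (u v : T -> 'rV[R]_k) : continuous f -> homot u v -> homot (u \o f) (v \o f).
move=>cf [H [cH H0 Hu Hv]]; exists (fun t p => H t (f p)); split => //=.
move=> [t p]; apply:(@continuous_comp _ _ _ (fun z : R * S => (z.1, f z.2)) (fun z => H z.1 z.2)).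
 have c1 : z.1 @[z --> (t, p)] --> t by exact:cvg_fst.
 have c2 := @cvg_snd_comp _ _ _ f t p (cf p).
 exact:(cvg_pair c1 c2).
exact:cH.
Qed.

(** * Inner product and perturbations of the identity *)

Section Dot.
Context {R : realType}.

Definition dot k (u v : 'rV[R]_k) : R := (u *m v^T) 0 0.
Lemma dotE k (u v : 'rV_k) : dot u v = \sum_i u 0 i * v 0 i.
by rewrite /dot mxE; apply:eq_bigr => i _; rewrite mxE. Qed.
Lemma dotC k (u v : 'rV_k) : dot u v = dot v u.
by rewrite !dotE; apply:eq_bigr => i _; rewrite mulrC. Qed.
Lemma dot_ge0 k (u : 'rV_k) : 0 <= dot u u.
by rewrite dotE; apply:sumr_ge0 => i _; rewrite -expr2 sqr_ge0. Qed.

Lemma dot_gt0 k (u : 'rV_k) : u != 0 -> 0 < dot u u.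
move=>u0; rewrite lt_def dot_ge0 andbT; apply:contraNneq u0.
rewrite dotE => /eqP; rewrite psumr_eq0 => [/allP H|i _]; last by rewrite -expr2 sqr_ge0.
apply/eqP/rowP => i; rewrite mxE; apply/eqP.
by have /= := H i (mem_index_enum i); rewrite mulf_eq0 orbb.
Qed.

Lemma dot_scalar k (u v : 'rV_k) : u *m v^T = (dot u v)%:M.
by rewrite [LHS]mx11_scalar. Qed.
Lemma dotDl k (u v w : 'rV_k) : dot (u + v) w = dot u w + dot v w.
by rewrite /dot mulmxDl mxE. Qed.
Lemma dotZl k a (u w : 'rV_k) : dot (a *: u) w = a * dot u w.
by rewrite /dot -scalemxAl mxE. Qed.
Lemma dotZr k a (u w : 'rV_k) : dot w (a *: u) = a * dot w u.
by rewrite ![dot w _]dotC dotZl. Qed.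
Lemma dot0l k (w : 'rV_k) : dot 0 w = 0.
by rewrite /dot mul0mx mxE. Qed.

Lemma cvg_dot (S : Type) (F : set_system S) {FF : Filter F} k (f g : S -> 'rV_k)
  (a b : 'rV_k) : f x @[x --> F] --> a -> g x @[x --> F] --> b ->
 dot (f x) (g x) @[x --> F] --> dot a b.
by move=>fa gb; apply:cvg_coord; apply:cvg_mulmx => //; exact:cvg_trmx. Qed.

Lemma small_unitmx k (A : 'M[R]_k) : k%:R * `|A| < 1 -> 1%:M + A \in unitmx.
move=>A1; apply:inj_unitmx => v; rewrite mulmxDr mulmx1 => /eqP.
rewrite addr_eq0 => /eqP vE; apply/eqP; rewrite -normr_eq0.
have : `|v| <= k%:R * `|A| * `|v|.
 by rewrite {1}vE normrN (le_trans (norm_mulmx _ _))// mulrCA mulrC.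
rewrite -subr_ge0 -[X in _ - X]mul1r -mulrBl => H.
rewrite eq_le normr_ge0 andbT.
by move: H; rewrite nmulr_rge0// subr_lt0.
Qed.
End Dot.

(** * Transport along homotopies by products of matrices close to 1 *)

Section Transport.
Context {R : realType} {T : topologicalType}.
Hypothesis Tc : compact [set: T].

Fixpoint eprod k (A : nat -> T -> 'M[R]_k) (N : nat) (p : T) : 'M[R]_k :=
 if N is N'.+1 then eprod A N' p *m (1%:M + A N' p) else 1%:M.

Lemma cvg_eprod (F : set_system T) {FF : Filter F} k (A : nat -> T -> 'M[R]_k) N p :
 (forall i, (i < N)%N -> A i x @[x --> F] --> A i p) ->
 eprod A N x @[x --> F] --> eprod A N p.
elim:N => [|N IH] H; first exact:cvg_cst.
apply:cvg_mulmx; first by apply:IH => i iN; apply:H; exact:ltnW.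
by apply:cvgD; [exact:cvg_cst|exact:H].
Qed.

Lemma eprod_unitmx k (A : nat -> T -> 'M[R]_k) N p :
 (forall i, (i < N)%N -> k%:R * `|A i p| < 1) -> eprod A N p \in unitmx.
elim:N => [|N IH] H; first exact:unitmx1.
rewrite unitmx_mul IH ?small_unitmx//; first exact:H.
by move=>i iN; apply:H; exact:ltnW.
Qed.

Lemma unif_steps_small k (G : R -> R -> T -> 'M[R]_k) :
 continuous (fun z : R * R * T => G z.1.1 z.1.2 z.2) -> (forall t p, G t t p = 0) ->
 exists N : nat, forall i p, (i < N.+1)%N ->
  k%:R * `|G (i%:R / N.+1%:R) (i.+1%:R / N.+1%:R) p| < 1.
move=>cG G0; have e0 : 0 < (k.+1%:R)^-1 :> R by rewrite invr_gt0.
have [N HN] := unif_steps Tc cG G0 e0; exists N => i p iN.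
have := HN i p iN; rewrite -[ltRHS]mulr1 -ltr_pdivrMl// invrK => H.
by apply:le_lt_trans H; rewrite ler_wpM2r// ler_nat.
Qed.

(** Rank one correction: [1 + step u w] sends u to w, and it tends to 1 as w tends to u. *)
Definition step k (u w : 'rV[R]_k) : 'M[R]_k := (dot u u)^-1 *: (u^T *m (w - u)).

Lemma stepE k (u w : 'rV_k) : u != 0 -> u *m (1%:M + step u w) = w.
move=>u0; rewrite mulmxDr mulmx1 /step -scalemxAr mulmxA dot_scalar.
by rewrite mul_scalar_mx scalerA mulVf ?scale1r ?gt_eqF ?dot_gt0// addrC subrK.
Qed.

Lemma mx_time_cont m n (H : R -> T -> 'M[R]_(m, n)) :
 continuous (fun z : R * T => H z.1 z.2) ->
 continuous (fun z : R * R * T => H z.1.1 z.2) /\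
 continuous (fun z : R * R * T => H z.1.2 z.2).
move=>cH; split.
- apply:(@compc _ _ _ (fun z : R * R * T => (z.1.1, z.2)) (fun z => H z.1 z.2)) => //.
 move=> [[t t'] p]; have c1 := @cvg_fst_comp _ _ _ fst (t, t') p (@cvg_fst R R (nbhs t) (nbhs t') (nbhs_filter t')).
 have c2 : z.2 @[z --> ((t, t', p) : R * R * T)] --> p by exact:cvg_snd.
 exact:(cvg_pair c1 c2).
- apply:(@compc _ _ _ (fun z : R * R * T => (z.1.2, z.2)) (fun z => H z.1 z.2)) => //.
 move=> [[t t'] p]; have c1 := @cvg_fst_comp _ _ _ snd (t, t') p (@cvg_snd R R (nbhs t) (nbhs t') (nbhs_filter t)).
 have c2 : z.2 @[z --> ((t, t', p) : R * R * T)] --> p by exact:cvg_snd.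
 exact:(cvg_pair c1 c2).
Qed.

Lemma slice_cont (W : topologicalType) (K : R * R * T -> W) (a b : R) :
 continuous K -> continuous (fun p => K (a, b, p)).
move=>cK p; apply:cvg_comp; last exact:cK.
exact:(cvg_pair (@cvg_cst _ (a, b) _ (nbhs p) _) (@cvg_id _ (nbhs p))).
Qed.

Lemma transport k (u v : T -> 'rV_k) (e : R) : 0 < e -> homot u v ->
 exists (N : nat) (A : nat -> T -> 'M[R]_k),
  [/\ forall i, continuous (A i), forall i p, (i < N)%N -> `|A i p| < e &
    forall p, v p = u p *m eprod A N p].
move=>e0 [H [cH H0 Hu Hv]].
have [c1 c2] := mx_time_cont cH.
pose G t t' p := step (H t p) (H t' p).
have cG : continuous (fun z : R * R * T => G z.1.1 z.1.2 z.2).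
 move=>z; apply:cvgZ.
  apply:cvgV; first by rewrite gt_eqF// dot_gt0.
  exact:(cvg_dot (c1 z) (c1 z)).
 apply:cvg_mulmx; first exact:(cvg_trmx (c1 z)).
 exact:(cvgB (c2 z) (c1 z)).
have G0 t p : G t t p = 0 by rewrite /G /step subrr mulmx0 scaler0.
have [N HN] := unif_steps Tc cG G0 e0.
pose A i p := G (i%:R / N.+1%:R) (i.+1%:R / N.+1%:R) p.
exists N.+1, A; split => //.
 by move=>i; exact:(@slice_cont _ (fun z => G z.1.1 z.1.2 z.2) (i%:R / N.+1%:R) (i.+1%:R / N.+1%:R) cG).
move=>p; have E j : H (j%:R / N.+1%:R) p = u p *m eprod A j p.
 elim:j => [|j IH]; first by rewrite mul0r mulmx1 Hu.
 by rewrite mulmxA -IH stepE.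
by rewrite -E divff// Hv.
Qed.

(* J-linear version: the rank one operator of [step] is replaced by the
  J-complex one for the J-invariant inner product of matrix 1 + J J^T. *)
Lemma transport_cplx k (J : 'M[R]_k) (u v : T -> 'rV_k) : J *m J = - 1%:M ->
 homot u v -> exists B : T -> 'M[R]_k,
  [/\ continuous B, forall p, B p \in unitmx, forall p, J *m B p = B p *m J &
    forall p, v p = u p *m B p].
move=>JJ [H [cH H0 Hu Hv]].
have [c1 c2] := mx_time_cont cH.
pose S := 1%:M + J *m J^T.
have JTJT : J^T *m J^T = - 1%:M by rewrite -trmx_mul JJ linearN /= trmx1.
have JS : J *m S = - (S *m J^T).
 rewrite mulmxDr mulmx1 mulmxA JJ mulmxDl mul1mx -mulmxA JTJT mulmxN mulmx1.
 by rewrite mulNmx mul1mx opprB.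
have JSJ : J *m S *m J^T = S.
 by rewrite JS mulNmx -mulmxA JTJT mulmxN mulmx1 opprK.
have ST : S^T = S by rewrite linearD /= trmx1 trmx_mul trmxK.
pose q w := dot (w *m S) w.
have qgt w : w != 0 -> 0 < q w.
 move=>w0; rewrite /q mulmxDr mulmx1 dotDl ltr_wpDr ?dot_gt0//.
 have -> : dot (w *m (J *m J^T)) w = dot (w *m J) (w *m J).
  by rewrite /dot trmx_mul !mulmxA.
 exact:dot_ge0.
pose sJ (w z : 'rV_k) : 'M[R]_k :=
 (q w)^-1 *: (S *m w^T *m (z - w) + S *m (w *m J)^T *m ((z - w) *m J)).
have sJE (w z : 'rV_k) : w != 0 -> w *m (1%:M + sJ w z) = z.
 move=>w0; rewrite mulmxDr mulmx1 -scalemxAr mulmxDr !mulmxA.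
 (* The matrix [J S] is skew, so this 1 by 1 matrix is its own opposite: w and w J are orthogonal
    for the form S. *)
 have -> : w *m S *m (w *m J)^T = 0.
  set X := _ *m _; have XX : X^T = X by rewrite [X]mx11_scalar tr_scalar_mx.
  have XN : X^T = - X.
   rewrite /X trmx_mul trmxK [(w *m S)^T]trmx_mul ST !mulmxA -[w *m J *m S]mulmxA.
   by rewrite JS mulmxN mulNmx [(w *m J)^T]trmx_mul !mulmxA.
  apply/eqP; have /eqP := XN; rewrite XX -subr_eq0 opprK -mulr2n.
  by rewrite -scaler_nat scaler_eq0 pnatr_eq0.
 rewrite mul0mx mul0mx addr0 dot_scalar mul_scalar_mx scalerA mulVf ?gt_eqF ?qgt//.
 by rewrite scale1r addrC subrK.
have sJJ (w z : 'rV_k) : J *m sJ w z = sJ w z *m J.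
 rewrite -scalemxAr -scalemxAl; congr (_ *: _).
 rewrite mulmxDr mulmxDl !trmx_mul !mulmxA JSJ JS.
 rewrite addrC; congr (_ + _).
 by rewrite -[RHS]mulmxA JJ mulmxN mulmx1 !mulNmx.
pose G t t' p := sJ (H t p) (H t' p).
have cG : continuous (fun z : R * R * T => G z.1.1 z.1.2 z.2).
 have cc (M : 'M[R]_k) z : cst M x @[x --> nbhs (z : R * R * T)] --> M by exact:cvg_cst.
 move=>z; have FF : Filter (nbhs z) := @nbhs_filter (R * R * T)%type z.
 pose proof (cvgB (c2 z) (c1 z)) as cd.
 have q0 : q (H z.1.1 z.2) != 0 by rewrite gt_eqF// qgt.
 pose proof (cvg_dot (cvg_mulmx (c1 z) (cc S z)) (c1 z)) as d1.
 pose proof (cvg_mulmx (cvg_mulmx (cc S z) (cvg_trmx (c1 z))) cd) as d2.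
 pose proof (cvg_mulmx (cvg_mulmx (cc S z) (cvg_trmx (cvg_mulmx (c1 z) (cc J z))))
   (cvg_mulmx cd (cc J z))) as d3.
 exact:(cvgZ (cvgV q0 d1) (cvgD d2 d3)).
have G0 t p : G t t p = 0 by rewrite /G /sJ subrr mul0mx !mulmx0 addr0 scaler0.
have [N HN] := unif_steps_small cG G0.
pose A i p := G (i%:R / N.+1%:R) (i.+1%:R / N.+1%:R) p.
exists (eprod A N.+1); split.
- move=>p; apply:cvg_eprod => i iN.
 exact:(@slice_cont _ (fun z => G z.1.1 z.1.2 z.2) (i%:R / N.+1%:R) (i.+1%:R / N.+1%:R) cG).
- by move=>p; apply:eprod_unitmx => i iN; exact:HN.
- move=>p; elim:(N.+1) => [|j IH]; first by rewrite mulmx1 mul1mx.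
 by rewrite mulmxA IH -!mulmxA mulmxDr mulmxDl mulmx1 mul1mx sJJ.
- move=>p; have E j : H (j%:R / N.+1%:R) p = u p *m eprod A j p.
  elim:j => [|j IH]; first by rewrite mul0r mulmx1 Hu.
  by rewrite mulmxA -IH sJE.
 by rewrite -E divff// Hv.
Qed.

(** For two complex structures, 1 - J J' intertwines them, since J (1 - J J') = J + J' = (1 - J J')
    J'. Halved, it equals 1 when J = J', so it is close to 1 for close times, and the factors
    compose along the homotopy. *)
Lemma cplx_trivial k (J : R -> T -> 'M[R]_k) :
 continuous (fun z : R * T => J z.1 z.2) -> (forall t p, J t p *m J t p = - 1%:M) ->
 exists G : T -> 'M[R]_k, [/\ continuous G, forall p, G p \in unitmx &
  forall p, J 0 p *m G p = G p *m J 1 p].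
move=>cJ JJ; have [c1 c2] := mx_time_cont cJ.
pose G t t' p := - 2^-1 *: (1%:M + J t p *m J t' p).
have cG : continuous (fun z : R * R * T => G z.1.1 z.1.2 z.2).
 move=>z; apply:cvgZ; first exact:cvg_cst.
 exact:(cvgD (cvg_cst _) (cvg_mulmx (c1 z) (c2 z))).
have G0 t p : G t t p = 0 by rewrite /G JJ subrr scaler0.
have [N HN] := unif_steps_small cG G0.
pose A i p := G (i%:R / N.+1%:R) (i.+1%:R / N.+1%:R) p.
exists (eprod A N.+1); split.
- move=>p; apply:cvg_eprod => i iN.
 exact:(@slice_cont _ (fun z => G z.1.1 z.1.2 z.2) (i%:R / N.+1%:R) (i.+1%:R / N.+1%:R) cG).
- by move=>p; apply:eprod_unitmx => i iN; exact:HN.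
- move=>p; have E j : J 0 p *m eprod A j p = eprod A j p *m J (j%:R / N.+1%:R) p.
  elim:j => [|j IH]; first by rewrite mul0r mulmx1 mul1mx.
  rewrite mulmxA IH -!mulmxA; congr (_ *m _).
  rewrite /A /G; set J1 := J _ p; set J2 := J _ p.
  have J11 : J1 *m J1 = - 1%:M by exact:JJ.
  have J22 : J2 *m J2 = - 1%:M by exact:JJ.
  rewrite mulmxDr mulmxDl mulmx1 mul1mx -scalemxAr -scalemxAl mulmxDr mulmxDl.
  rewrite mulmx1 mul1mx mulmxA J11 -mulmxA J22 mulmxN mulmx1 mulNmx mul1mx.
  by apply/matrixP => a b; rewrite !mxE; field.
 by rewrite E divff.
Qed.

(* A line bundle (or any bundle) given by idempotents over T x [0,1] has a
  nowhere zero section over T x {1} if it has a constant one over T x {0}. *)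
Lemma idem_section k (P : R -> T -> 'M[R]_k) (e0 : 'rV_k) :
 continuous (fun z : R * T => P z.1 z.2) -> (forall t p, P t p *m P t p = P t p) ->
 e0 != 0 -> (forall p, e0 *m P 0 p = e0) ->
 exists e : T -> 'rV[R]_k,
  [/\ continuous e, forall p, e p != 0 & forall p, e p *m P 1 p = e p].
move=>cP PP e00 eP; have [c1 c2] := mx_time_cont cP.
pose G t t' p := P t' p - P t p.
have cG : continuous (fun z : R * R * T => G z.1.1 z.1.2 z.2).
 by move=>z; exact:(cvgB (c2 z) (c1 z)).
have G0 t p : G t t p = 0 by rewrite /G subrr.
have [N HN] := unif_steps_small cG G0.
pose A i p := G (i%:R / N.+1%:R) (i.+1%:R / N.+1%:R) p.
have E p j : e0 *m eprod A j p *m P (j%:R / N.+1%:R) p = e0 *m eprod A j p.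
 elim:j => [|j IH]; first by rewrite mul0r mulmx1 eP.
 rewrite mulmxA; set e := e0 *m eprod A j p in IH *.
 (* As [e] is fixed by the present idempotent P, the factor 1 + P' - P sends it to e P', which the
    next idempotent P' fixes. *)
 have -> : e *m (1%:M + A j p) = e *m P (j.+1%:R / N.+1%:R) p.
  by rewrite mulmxDr mulmx1 /A /G mulmxBr IH addrC subrK.
 by rewrite -mulmxA PP.
exists (fun p => e0 *m eprod A N.+1 p); split.
- move=>p; apply:cvg_mulmx; first exact:cvg_cst.
 apply:cvg_eprod => i iN.
 exact:(@slice_cont _ (fun z => G z.1.1 z.1.2 z.2) (i%:R / N.+1%:R) (i.+1%:R / N.+1%:R) cG).
- move=>p; apply:contraNneq e00 => H; apply/eqP.
 have u : eprod A N.+1 p \in unitmx by apply:eprod_unitmx => i iN; exact:HN.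
 by rewrite -[e0](mulmxK u) H mul0mx.
- by move=>p; have := E p N.+1; rewrite divff.
Qed.
End Transport.

(** * Orthogonal projection onto the complement of a row space *)

Section NormalProjection.
Context {R : realType}.

Lemma Ck_loc (V W : normedModType R) k (U : set V) (f : V -> W) :
 (forall x, U x -> exists A : set V, [/\ A x & Ck_on k A f]) -> Ck_on k U f.
elim:k f => [|k IH] f H.
 by move=>x /H [A [Ax]]; apply.
split=> [x /H [A [Ax [df _]]]|v]; first exact:df.
by apply:IH => x /H [A [Ax [_ /(_ v) HA]]]; exists A.
Qed.

Lemma diff_min (V : normedModType R) (phi : V -> R) x :
 differentiable phi x -> (\forall y \near x, phi x <= phi y) ->
 forall u, 'd phi x u = 0.
move=>dphi xmin.
have key u : 0 <= 'd phi x u.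
 apply/ler_addgt0Pr => e e0.
 have e'0 : 0 < e / (`|u| + 1) by rewrite divr_gt0// ltr_wpDl.
 have /nbhs_ballE[d d0 Hd] := diff_eps dphi e'0.
 have /nbhs_ballE[r r0 Hr] := xmin.
 pose t := Num.min d r / (2 * (`|u| + 1)).
 have m0 : 0 < Num.min d r by rewrite lt_min d0.
 have t0 : 0 < t by rewrite divr_gt0// mulr_gt0.
 pose h := t *: u.
 have hs : `|h| < Num.min d r.
  rewrite normrZ gtr0_norm// /t mulrAC ltr_pdivrMr//.
  by rewrite ltr_pM2l//; have := normr_ge0 u; lra.
 move: (hs); rewrite lt_min => /andP[hd hr].
 have := Hd h; rewrite subr0 => /(_ hd); rewrite ler_norml => /andP[_ H].
 have := Hr (h + x); rewrite addrK => /(_ hr) H2.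
 have dE : 'd phi x h = t * 'd phi x u by rewrite linearZ.
 move: H; rewrite dE normrZ gtr0_norm// => H.
 have H4 : e / (`|u| + 1) * (t * `|u|) <= t * e.
  rewrite mulrCA ler_pM2l// mulrAC ler_pdivrMr// ler_pM2l// lerDl.
  by [].
 rewrite -(ler_pM2l t0) mulr0 mulrDr.
 by move: H H2 H4; set A := t * _; set B := _ / _ * _; lra.
move=>u; apply/le_anti; rewrite key andbT.
by have := key (- u); rewrite linearN oppr_ge0.
Qed.

Lemma gram_unit m D (A : 'M[R]_(m, D)) : (forall v : 'rV_m, v *m A = 0 -> v = 0) ->
 A *m A^T \in unitmx.
move=>iA; apply:inj_unitmx => v vAA; apply:iA.
apply/eqP; apply:contraTT isT => vA0.
have := dot_gt0 vA0; rewrite /dot trmx_mul mulmxA -[v *m A *m A^T]mulmxA vAA mul0mx mxE.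
by rewrite ltxx.
Qed.

(** One minus the projection onto the row space of A, written with the inverse Gram matrix. It
    depends on the row space alone ([nproj_mul]), which later makes it independent of the chart. *)
Definition nproj m D (A : 'M[R]_(m, D)) : 'M[R]_D := 1%:M - A^T *m invmx (A *m A^T) *m A.

Lemma invmx_mulmx n (A B : 'M[R]_n) : A \in unitmx -> B \in unitmx ->
 invmx (A *m B) = invmx B *m invmx A.
move=>uA uB; have uAB : A *m B \in unitmx by rewrite unitmx_mul uA.
apply:(can_inj (mulKmx uAB)); rewrite mulmxV// mulmxA -(mulmxA A) mulmxV//.
by rewrite mulmx1 mulmxV.
Qed.
Section NProj.
Context {m D : nat} {A : 'M[R]_(m, D)}.
Hypothesis iA : forall v : 'rV_m, v *m A = 0 -> v = 0.

Lemma nprojA : A *m nproj A = 0.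
by rewrite /nproj mulmxBr mulmx1 !mulmxA mulmxV ?gram_unit// mul1mx subrr.
Qed.

Lemma nproj_tr : (nproj A)^T = nproj A.
rewrite /nproj linearB /= trmx1 !trmx_mul trmxK trmx_inv trmx_mul trmxK.
by rewrite !mulmxA.
Qed.

Lemma nproj_fix p (v : 'M[R]_(p, D)) : v *m A^T = 0 -> v *m nproj A = v.
by move=>vA; rewrite /nproj mulmxBr mulmx1 !mulmxA vA !mul0mx subr0. Qed.
Lemma nproj_trA : nproj A *m A^T = 0.
by rewrite -[nproj A]nproj_tr -trmx_mul nprojA trmx0. Qed.
Lemma nproj_idem : nproj A *m nproj A = nproj A.
exact/nproj_fix/nproj_trA. Qed.

Lemma nproj_ker p (v : 'M[R]_(p, D)) : v *m nproj A = 0 -> exists u, v = u *m A.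
rewrite /nproj mulmxBr mulmx1 => /eqP; rewrite subr_eq0 => /eqP vE.
by exists (v *m (A^T *m invmx (A *m A^T))); rewrite !mulmxA in vE *.
Qed.

Lemma nproj_mul (B : 'M[R]_m) : B \in unitmx -> nproj (B *m A) = nproj A.
move=>uB; rewrite /nproj; congr (_ - _).
have uG := gram_unit iA.
have -> : B *m A *m (B *m A)^T = B *m (A *m A^T *m B^T) by rewrite trmx_mul !mulmxA.
rewrite invmx_mulmx ?unitmx_mul ?uG ?unitmx_tr// invmx_mulmx ?unitmx_tr//.
rewrite trmx_mul !mulmxA -[A^T *m B^T *m invmx B^T]mulmxA mulmxV ?unitmx_tr// mulmx1.
by rewrite -[_ *m invmx B *m B]mulmxA mulVmx// mulmx1.
Qed.
End NProj.

Lemma cvg_nproj (S : Type) (F : set_system S) {FF : Filter F} m D (A : S -> 'M[R]_(m, D))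
  (B : 'M[R]_(m, D)) : (forall v : 'rV_m, v *m B = 0 -> v = 0) ->
 A x @[x --> F] --> B -> nproj (A x) @[x --> F] --> nproj B.
move=>iB AB; apply:cvgB; first exact:cvg_cst.
apply:cvg_mulmx => //; apply:cvg_mulmx; first exact:cvg_trmx.
apply:cvg_invmx; first exact:gram_unit.
by apply:cvg_mulmx => //; exact:cvg_trmx.
Qed.
End NormalProjection.

(** * The embedding in charts and its normal projection *)

Section Embedding.
Context {R : realType} {m D : nat} {M : manifold R m}.
Variable f : smooth_map M (euclidean R D).
Hypothesis fE : smooth_embedding f.
Let F : M -> 'rV[R]_D := f.
Definition loc (i : index M) : 'rV[R]_m -> 'rV[R]_D := fun x => F (chart_inv i x).
Definition locjac i (p : M) : 'M[R]_(m, D) := jac (loc i) (chart i p).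

Lemma loc_smooth i : smooth_on (chart i @` dom i) (loc i).
move=>k; apply:Ck_sub (smooth_fun_smooth f i tt k).
by move=> _ [p ip <-]; exists p.
Qed.

Lemma locK i p : dom i p -> loc i (chart i p) = F p.
by move=>ip; rewrite /loc chart_invK. Qed.
Lemma F_cont : continuous F.
by move=>p; exact:(@smooth_fun_continuous _ _ _ _ _ f p). Qed.
Lemma F_inj : injective F.
by case:fE. Qed.

Lemma tangent_mapJ i p (v : tangent p) : dom i p ->
 tangent_map f v tt = v i *m locjac i p.
by move=>ip; rewrite (@tangent_mapE _ _ _ _ _ f p v i tt ip)// -jacE. Qed.

Lemma locjac_inj i p : dom i p -> forall v : 'rV_m, v *m locjac i p = 0 -> v = 0.
move=>ip v v0; have [_ _ /(_ p) inj] := fE.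
have [t [ti _]] := tangent_coord_unique v ip.
suff t0 : t = 0 by rewrite -ti t0.
apply:inj; apply/val_inj/funext => -[].
apply:etrans (tangent_mapJ t ip) _; apply:etrans _ (esym (tangent_mapJ 0 ip)).
rewrite ti v0.
by rewrite [(0 : tangent p) i](_ : _ = 0)// mul0mx.
Qed.

Lemma locjac_change i j p : dom i p -> dom j p ->
 exists2 B, B \in unitmx & locjac i p = B *m locjac j p.
move=>ip jp; pose B := jac (chart j \o chart_inv i) (chart i p).
have E : locjac i p = B *m locjac j p.
 have key (v : 'rV_m) : v *m locjac i p = v *m (B *m locjac j p).
  have [t [ti _]] := tangent_coord_unique v ip.
  rewrite mulmxA -ti -(tangent_mapJ t ip) (tangent_mapJ t jp).
  have /asboolP[_ /(_ i j ip jp) ->] := tcoordP t.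
  by rewrite jacE.
 by apply/row_matrixP => k; rewrite !rowE key.
exists B => //; apply:inj_unitmx => v vB; apply:(locjac_inj ip).
by rewrite E mulmxA vB mul0mx.
Qed.

Lemma locjac_cvg i p : dom i p -> locjac i q @[q --> p] --> locjac i p.
move=>ip; apply:(@cvg_comp _ _ _ (chart i) (jac (loc i)) (nbhs p) (nbhs (chart i p))).
 exact:chart_continuous.
exact:(Ck_on0 (Ck_jac (codom_open (i := i)) (@loc_smooth i 1%N))); exists p.
Qed.

Definition Qn (p : M) : 'M[R]_D := nproj (locjac (projT1 (cid (dom_cover p))) p).

Lemma QnE i p : dom i p -> Qn p = nproj (locjac i p).
move=>ip; rewrite /Qn; case:cid => j jp.
have [B uB ->] := locjac_change jp ip.
by rewrite nproj_mul//; exact:locjac_inj.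
Qed.

Lemma Qn_cont : continuous Qn.
move=>p; have [i ip] := dom_cover p.
rewrite /continuous_at (QnE ip).
apply:cvg_trans.
 apply:near_eq_cvg; have := near_dom ip.
 by apply:filterS => q iq; rewrite (QnE iq).
by apply:cvg_nproj; [exact:locjac_inj|exact:locjac_cvg].
Qed.

Lemma Qn_idem p : Qn p *m Qn p = Qn p.
by have [i ip] := dom_cover p; rewrite (QnE ip) nproj_idem//; exact:locjac_inj. Qed.
Lemma Qn_tr p : (Qn p)^T = Qn p.
by have [i ip] := dom_cover p; rewrite (QnE ip) nproj_tr. Qed.

(** Metric form of the homeomorphism onto the image: points of M whose images are close are
    close. *)
Lemma F_near p (A : set M) : nbhs p A ->
 exists2 r : R, 0 < r & forall q, `|F q - F p| < r -> A q.
rewrite nbhsE => -[B [oB Bp] BA].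
have [_ /(_ B oB) [V oV FB] _] := fE.
have VFp : V (F p).
 have : (f @` B) (F p) by exists p.
 by rewrite FB => -[].
have /nbhs_ballE[r r0 Hr] : nbhs (F p) V by exact:open_nbhs_nbhs.
exists r => // q /Hr Vq; apply:BA.
have : (f @` B) (F q) by rewrite FB; split => //; exists q.
by move=> [q' Bq' /F_inj <-].
Qed.
End Embedding.
Section DiffRules.
Context {R : realType}.

Lemma diff_mulmx (V : normedModType R) m n p (A : V -> 'M[R]_(m, n)) (B : V -> 'M[R]_(n, p)) x :
 differentiable A x -> differentiable B x ->
 differentiable (fun y => A y *m B y) x /\
 forall v, 'd (fun y => A y *m B y) x v = A x *m 'd B x v + 'd A x v *m B x.
move=>dA dB.
have cb : continuous (fun q : 'M[R]_(m, n) * 'M[R]_(n, p) => mulmx q.1 q.2).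
 by move=> [a b]; apply:cvg_mulmx; [exact:cvg_fst|exact:cvg_snd].
have db q := @differentiable_bilin R _ _ _ (@mulmx R m n p) q cb.
have dp := differentiable_pair dA dB.
split; first exact:(differentiable_comp dp (db (A x, B x))).
move=>v; have E1 := congr1 (fun F => F v) (diff_comp dp (db (A x, B x))).
have E2 := congr1 (fun F => F ('d A x v, 'd B x v)) (@diff_bilin R _ _ _ (@mulmx R m n p) (A x, B x) cb).
have E3 := congr1 (fun F => F v) (diff_pair dA dB).
apply:etrans E1 _; rewrite /= E3; exact:E2.
Qed.

Lemma diff_linl (V W U : normedModType R) (f : V -> W) (L : {linear W -> U}) x :
 continuous L -> differentiable f x ->
 differentiable (fun y => L (f y)) x /\ forall v, 'd (fun y => L (f y)) x v = L ('d f x v).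
move=>cL df; have dL := linear_differentiable (f x) cL.
split; first exact:(differentiable_comp df dL).
move=>v; apply:etrans (congr1 (fun F => F v) (diff_comp df dL)) _.
exact:(congr1 (fun F => F ('d f x v)) (diff_lin (f x) cL)).
Qed.

Lemma smooth_on_linear (V W : normedModType R) (A : set V) (L : {linear V -> W}) :
 continuous L -> smooth_on A L.
move=>cL k; apply:(@Ck_sub _ _ _ _ _ setT) => //.
apply:Ck_linl => //.
Qed.

Lemma dot_le k (u : 'rV[R]_k) : dot u u <= k%:R * `|u| ^+ 2.
rewrite dotE; apply:(@le_trans _ _ (\sum_(i < k) `|u| ^+ 2)).
 apply:ler_sum => i _; rewrite -expr2 -[leLHS]real_normK ?num_real//.
 by rewrite lerXn2r ?nnegrE// entry_le.
by rewrite sumr_const card_ord mulr_natl.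
Qed.

Lemma norm_le_dot k (u : 'rV[R]_k) : `|u| ^+ 2 <= dot u u.
have [->|u0] := eqVneq u 0; first by rewrite normr0 expr0n dot0l.
have nu0 : mx_norm u != 0 by apply:contraNneq u0 => /mx_norm_eq0 ->.
have [[i j] /= uE] := mx_norm_neq0 nu0.
rewrite [`|u|]uE (ord1 i) dotE (bigD1 j)//= real_normK ?num_real// expr2 lerDl.
by apply:sumr_ge0 => l _; rewrite -expr2 sqr_ge0.
Qed.

Lemma row_mx_norm_lt m n (u : 'rV_m) (v : 'rV_n) (r : R) : 0 < r ->
 `|u| < r -> `|v| < r -> `|row_mx u v| < r.
move=>r0 ur vr; rewrite /Num.Def.normr /= mx_normrE; apply:bigmax_lt => // -[i j] _.
rewrite (ord1 i) mxE; case:(fintype.split j) => l.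
 exact:le_lt_trans (entry_le _ _ _) ur.
exact:le_lt_trans (entry_le _ _ _) vr.
Qed.
End DiffRules.

(** * Nearest point projection *)

Section Tubular.
Context {R : realType} {m D : nat} {M : manifold R m}.
Variables (f : smooth_map M (euclidean R D)) (fE : smooth_embedding f) (Mc : closed_manifold M) (p_ : M).
Let F : M -> 'rV[R]_D := f.

Definition nearest (y : 'rV[R]_D) (p : M) :=
 forall q, dot (y - F p) (y - F p) <= dot (y - F q) (y - F q).

Lemma nearest_ex y : exists p, nearest y p.
have [|||p _ pmin] := @compact_EVT_min M R (fun p => dot (y - F p) (y - F p)) setT.
- by exists p_.
- exact:Mc.
- apply:continuous_subspaceT => q.
 have c : y - F p @[p --> q] --> y - F q by exact:(cvgB (cvg_cst y) (F_cont (x := q))).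
 exact:(cvg_dot c c).
by exists p => q; apply:pmin; rewrite inE.
Qed.

(** An arbitrary choice of nearest point, made for every y; uniqueness and smoothness hold on
    [tubU]. *)
Definition tubpi (y : 'rV[R]_D) : M := projT1 (cid (nearest_ex y)).
Lemma tubpiP y : nearest y (tubpi y). Proof. exact:(projT2 (cid (nearest_ex y))). Qed.

Lemma nearest_self p q : nearest (F p) q -> q = p.
move=> /(_ p); rewrite subrr dot0l => H; apply:(F_inj fE).
apply/esym/eqP; rewrite -subr_eq0; apply:contraTT isT => /dot_gt0.
by rewrite ltNge H.
Qed.

Lemma tubpi_id p : tubpi (F p) = p.
exact/nearest_self/tubpiP. Qed.

(** [nearest] minimises the Euclidean distance while the norm is the sup norm; the factors D.+1 and
    D.+2 pay for the comparison. *)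
Lemma nearest_close y p p0 : nearest y p -> `|F p - F p0| <= (D.+2)%:R * `|y - F p0|.
move=> /(_ p0) H.
have h1 : `|y - F p| <= D.+1%:R * `|y - F p0|.
 rewrite -(@ler_pXn2r _ 2)// ?nnegrE// exprMn.
 apply:le_trans (norm_le_dot _) _; apply:le_trans H _; apply:le_trans (dot_le _) _.
 rewrite ler_wpM2r// expr2 -natrM ler_nat.
 by rewrite mulSn -[X in (X <= _)%N]addn0 leq_add.
have -> : F p - F p0 = (y - F p0) - (y - F p) by apply/rowP => i; rewrite !mxE; ring.
by rewrite (le_trans (ler_normB _ _))// -[D.+2]add1n natrD mulrDl mul1r lerD2l.
Qed.

(** First order condition at the minimum of the squared distance, read in the chart. *)
Lemma nearest_normal y p i : dom i p -> nearest y p -> (y - F p) *m (locjac f i p)^T = 0.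
move=>ip pmin; pose x := chart i p.
have Ox : (chart i @` dom i) x by exists p.
have dg : differentiable (loc f i) x by have [+ _] := loc_smooth f i 1%N; apply.
pose A z := y - loc f i z.
have Ax : A x = y - F p by rewrite /A /x locK.
have dA : differentiable A x by apply:differentiableB.
have dAE u : 'd A x u = - (u *m locjac f i p).
 have E := congr1 (fun F => F u) (@diffB R _ _ (cst y) (loc f i) x (differentiable_cst _ _) dg).
 have E0 := congr1 (fun F => F u) (diff_cst y x).
 exact:etrans E (etrans (congr2 (fun a b => a - b) E0 (jacE (loc f i) x u)) (sub0r _)).
pose trL : {linear 'rV_D -> 'cV_D} := (@trmx R 1 D).
have ctr : continuous trL by move=>z; apply:(@cvg_trmx _ _ (nbhs z) _ _ _ id) => A'.
have [dT dTE] := diff_linl ctr dA.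
have [dP dPE] := diff_mulmx dA dT.
pose en : {linear 'M[R]_(1, 1) -> R} := @mx_entry R 1 1 0 0.
have cen : continuous en by exact:coord_continuous.
have [dphi dphiE] := diff_linl cen dP.
have H0 := diff_min dphi.
have {}H0 u : dot (u *m locjac f i p) (y - F p) = 0.
 have : 'd (fun z => en (A z *m trL (A z))) x u = 0.
  apply:H0; have := @codom_open _ _ M i; rewrite openE => /(_ x Ox).
  apply:filterS => _ [q iq <-]; have := pmin q.
  by rewrite /en /= /mx_entry -/(dot (A x) (A x)) Ax /A locK.
 rewrite dphiE dPE dTE dAE Ax.
 rewrite /en /= /mx_entry /trL /= linearN /= mulmxN mulNmx mxE [X in X + _]mxE [X in _ + X]mxE.
 rewrite -/(dot (y - F p) (u *m locjac f i p)) -/(dot (u *m locjac f i p) (y - F p)).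
 by rewrite dotC; lra.
apply:trmx_inj; rewrite trmx_mul trmxK trmx0.
apply/row_matrixP => k; rewrite row0 rowE mulmxA dot_scalar (H0 (delta_mx 0 k)).
exact:raddf0.
Qed.

(** The inverse function theorem for [Phi] (x, y) = ((y - g x) (jac g x)^T, y) at (x0, F p0). There
    the derivative in x is minus the Gram matrix of the chart, so [Phi] is a local diffeomorphism. A
    nearest point x of y satisfies [Phi] (x, y) = (0, y), so it is the first component of the
    inverse at (0, y). *)
Lemma local_proj p0 : exists i, dom i p0 /\ exists (r : R) (xl : 'rV_D -> 'rV_m),
 [/\ 0 < r, smooth_on [set y | `|y - F p0| < r] xl &
   forall y p, `|y - F p0| < r -> nearest y p -> dom i p /\ chart i p = xl y].
have [i ip] := dom_cover p0; exists i; split => //.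
pose g := loc f i; pose x0 := chart i p0; pose Dom := chart i @` dom i.
have oDom : open Dom by exact:codom_open.
have Dx0 : Dom x0 by exists p0.
pose J := locjac f i p0.
pose lL : {linear 'rV_(m + D) -> 'rV_m} := @lsubmx R 1 m D.
pose rL : {linear 'rV_(m + D) -> 'rV_D} := @rsubmx R 1 m D.
have cl : continuous lL by exact:continuous_lsubmx.
have cr : continuous rL by exact:continuous_rsubmx.
pose A z := rL z - g (lL z).
pose B z := (jac g (lL z))^T.
pose Phi z := row_mx (A z *m B z) (rL z).
pose Dom' := lL @^-1` Dom.
have oDom' : open Dom' by apply:open_comp => // z _; exact:cl.
have sr V : smooth_on V rL by exact:smooth_on_linear.
have sg : smooth_on Dom g by exact:loc_smooth.
have sA : smooth_on Dom' A.
 move=>k; apply:CkB => //; first exact:sr.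
 exact:Ck_linr.
have sB : smooth_on Dom' B.
 move=>k; apply:Ck_trmx => //.
 by apply:Ck_linr => //; apply:Ck_jac.
have sPhi : smooth_on Dom' Phi.
 by move=>k; apply:(Ck_row_mx oDom' (Ck_mulmx oDom' (sA k) (sB k))); exact:sr.
pose z0 : 'rV_(m + D) := row_mx x0 (F p0).
have lz0 : lL z0 = x0 by rewrite /lL /= row_mxKl.
have rz0 : rL z0 = F p0 by rewrite /rL /= row_mxKr.
have Dz0 : Dom' z0 by rewrite /Dom' /= lz0.
have Az0 : A z0 = 0 by rewrite /A lz0 rz0 /g /x0 locK// subrr.
have Bz0 : B z0 = J^T by rewrite /B lz0.
have [dA _] := sA 1%N; have [dB _] := sB 1%N; have [dPhi _] := sPhi 1%N.
have dgx : differentiable g x0 by have [+ _] := sg 1%N; apply.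
have dAE v : 'd A z0 v = rL v - lL v *m J.
 have dll := linear_differentiable z0 cl.
 have dgx' : differentiable g (lL z0) := eq_ind_r (fun x => differentiable g x) dgx lz0.
 have dgl : differentiable (fun z => g (lL z)) z0 := differentiable_comp dll dgx'.
 have dglE w : 'd (fun z => g (lL z)) z0 w = lL w *m J.
  have E1 := congr1 (fun F => F w) (diff_comp dll dgx').
  have E2 := congr1 (fun y => 'd g (lL z0) y) (congr1 (fun F => F w) (diff_lin z0 cl)).
  have E3 := congr1 (fun y => lL w *m jac g y) lz0.
  exact:etrans E1 (etrans E2 (etrans (jacE _ _ _) E3)).
 have drr := linear_differentiable z0 cr.
 have E1 := congr1 (fun F => F v) (diffB drr dgl).
 have E2 := congr1 (fun F => F v) (diff_lin z0 cr).
 exact:etrans E1 (congr2 (fun a b => a - b) E2 (dglE v)).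
have uPhi : jac Phi z0 \in unitmx.
 apply:inj_unitmx => v; rewrite -jacE => v0.
 have [dAB dABE] := diff_mulmx (dA z0 Dz0) (dB z0 Dz0).
 have rv : rL v = 0.
  have [_ H] := diff_linl cr (dPhi z0 Dz0).
  have := H v; rewrite v0 linear0 => <-.
  have -> : (fun y => rL (Phi y)) = rL by apply/funext => y; rewrite /rL /= row_mxKr.
  by apply/esym; exact:(congr1 (fun F => F v) (diff_lin z0 cr)).
 have lv : (lL v *m J) *m J^T = 0.
  have [_ H] := diff_linl cl (dPhi z0 Dz0).
  have := H v; rewrite v0 linear0.
  have -> : (fun y => lL (Phi y)) = (fun y => A y *m B y) by apply/funext => y; rewrite /lL /= row_mxKl.
  rewrite dABE Az0 mul0mx add0r dAE rv sub0r Bz0 mulNmx => /eqP.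
  by rewrite oppr_eq0 => /eqP.
 have lv0 : lL v = 0.
  have uG := gram_unit (locjac_inj fE ip).
  by rewrite -[lL v](mulmxK uG) !mulmxA lv mul0mx.
 by rewrite -[v](@hsubmxK _ 1 m D) -/(lL v) -/(rL v) lv0 rv row_mx0.
have [Bs [oBs Bz0' BsD uBs [gi [oI sgi giK]]]] := ift oDom' Dz0 sPhi uPhi.
pose emb y : 'rV[R]_(m + D) := row_mx 0 y.
have semb V : smooth_on V emb.
 move=>k; apply:Ck_sub; first exact:subsetT.
 have c0 : Ck_on k setT (fun _ : 'rV_D => 0 : 'rV[R]_m) by exact:Ck_cst.
 exact:(Ck_row_mx openT c0 (@smooth_on_id R 'rV_D setT k)).
have Phiz0 : Phi z0 = emb (F p0) by rewrite /Phi Az0 mul0mx rz0.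
have N1 : nbhs (F p0) [set y | (Phi @` Bs) (emb y)].
 have c : emb y @[y --> F p0] --> emb (F p0) by exact:(Ck_on0 (semb setT 0%N)).
 apply:c; apply:open_nbhs_nbhs; split; first exact:oI.
 by exists z0; [exact:Bz0'|exact:Phiz0].
have /nbhs_ballE[r1 r10 H1] := N1.
have /nbhs_ballE[s s0 Hs] := open_nbhs_nbhs (conj oBs Bz0').
have N2 : nbhs p0 [set p | dom i p /\ `|chart i p - x0| < s].
 apply:filterI; first exact:near_dom.
 have c : chart i p @[p --> p0] --> x0 by exact:chart_continuous.
 by have /cvgrPdistC_lt := c; apply.
have [r2 r20 H2] := F_near fE N2.
(* The quotient by D.+2 forces every nearest point of y into the chart and into the ball where [Phi]
   is inverted, by [nearest_close]. *)
pose r := Num.min r1 (Num.min s (r2 / D.+2%:R)).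
exists r, (fun y => lL (gi (emb y))); split.
- by rewrite /r !lt_min r10 s0 divr_gt0.
- have oB : open [set y : 'rV_D | `|y - F p0| < r] by exact:open_ball.
 have AB y : `|y - F p0| < r -> (Phi @` Bs) (emb y).
  by rewrite lt_min => /andP[/H1].
 move=>k; apply:(Ck_linl oB cl).
 exact:(Ck_comp (@has_basis_mx R 1 (m + D)) oB oI AB (semb _ k) (sgi k)).
- move=>y p; rewrite !lt_min => /andP[yr1 /andP[ys yr2]] pmin.
 have pr2 : `|F p - F p0| < r2.
  by apply:le_lt_trans (nearest_close p0 pmin) _; rewrite mulrC -ltr_pdivlMr.
 have [dp cp] := H2 p pr2; split; first exact:dp.
 pose z : 'rV_(m + D) := row_mx (chart i p) y.
 have lz : lL z = chart i p := row_mxKl _ _.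
 have rz : rL z = y := row_mxKr _ _.
 have Bz : Bs z.
  apply:Hs; rewrite /z /z0 opp_row_mx add_row_mx.
  exact:(row_mx_norm_lt s0 cp ys).
 have Az : A z = y - F p := congr2 (fun a b => a - b) rz (etrans (congr1 g lz) (locK f dp)).
 have BzE : B z = (locjac f i p)^T := congr1 (fun x => (jac g x)^T) lz.
 have Pz : Phi z = emb y.
  have AB0 : A z *m B z = 0.
   exact:(etrans (congr2 (fun a b => a *m b) Az BzE) (nearest_normal dp pmin)).
  exact:(congr2 (fun a b => row_mx a b) AB0 rz).
 have E := congr1 lL (etrans (congr1 gi (esym Pz)) (giK z Bz)).
 exact:etrans (esym lz) (esym E).
Qed.
End Tubular.

(** * The tubular neighbourhood *)

Section TubularMap.
Context {R : realType} {m D : nat} {M : manifold R m}.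
Variables (f : smooth_map M (euclidean R D)) (fE : smooth_embedding f) (Mc : closed_manifold M) (p_ : M).
Let F : M -> 'rV[R]_D := f.
Let pi := tubpi f Mc p_.

(** The set where the nearest point problem is solved by a smooth map in a chart. All nearest points
    are quantified over, so uniqueness is built in, and openness follows from the form of the
    definition. *)
Definition tubU : set 'rV[R]_D := [set y | exists i (V : set 'rV[R]_D) (xl : 'rV[R]_D -> 'rV[R]_m),
 [/\ open V, V y, smooth_on V xl &
   forall y' p, V y' -> nearest f y' p -> dom i p /\ chart i p = xl y']].

Lemma tubU_F p : tubU (F p).
have [i [ip [r [xl [r0 sxl H]]]]] := local_proj fE p.
exists i, [set y | `|y - F p| < r], xl; split => //.
 exact:open_ball.
by rewrite /= subrr normr0.
Qed.

Lemma tubpi_chart y : tubU y -> exists i (V : set 'rV_D) (xl : 'rV_D -> 'rV_m),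
 [/\ open V, V y, V `<=` tubU, smooth_on V xl &
   forall y', V y' -> dom i (pi y') /\ chart i (pi y') = xl y'].
move=> [i [V [xl [oV Vy sxl H]]]]; exists i, V, xl; split => //.
 by move=>y' Vy'; exists i, V, xl.
by move=>y' Vy'; apply:H => //; exact:tubpiP.
Qed.

Lemma tubU_open : open tubU.
rewrite openE => y /tubpi_chart[i [V [xl [oV Vy VU _ _]]]].
by apply:filterS VU _; exact:open_nbhs_nbhs.
Qed.

Lemma tubpi_smooth (W : normedModType R) (G : M -> W) :
 (forall i, smooth_on (chart i @` dom i) (fun x => G (chart_inv i x))) ->
 smooth_on tubU (fun y => G (pi y)).
move=>sG k; apply:Ck_loc => y /tubpi_chart[i [V [xl [oV Vy VU sxl H]]]].
exists V; split => //.
apply:(@Ck_ext _ _ _ _ _ _ (fun y => G (chart_inv i (xl y)))) => //.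
 by move=>y' /H [ip <-]; rewrite chart_invK.
apply:(@Ck_comp _ _ _ _ k V (chart i @` dom i) xl (fun x => G (chart_inv i x))) => //.
- exact:has_basis_mx.
- exact:codom_open.
- by move=>y' /H [ip <-]; exists (pi y').
- exact:sG.
Qed.

Lemma tubpi_cont y : tubU y -> {for y, continuous pi}.
move=> /tubpi_chart[i [V [xl [oV Vy VU sxl H]]]].
have [ip ix] := H y Vy.
have c1 : xl y' @[y' --> y] --> chart i (pi y) by rewrite ix; exact:(Ck_on0 (sxl 0%N)).
have c2 : chart_inv i x @[x --> chart i (pi y)] --> chart_inv i (chart i (pi y)).
 exact:chart_inv_continuous; exists (pi y).
have c3 : chart_inv i (xl y') @[y' --> y] --> pi y.
 by rewrite -[X in _ --> X](chart_invK ip); exact:cvg_comp c1 c2.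
apply:cvg_trans c3; have H' : \forall y' \near y, V y' by exact:(open_nbhs_nbhs (conj oV Vy)).
apply:(@near_eq_cvg _ _ (nbhs y)); near=> y'.
have Vy' : V y' by near: y'.
by have [iy' <-] := H y' Vy'; rewrite chart_invK.
Unshelve. all: by end_near. Qed.

Lemma tubpiK p : pi (F p) = p.
exact:tubpi_id. Qed.

Lemma tub_normal y : (y - F (pi y)) *m Qn f (pi y) = y - F (pi y).
have [i ip] := dom_cover (pi y).
rewrite (QnE fE ip); apply:nproj_fix.
by apply:nearest_normal => //; exact:tubpiP.
Qed.

Lemma F_smooth i : smooth_on (chart i @` dom i) (fun x => F (chart_inv i x)).
exact:loc_smooth. Qed.

Lemma range_compact : compact (range F).
apply:continuous_compact; last exact:Mc.
by apply:continuous_subspaceT => p; exact:F_cont.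
Qed.

(** Compactness of f(M) makes the radius of the balls contained in [tubU] uniform. *)
Lemma tub_radius : exists2 r : R, 0 < r & forall y p, `|y - F p| < r -> tubU y.
have /compact_near_coveringP := range_compact => /(_ R 0^'+
  (fun d x => forall y, `|y - x| < d -> tubU y)) H.
have {}H : \forall d \near 0^'+, range F `<=`
  (fun x => forall y, `|y - x| < d -> tubU y).
 apply:H => _ [p _ <-].
 have /nbhs_ballE[r r0 Hr] := open_nbhs_nbhs (conj tubU_open (tubU_F p)).
 have m0 : 0 < r / 2 by rewrite divr_gt0.
 exists ([set y | `|y - F p| < r / 2], [set d | d < r / 2]) => /=.
  split; last exact:nbhs_right_lt.
  by apply/nbhs_ballE; exists (r / 2).
 move=> [y d] /= [yx dr] z zy; apply:Hr.
 rewrite -[z - _](subrKA y) (le_lt_trans (ler_normD _ _))//.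
 by rewrite (splitr r) ltrD// (lt_trans zy).
have [d d0 Hd] : exists2 d : R, 0 < d & range F `<=`
  (fun x => forall y, `|y - x| < d -> tubU y).
 near (0 : R)^'+ => d; exists d; first by near: d; exact:nbhs_right_gt.
 by near: d.
by exists d => // y p; apply:(Hd (F p)); exists p.
Unshelve. all: by end_near. Qed.
End TubularMap.

(** * Continuity of the clutched idempotent field *)

Section TubProj.
Context {R : realType} {D : nat} {T : topologicalType}.
Variables (y : T) (Q K : T -> 'M[R]_D) (a : T -> 'rV[R]_D) (r : R).
Hypothesis r0 : 0 < r.
Hypothesis cQ : Q z @[z --> y] --> Q y.
Hypothesis cKp : K z @[z --> y] --> K y.
Hypothesis ca : a z @[z --> y] --> a y.
Let N y : 'M[R]_(1 + 1, D) := col_mx (a y) (a y *m K y).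
Let w y : R := dot (a y) (a y) + dot (a y *m K y) (a y *m K y).
Let S y : 'M[R]_D := 1%:M + K y *m (K y)^T.
Let s y : R := w y / r ^+ 2.
Let s' y : R := Num.min (s y) 1.
Let alpha y : R := (1 - s' y) / (1 + s' y).
Let tau y : R := 2 / (r * (1 + s' y) * Num.max 1 (Num.sqrt (s y))).
Let Phi y : 'M[R]_(D, D + (1 + 1)) :=
 row_mx (alpha y *: Q y) (tau y *: (Q y *m S y *m (N y)^T)).
Let Psi y : 'M[R]_(D + (1 + 1), D) := col_mx (alpha y *: Q y) (tau y *: N y).

(** The formulas are those of the line bundle on R^(m+2) constructed below, with Q, K and the
    tautological section left abstract; they are later instantiated by composites with [tubpi]. *)
Lemma tub_proj_cont : Psi z *m Phi z @[z --> y] --> Psi y *m Phi y.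
have s'_ge0 : 0 <= s' y.
 by rewrite le_min ler01 andbT divr_ge0 ?addr_ge0 ?dot_ge0// exprn_ge0// ltW.
pose proof (cvg_mulmx ca cKp) as caK.
pose proof (cvg_col_mx ca caK) as cN.
have cw : w z @[z --> y] --> w y by exact:(cvgD (cvg_dot ca ca) (cvg_dot caK caK)).
have cS : S z @[z --> y] --> S y.
 by apply:cvgD; [exact:cvg_cst|exact:cvg_mulmx cKp (cvg_trmx cKp)].
have cs : s z @[z --> y] --> s y by apply:cvgM; [exact:cw|exact:cvg_cst].
have cs' : s' z @[z --> y] --> s' y by apply:continuous_min; [exact:cs|exact:cvg_cst].
have s1 : 1 + s' y != 0 by rewrite gt_eqF// ltr_pwDl.
have c1s : 1 + s' z @[z --> y] --> 1 + s' y by apply:cvgD; [exact:cvg_cst|exact:cs'].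
have cal : alpha z @[z --> y] --> alpha y.
 apply:cvgM; last exact:cvgV.
 by apply:cvgB; [exact:cvg_cst|exact:cs'].
have csq : Num.sqrt (s z) @[z --> y] --> Num.sqrt (s y).
 by apply:cvg_comp cs _; exact:sqrt_continuous.
have cm : Num.max 1 (Num.sqrt (s z)) @[z --> y] --> Num.max 1 (Num.sqrt (s y)).
 exact:(@continuous_max _ _ (fun=> 1) (fun z => Num.sqrt (s z)) y (cvg_cst _) csq).
have m0 : Num.max 1 (Num.sqrt (s y)) != 0.
 by rewrite gt_eqF// lt_max ltr01.
have cta : tau z @[z --> y] --> tau y.
 apply:cvgM; first exact:cvg_cst.
 apply:cvgV; first by rewrite !mulf_neq0// gt_eqF.
 by apply:cvgM => //; apply:cvgM => //; exact:cvg_cst.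
have cPsi : Psi z @[z --> y] --> Psi y.
 by apply:cvg_col_mx; [exact:(cvgZ cal cQ)|exact:(cvgZ cta cN)].
have cPhi : Phi z @[z --> y] --> Phi y.
 apply:cvg_row_mx; first exact:(cvgZ cal cQ).
 exact:(cvgZ cta (cvg_mulmx (cvg_mulmx cQ cS) (cvg_trmx cN))).
exact:(cvg_mulmx cPsi cPhi).
Qed.
End TubProj.

(** * A nowhere zero normal field *)

Section NormalSection.
Context {R : realType} {m : nat} {M : manifold R m}.
Variables (f : smooth_map M (euclidean R (m + 2))) (fE : smooth_embedding f) (Mc : closed_manifold M) (p_ : M).
Let D := (m + 2)%N.
Let F : M -> 'rV[R]_D := f.
Let pi := tubpi f Mc p_.
Let U := tubU f.
Let Q p : 'M[R]_D := Qn f p.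
Variable K : M -> 'M[R]_D.
Hypothesis cK : continuous K.
Hypothesis KK : forall p, K p *m K p = - Q p.
Hypothesis KQ : forall p, K p *m Q p = K p.
Hypothesis QK : forall p, Q p *m K p = K p.

(** Dimension count: v and v K are independent in the normal plane since K squares to -1 there, so
    with the m tangent rows they form an invertible matrix. *)
Lemma normal_plane p (v w : 'rV_D) : v *m Q p = v -> v != 0 -> w *m Q p = w ->
 exists c1 c2, w = c1 *: v + c2 *: (v *m K p).
move=>vQ v0 wQ; have [i ip] := dom_cover p; pose J := locjac f i p.
have iJ := locjac_inj fE ip.
have JQ : J *m Q p = 0 by rewrite /Q (QnE fE ip); exact:nprojA.
pose B : 'M[R]_(m + 2) := col_mx J (col_mx v (v *m K p) : 'M[R]_(1 + 1, m + 2)).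
have mulB u (c : 'rV_(1 + 1)) : row_mx u c *m B =
  u *m J + (c 0 0 *: v + c 0 1 *: (v *m K p)).
 rewrite mul_row_col; congr (_ + _).
 have cE : c = row_mx (c 0 0)%:M (c 0 1)%:M :> 'rV_(1 + 1).
  apply/rowP => j; rewrite [RHS]mxE; case:(fintype.splitP j) => k jk;
  rewrite (ord1 k) !mxE; congr (c _ _); apply/val_inj;
  by rewrite /= jk (ord1 k).
 by rewrite {1}cE mul_row_col !mul_scalar_mx.
have uB : B \in unitmx.
 apply:inj_unitmx => z; rewrite -[z](@hsubmxK _ 1 m 2) mulB => H.
 set u := lsubmx z in H *; set c := rsubmx z in H *.
 have H1 : c 0 0 *: v + c 0 1 *: (v *m K p) = 0.
  have := congr1 (mulmx^~ (Q p)) H; rewrite mulmxDl -mulmxA JQ mulmx0 add0r mul0mx.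
  by rewrite mulmxDl -!scalemxAl vQ -mulmxA KQ.
 have H2 : c 0 0 *: (v *m K p) - c 0 1 *: v = 0.
  have := congr1 (mulmx^~ (K p)) H1; rewrite mulmxDl -!scalemxAl mul0mx.
  by rewrite -mulmxA KK mulmxN vQ scalerN.
 have H3 : (c 0 0 ^+ 2 + c 0 1 ^+ 2) *: v = 0.
  have : c 0 0 *: (c 0 0 *: v + c 0 1 *: (v *m K p)) -
    c 0 1 *: (c 0 0 *: (v *m K p) - c 0 1 *: v) = 0 by rewrite H1 H2 !scaler0 subr0.
  move=> <-; apply/rowP => j; rewrite !mxE; ring.
 move/eqP: H3; rewrite scaler_eq0 (negPf v0) orbF => /eqP H3.
 have c00 : c 0 0 = 0 by have := sqr_ge0 (c 0 0); have := sqr_ge0 (c 0 1); move=>h1 h2; apply/eqP; rewrite -sqrf_eq0; apply/eqP; lra.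
 have c01 : c 0 1 = 0 by have := sqr_ge0 (c 0 0); have := sqr_ge0 (c 0 1); move=>h1 h2; apply/eqP; rewrite -sqrf_eq0; apply/eqP; lra.
 have c0 : c = 0.
  apply/rowP => j; rewrite [RHS]mxE.
  by case:(@fintype.splitP 1 1 j) => k jk; [rewrite -c00|rewrite -c01]; congr (c _ _);
   apply/val_inj; rewrite /= jk (ord1 k).
 have u0 : u = 0.
  by apply:iJ; move: H; rewrite c0 !mxE !scale0r !addr0.
 by rewrite u0 c0 row_mx0.
pose z := w *m invmx B; exists ((rsubmx z) 0 0), ((rsubmx z) 0 1).
have wE : w = z *m B by rewrite mulmxKV.
rewrite -{1}wQ wE -[z in LHS](@hsubmxK _ 1 m 2) mulB mulmxDl -mulmxA JQ mulmx0 add0r.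
by rewrite mulmxDl -!scalemxAl vQ -mulmxA KQ.
Qed.

Lemma Q_neq0 p : Q p != 0.
have [i ip] := dom_cover p; apply/eqP; rewrite /Q (QnE fE ip) /nproj => /eqP.
rewrite subr_eq0 => /eqP H.
have := mxrank1 R D; rewrite H -mulmxA => rk.
have lk k (X : 'M[R]_(m, k)) : (\rank ((locjac f i p)^T *m X) <= m)%N :=
 leq_trans (mxrankM_maxl _ _) (rank_leq_col _).
have := lk _ (invmx (locjac f i p *m (locjac f i p)^T) *m locjac f i p).
by rewrite rk /D -{2}[m]addn0 leq_add2l.
Qed.
Let a (y : 'rV[R]_D) : 'rV[R]_D := y - F (pi y).
Let N (y : 'rV[R]_D) : 'M[R]_(1 + 1, D) := col_mx (a y) (a y *m K (pi y)).
(** The squared length of the tautological section [a y] in the K-invariant metric [S]. In that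
    metric [a] and [a K] are orthogonal of equal length, which is [NSN]. *)
Let w (y : 'rV[R]_D) : R := dot (a y) (a y) + dot (a y *m K (pi y)) (a y *m K (pi y)).
Let S (y : 'rV[R]_D) : 'M[R]_D := 1%:M + K (pi y) *m (K (pi y))^T.
Let aQ y : a y *m Q (pi y) = a y. Proof. exact:tub_normal. Qed.
Let SdotE y (u v : 'rV_D) : u *m S y *m v^T = (dot u v + dot (u *m K (pi y)) (v *m K (pi y)))%:M.
by rewrite /S mulmxDr mulmx1 mulmxDl raddfD /= -!dot_scalar trmx_mul !mulmxA.
Qed.
Let NSN y : N y *m S y *m (N y)^T = (w y)%:M.
rewrite /N tr_col_mx mul_col_mx mul_col_row !SdotE.
have aKK : a y *m K (pi y) *m K (pi y) = - a y by rewrite -mulmxA KK mulmxN aQ.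
rewrite !aKK.
have dN (x z : 'rV_D) : dot x (- z) = - dot x z by rewrite -scaleN1r dotZr mulN1r.
have dNl (x z : 'rV_D) : dot (- x) z = - dot x z by rewrite -scaleN1r dotZl mulN1r.
rewrite !dN !dNl opprK [dot (a y *m _) (a y)]dotC subrr raddf0.
rewrite [dot (_ *m _) (_ *m _) + _]addrC -/(w y).
by rewrite -(scalar_mx_block 1 1).
Qed.
Let NQ y : N y *m Q (pi y) = N y.
by rewrite /N mul_col_mx aQ -mulmxA KQ. Qed.
Let SNN y : Q (pi y) *m S y *m (N y)^T *m N y = w y *: Q (pi y).
apply/row_matrixP => k; rewrite !rowE; set e := delta_mx 0 k.
rewrite -scalemxAr !mulmxA; set n := e *m Q (pi y).
have nQ : n *m Q (pi y) = n by rewrite /n -mulmxA (Qn_idem fE).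
have [a0|a0] := eqVneq (a y) 0.
 have -> : N y = 0 by rewrite /N a0 mul0mx col_mx0.
 have -> : w y = 0 by rewrite /w a0 mul0mx dot0l addr0.
 by rewrite mulmx0 scale0r.
have [c1 [c2 nE]] := normal_plane (aQ y) a0 nQ.
have nN : n = row_mx c1%:M c2%:M *m N y.
 by rewrite /N mul_row_col !mul_scalar_mx.
by rewrite nN -!(mulmxA _ (N y)) mulmxA -!mulmxA [N y *m (_ *m _)]mulmxA
 [N y *m S y *m _]mulmxA NSN mul_scalar_mx -scalemxAr.
Qed.
Section LineBundle.
Variable r : R.
Hypothesis r0 : 0 < r.
Hypothesis rU : forall y p, `|y - F p| < 2 * r -> U y.
Let s (y : 'rV[R]_D) : R := w y / r ^+ 2.
Let s' (y : 'rV[R]_D) : R := Num.min (s y) 1.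
(** For s <= 1, [alpha] and [tau] times the square root of [w] are (1 - s) / (1 + s) and 2 sqrt(s) /
    (1 + s), the rational parametrisation of the circle; [min] and [max] freeze the point at (0, 1)
    for s >= 1. Hence [atw]. *)
Let alpha (y : 'rV[R]_D) : R := (1 - s' y) / (1 + s' y).
Let tau (y : 'rV[R]_D) : R := 2 / (r * (1 + s' y) * Num.max 1 (Num.sqrt (s y))).
Let Phi (y : 'rV[R]_D) : 'M[R]_(D, D + (1 + 1)) :=
 row_mx (alpha y *: Q (pi y)) (tau y *: (Q (pi y) *m S y *m (N y)^T)).
Let Psi (y : 'rV[R]_D) : 'M[R]_(D + (1 + 1), D) := col_mx (alpha y *: Q (pi y)) (tau y *: N y).
Let Pinf : 'M[R]_(D + (1 + 1)) := block_mx 0 0 0 1%:M.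
(** Clutching by an idempotent. By [atw], [Phi] composed with [Psi] is Q, so [Psi] composed with
    [Phi] is idempotent and its image is a copy of the normal plane in R^(D+2). The copy is the
    plane itself on f(M), is turned by the section [a], and becomes the constant plane [Pinf] as
    soon as s >= 1; hence the extension by [Pinf] off the tube. *)
Let P (y : 'rV[R]_D) := if `[< U y >] then Psi y *m Phi y else Pinf.
Let w_ge0 y : 0 <= w y. Proof. by rewrite addr_ge0// dot_ge0. Qed.
Let s_ge0 y : 0 <= s y. Proof. by rewrite divr_ge0// exprn_ge0// ltW. Qed.
Let s'_ge0 y : 0 <= s' y. Proof. by rewrite le_min s_ge0 ler01. Qed.
Let atw y : alpha y ^+ 2 + tau y ^+ 2 * w y = 1.
have s1 : 1 + s' y != 0 by rewrite gt_eqF// ltr_pwDl.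
have r0' : r != 0 by rewrite gt_eqF.
have wE : w y = s y * r ^+ 2 by rewrite /s divfK// expf_neq0.
rewrite /alpha /tau wE; have [s1'|s1'] := leP (s y) 1.
 have sq : Num.sqrt (s y) <= 1 by rewrite -sqrtr1 ler_sqrt.
 rewrite (max_l sq) mulr1 /s' (min_l s1') in s1 *; field.
 by rewrite r0' s1.
have sq : 1 <= Num.sqrt (s y) by rewrite -[X in X <= _](@sqrtr1 R) ler_sqrt// ltW.
rewrite (max_r sq) /s' (min_r (ltW s1')).
have sq2 : Num.sqrt (s y) ^+ 2 = s y by rewrite sqr_sqrtr.
rewrite -{2}sq2; field.
by rewrite r0' gt_eqF// (lt_le_trans ltr01).
Qed.
Let PhiPsi y : Phi y *m Psi y = Q (pi y).
rewrite /Phi /Psi mul_row_col -!scalemxAl -!scalemxAr !scalerA (Qn_idem fE).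
by rewrite -!expr2 SNN scalerA -scalerDl atw scale1r.
Qed.
Let PsiQ y : Psi y *m Q (pi y) = Psi y.
by rewrite /Psi mul_col_mx -!scalemxAl (Qn_idem fE) NQ.
Qed.
Let PP y : P y *m P y = P y.
rewrite /P; case:asboolP => _.
 by rewrite !mulmxA -[Psi y *m Phi y *m Psi y]mulmxA PhiPsi PsiQ.
by rewrite /Pinf mulmx_block !mul0mx !mulmx0 mulmx1 !addr0 add0r.
Qed.
Let P_far y : U y -> 1 <= s y -> Psi y *m Phi y = Pinf.
move=>Uy s1; have s'1 : s' y = 1 by rewrite /s' min_r.
have al : alpha y = 0 by rewrite /alpha s'1 subrr mul0r.
have := atw y; rewrite al expr0n /= add0r => tw.
rewrite /Psi /Phi mul_col_row al !scale0r !mul0mx !mulmx0.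
rewrite -scalemxAl -scalemxAr !mulmxA scalerA -expr2.
by rewrite NQ NSN scale_scalar_mx tw.
Qed.
(** The two definitions match across the boundary of the tube: a point of [U] within r of a point
    outside [U] has s >= 1, for otherwise the latter would be within 2 r of f(M). *)
Let P_continuous_at (y : 'rV_D) : {for y, continuous P}.
have [Uy|nUy] := pselect (U y).
 have cpi : {for y, continuous pi} by exact:tubpi_cont.
 have cQ0 : {for pi y, continuous Q} by exact:Qn_cont.
 have cF0 : {for pi y, continuous F} by exact:F_cont.
 have cK0 : {for pi y, continuous K} by exact:cK.
 have c1 : {for y, continuous (fun z => Q (pi z))} by exact:(continuous_comp cpi cQ0).
 have c2 : {for y, continuous (fun z => K (pi z))} by exact:(continuous_comp cpi cK0).
 have c3 : {for y, continuous (fun z => F (pi z))} by exact:(continuous_comp cpi cF0).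
 have c4 : {for y, continuous a} by exact:(cvgB (@cvg_id _ (nbhs y)) c3).
 have cP := @tub_proj_cont _ _ _ y _ _ a r r0 c1 c2 c4.
 change (P z @[z --> y] --> P y); rewrite {2}/P asboolT//.
 apply:cvg_trans cP.
 have H' : \forall z \near y, U z by apply:open_nbhs_nbhs; split => //; exact:tubU_open.
 apply:(@near_eq_cvg _ _ (nbhs y)); near=> z.
 by rewrite /P asboolT//; near: z.
change (P z @[z --> y] --> P y); rewrite {2}/P asboolF//.
have c0 : {for y, continuous (cst Pinf)} by exact:cst_continuous.
apply:cvg_trans c0; apply:(@near_eq_cvg _ _ (nbhs y)); apply/nbhs_ballE; exists r => // z zy.
rewrite /P; case:asboolP => // Uz; apply/esym/P_far => //.
rewrite leNgt; apply/negP => sz; apply:nUy; apply:(rU (p := pi z)).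
have az : `|a z| < r.
 rewrite -(@ltr_pXn2r _ 2)// ?nnegrE ?(ltW r0)//.
 apply:le_lt_trans (norm_le_dot _) _.
 apply:(@le_lt_trans _ _ (w z)); first by rewrite /w lerDl dot_ge0.
 by move: sz; rewrite /s ltr_pdivrMr ?exprn_gt0// mul1r.
have -> : y - F (pi z) = a z - (z - y) by apply/rowP => j; rewrite !mxE; ring.
by rewrite (le_lt_trans (ler_normB _ _))// mulr_natl mulr2n ltrD.
Unshelve. all: by end_near. Qed.
Let P_cont : continuous P.
exact:P_continuous_at. Qed.

Lemma normal_section_aux : exists nu : M -> 'rV[R]_D,
 [/\ continuous nu, forall p, nu p != 0 & forall p, nu p *m Q p = nu p].
pose H t p := P (t *: F p).
have cH : continuous (fun z : R * M => H z.1 z.2).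
 apply:compc; last exact:P_cont.
 move=> [t p]; have c1 : z.1 @[z --> (t, p)] --> t by exact:cvg_fst.
 have c2 := @cvg_snd_comp _ _ _ F t p (@F_cont _ _ _ _ f p).
 exact:(cvgZ c1 c2).
have HH t p : H t p *m H t p = H t p by exact:PP.
have P0 : P 0 != 0.
 rewrite /P; case:asboolP => _.
  apply:contraNneq (Q_neq0 (pi 0)) => H0.
  have -> : Q (pi 0) = Phi 0 *m (Psi 0 *m Phi 0) *m Psi 0.
   by rewrite !mulmxA -mulmxA PhiPsi (Qn_idem fE).
  by rewrite H0 mulmx0 mul0mx.
 rewrite /Pinf; apply/eqP => /(congr1 (@drsubmx _ _ _ _ _)).
 rewrite block_mxKdr => /matrixP /(_ 0 0); rewrite !mxE /= => /eqP.
 by rewrite oner_eq0.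
(* Any nonzero row of an idempotent is fixed by it; at time 0 the idempotent does not depend on p,
   so the fixed vector is constant. *)
have [e0 e00 e0P] : exists2 e0 : 'rV_(D + (1 + 1)), e0 != 0 & e0 *m P 0 = e0.
 have /matrix0Pn[i [j Pij]] := P0.
 exists (row i (P 0)); last by rewrite -row_mul PP.
 by apply/rV0Pn; exists j; rewrite mxE.
have e0H p : e0 *m H 0 p = e0 by rewrite /H scale0r.
have [e [ce en eH]] := idem_section Mc cH HH e00 e0H.
have P1 p : H 1 p = block_mx (Q p) 0 0 0.
 rewrite /H scale1r /P asboolT; last exact:tubU_F.
 have pF : pi (F p) = p by exact:tubpiK.
 have a0 : a (F p) = 0 by rewrite /a pF subrr.
 have N0 : N (F p) = 0 by rewrite /N a0 mul0mx col_mx0.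
 have w0 : w (F p) = 0 by rewrite /w a0 mul0mx dot0l addr0.
 have s0 : s' (F p) = 0 by rewrite /s' /s w0 mul0r min_l.
 have al : alpha (F p) = 1 by rewrite /alpha s0 subr0 addr0 divr1.
 rewrite /Psi /Phi mul_col_row al !scale1r N0 trmx0 !scaler0 !mulmx0 !mul0mx pF.
 by rewrite scaler0 !mulmx0 (Qn_idem fE).
exists (fun p => lsubmx (e p)); split.
- move=>p; apply:cvg_comp.
  exact:ce.
 exact:continuous_lsubmx.
- move=>p; apply:contraNneq (en p) => l0.
 have := eH p; rewrite P1 -{1}[e p]hsubmxK mul_row_block !mulmx0 !addr0 l0 mul0mx.
 by rewrite row_mx0 => <-.
- move=>p; have := congr1 lsubmx (eH p); rewrite P1 -{1}[e p]hsubmxK mul_row_block.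
 by rewrite row_mxKl mulmx0 addr0.
Qed.
End LineBundle.

Theorem normal_section : exists nu : M -> 'rV[R]_D,
 [/\ continuous nu, forall p, nu p != 0 & forall p, nu p *m Q p = nu p].
have [r r0 Hr] := tub_radius fE Mc p_.
have r2 : 0 < r / 2 by rewrite divr_gt0.
apply:(@normal_section_aux (r / 2)) => // y p yp; apply:(Hr y p).
by move: yp; rewrite mulrCA divff// mulr1.
Qed.
End NormalSection.

(** * Sard's theorem in equal dimensions, by counting *)

Section Sard.
Context {R : realType}.

(** The Jacobian is uniformly continuous near K, so the mean value inequality for g minus its linear
    part has a uniform radius. *)
Lemma compact_C1_unif n q (g : 'rV_n -> 'rV_q) (U K : set 'rV_n) (e : R) :
 open U -> compact K -> K `<=` U -> Ck_on 1 U g -> 0 < e ->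
 exists2 d : R, 0 < d & forall x h, K x -> `|h| < d ->
  `|g (x + h) - g x - h *m jac g x| <= e * `|h|.
move=>oU cK KU sg e0.
pose E z := jac g z.
have e'0 : 0 < e / (2 * n.+1%:R) by rewrite divr_gt0// mulr_gt0.
have /compact_near_coveringP := cK => /(_ R 0^'+
  (fun d x => forall y, `|y - x| < d -> U y /\ `|jac g y - jac g x| < e / n.+1%:R)) H.
have {}H : \forall d \near 0^'+, K `<=`
  (fun x => forall y, `|y - x| < d -> U y /\ `|jac g y - jac g x| < e / n.+1%:R).
 apply:H => x Kx; have Ux := KU x Kx.
 have c : jac g y @[y --> x] --> jac g x by exact:(Ck_on0 (Ck_jac oU sg)).
 have /cvgrPdist_lt /(_ _ e'0) /nbhs_ballE[r1 r10 H1] := c.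
 have /nbhs_ballE[r2 r20 H2] : nbhs x U by exact:open_nbhs_nbhs.
 have m0 : 0 < Num.min r1 r2 / 2 by rewrite divr_gt0// lt_min r10.
 exists ([set y | `|y - x| < Num.min r1 r2 / 2], [set d | d < Num.min r1 r2 / 2]) => /=.
  split; last exact:nbhs_right_lt.
  by apply/nbhs_ballE; exists (Num.min r1 r2 / 2).
 move=> [y d] /= [yx dr] z zy.
 have zx : `|z - x| < Num.min r1 r2.
  rewrite -[z - x](subrKA y) (le_lt_trans (ler_normD _ _))//.
  by rewrite (splitr (Num.min r1 r2)) ltrD// (lt_trans zy).
 have yx' : `|y - x| < Num.min r1 r2.
  by apply:lt_trans yx _; rewrite ltr_pdivrMr// ltr_pMr ?ltr1n// lt_min r10.
 move: zx yx'; rewrite !lt_min => /andP[z1 z2] /andP[y1 y2].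
 split; first exact:H2.
 have -> : jac g z - jac g y = (jac g x - jac g y) - (jac g x - jac g z).
  by rewrite opprB [in RHS]addrC subrKA.
 rewrite (le_lt_trans (ler_normB _ _))//.
 have -> : e / n.+1%:R = e / (2 * n.+1%:R) + e / (2 * n.+1%:R) by rewrite -mulrDr -mulr2n -[_ *+ 2]mulr_natl invfM [2 * (_ * _)]mulrA divff ?mul1r// pnatr_eq0.
 by rewrite ltrD// H1.
have [d d0 Hd] : exists2 d : R, 0 < d & K `<=`
  (fun x => forall y, `|y - x| < d -> U y /\ `|jac g y - jac g x| < e / n.+1%:R).
 near (0 : R)^'+ => d; exists d; first by near: d; exact:nbhs_right_gt.
 by near: d.
exists d => // x h Kx hd.
have [dg _] := sg.
have inU t : 0 <= t <= 1 -> U (x + t *: h) /\ `|jac g (x + t *: h) - jac g x| < e / n.+1%:R.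
 move=> /andP[t0 t1]; apply:(Hd x Kx); rewrite addrAC subrr add0r normrZ ger0_norm//.
 by apply:le_lt_trans hd; rewrite ler_piMl.
pose L : {linear 'rV_n -> 'rV_q} := mulmxr (jac g x).
have cL : continuous L by exact:mul_mx_cont.
have -> : g (x + h) - g x - h *m jac g x = (g (x + h) - L (x + h)) - (g x - L x).
 rewrite linearD; apply/rowP => i; rewrite !mxE; ring.
have dL y : differentiable L y by exact:linear_differentiable.
apply:(@mvt_le _ _ _ _ (fun y => g y - L y)) => t t01; have [Ut Jt] := inU t t01.
 by apply:differentiableB; [exact:dg|exact:dL].
have E1 := congr1 (fun F => F h) (diffB (dg _ Ut) (dL (x + t *: h))).
have E2 := congr1 (fun F => F h) (diff_lin (x + t *: h) cL).
rewrite (_ : 'd _ _ h = h *m (jac g (x + t *: h) - jac g x)); last first.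
 rewrite mulmxBr; apply:etrans E1 _.
 exact:(congr2 (fun a b => a - b) (jacE g (x + t *: h) h) E2).
apply:le_trans (norm_mulmx _ _) _; rewrite mulrCA mulrC ler_wpM2r//.
apply:(@le_trans _ _ (n.+1%:R * (e / n.+1%:R))).
 by rewrite ler_pM// ?ler_nat// ltW.
by rewrite mulrCA divff ?mulr1// pnatr_eq0.
Unshelve. all: by end_near. Qed.

Lemma compact_bound n p q (h : 'rV[R]_n -> 'M[R]_(p, q)) (K : set 'rV_n) :
 compact K -> (forall x, K x -> {for x, continuous h}) ->
 exists2 C : R, 0 < C & forall x, K x -> `|h x| <= C.
move=>cK ch; have [->|/set0P K0] := eqVneq K set0; first by exists 1.
have [|c cK' cmax] := @EVT_max_rV R n (fun x => `|h x|) K K0 cK.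
 apply:continuous_in_subspaceT => x; rewrite inE /= => Kx.
 have c : h z @[z --> x] --> h x by exact:(ch x Kx).
 exact:cvg_norm c.
exists (`|h c| + 1); first by rewrite ltr_wpDl.
by move=>x Kx; rewrite (le_trans (cmax x _)) ?inE// lerDl.
Qed.

(** Normalising a kernel vector at an entry of largest absolute value bounds all its entries by 1:
    on the image of the linear part, coordinate j is a combination of the others with bounded
    coefficients. *)
Lemma singular_covector n (A : 'M[R]_n) : A \notin unitmx ->
 exists (l : 'cV_n) (j : 'I_n), [/\ A *m l = 0, l j 0 = 1 & forall i, `|l i 0| <= 1].
move=>nA.
have [v v0 Av] : exists2 v : 'rV_n, v != 0 & v *m A^T = 0.
 apply:contrapT => H; move/negP: nA; apply; rewrite -unitmx_tr.
 apply:inj_unitmx => v vA; apply/eqP; apply:contrapT => /negP v0; apply:H.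
 by exists v.
have nv0 : mx_norm v != 0 by apply:contraNneq v0 => /mx_norm_eq0 ->.
have [[i j] /= vE] := mx_norm_neq0 nv0.
have vj : `|v| = `|v 0 j| by rewrite [LHS]vE (ord1 i).
have vj0 : v 0 j != 0 by rewrite -normr_eq0 -vj normr_eq0.
exists ((v 0 j)^-1 *: v^T), j; split.
- rewrite -scalemxAr; apply/eqP; rewrite scaler_eq0; apply/orP; right.
 by rewrite -[A]trmxK -trmx_mul Av trmx0.
- by rewrite !mxE mulVf.
- move=>k; rewrite !mxE normrM normfV ler_pdivrMl ?normr_gt0// mulr1 -vj.
 exact:entry_le.
Qed.

(* Pigeonhole for one cell: grid points in a thin slab around a hyperplane are
  determined by all coordinates but the j-th. *)
Lemma nat_floor (x : R) : 0 <= x -> exists n : nat, n%:R <= x < n.+1%:R.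
move=>x0; exists (Num.truncn x); exact:truncn_itv.
Qed.

(** If a whole ball were covered, every point of a fine grid in it would have a preimage in K. By
    criticality the image of a cell of side s is within e s of a hyperplane, so the grid points it
    contains are counted by n coordinates instead of n + 1. The number of grid points grows like
    E^(n+1) with E = 1/e, the number of available codes only like E^n. *)
Theorem Sard n (U K : set 'rV_n) (g : 'rV_n -> 'rV_n) :
 open U -> compact K -> K `<=` U -> Ck_on 1 U g ->
 (forall x, K x -> jac g x \notin unitmx) ->
 forall (c : 'rV_n) (rho : R), 0 < rho ->
 exists2 y, `|y - c| < rho & ~ (g @` K) y.
case:n U K g => [|n] U K g oU cK KU sg sing c rho rho0.
 exists c; first by rewrite subrr normr0.
 move=> [x Kx _]; have := sing x Kx; rewrite unitmxE det_mx00 unitr1.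
 by [].
apply:contrapT => H.
have {}H y : `|y - c| < rho -> exists2 x, K x & g x = y.
 by move=>yc; apply:contrapT => H1; apply:H; exists y.
have [L L0 KL] := @compact_bound n.+1 1 n.+1 id K cK (fun x _ => (fun A => id)).
have [C C0 gC] := compact_bound cK (fun x Kx => Ck_on0 (Ck_jac oU sg) (KU x Kx)).
pose k : R := n.+1%:R.
have k0 : 0 < k by rewrite ltr0n.
(* e: differentiability scale; a cell has side s = 2 L / N, the grid step is
  eta = 4 k e s, and E bounds the number of steps across the image of a cell. *)
pose C1 := k * C + 1.
have C10 : 0 < C1 by rewrite ltr_wpDl// mulr_ge0// ltW.
(* The threshold that E must exceed, solved from the final counting inequality. *)
pose A := (C1 / k + 2) ^+ n * (32 * k * L / rho) ^+ n.+1.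
have A0 : 0 < A.
 by rewrite mulr_gt0// exprn_gt0// ?addr_gt0// !mulr_gt0// invr_gt0.
have [E' /andP[_ E'A]] := nat_floor (ltW A0).
pose E : R := E'.+1%:R.
have E1 : 1 <= E by rewrite /E ler1n.
pose e := E^-1.
have e0 : 0 < e by rewrite invr_gt0.
have e1 : e <= 1 by rewrite invf_le1.
have [d d0 Hd] := compact_C1_unif oU cK KU sg e0.
pose w0 := 2 * L / d + 8 * k * L / rho.
have w00 : 0 < w0 by rewrite addr_gt0// divr_gt0// !mulr_gt0.
have [N' /andP[_ N'w]] := nat_floor (ltW w00).
pose N := N'.+1.
pose s := 2 * L / N%:R.
have s0 : 0 < s by rewrite divr_gt0// mulr_gt0.
have sd : s < d.
 rewrite /s ltr_pdivrMr// -ltr_pdivrMl// [_^-1 * _]mulrC; apply:(lt_trans _ N'w).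
 by rewrite /w0 ltrDl divr_gt0// !mulr_gt0.
pose eta : R := 4 * k * e * s.
have eta0 : 0 < eta by rewrite /eta; do 3!apply:mulr_gt0 => //.
have eta_rho : eta < rho.
 have : 8 * k * L / N%:R < rho.
  rewrite ltr_pdivrMr// -ltr_pdivrMl// [_^-1 * _]mulrC; apply:(lt_trans _ N'w).
  by rewrite /w0 ltrDr divr_gt0// mulr_gt0.
 apply:le_lt_trans; rewrite /eta /s.
 rewrite (_ : _ * (2 * L / N%:R) = e * (8 * k * L / N%:R)); last by field; rewrite gt_eqF.
 by rewrite ler_piMl// divr_ge0// !mulr_ge0// ltW.
have etaE : eta = 4 * k * e * s by [].
have sE : s = 2 * L / N%:R by [].
have eE : e = E^-1 by [].
clearbody eta s e.
have re0 : 0 <= rho / eta by rewrite divr_ge0// ltW.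
have [q /andP[qle qlt]] := nat_floor re0.
have q0 : (0 < q)%N.
 rewrite lt0n; apply/eqP => q0; move: qlt; rewrite q0 ltr_pdivrMr// mul1r.
 by rewrite ltNge (ltW eta_rho).
have W0 : 0 <= C1 * E / k by rewrite divr_ge0// mulr_ge0// ltW.
have [W' /andP[Wge Wlt]] := nat_floor W0.
pose W := W'.+1.
pose pt (a : {ffun 'I_n.+1 -> 'I_q}) : 'rV[R]_n.+1 := \row_i (c 0 i + (nat_of_ord (a i))%:R * eta).
have ptc a : `|pt a - c| < rho.
 rewrite /Num.Def.normr /= mx_normrE; apply:bigmax_lt => // -[i j] _.
 rewrite !mxE (ord1 i) addrAC subrr add0r ger0_norm; last by rewrite mulr_ge0// ltW.
 rewrite -ltr_pdivlMr//; apply:lt_le_trans qle.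
 by rewrite ltr_nat.
have Hx a := cid2 (H (pt a) (ptc a)).
pose xs a := projT1 (Hx a).
have xsK a : K (xs a) by rewrite /xs; case:(Hx a).
have gxs a : g (xs a) = pt a by rewrite /xs; case:(Hx a).
have Hcell a i : exists t : nat, t%:R <= (xs a 0 i + L) / s < t.+1%:R.
 apply:nat_floor; rewrite divr_ge0 ?(ltW s0)//.
 have := le_trans (entry_le (xs a) 0 i) (KL _ (xsK a)).
 by rewrite ler_norml -lerBlDr sub0r => /andP[].
pose cellN a i := projT1 (cid (Hcell a i)).
have cellP a i : (cellN a i)%:R <= (xs a 0 i + L) / s < (cellN a i).+1%:R.
 exact:(projT2 (cid (Hcell a i))).
have cellle a i : (cellN a i < N.+1)%N.
 rewrite ltnS -(ler_nat R); have /andP[H1 _] := cellP a i; apply:le_trans H1 _.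
 rewrite ler_pdivrMr// sE mulrCA divff ?gt_eqF// mulr1.
 have := le_trans (entry_le (xs a) 0 i) (KL _ (xsK a)).
 by rewrite ler_norml => /andP[_]; lra.
pose cell a : {ffun 'I_n.+1 -> 'I_N.+1} := [ffun i => Ordinal (cellle a i)].
have near_cell a b : cell a = cell b -> `|xs a - xs b| < s.
 move=>ab; rewrite /Num.Def.normr /= mx_normrE; apply:bigmax_lt => // -[i' i] _.
 rewrite (ord1 i') !mxE.
 have : cellN a i = cellN b i by have := congr1 (fun F : {ffun 'I_n.+1 -> 'I_N.+1} => nat_of_ord (F i)) ab; rewrite !ffunE.
 have /andP[a1 a2] := cellP a i; have /andP[b1 b2] := cellP b i.
 move=>abE; rewrite abE -natr1 in a1 a2; rewrite -natr1 in b2.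
 move: a1 a2 b1 b2; rewrite ler_pdivlMr// ltr_pdivrMr// ler_pdivlMr// ltr_pdivrMr//.
 rewrite ltr_norml; set X := xs a 0 i; set Y := xs b 0 i; set Z := (_ %:R).
 by rewrite !mulrDl mul1r; lra.
have Hj x : exists j : 'I_n.+1, K x -> exists l : 'cV_n.+1,
  [/\ jac g x *m l = 0, l j 0 = 1 & forall i, `|l i 0| <= 1].
 have [Kx|nKx] := pselect (K x); last by exists ord0.
 by have [l [j lj]] := singular_covector (sing x Kx); exists j => _; exists l.
pose jj x := projT1 (cid (Hj x)).
have jjP x : K x -> exists l : 'cV_n.+1,
  [/\ jac g x *m l = 0, l (jj x) 0 = 1 & forall i, `|l i 0| <= 1].
 exact:(projT2 (cid (Hj x))).
pose rep z : {ffun 'I_n.+1 -> 'I_q} :=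
 odflt [ffun=> Ordinal q0] [pick a | cell a == z].
have repP a : cell (rep (cell a)) = cell a.
 by rewrite /rep; case:pickP => [b /eqP //|/(_ a)]; rewrite eqxx.
(* The images of one cell differ by fewer than W steps in each coordinate, so residues mod W.+1
   determine the coordinates other than j; coordinate j then follows because the slab is thinner
   than a grid step. *)
pose code (a : {ffun 'I_n.+1 -> 'I_q}) : {ffun 'I_n.+1 -> 'I_N.+1} * {ffun 'I_n -> 'I_W.+1} :=
 (cell a, [ffun i => inord ((a (lift (jj (xs (rep (cell a)))) i)) %% W.+1)]).
have code_inj : injective code.
 move=>a b ab; have cab : cell a = cell b by have := congr1 fst ab.
 pose o := rep (cell a); have co : cell o = cell a by exact:repP.
 have co' : cell o = cell b by rewrite co.
 pose x := xs o; pose j := jj x.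
 have mab i : a (lift j i) = b (lift j i) %[mod W.+1].
  have := congr1 (fun F : {ffun 'I_n.+1 -> 'I_N.+1} * {ffun 'I_n -> 'I_W.+1} => nat_of_ord (F.2 i)) ab; rewrite /= !ffunE -cab.
  by rewrite !inordK ?ltn_mod.
 have [l [Jl lj l1]] := jjP x (xsK o).
 have dev z : cell o = cell z ->
   `|pt z - pt o - (xs z - x) *m jac g x| <= e * s /\ `|xs z - x| < s.
  move=>oz; have zs : `|xs z - x| < s by rewrite near_cell.
  split => //; have := Hd x (xs z - x) (xsK o) (lt_trans zs sd).
  have xE : x + (xs z - x) = xs z by rewrite addrC subrK.
  rewrite xE gxs (gxs o : g x = _); move/le_trans; apply.
  by rewrite ler_pM2l// ltW.
 have [da xa] := dev a co; have [db xb] := dev b co'.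
 pose u := xs a - xs b.
 have us : `|u| <= 2 * s.
  have -> : u = (xs a - x) - (xs b - x) by rewrite opprB addrA subrK.
  by rewrite (le_trans (ler_normB _ _))//; move: xa xb; lra.
 have dab : `|pt a - pt b - u *m jac g x| <= 2 * (e * s).
  have -> : pt a - pt b - u *m jac g x =
    (pt a - pt o - (xs a - x) *m jac g x) - (pt b - pt o - (xs b - x) *m jac g x).
   rewrite /u (_ : xs a - xs b = (xs a - x) - (xs b - x)); last first.
    by apply/rowP => i; rewrite !mxE; ring.
   by rewrite mulmxBl; apply/rowP => i; rewrite !mxE; ring.
  by rewrite (le_trans (ler_normB _ _))//; lra.
 have ptab i : (pt a - pt b) 0 i = ((nat_of_ord (a i))%:R - (nat_of_ord (b i))%:R) * eta.
  by rewrite !mxE; ring.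
 have nab i : `|(pt a - pt b) 0 i| < W%:R * eta.
  apply:le_lt_trans (entry_le _ _ _) _.
  apply:(@le_lt_trans _ _ (2 * (e * s) + k * (2 * s * C))).
   rewrite -[pt a - pt b](subrK (u *m jac g x)) (le_trans (ler_normD _ _))// lerD//.
   rewrite (le_trans (norm_mulmx _ _))// ler_wpM2l ?(ltW k0)//.
   by apply:ler_pM => //; apply:gC; exact:xsK.
  apply:(@le_lt_trans _ _ (2 * s * C1)).
   rewrite /C1; have : e * s <= 1 * s by rewrite ler_wpM2r// ltW.
   move=>h; have -> : 2 * s * (k * C + 1) = 2 * (1 * s) + k * (2 * s * C) by ring.
   by rewrite lerD2r ler_pM2l.
  have -> : 2 * s * C1 = (C1 * E / k / 2) * eta.
   by rewrite etaE eE; field; rewrite !gt_eqF.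
  rewrite ltr_pM2r//; apply:le_lt_trans Wlt.
  by rewrite ler_pdivrMr// ler_pMr ?ler1n// divr_gt0// mulr_gt0.
 have eq_other i : a (lift j i) = b (lift j i) :> nat.
  have := nab (lift j i); rewrite ptab normrM (gtr0_norm eta0) ltr_pM2r//.
  move: (mab i); set p := nat_of_ord (a _); set r := nat_of_ord (b _).
  wlog pr : p r / (p <= r)%N.
   move=>wl; case/orP: (leq_total p r) => [pr|rp] mpr; first exact:wl.
   by rewrite distrC => H1; apply/esym/wl.
  move=>mpr; rewrite distrC ger0_norm ?subr_ge0 ?ler_nat// -natrB// ltr_nat => rpW.
  have : (W.+1 %| r - p)%N by rewrite -eqn_mod_dvd// mpr.
  case:(posnP (r - p)) => [/eqP|rp /dvdn_leq]; first by rewrite subn_eq0 => rp _; apply/eqP; rewrite eqn_leq pr.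
  by move=> /(_ rp) H1; have := leq_trans rpW (leqW (leqnn W)); rewrite ltnNge (leq_trans _ H1).
 have eq_j : a j = b j :> nat.
  (* Pairing with the kernel covector removes the linear part; as the other coordinates agree, only
     the difference in coordinate j remains, and it is smaller than one step [eta]. *)
  have lE : ((pt a - pt b - u *m jac g x) *m l) 0 0 = ((nat_of_ord (a j))%:R - (nat_of_ord (b j))%:R) * eta.
   rewrite mulmxBl -mulmxA Jl mulmx0 subr0 mxE (bigD1 j)//= lj mulr1 ptab.
   rewrite big1 ?addr0// => i ij; rewrite ptab.
   have [i' ->] : exists i', i = lift j i' by have := unlift_some (_ : j != i); rewrite eq_sym => /(_ ij) [i' -> _]; exists i'.
   by rewrite eq_other subrr mul0r mul0r.
  have := entry_le ((pt a - pt b - u *m jac g x) *m l) 0 0.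
  rewrite lE normrM (gtr0_norm eta0) => H1.
  have l1' : `|l| <= 1 by apply:mx_norm_le => // i i'; rewrite (ord1 i').
  have H2 : `|(nat_of_ord (a j))%:R - (nat_of_ord (b j))%:R| * eta < 1 * eta.
   apply:le_lt_trans H1 _; apply:le_lt_trans (norm_mulmx _ _) _.
   apply:(@le_lt_trans _ _ (k * (2 * (e * s)))).
    rewrite ler_wpM2l ?(ltW k0)//; apply:le_trans dab.
    by rewrite ler_piMr.
   rewrite etaE mul1r (_ : 4 * k * e * s = k * (2 * (e * s)) * 2); last by ring.
   by rewrite ltr_pMr ?ltr1n// !mulr_gt0.
  move: H2; rewrite ltr_pM2r//.
  set p := nat_of_ord (a _); set r := nat_of_ord (b _).
  wlog pr : p r / (p <= r)%N.
   move=>wl; case/orP: (leq_total p r) => [pr|rp]; first exact:wl.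
   by rewrite distrC => H2; apply/esym/wl.
  rewrite distrC ger0_norm ?subr_ge0 ?ler_nat// -natrB// -[1]/(1%:R) ltr_nat ltnS leqn0 subn_eq0 => rp.
  by apply/eqP; rewrite eqn_leq pr.
 apply/ffunP => i; apply/val_inj => /=.
 have [->//|ij] := eqVneq i j.
 have [i' ->] : exists i', i = lift j i' by have := unlift_some (_ : j != i); rewrite eq_sym => /(_ ij) [i' -> _]; exists i'.
 exact:eq_other.
have := leq_card code code_inj.
rewrite card_prod !card_ffun !card_ord => count.
have {}count : (q%:R : R) ^+ n.+1 <= (N.+1)%:R ^+ n.+1 * (W.+1)%:R ^+ n.
 by rewrite -!natrX -natrM ler_nat.
(* The counting inequality contradicts the choice of E. *)
pose a := rho / (16 * k * L).
have a0 : 0 < a by rewrite divr_gt0// !mulr_gt0.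
have qa : a * N%:R * E < q%:R.
 have : rho / eta < 2 * q%:R.
  by apply:lt_le_trans qlt _; rewrite -natr1 mulr_natl mulr2n lerD2l ler1n.
 have -> : rho / eta = 2 * (a * N%:R * E).
  by rewrite /a etaE eE sE; field; rewrite !gt_eqF.
 by rewrite ltr_pM2l.
have W3 : W.+1%:R <= (C1 / k + 2) * E.
 have := Wge; have -> : C1 * E / k = C1 / k * E by rewrite mulrAC.
 have -> : W.+1%:R = W'%:R + 2 :> R by rewrite /W -addn2 natrD.
 by move=>Wle; rewrite mulrDl; apply:lerD => //; rewrite ler_peMr.
have N2 : N.+1%:R <= 2 * N%:R :> R by rewrite -natr1 mulr_natl mulr2n lerD2l ler1n.
have Ck0 : 0 < C1 / k + 2 by rewrite addr_gt0// divr_gt0.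
have aNE0 : 0 <= a * N%:R * E.
 by apply:mulr_ge0; [apply:mulr_ge0|]; exact:ltW.
have CE0 : 0 <= (C1 / k + 2) * E by apply:mulr_ge0; exact:ltW.
have c1 : (a * N%:R * E) ^+ n.+1 < (2 * N%:R) ^+ n.+1 * ((C1 / k + 2) * E) ^+ n.
 apply:(@lt_le_trans _ _ (q%:R ^+ n.+1)); first by rewrite ltr_pXn2r// nnegrE.
 apply:le_trans count _; apply:ler_pM; rewrite ?exprn_ge0//.
  by apply:lerXn2r => //; rewrite nnegrE// mulr_ge0.
 by apply:lerXn2r; rewrite ?nnegrE.
have c2 : a ^+ n.+1 * A = 2 ^+ n.+1 * (C1 / k + 2) ^+ n.
 rewrite /A mulrCA -exprMn mulrC; congr (_ ^+ _ * _).
 by rewrite /a; field; rewrite !gt_eqF.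
have : E < A.
 have p0 : 0 < N%:R ^+ n.+1 * E ^+ n :> R by rewrite mulr_gt0// exprn_gt0.
 rewrite -(ltr_pM2l (exprn_gt0 n.+1 a0)) c2 -(ltr_pM2l p0).
 rewrite (_ : _ * _ * _ = (a * N%:R * E) ^+ n.+1); last by rewrite !exprMn [E ^+ n.+1]exprS; ring.
 rewrite [ltRHS](_ : _ = (2 * N%:R) ^+ n.+1 * ((C1 / k + 2) * E) ^+ n)//.
 by rewrite !exprMn; ring.
by rewrite ltNge (ltW E'A).
Qed.
End Sard.

(** * Smooth steps and cutoff functions *)

Section SmoothStep.
Context {R : realType}.

Definition st (t : R) : R := flat 0 t / (flat 0 t + flat 0 (1 - t)).

Lemma st_den (t : R) : 0 < flat 0 t + flat 0 (1 - t).
have [t0|t0] := ltP 0 t; first by rewrite ltr_pwDl ?flat_ge0// flat0_gt0.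
by rewrite ltr_wpDl ?flat_ge0// flat0_gt0 subr_gt0 (le_lt_trans t0).
Qed.

Lemma st_smooth A : smooth_on A st.
move=>k; apply:(@Ck_sub _ _ _ _ _ setT) => //.
have oT : open [set: R] := openT.
have c1 : Ck_on k setT (flat 0 : R -> R) by exact:flat_smooth.
have c2 : Ck_on k setT (fun t : R => flat 0 (1 - t)).
 apply:(@Ck_comp _ _ _ _ k setT setT (fun t : R => 1 - t) (flat 0)) => //.
 by apply:CkB => //.
apply:CkM => //; apply:Ck_inv => //; last exact:CkD.
by move=>t _; rewrite gt_eqF// st_den.
Qed.

Lemma st_le0 t : t <= 0 -> st t = 0.
move=>t0; have := flat_ge0 0 t; rewrite le_eqVlt flat0_gt0 ltNge t0 orbF.
by move=> /eqP H; rewrite /st -H mul0r.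
Qed.

Lemma st_ge1 t : 1 <= t -> st t = 1.
move=>t1; have := flat_ge0 0 (1 - t); rewrite le_eqVlt flat0_gt0 subr_gt0 ltNge t1 orbF.
by move=> /eqP H; have := st_den t; rewrite /st -H addr0 => h; rewrite divff// gt_eqF.
Qed.

Lemma st01 t : 0 <= st t <= 1.
apply/andP; split; first by rewrite divr_ge0 ?flat_ge0 ?ltW ?st_den.
by rewrite ler_pdivrMr ?st_den// mul1r lerDl flat_ge0.
Qed.

(** Differentiating [st * den = flat 0] expresses the derivative times [den] as a combination of
    [flat 2 t] and [flat 2 (1 - t)] with weights [1 - st t] and [st t], whose signs are visible. *)
Lemma st_diff t : exists s, [/\ differentiable st t, forall v, 'd st t v = v * s,
 0 <= s, (0 < t < 1 -> 0 < s) & (~~ (0 < t < 1) -> s = 0)].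
have ds : differentiable st t by have [+ _] := st_smooth setT 1; apply.
pose den (u : R) := flat 0 u + flat 0 (1 - u).
have d1 : differentiable (fun u : R => 1 - u) t by apply:differentiableB.
have [df0 df0E] := flat_diff 0 t.
have [df1 df1E] := flat_diff 0 (1 - t).
have df1' : differentiable (flat 0 \o (fun u : R => 1 - u)) t by apply:differentiable_comp.
have d1E v : 'd (fun u : R => 1 - u) t v = - v.
 have E : 'd (cst 1 - id : R -> R) t = 0 - id :> (R -> R) by rewrite diff_val.
 have -> : (fun u : R => 1 - u) = cst 1 - id by apply/funext.
 by rewrite E fctE /= sub0r.
have df1E' v : 'd (flat 0 \o (fun u : R => 1 - u)) t v = - v * flat 2 (1 - t).
 have H0 : \forall u \near t, (flat 0 \o (fun u : R => 1 - u)) u = flat 0 (1 - u).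
  exact:filterE.
 apply:etrans (diff_near_comp erefl H0 d1 df1 v) _.
 by rewrite df1E d1E mul0r subr0.
have dd : differentiable den t.
 by rewrite (_ : den = flat 0 + (flat 0 \o (fun u : R => 1 - u)))//; exact:differentiableD.
have ddE v : 'd den t v = v * flat 2 t - v * flat 2 (1 - t).
 have E := diffD df0 df1'.
 have E' : 'd den t v = 'd (flat 0) t v + 'd (flat 0 \o (fun u : R => 1 - u)) t v.
  exact:(congr1 (fun h : R -> R => h v) E).
 by rewrite E'; apply:etrans (congr2 +%R (df0E v) (df1E' v)) _; ring.
pose s := 'd st t 1.
have dsE v : 'd st t v = v * s.
 have -> : v = v *: 1 by rewrite /GRing.scale /= mulr1.
 by rewrite linearZ /= /GRing.scale /= mulr1.
have pE : st * den = flat 0.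
 by apply/funext => u; rewrite fctE /st /den divfK// gt_eqF// st_den.
have sE : s * den t = flat 2 t * (1 - st t) + flat 2 (1 - t) * st t.
 have := df0E 1; rewrite -pE diffM// fctE /= ddE -/s !mul1r mul0r subr0 => h.
 move: h; rewrite /GRing.scale /= => h.
 move: h; move: (flat 2 t) (flat 2 (1 - t)) (st t) (den t) (s : R) => a b c d u h.
 have -> : a * (1 - c) + b * c = a - c * (a - b) by ring.
 by rewrite -{1}h; ring.
have den0 : 0 < den t by exact:st_den.
have st1 := st01 t.
have f2 u : 0 < u -> 0 < flat 2 u.
 by move=>u0; rewrite /flat u0 mulr_gt0 ?expR_gt0// exprn_gt0// invr_gt0.
have s0 : 0 <= s * den t.
 rewrite sE addr_ge0// mulr_ge0 ?flat_ge0//; last by case/andP: st1.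
 by rewrite subr_ge0; case/andP: st1.
exists s; split => //.
- by move: s0; rewrite pmulr_lge0.
- move=> /andP[t0 t1]; rewrite -(pmulr_lgt0 _ den0) sE ltr_pwDl//.
  rewrite mulr_gt0 ?f2// subr_gt0 /st ltr_pdivrMr// mul1r ltrDl.
  by rewrite flat0_gt0 subr_gt0.
 by rewrite mulr_ge0 ?flat_ge0//; case/andP: st1.
- rewrite negb_and -!leNgt => t01; apply/eqP.
 have : s * den t = 0.
  rewrite sE; case/orP: t01 => h.
   by rewrite (st_le0 h) mulr0 addr0 /flat ltNge h mul0r.
  by rewrite (st_ge1 h) subrr mulr0 add0r /flat subr_gt0 ltNge h mul0r.
 by move/eqP; rewrite mulf_eq0 (gt_eqF den0) orbF.
Qed.

Lemma pos_lower n (K : set 'rV[R]_n) (f : 'rV_n -> R) : compact K ->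
 (forall x, K x -> {for x, continuous f}) -> (forall x, K x -> 0 < f x) ->
 exists2 e : R, 0 < e & forall x, K x -> e < f x.
move=>cK cf f0.
have ci x : K x -> {for x, continuous (fun x => (f x)^-1 *: (1%:M : 'M[R]_1))}.
 move=>Kx; have c : (f y)^-1 @[y --> x] --> (f x)^-1.
  exact:(cvgV (lt0r_neq0 (f0 x Kx)) (cf x Kx)).
 exact:(cvgZ c (cvg_cst _)).
have [C C0 HC] := compact_bound cK ci.
exists ((C + 1)^-1); first by rewrite invr_gt0 addr_gt0.
move=>x Kx; have tx := f0 x Kx.
rewrite -[f x]invrK ltf_pV2 ?posrE ?invr_gt0 ?addr_gt0//.
have := le_trans (entry_le _ 0 0) (HC x Kx); rewrite !mxE eqxx mulr1.
by rewrite ger0_norm ?invr_ge0 ?(ltW tx)// => h; rewrite (le_lt_trans h)// ltrDl.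
Qed.

(** A smooth step applied to a sum of bumps divided by a positive lower bound [e] of that sum on K:
    the value is 1 wherever the sum exceeds e, hence near K, and 0 off finitely many closed balls
    contained in U. *)
Lemma cutoff n (K U : set 'rV_n) : compact K -> open U -> K `<=` U ->
 exists (th : 'rV_n -> R) (K1 : set 'rV_n),
  [/\ smooth_on setT th, forall x, 0 <= th x <= 1,
    (exists2 V, open V & K `<=` V /\ forall x, V x -> th x = 1),
    compact K1 /\ K1 `<=` U & forall x, ~ K1 x -> th x = 0].
move=>cK oU KU.
have hd z : exists d : R, 0 < d /\ (K z -> forall y, `|y - z| <= d -> U y).
 have [Kz|nKz] := pselect (K z); last by exists 1.
 have /nbhs_ballE[r r0 Hr] := open_nbhs_nbhs (conj oU (KU z Kz)).
 exists (r / 2); split; first by rewrite divr_gt0.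
 move=> _ y yz; apply:Hr; rewrite (le_lt_trans yz)// ltr_pdivrMr//.
 by rewrite ltr_pMr// ltr1n.
have [delta Hd] := choice hd.
have cc := cK; rewrite compact_cover in cc.
pose F z := [set y : 'rV_n | `|y - z| < delta z].
have oF z : K z -> open (F z) by move=> _; exact:open_ball.
have KF : K `<=` cover K F.
 by move=>x Kx; exists x => //=; rewrite /F /= subrr normr0; have [] := Hd x.
have [D DK cov] := cc _ K F oF KF.
pose s := finmap.enum_fset D.
pose tot x := \sum_(z <- s) bump z (delta z) x.
have tot_smooth : smooth_on setT tot.
 move=>k; apply:Ck_sum => //.
 by move=>z _; exact:bump_smooth.
have ctot : continuous tot by move=>x; exact:(Ck_on0 (tot_smooth 0%N)).
have tot_gt0 x : K x -> 0 < tot x.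
 move=> /cov [z /= zD xz]; rewrite /tot (big_rem z)//=.
 rewrite ltr_pwDl//; first by rewrite bump_gt0//; have [] := Hd z.
 by apply:sumr_ge0 => i _; exact:bump_ge0.
have [e e0 He] := pos_lower cK (fun x _ => @ctot x) tot_gt0.
pose K1 : set 'rV_n := \big[setU/set0]_(z <- s) [set y | `|y - z| <= delta z].
exists (fun x => st (tot x / e)), K1; split.
- move=>k; apply:(@Ck_comp _ _ _ _ k setT setT (fun x => tot x / e) st) => //.
 + exact:CkM; exact:tot_smooth.
 + exact:st_smooth.
- by move=>x; exact:st01.
- exists (tot @^-1` [set t | e < t]).
  by apply:open_comp; [move=>x _; exact:ctot|exact:open_gt].
 split => [x Kx|x /= ex]; first exact:He.
 by apply:st_ge1; rewrite ler_pdivlMr// mul1r ltW.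
- split.
  by apply:bigsetU_compact => z _; exact:cball_compact.
 rewrite /K1 => x; rewrite -bigcup_seq => -[z zs /= xz].
 by have [_ H] := Hd z; apply:H xz; apply/set_mem/DK.
- move=>x nK; rewrite (_ : tot x = 0) ?mul0r ?st_le0//.
 rewrite /tot big_seq big1// => z zs; apply/eqP; rewrite eq_le bump_ge0 andbT leNgt.
 apply/negP; rewrite bump_gt0; last by have [] := Hd z.
 move=>xz; apply:nK; rewrite /K1 -bigcup_seq; exists z => //=; exact:ltW.
Qed.
End SmoothStep.

(** * Paths in the general linear group *)

Section GLPath.
Context {R : realType}.

Lemma indep_vector k (u : 'rV[R]_k.+2) : exists w : 'rV_k.+2,
 forall a b, a *: u + b *: w = 0 -> b = 0.
have [H0|H0] := pselect (exists a, delta_mx 0 0 = a *: u).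
 have [a aE] := H0.
 exists (delta_mx 0 1) => c b H; apply/eqP/negPn/negP => b0.
 have a0 : a != 0.
  apply:contraTneq isT => a0; move/rowP: aE => /(_ 0).
  by rewrite a0 scale0r !mxE !eqxx => /eqP; rewrite oner_eq0.
 have uE : u = a^-1 *: delta_mx 0 0 by rewrite aE scalerA mulVf// scale1r.
 by move: H; rewrite uE => /rowP /(_ 1); rewrite !mxE /= mulr0 mulr0 add0r mulr1 => /eqP; apply/negP.
exists (delta_mx 0 0) => c b H; apply/eqP/negPn/negP => b0; apply:H0.
have bE : b *: delta_mx 0 0 = - (c *: u) :> 'rV_k.+2.
 by apply/eqP; rewrite -addr_eq0 addrC H.
by exists (- b^-1 * c); rewrite mulNr scaleNr -scalerA -scalerN -bE scalerK.
Qed.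

(** The segment from u to v meets 0 only if v is a negative multiple of u; a detour through an
    independent vector avoids this, which takes dimension at least 2. *)
Lemma homot_cst (T : topologicalType) k (u v : 'rV[R]_k.+2) : u != 0 -> v != 0 ->
 homot (fun _ : T => u) (fun _ => v).
move=>u0 v0.
have cc (w : 'rV[R]_k.+2) : continuous (fun _ : T => w) by move=>p; exact:cvg_cst.
have [H|H] := pselect (forall t, 0 <= t <= 1 -> (1 - t) *: u + t *: v != 0).
 exact:homot_line.
have [w Hw] := indep_vector u.
have uw : homot (fun _ : T => u) (fun _ => w).
 apply:homot_line => // _ t _; apply/eqP => /[dup] /Hw t0.
 by rewrite t0 subr0 scale1r scale0r addr0 => /eqP; apply/negP.
apply:homot_trans uw _.
have [t t01 tH] : exists2 t, 0 <= t <= 1 & (1 - t) *: u + t *: v = 0.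
 by apply:contrapT => H'; apply:H => t t01; apply/eqP => tH; apply:H'; exists t.
have t0 : t != 0.
 by apply:contraNneq u0 => t0; rewrite -tH t0 subr0 scale1r scale0r addr0.
have vE : v = (- t^-1 * (1 - t)) *: u.
 apply/eqP; rewrite -subr_eq0 -(inj_eq (scalerI t0)) scaler0 scalerBr scalerA.
 by rewrite mulrA mulrN mulfV// mulN1r scaleNr opprK addrC tH.
apply:homot_line => // _ s _; apply/eqP.
rewrite vE scalerA addrC => /[dup] /Hw s1.
rewrite s1 scale0r addr0 -scalerA => /eqP.
have -> : s = 1 by lra.
by rewrite scale1r -vE; apply/negP.
Qed.

Definition glc n (A B : 'M[R]_n) := exists G : R -> 'M[R]_n,
 [/\ continuous G, forall t, G t \in unitmx, G 0 = A & G 1 = B].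

Lemma glc_trans n (B A C : 'M[R]_n) : glc A B -> glc B C -> glc A C.
move=> [G [cG uG G0 G1]] [H [cH uH H0 H1]].
have uB : B \in unitmx by rewrite -G1.
exists (fun t => G (clamp (2 * t)) *m invmx B *m H (clamp (2 * t - 1))); split.
- have c2 : continuous (fun t : R => 2 * t).
  by move=>t; exact:(cvgM (cvg_cst _) (@cvg_id _ (nbhs t))).
 have c21 : continuous (fun t : R => 2 * t - 1).
  by move=>t; apply:cvgB; [exact:c2|exact:cvg_cst].
 have h1 := compc (compc c2 (@clamp_cont R)) cG.
 have h2 := compc (compc c21 (@clamp_cont R)) cH.
 move=>t; apply:cvg_mulmx; last exact:h2.
 by apply:cvg_mulmx; [exact:h1|exact:cvg_cst].
- by move=>t; rewrite !unitmx_mul uG uH unitmx_inv uB.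
- rewrite mulr0 sub0r !clamp_le0//// G0 H0 mulmxKV//.
- have e1 : clamp (2 * 1) = 1 :> R by apply:clamp_ge1; lra.
 have e2 : clamp (2 * 1 - 1) = 1 :> R by apply:clamp_ge1; lra.
 by rewrite e1 e2 G1 mulmxV// mul1mx H1.
Qed.

Lemma glc_sym n (A B : 'M[R]_n) : glc A B -> glc B A.
move=> [G [cG uG G0 G1]]; exists (fun t => G (1 - t)); split.
- apply:compc => // t.
 exact:(cvgB (cvg_cst _) (@cvg_id _ (nbhs t))).
- by move=>t; exact:uG.
- by rewrite subr0.
- by rewrite subrr.
Qed.

Lemma glc_mulr n (A B C : 'M[R]_n) : C \in unitmx -> glc A B -> glc (A *m C) (B *m C).
move=>uC [G [cG uG G0 G1]]; exists (fun t => G t *m C); split.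
- by move=>t; apply:cvg_mulmx; [exact:cG|exact:cvg_cst].
- by move=>t; rewrite unitmx_mul uG uC.
- by rewrite G0.
- by rewrite G1.
Qed.

Lemma glc_mull n (A B C : 'M[R]_n) : C \in unitmx -> glc A B -> glc (C *m A) (C *m B).
move=>uC [G [cG uG G0 G1]]; exists (fun t => C *m G t); split.
- by move=>t; apply:cvg_mulmx; [exact:cvg_cst|exact:cG].
- by move=>t; rewrite unitmx_mul uG uC.
- by rewrite G0.
- by rewrite G1.
Qed.

(** [transport] between constant maps on a finite compact space gives a product of matrices close to
    1; scaling the small parts by t joins this product to 1. *)
Lemma glc_row n (u v : 'rV_n.+2) : u != 0 -> v != 0 ->
 exists2 B : 'M[R]_n.+2, glc B 1%:M & v = u *m B.
move=>u0 v0; have h := homot_cst bool u0 v0.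
have e0 : (0 : R) < (n.+3%:R)^-1 by rewrite invr_gt0 ltr0n.
have [N [A [cA sA vE]]] := transport bool_compact e0 h.
exists (eprod A N true); last exact:vE.
apply:glc_sym; pose A' i t := clamp t *: A i true.
exists (eprod A' N); split.
- move=>t; apply:cvg_eprod => i _.
 exact:(cvgZ (@clamp_cont R t) (cvg_cst _)).
- move=>t; apply:eprod_unitmx => i iN; rewrite /A' normrZ.
 have /andP[c0 c1] := clamp01 t.
 apply:(@le_lt_trans _ _ (n.+2%:R * `|A i true|)).
  by rewrite ler_wpM2l// ger0_norm// ler_piMl.
 apply:(@le_lt_trans _ _ (n.+2%:R * n.+3%:R^-1)).
  by rewrite ler_wpM2l// ltW// sA.
 by rewrite ltr_pdivrMr// mul1r ltr_nat.
- elim:(N) => //= k ->; rewrite /A' clamp_le0// scale0r addr0 mulmx1//.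
- elim:(N) => //= k ->; rewrite /A' clamp_ge1// scale1r//.
Qed.

(** Induction on n: a right factor joined to 1 moves the first row to the first basis vector, the
    matrix becomes block triangular, and the remaining column is scaled to 0 while the smaller block
    is joined to 1. The determinant of that factor is positive by the intermediate value theorem. *)
Theorem gl_path n (A : 'M[R]_n) : 0 < \det A -> glc A 1%:M.
elim:n A => [A _|n IH A dA].
 exists (fun=> A); split => [t|t||]; [exact:cvg_cst|by rewrite unitmxE det_mx00 unitr1|by []|].
 by apply/matrixP => -[].
(* Dimension 1 is done by a segment of positive numbers, since the complement of 0 in R is not
   connected and [glc_row] starts at dimension 2. *)
case:n IH A dA => [_ A dA|n IH A dA].
 move: dA; rewrite [A]mx11_scalar det_scalar expr1; set a := A 0 0 => a0.
 have H t : 0 < (1 - clamp t) * a + clamp t.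
  have /andP[] := clamp01 t; rewrite le_eqVlt => /orP[/eqP <- _|c0 c1].
   by rewrite subr0 mul1r addr0.
  by rewrite ltr_wpDl// mulr_ge0 ?subr_ge0// ltW.
 exists (fun t => ((1 - clamp t) * a + clamp t)%:M); split.
 - move=>t; apply:cvg_mx => i j; rewrite mxE; under eq_fun do rewrite mxE.
  rewrite (ord1 i) (ord1 j) eqxx /= !mulr1n.
  have c := @clamp_cont R t.
  apply:cvgD => //; apply:cvgM; last exact:cvg_cst.
  by apply:cvgB => //; exact:cvg_cst.
 - by move=>t; rewrite unitmxE det_scalar expr1 unitfE gt_eqF.
 - by rewrite clamp_le0// subr0 mul1r addr0.
 - by rewrite clamp_ge1// subrr mul0r add0r.
have uA : A \in unitmx by rewrite unitmxE unitfE gt_eqF.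
have r0 : row 0 A != 0.
 apply:contraTneq uA => r0; rewrite unitmxE unitfE negbK.
 by rewrite (expand_det_row A 0) big1// => j _; move/rowP: r0 => /(_ j); rewrite !mxE => ->; rewrite mul0r.
have e0 : delta_mx 0 0 != 0 :> 'rV[R]_n.+2.
 by apply/rV0Pn; exists 0; rewrite mxE !eqxx oner_eq0.
have [B Bc rB] := glc_row r0 e0.
have [uB dB] : B \in unitmx /\ 0 < \det B.
 have [G [cG uG G0 G1]] := Bc; split; first by rewrite -G0.
 have cd : continuous (fun t => \det (G t)) by move=>t; apply:cvg_det; exact:cG.
 have nd t : \det (G t) != 0 by rewrite -unitfE -unitmxE.
 rewrite ltNge le_eqVlt; apply/negP => /orP[/eqP d0|d0].
  by have := nd 0; rewrite G0 d0 eqxx.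
 have h0 : Num.min (\det (G 0)) (\det (G 1)) <= 0 <= Num.max (\det (G 0)) (\det (G 1)).
  by rewrite G0 G1 det1 ge_min le_max (ltW d0) ler01 orbT.
 have [t _ /eqP] := IVT ler01 (continuous_subspaceT cd) h0.
 by apply/negP.
have AB : glc (A *m B) A.
 by rewrite -[X in glc _ X]mulmx1; exact:glc_mull.
apply:(glc_trans (glc_sym AB)).
pose A1 : 'M[R]_(1 + n.+1) := A *m B.
have A1E : A1 = block_mx 1%:M 0 (dlsubmx A1) (drsubmx A1).
 rewrite -{1}[A1]submxK; congr block_mx.
  apply/matrixP => i j; rewrite !ord1 !mxE.
  move/rowP: rB => /(_ 0); rewrite !mxE eqxx /= => ->.
  by apply:eq_bigr => k _; rewrite mxE; congr (A _ _ * B _ _); apply/val_inj.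
 apply/matrixP => i j; rewrite !ord1 [RHS]mxE !mxE.
 move/rowP: rB => /(_ (rshift 1 j)); rewrite !mxE eqxx /= => H.
 apply:etrans (esym H); apply:eq_bigr => k _; rewrite mxE.
 by congr (A _ _ * B _ _); apply/val_inj.
have dD : 0 < \det (drsubmx A1).
 have : 0 < \det A1 by rewrite /A1 det_mulmx mulr_gt0.
 by rewrite A1E det_lblock det1 mul1r block_mxKdr.
have [G [cG uG G0 G1]] := IH _ dD.
pose H t : 'M[R]_(1 + n.+1) := block_mx 1%:M 0 ((1 - clamp t) *: dlsubmx A1) (G t).
have cH : continuous H.
 move=>t; have c1 : (1 - clamp t0) *: dlsubmx A1 @[t0 --> t] --> (1 - clamp t) *: dlsubmx A1.
  exact:(cvgZ (cvgB (cvg_cst _) (@clamp_cont R t)) (cvg_cst _)).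
 exact:(cvg_col_mx (cvg_cst _) (cvg_row_mx c1 (cG t))).
have uH t : H t \in unitmx by rewrite unitmxE /H det_lblock det1 mul1r -unitmxE.
exists H; rewrite /H; split => //.
- by rewrite clamp_le0// subr0 scale1r G0 -A1E.
- by rewrite clamp_ge1// subrr scale0r G1 -scalar_mx_block.
Qed.

Lemma glc_det n (A B : 'M[R]_n) : 0 < \det A * \det B -> glc A B.
move=>dAB; have uB : B \in unitmx.
 by rewrite unitmxE unitfE; apply:contraTneq dAB => ->; rewrite mulr0 ltxx.
have -> : A = A *m invmx B *m B by rewrite mulmxKV.
rewrite -[X in glc _ X]mul1mx; apply:glc_mulr => //; apply:gl_path.
rewrite det_mulmx det_inv; move: dAB.
have d0 : \det B != 0 by rewrite -unitfE -unitmxE.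
have b2 : 0 < \det B ^+ 2 by rewrite lt_def sqr_ge0 sqrf_eq0 d0.
have -> : \det A * \det B = (\det A / \det B) * \det B ^+ 2 by field.
by rewrite pmulr_lgt0.
Qed.
End GLPath.

(** * A nonnegative divergence of a compactly supported field vanishes *)

Section Divergence.
Context {R : realType}.

Lemma C1_unif_scalar n (f : 'rV_n -> R) (K : set 'rV_n) (e : R) :
 compact K -> Ck_on 1 setT f -> 0 < e ->
 exists2 d : R, 0 < d & forall x h, K x -> `|h| < d ->
  `|f (x + h) - f x - 'd f x h| <= e * `|h|.
move=>cK sf e0.
pose g x : 'rV_1 := f x *: 1%:M.
have sg : Ck_on 1 setT g.
 exact:CkZ; exact:sf.
have [d d0 Hd] := compact_C1_unif openT cK (@subsetT _ K) sg e0.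
exists d => // x h Kx hd; have := Hd x h Kx hd.
have df : differentiable f x by have [+ _] := sf; apply.
have -> : h *m jac g x = 'd f x h *: 1%:M.
 by rewrite -jacE /g; exact:(congr1 (fun F : 'rV_n -> 'rV_1 => F h) (diffZl 1%:M df)).
rewrite /g -!scalerBl; apply:le_trans.
by apply:le_trans (entry_le _ 0 0); rewrite !mxE eqxx mulr1.
Qed.
Section Grid.
Variables (n N' : nat) (L : R).
Hypothesis L0 : 0 < L.
Let N := N'.+1.
Let h : R := 4 * L / N%:R.

Definition gpt (a : {ffun 'I_n -> 'I_N}) : 'rV[R]_n := \row_j ((a j)%:R * h - 2 * L).

Lemma gpt_le a : `|gpt a| <= 2 * L.
have h0 : 0 < h by rewrite divr_gt0// mulr_gt0.
apply:mx_norm_le => [|i j]; first by rewrite mulr_ge0// ltW.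
rewrite mxE ler_norml; apply/andP; split.
 by rewrite lerBrDr addNr mulr_ge0// ltW.
rewrite lerBlDr; apply:(@le_trans _ _ (N%:R * h)).
 by rewrite ler_pM2r// ler_nat ltnW.
by rewrite /h mulrCA divff ?gt_eqF// mulr1; lra.
Qed.

(** One step along an axis is a cyclic permutation of the grid of the cube of half-side 2 L, except
    at the last layer; there W vanishes at both points concerned. *)
Lemma grid_shift (W : 'rV_n -> R) (d : 'I_n) : (forall x, L <= `|x| -> W x = 0) ->
 \sum_a W (gpt a + h *: delta_mx 0 d) = \sum_a W (gpt a).
move=>W0; have N0 : 0 < N%:R :> R by rewrite ltr0n.
have L2 : 0 < 2 * L by rewrite mulr_gt0.
pose phi (a : {ffun 'I_n -> 'I_N}) := [ffun j => if j == d then ordS (a j) else a j].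
have phi_inj : injective phi.
 move=>a b /ffunP ab; apply/ffunP => j; have := ab j; rewrite !ffunE.
 by case:eqP => // _; exact:ordS_inj.
rewrite [RHS](reindex_inj phi_inj); apply:eq_bigr => a _.
have [aN|aN] := ltnP (a d).+1 N.
 congr W; apply/rowP => j; rewrite !mxE ffunE eqxx /= eq_sym.
 case:(eqVneq d j) => [dj|_]; last by rewrite mulr0 addr0.
 have -> : (ordS (a j))%:R = (a j)%:R + 1 :> R by rewrite natr1 /= modn_small// -dj.
 by rewrite /=; ring.
have aE : a d = N' :> nat.
 by apply/eqP; rewrite eqn_leq -ltnS ltn_ord /= -ltnS.
rewrite !W0//.
 apply:le_trans (entry_le _ 0 d); rewrite !mxE ffunE eqxx /= aE modnn mul0r sub0r.
 by rewrite normrN (ger0_norm (ltW L2)) ler_peMl ?ler1n// ltW.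
apply:le_trans (entry_le _ 0 d); rewrite !mxE !eqxx aE mulr1.
have -> : N'%:R * h - 2 * L + h = 2 * L.
 have NE : N%:R = N'%:R + 1 :> R by rewrite natr1.
 have -> : N'%:R * h - 2 * L + h = N%:R * h - 2 * L by rewrite NE; move: (h) => h1; ring.
 by rewrite /h mulrCA divff ?gt_eqF// mulr1; lra.
by rewrite (ger0_norm (ltW L2)) ler_peMl ?ler1n// ltW.
Qed.

(** A cube of half-side rho inside the grid contains at least q grid points per axis when q h <=
    rho, and f is at least c at each of them. *)
Lemma grid_count (f : 'rV_n -> R) (x0 : 'rV_n) (rho c : R) (q : nat) :
 (forall x, 0 <= f x) -> (forall x, `|x - x0| <= rho -> c <= f x) ->
 0 < rho <= L -> `|x0| <= L -> (0 < q)%N -> q%:R * h <= rho ->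
 (q ^ n)%:R * c <= \sum_a f (gpt a).
move=>f0 fc /andP[rho0 rhoL] x0L q0 qh.
have h0 : 0 < h by rewrite divr_gt0// mulr_gt0.
have Nh : N%:R * h = 4 * L by rewrite /h mulrCA divff ?gt_eqF// mulr1.
have x0j j : - L <= x0 0 j <= L by rewrite -ler_norml (le_trans (entry_le _ _ _)).
pose lo j := Num.truncn ((x0 0 j + 2 * L) / h).
have loE j : (lo j)%:R * h <= x0 0 j + 2 * L < (lo j)%:R * h + h.
 have /andP[h1 h2] : (lo j)%:R <= (x0 0 j + 2 * L) / h < (lo j).+1%:R.
  apply:truncn_itv; rewrite divr_ge0//; last exact:ltW.
  by have /andP[x1 _] := x0j j; lra.
 have -> : (lo j)%:R * h + h = (lo j).+1%:R * h by rewrite -natr1 mulrDl mul1r.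
 by rewrite -ler_pdivlMr// h1 -ltr_pdivrMr.
have bnd j (b : 'I_q) : (lo j + b < N)%N.
 rewrite -(ltr_nat R) -(ltr_pM2r h0) Nh natrD mulrDl.
 have /andP[l1 _] := loE j; have /andP[_ x1] := x0j j.
 have b1 : b%:R * h < rho.
  by rewrite (lt_le_trans _ qh)// ltr_pM2r// ltr_nat.
 by lra.
pose io (b : {ffun 'I_n -> 'I_q}) : {ffun 'I_n -> 'I_N} := [ffun j => Ordinal (bnd j (b j))].
have io_inj : injective io.
 move=>b b' /ffunP bb; apply/ffunP => j; have := bb j; rewrite !ffunE => /(congr1 val) /= /eqP.
 by rewrite eqn_add2l => /eqP /val_inj.
apply:(@le_trans _ _ (\sum_b f (gpt (io b)))).
 rewrite mulr_natl -[(q ^ n)%N]/((q ^ n)%N) -{1}[q]card_ord -{1}[n]card_ord -card_ffun -sumr_const.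
 rewrite [leLHS](eq_bigl xpredT)//; apply:ler_sum => b _; apply:fc.
 apply:mx_norm_le => [|i j]; first exact:ltW.
 rewrite (ord1 i) !mxE ffunE /= natrD mulrDl.
 have /andP[l1 l2] := loE j.
 have b0 : 0 <= (b j)%:R * h by rewrite mulr_ge0// ltW.
 have b1 : (b j)%:R * h + h <= q%:R * h.
  by rewrite -[X in _ + X]mul1r -mulrDl natr1 ler_pM2r// ler_nat ltn_ord.
 by rewrite ler_norml; apply/andP; split; lra.
rewrite [leRHS](bigID (mem (io @: finset.setT))) /= big_imset/=; last by move=>b b' _ _; exact:io_inj.
rewrite [X in _ <= X + _](eq_bigl xpredT); last by move=>b; rewrite finset.in_setT.
by rewrite lerDl sumr_ge0.
Qed.
End Grid.

(** Discrete divergence theorem. Riemann sums of the differences W(x + h d) - W(x) vanish by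
    [grid_shift], so the sum of [f] over the N^n grid points is at most N^n |I| e. A positive value
    of f would contribute at least a fixed multiple of N^n. *)
Theorem div_zero n (I : finType) (W : I -> 'rV_n -> R) (d : I -> 'I_n) (L : R) :
 0 < L -> (forall i, Ck_on 1 setT (W i)) -> (forall i x, L <= `|x| -> W i x = 0) ->
 (forall x, 0 <= \sum_i 'd (W i) x (delta_mx 0 (d i))) ->
 forall x, \sum_i 'd (W i) x (delta_mx 0 (d i)) = 0.
move=>L0 sW W0 f0 x0; pose f x := \sum_i 'd (W i) x (delta_mx 0 (d i)).
apply/eqP; rewrite eq_le f0 andbT leNgt; apply/negP => c0; set c := f x0 in c0.
have cf x : {for x, continuous f}.
 apply:(@cvg_sumr R _ (nbhs x) _) => i _.
 by have [_ /(_ (delta_mx 0 (d i)))] := sW i; apply.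
have x0L : `|x0| <= L.
 rewrite leNgt; apply/negP => Lx; move: c0; rewrite /c /f big1 ?ltxx// => i _.
 have E : \forall y \near x0, W i y = cst 0 y.
  have : nbhs x0 [set y : 'rV_n | L < `|y|].
   apply:open_nbhs_nbhs; split => //.
   rewrite (_ : mkset _ = (fun y : 'rV_n => `|y|) @^-1` [set t | L < t])//.
   by apply:open_comp; [move=>y _; exact:norm_continuous|exact:open_gt].
  by apply:filterS => y Ly; rewrite W0// ltW.
 have [_ ->] := near_eq_is_diff E (differentiable_cst 0 x0).
 by rewrite diff_cst.
have [rho /andP[r0 rL] Hr] : exists2 rho, 0 < rho <= L & forall x, `|x - x0| <= rho -> c / 2 <= f x.
 have : \forall y \near x0, c / 2 < f y.
  by apply:(cvgr_gt _ (cf x0)); rewrite -/c ltr_pdivrMr// ltr_pMr// ltr1n.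
 move=> /nbhs_ballE[r r0 Hr]; exists (Num.min (r / 2) L).
  by rewrite lt_min L0 divr_gt0//= ge_min lexx orbT.
 move=>x; rewrite le_min => /andP[xr _]; apply/ltW/Hr.
 by rewrite (le_lt_trans xr)// ltr_pdivrMr// ltr_pMr// ltr1n.
pose kap := rho / (8 * L).
have k0 : 0 < kap by rewrite divr_gt0// mulr_gt0.
(* Chosen so that |I| e is smaller than (c / 2) kap^n, where [kap] N bounds from below the number of
   grid points per axis in the ball where f >= c / 2. *)
pose e := c / 2 * kap ^+ n / (#|I|.+1)%:R.
have e0 : 0 < e by rewrite divr_gt0// mulr_gt0 ?divr_gt0// exprn_gt0.
have cK := @cball_compact R n 0 (2 * L).
have hd i : exists dl : R, 0 < dl /\ forall x h, `|x - 0| <= 2 * L -> `|h| < dl ->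
  `|W i (x + h) - W i x - 'd (W i) x h| <= e * `|h|.
 by have [dl dl0 Hdl] := C1_unif_scalar cK (sW i) e0; exists dl; split.
have [dl Hdl] := choice hd.
pose dm := \big[Num.min/1]_i dl i.
have dm0 : 0 < dm.
 by rewrite /dm; elim/big_ind: _ => // [x y x1 y1|i _]; [rewrite lt_min x1|have [] := Hdl i].
have dmE i : dm <= dl i by exact:bigmin_le_cond.
have p1 : 0 < 4 * L / dm by rewrite divr_gt0// mulr_gt0.
have p2 : 0 < 4 * L / rho by rewrite divr_gt0// mulr_gt0.
pose N' := Num.truncn (4 * L / dm + 4 * L / rho).
have N'E : 4 * L / dm + 4 * L / rho < N'.+1%:R.
 by have /andP[] := truncn_itv (ltW (addr_gt0 p1 p2)).
set N := N'.+1 in N'E.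
pose h := 4 * L / N%:R.
have h0 : 0 < h by rewrite divr_gt0// mulr_gt0.
have hdm : h < dm.
 by rewrite /h ltr_pdivrMr// -ltr_pdivrMl// mulrC; lra.
have hrho : h < rho.
 by rewrite /h ltr_pdivrMr// -ltr_pdivrMl// mulrC; lra.
pose q := Num.truncn (rho / h).
have /andP[q1 q2] : q%:R <= rho / h < q.+1%:R.
 by apply:truncn_itv; rewrite divr_ge0// ltW.
have rh1 : 1 < rho / h by rewrite ltr_pdivlMr// mul1r.
have q0 : (0 < q)%N by rewrite -ltnS -(ltr_nat R) (lt_trans rh1).
have qh : q%:R * h <= rho by rewrite -ler_pdivlMr.
have qk : kap * N%:R <= q%:R.
 have -> : kap * N%:R = (rho / h) / 2.
  by rewrite /kap /h; field; rewrite !gt_eqF.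
 have q1' : (1 : R) <= q%:R by rewrite ler1n.
 by rewrite -natr1 in q2; lra.
have r0L : 0 < rho <= L by rewrite r0.
have lo := grid_count L0 f0 Hr r0L x0L q0 qh.
have up : \sum_a f (@gpt n N' L a) <= (N ^ n)%:R * (#|I|%:R * e).
 rewrite -(ler_pM2r h0) mulr_suml.
 apply:(@le_trans _ _ (\sum_a \sum_i
   (e * h + (W i (@gpt n N' L a + h *: delta_mx 0 (d i)) - W i (@gpt n N' L a))))).
  apply:ler_sum => a _; rewrite /f mulr_suml; apply:ler_sum => i _.
  have nh : `|h *: delta_mx 0 (d i) : 'rV_n| <= h.
   apply:mx_norm_le => [|k j]; first exact:ltW.
   rewrite !mxE; case:(_ && _); rewrite ?mulr1 ?mulr0 ?normr0 ?(ltW h0)//.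
   by rewrite ger0_norm// ltW.
  have [dl0 H] := Hdl i.
  have := H (@gpt n N' L a) (h *: delta_mx 0 (d i)) _ _.
  rewrite subr0 (gpt_le L0) (le_lt_trans nh (lt_le_trans hdm (dmE i))) => /(_ isT isT).
  rewrite linearZ /= /GRing.scale /= => H'.
  have := le_trans H' (ler_wpM2l (ltW e0) nh).
  rewrite ler_norml => /andP[h1 h2]; rewrite mulrC.
  by move: h1 h2; rewrite /GRing.scale; lra.
 rewrite exchange_big.
 apply:(@le_trans _ _ (\sum_i (N ^ n)%:R * (e * h))).
  apply:ler_sum => i _; rewrite big_split /= sumrB.
  have E : \sum_a W i (@gpt n N' L a + h *: delta_mx 0 (d i)) = \sum_a W i (@gpt n N' L a).
   exact:(@grid_shift n N' L L0 (W i) (d i) (W0 i)).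
  rewrite E subrr addr0.
  by rewrite sumr_const card_ffun !card_ord mulr_natl.
 have aux (a b u v : R) : a * (b * (u * v)) = b * (a * u) * v by ring.
 have -> : \sum_(i : I) (N ^ n)%:R * (e * h) = #|I|%:R * ((N ^ n)%:R * (e * h)).
  by rewrite sumr_const [RHS]mulr_natl.
 by rewrite aux.
have := le_trans lo up.
rewrite !natrX => H.
have : (kap * N%:R) ^+ n * (c / 2) <= N%:R ^+ n * (#|I|%:R * e).
 apply:le_trans H; rewrite ler_pM2r ?divr_gt0//.
 have k0' : 0 <= kap * N%:R by rewrite mulr_ge0// ltW.
 exact:(lerXn2r n k0' (ler0n _ q) qk).
rewrite exprMn [kap ^+ n * _]mulrC -mulrA ler_pM2l ?exprn_gt0//.
apply/negP; rewrite -ltNge /e mulrA ltr_pdivrMr//.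
rewrite mulrC [X in _ < X * _]mulrC ltr_pM2l; first by rewrite ltr_nat.
by rewrite mulr_gt0 ?divr_gt0 ?exprn_gt0.
Qed.
End Divergence.

(** * The Jacobian determinant in divergence form *)

Section Deg2.
Context {R : realType}.

Lemma diff_mul (V : normedModType R) (f g : V -> R) x v :
 differentiable f x -> differentiable g x ->
 differentiable (fun y => f y * g y) x /\
 'd (fun y => f y * g y) x v = f x * 'd g x v + g x * 'd f x v.
move=>df dg; split; first exact:differentiableM.
exact:(congr1 (fun F : V -> R => F v) (diffM df dg)).
Qed.

Lemma diff_prod (V : normedModType R) (I : eqType) (r : seq I) (P : pred I)
  (F : I -> V -> R) x v : uniq r -> (forall i, differentiable (F i) x) ->
 differentiable (fun y => \prod_(i <- r | P i) F i y) x /\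
 'd (fun y => \prod_(i <- r | P i) F i y) x v =
  \sum_(k <- r | P k) 'd (F k) x v * \prod_(i <- r | P i && (i != k)) F i x.
move=> + dF; elim:r => [_|a r IH /= /andP[ar ur]].
 rewrite (_ : (fun y => _) = cst 1); last by apply/funext => y; rewrite big_nil.
 by split; [exact:differentiable_cst|rewrite diff_cst big_nil].
have [dr rE] := IH ur.
have Pa : \prod_(i <- r | P i && (i != a)) F i x = \prod_(i <- r | P i) F i x.
 rewrite big_seq_cond [RHS]big_seq_cond; apply:eq_bigl => i.
 by have [->|] := eqVneq i a; rewrite ?(negPf ar)// andbT.
have [Pai|Pai] := boolP (P a); last first.
 rewrite (_ : (fun y => _) = (fun y => \prod_(i <- r | P i) F i y)); last first.
  by apply/funext => y; rewrite big_cons (negPf Pai).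
 split => //; rewrite rE big_cons (negPf Pai); apply:eq_bigr => k _.
 by rewrite big_cons (negPf Pai).
rewrite (_ : (fun y => _) = (fun y => F a y * \prod_(i <- r | P i) F i y)); last first.
 by apply/funext => y; rewrite big_cons Pai.
have [d1 E1] := diff_mul v (dF a) dr; split => //.
rewrite E1 rE big_cons Pai big_cons eqxx andbF Pa addrC mulrC; congr (_ + _).
rewrite mulr_sumr [LHS]big_seq_cond [RHS]big_seq_cond; apply:eq_bigr => k /andP[kr Pk].
rewrite big_cons Pai /= (_ : a != k); first by rewrite mulrCA.
by apply:contraNneq ar => ->.
Qed.

Lemma jac_sym n (O : set 'rV[R]_n) (S : 'rV_n -> 'rV_n) x a b i :
 open O -> smooth_on O S -> O x ->
 'd (fun y => jac S y a i) x (delta_mx 0 b) = 'd (fun y => jac S y b i) x (delta_mx 0 a).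
move=>oO sS Ox; pose Si y := S y 0 i.
have sSi : Ck_on 2 O Si by exact:Ck_entry.
have [dSi sdSi] := sSi; have [dS _] := sS 1.
have E c y : O y -> jac S y c i = 'd Si y (delta_mx 0 c).
 move=>Oy; rewrite jac_entry; symmetry.
 have ce : continuous (@mx_entry R 1 n 0 i) by exact:coord_continuous.
 have H0 : \forall z \near y, Si z = mx_entry 0 i (S z) by exact:filterE.
 have E1 := @diff_near_comp R _ _ _ S (@mx_entry R 1 n 0 i) Si y (S y) erefl H0
  (dS y Oy) (linear_differentiable (S y) ce) (delta_mx 0 c).
 apply:etrans E1 _; exact:(congr1 (fun F : 'rV_n -> R => F ('d S y (delta_mx 0 c))) (diff_lin (S y) ce)).
have dd c u : 'd (fun y => jac S y c i) x u = 'd (fun y => 'd Si y (delta_mx 0 c)) x u.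
 have e : \forall y \near x, jac S y c i = 'd Si y (delta_mx 0 c).
  by apply:filterS (open_nbhs_nbhs (conj oO Ox)) => y Oy; exact:E.
 have dx : differentiable (fun y => 'd Si y (delta_mx 0 c)) x.
  by have [+ _] := sdSi (delta_mx 0 c); apply.
 have [_ h] := near_eq_is_diff e dx.
 exact:(congr1 (fun F : 'rV_n -> R => F u) h).
exact:etrans (dd _ _) (etrans (Schwarz _ _ oO sSi Ox) (esym (dd _ _))).
Qed.

(** The cofactor rows of a Jacobian are divergence free. In the Leibniz expansion, the terms with
    second derivatives of S cancel in pairs by [jac_sym]; the derivatives of [Phi] in a direction j
    other than 0 multiply a determinant with two equal columns. *)
Lemma det_div n (O : set 'rV_n.+1) (S : 'rV_n.+1 -> 'rV_n.+1)
  (Phi : 'rV_n.+1 -> R) x : open O -> smooth_on O S -> Ck_on 1 setT Phi -> O x ->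
 \sum_(s : 'S_n.+1) 'd (fun y => (-1) ^+ s *
   (Phi (S y) * \prod_(i | i != ord0) jac S y (s i) i)) x (delta_mx 0 (s ord0)) =
 'd Phi (S x) (delta_mx 0 ord0) * \det (jac S x).
have aux (a B C q : R) : a * (B * (C * q)) = q * (a * (C * B)) by ring.
move=>oO sS sPhi Ox; pose J := jac S x.
have [dPhi _] := sPhi; have [dS _] := sS 1.
have dJ a i : differentiable (fun y => jac S y a i) x.
 by have [+ _] := Ck_entry a i oO (Ck_jac oO (sS 2)); apply.
pose D a i b := 'd (fun y => jac S y a i) x (delta_mx 0 b).
have Dsym a i b : D a i b = D b i a by exact:jac_sym oO sS Ox.
pose p j := 'd Phi (S x) (delta_mx 0 j).
have term (s : 'S_n.+1) : 'd (fun y => (-1) ^+ s *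
   (Phi (S y) * \prod_(i | i != ord0) jac S y (s i) i)) x (delta_mx 0 (s ord0)) =
 (\sum_j p j * ((-1) ^+ s * (J (s ord0) j * \prod_(i | i != ord0) J (s i) i))) +
 Phi (S x) * (\sum_(k | k != ord0) (-1) ^+ s * (D (s k) k (s ord0) *
   \prod_(i | (i != ord0) && (i != k)) J (s i) i)).
 have dPS : differentiable (fun y => Phi (S y)) x.
  by apply:differentiable_comp; [exact:dS|exact:dPhi].
 have PSE v : 'd (fun y => Phi (S y)) x v = 'd Phi (S x) ('d S x v).
  apply:diff_near_comp => //.
  - exact:filterE.
  - exact:dS.
  - exact:dPhi.
 set v := delta_mx 0 (s ord0).
 have [dp pE] := @diff_prod _ _ (index_enum 'I_n.+1) (fun i => i != ord0)
   (fun i y => jac S y (s i) i) x v (index_enum_uniq _) (fun i => dJ (s i) i).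
 have [d2 E2] := diff_mul v dPS dp.
 have [d3 E3] := @diff_mul _ (cst ((-1) ^+ s)) _ x v (differentiable_cst _ _) d2.
 rewrite E3 diff_cst mulr0 addr0 /cst E2 pE PSE mulrDr addrC; congr (_ + _).
  have -> : 'd S x v = \sum_j J (s ord0) j *: delta_mx 0 j.
   by rewrite jacE -rowE [LHS]row_sum_delta; apply:eq_bigr => j _; rewrite mxE.
  rewrite linear_sum mulr_sumr mulr_sumr; apply:eq_bigr => j _.
  have -> : 'd Phi (S x) (J (s ord0) j *: delta_mx 0 j) = J (s ord0) j * p j by exact:linearZ.
  exact:aux.
 by rewrite mulrCA mulr_sumr.
rewrite (eq_bigr _ (fun s _ => term s)) big_split /= -mulr_sumr.
have -> : \sum_(s : 'S_n.+1) \sum_(k | k != ord0) (-1) ^+ s * (D (s k) k (s ord0) *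
   \prod_(i | (i != ord0) && (i != k)) J (s i) i) = 0.
 rewrite exchange_big /= big1// => k k0.
 set X := \sum_s _.
 suff : X = - X by move=> /eqP; rewrite -addr_eq0 -mulr2n mulrn_eq0 /= => /eqP.
 (* Composing with the transposition of 0 and k changes the sign and exchanges the two indices of
    the symmetric second derivative. *)
 rewrite {1}/X (reindex_inj (mulgI (tperm ord0 k))) /= -sumrN; apply:eq_bigr => s _.
 rewrite odd_mul_tperm eq_sym k0 /= signrN mulNr; congr (- (_ * _)).
 rewrite !permM tpermL tpermR Dsym; congr (_ * _); apply:eq_bigr => i /andP[i0 ik].
 by rewrite permM tpermD// eq_sym.
rewrite mulr0 addr0 exchange_big.
have detE j : \sum_(s : 'S_n.+1) p j * ((-1) ^+ s * (J (s ord0) j *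
  \prod_(i | i != ord0) J (s i) i)) =
  p j * \det (\matrix_(i, a) J a (if i == ord0 then j else i)).
 rewrite -mulr_sumr; congr (_ * _); rewrite /determinant; apply:eq_bigr => s _.
 congr (_ * _); rewrite [RHS](bigD1 ord0)//= mxE eqxx; congr (_ * _).
 by apply:eq_bigr => i i0; rewrite mxE (negPf i0).
rewrite (eq_bigr _ (fun j _ => detE j)) (bigD1 ord0)//= [X in _ + X]big1 ?addr0.
 congr (_ * _); rewrite -[RHS]det_tr; congr (\det _).
 by apply/matrixP => i a; rewrite !mxE; case:eqP => // ->.
move=>j j0; rewrite (@determinant_alternate _ _ _ ord0 j) ?mulr0//; first by rewrite eq_sym.
by move=>a; rewrite [LHS]mxE [RHS]mxE eqxx (negPf j0).
Qed.
End Deg2.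

(** * Contradiction between opposite local degrees *)

Section DegreeContra.
Context {R : realType}.

Lemma diff_dir (V : normedModType R) (f : V -> R) y v q : differentiable f y ->
 (forall s : R, f (s *: v + y) = f y + s * q) -> 'd f y v = q.
move=>df H; have w0 : 0 < `|v| + 1 by rewrite ltr_wpDl.
suff E e : 0 < e -> `|q - 'd f y v| <= 0 + e.
 have : `|q - 'd f y v| <= 0 by apply/ler_addgt0Pr => e /E.
 by rewrite normr_le0 subr_eq0 => /eqP.
move=>e0; have e1 : 0 < e / (`|v| + 1) by rewrite divr_gt0.
have /nbhs_ballE[r r0 Hr] := diff_eps df e1.
pose s := r / 2 / (`|v| + 1); have s0 : 0 < s by rewrite !divr_gt0.
have sv : `|s *: v| < r.
 rewrite normrZ gtr0_norm// /s mulrAC ltr_pdivrMr//.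
 apply:(@le_lt_trans _ _ (r / 2 * (`|v| + 1))); first by rewrite ler_pM2l ?divr_gt0// lerDl.
 by rewrite ltr_pM2r// ltr_pdivrMr// ltr_pMr// ltr1n.
have := Hr (s *: v); rewrite subr0 => /(_ sv).
have -> : f (s *: v + y) - f y - 'd f y (s *: v) = s * (q - 'd f y v).
 have -> : 'd f y (s *: v) = s * 'd f y v by exact:linearZ.
 by rewrite H; ring.
rewrite normrM (gtr0_norm s0) normrZ (gtr0_norm s0) => h.
rewrite add0r -(ler_pM2l s0) (le_trans h)// mulrCA ler_pM2l// mulrAC ler_pdivrMr//.
by rewrite ler_pM2l// lerDl.
Qed.

(** A smooth step in coordinate 0 times bumps in the other coordinates. Its derivative in direction
    0 is a bump supported near c, although [Phi] itself does not vanish past c in that direction. *)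
Lemma slab n (c : 'rV_n.+1) (e : R) : 0 < e -> exists Phi : 'rV_n.+1 -> R,
 [/\ smooth_on setT Phi, forall y, 0 <= 'd Phi y (delta_mx 0 ord0),
   0 < 'd Phi c (delta_mx 0 ord0) &
   forall y, 'd Phi y (delta_mx 0 ord0) != 0 -> `|y - c| < e].
move=>e0; have e20 : 0 < 2 * e by rewrite mulr_gt0.
have oT : open [set: 'rV[R]_n.+1] := openT.
pose l (y : 'rV_n.+1) := (y 0 ord0 - (c 0 ord0 - e)) * (2 * e)^-1.
pose B (y : 'rV_n.+1) := \prod_(j | j != ord0) flat 0 (e ^+ 2 - (y 0 j - c 0 j) ^+ 2).
have ce j : smooth_on setT (fun y : 'rV[R]_n.+1 => y 0 j).
 by move=>k; apply:Ck_entry.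
have sl : smooth_on setT l.
 by move=>k; apply:CkM => //; apply:CkB => //; exact:ce.
have sB : smooth_on setT B.
 move=>k; apply:Ck_prod => // j _.
 apply:(@Ck_comp _ _ _ _ _ setT setT (fun y : 'rV_n.+1 => e ^+ 2 - (y 0 j - c 0 j) ^+ 2) (flat 0)) => //.
 - apply:CkB => //.
  by apply:CkM => //; apply:CkB => //; by [exact:ce|exact:Ck_cst].
 - exact:flat_smooth.
have ssl : smooth_on setT (fun y => st (l y)).
 move=>k; apply:(@Ck_comp _ _ _ _ _ setT setT l st) => //.
 - exact:st_smooth.
have dl y : differentiable l y by have [+ _] := sl 1; apply.
have dB y : differentiable B y by have [+ _] := sB 1; apply.
have dsl y : differentiable (fun y => st (l y)) y by have [+ _] := ssl 1; apply.
have B0 y : 0 <= B y by apply:prodr_ge0 => j _; exact:flat_ge0.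
have E y : 'd (fun y => st (l y) * B y) y (delta_mx 0 ord0) =
  B y * 'd st (l y) (2 * e)^-1.
 have [_ ->] := diff_mul (delta_mx 0 ord0) (dsl y) (dB y).
 rewrite (@diff_dir _ B y _ 0 (dB y)) ?mulr0 ?add0r; last first.
  move=>s; rewrite mulr0 addr0; apply:eq_bigr => j j0.
  by rewrite !mxE eqxx (negPf j0) mulr0 add0r.
 congr (_ * _); have [_ [dst _ _ _ _]] := st_diff (l y).
 have H0 : \forall z \near y, st (l z) = st (l z) by exact:filterE.
 have E1 := @diff_near_comp R _ _ _ l st (fun y => st (l y)) y (l y) erefl H0 (dl y) dst (delta_mx 0 ord0).
 apply:etrans E1 _; congr ('d st (l y) _); apply:diff_dir => //.
 by move=>s; rewrite /l !mxE !eqxx mulr1; ring.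
have pos y : exists s, ('d (fun y => st (l y) * B y) y (delta_mx 0 ord0) = B y * ((2 * e)^-1 * s) /\
  0 <= s /\ (0 < l y < 1 -> 0 < s) /\ (~~ (0 < l y < 1) -> s = 0)).
 have [s [_ sE s0 s1 s2]] := st_diff (l y); exists s; split => //.
 by rewrite E sE.
exists (fun y => st (l y) * B y); split.
- by move=>k; apply:CkM.
- move=>y; have [s [-> [s0 _]]] := pos y.
 by rewrite mulr_ge0// mulr_ge0// invr_ge0 ltW.
- have [s [-> [_ [s1 _]]]] := pos c.
 have lc : l c = 2^-1.
  by rewrite /l; field; rewrite gt_eqF.
 rewrite mulr_gt0//.
  by apply:prodr_gt0 => j _; rewrite flat0_gt0 subrr expr0n /= subr0 exprn_gt0.
 by rewrite mulr_gt0 ?invr_gt0// s1// lc invr_gt0 invf_lt1 ?ltr0n// ltr1n.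
- move=>y; have [s [-> [s0 [_ s2]]]] := pos y.
 rewrite mulf_eq0 negb_or => /andP[By]; rewrite mulf_eq0 negb_or => /andP[_ sn].
 have ly : 0 < l y < 1 by apply:contraNT sn => /s2 ->.
 rewrite -bump_gt0//; apply:prodr_gt0 => j _; rewrite flat0_gt0.
 have [->|j0] := eqVneq j ord0; last first.
  have : flat 0 (e ^+ 2 - (y 0 j - c 0 j) ^+ 2) != 0.
   by apply:contraNneq By => H; rewrite /B (bigD1 j)//= H mul0r.
  by rewrite -flat0_gt0 lt_def flat_ge0 andbT.
 move: ly; rewrite /l ltr_pdivlMr// mul0r ltr_pdivrMr// mul1r => /andP[l1 l2].
 set a := y 0 ord0 in l1 l2 *; set b := c 0 ord0 in l1 l2 *.
 have -> : e ^+ 2 - (a - b) ^+ 2 = (e - (a - b)) * (e + (a - b)) by ring.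
 by rewrite mulr_gt0//; lra.
Qed.
Section Contra.
Variable n : nat.
Local Notation E1n := 'rV[R]_n.+1.
Variables (U K : set E1n) (S S' : E1n -> E1n).
Variables (z0 : E1n) (r : R).
Hypotheses (oU : open U) (cK : compact K) (KU : K `<=` U).
Hypotheses (cS : forall x, U x -> {for x, continuous S}) (cS' : forall x, U x -> {for x, continuous S'}).
Hypothesis SS' : forall x, U x -> ~ K x -> S x = S' x.
Hypothesis S0 : forall x, U x -> S x = 0 -> x = z0.
Hypothesis S0' : forall x, U x -> S' x = 0 -> x = z0.
Hypotheses (Sz0 : S z0 = 0) (r0 : 0 < r).
Let Br (s : R) := [set x : E1n | `|x - z0| < s].
Let Bc (s : R) := [set x : E1n | `|x - z0| <= s].
Hypotheses (rU : Br r `<=` U) (sS : smooth_on (Br r) S) (sS' : smooth_on (Br r) S').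
Hypothesis dS : forall x, Br r x -> 0 <= \det (jac S x).
Hypothesis dS' : forall x, Br r x -> \det (jac S' x) <= 0.
Hypothesis dSpos : forall e : R, 0 < e -> exists2 x, Br e x & 0 < \det (jac S x).
Let r4 : 0 < r / 4. Proof. by rewrite divr_gt0. Qed.
Let r2 : 0 < r / 2. Proof. by rewrite divr_gt0. Qed.

(** Smooth replacements T and T' of S and S' that keep three features: they agree off a compact set,
    they are unchanged near z0 where the signs of the Jacobians are known, and they are uniformly
    close to the originals. *)
Lemma deg_smoothing : exists K2 K3 : set E1n,
 [/\ compact K2 /\ K2 `<=` U, compact K3 /\ K3 `<=` K2, forall x, Br (r / 4) x -> K3 x &
 forall e : R, 0 < e -> exists (Q2 : set E1n) (T T' : E1n -> E1n),
 [/\ open Q2 /\ K2 `<=` Q2, smooth_on Q2 T /\ smooth_on Q2 T',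
   forall x, Q2 x -> ~ K3 x -> T x = T' x,
   forall x, Br (r / 4) x -> T x = S x /\ T' x = S' x &
   forall x, K2 x -> `|T x - S x| <= e /\ `|T' x - S' x| <= e + e]].
have [th [K1 [sth th01 [V oV [KV thV]] [cK1 K1U] thK1]]] := cutoff cK oU KU.
have cB4 : compact (Bc (r / 4)) by exact:cball_compact.
have B42 : Bc (r / 4) `<=` Br (r / 2).
 by move=>x /= h; rewrite /Br /= (le_lt_trans h)// ltr_pM2l// ltf_pV2 ?posrE// ltr_nat.
have [ch [C [sch ch01 [V' oV' [BV chV]] [cC CB] chC]]] := cutoff cB4 (@open_ball R _ z0 (r / 2)) B42.
have B2U x : Bc (r / 2) x -> U x.
 by move=>h; apply:rU; rewrite /Br /= (le_lt_trans h)// ltr_pdivrMr// ltr_pMr// ltr1n.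
have CBr : C `<=` Br r.
 by move=>x /CB h; rewrite /Br /= (lt_trans h)// ltr_pdivrMr// ltr_pMr// ltr1n.
have clC : closed C by apply:compact_closed => //; exact:norm_hausdorff.
have c4 x : Br (r / 4) x -> ch x = 1 by move=>h; apply/chV/BV/ltW.
exists (K1 `|` Bc (r / 2)), (K1 `|` C); split.
- split; first by apply:compactU => //; exact:cball_compact.
 by move=>x [/K1U|/B2U].
- split; first exact:compactU.
 by move=>x [h|/CB /ltW h]; [left|right].
- move=>x /c4 h; right; apply:contrapT => /chC h'.
 by move: h; rewrite h' => /eqP; rewrite eq_sym oner_eq0.
move=>e e0; set K2 := K1 `|` Bc (r / 2).
have cK2 : compact K2 by apply:compactU => //; exact:cball_compact.
have K2U x : K2 x -> U x by move=> [/K1U|/B2U].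
have [Q1 [T0 [oQ1 K2Q1 sT0 T0e]]] := smooth_approx cK2 (fun x h => cS (K2U x h)) e0.
have cD x : K2 x -> {for x, continuous (fun x => S' x - S x)}.
 by move=> /K2U h; exact:(cvgB (cS' h) (cS h)).
have [Q3 [D0 [oQ3 K2Q3 sD0 D0e]]] := smooth_approx cK2 cD e0.
have oO : open (Q1 `&` Q3) by exact:openI.
(* [T0] approximates S and [D0] approximates S' - S. The cutoff [th] is 1 near K and removes the
   difference farther out; [ch] restores the exact maps near z0. The double error in T' comes from
   using both approximations. *)
exists (Q1 `&` Q3), (fun x => T0 x + ch x *: (S x - T0 x)),
 (fun x => T0 x + th x *: D0 x + ch x *: (S' x - T0 x - th x *: D0 x)).
have oB : open (Br r) by exact:open_ball.
have oOB : open (Q1 `&` Q3 `&` Br r) by exact:openI.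
have sT0' A : A `<=` Q1 -> smooth_on A T0.
 by move=>h k; exact:Ck_sub (sT0 k).
have sD0' A : open A -> A `<=` Q3 -> smooth_on A (fun x => th x *: D0 x).
 move=>oA h k; apply:CkZ => //; last exact:Ck_sub (sD0 k).
 exact:Ck_sub (sth k).
have cut G : smooth_on (Q1 `&` Q3 `&` Br r) G ->
  smooth_on (Q1 `&` Q3) (fun x => ch x *: G x).
 move=>sG k; apply:Ck_loc => x Ox; have [Cx|nCx] := pselect (C x).
  exists (Q1 `&` Q3 `&` Br r); split; first by split => //; exact:CBr.
  by apply:CkZ => //; exact:Ck_sub (sch k).
 exists (~` C); split => //; apply:Ck_ext.
 - exact:closed_openC.
 - by move=>y /chC ->; rewrite scale0r.
 - exact:Ck_cst.
split.
- by split => // x h; split; [exact:K2Q1|exact:K2Q3].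
- split => k.
  apply:CkD => //; first exact:sT0' => x [].
  apply:cut => j; apply:CkB => //; last by apply:sT0' => x [[]].
  exact:Ck_sub (sS j) => x [].
 apply:CkD => //.
  apply:CkD => //; first exact:sT0' => x [].
  exact:sD0' => // x [].
 apply:cut => j; apply:CkB => //; last by apply:sD0' => // x [[]].
 apply:CkB => //; last by apply:sT0' => x [[]].
 exact:Ck_sub (sS' j) => x [].
- move=>x _ nx; rewrite thK1 ?chC ?scale0r ?addr0//.
  by move=>h; apply:nx; right.
 by move=>h; apply:nx; left.
- move=>x /c4 ->; rewrite !scale1r; split; apply/rowP => j; rewrite !mxE; ring.
- move=>x Kx; have /andP[c0 c1] := ch01 x; have /andP[t0 t1] := th01 x.
 have c1' : 0 <= 1 - ch x by rewrite subr_ge0.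
 have c1'' : 1 - ch x <= 1 by rewrite lerBlDr lerDl.
 have T0x := T0e x Kx.
 have cutn a b : 0 <= b -> `|a| <= b -> `|(1 - ch x) *: a| <= b.
  move=>b0 ab; rewrite normrZ ger0_norm//; apply:le_trans ab.
  by rewrite ler_piMl.
 split.
  have -> : T0 x + ch x *: (S x - T0 x) - S x = (1 - ch x) *: (T0 x - S x).
   by apply/rowP => j; rewrite !mxE; ring.
  by apply:cutn => //; exact:ltW.
 have -> : T0 x + th x *: D0 x + ch x *: (S' x - T0 x - th x *: D0 x) - S' x =
   (1 - ch x) *: ((T0 x - S x) + (th x *: D0 x - (S' x - S x))).
  by apply/rowP => j; rewrite !mxE; ring.
 apply:cutn; first by rewrite addr_ge0 ?ltW.
 apply:le_trans (ler_normD _ _) _; apply:lerD => //.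
 have Dx := D0e x Kx; have [KKx|nKx] := pselect (K x).
  by rewrite (thV x (KV x KKx)) scale1r.
 have Ux := K2U x Kx; move: Dx; rewrite SS'// subrr !subr0 => Dx.
 by rewrite normrZ ger0_norm// (le_trans _ Dx)// ler_piMl.
Qed.

Lemma jac_near (T T' : E1n -> E1n) y : (\forall z \near y, T z = T' z) ->
 differentiable T' y -> jac T y = jac T' y.
move=>h d; have [_ E] := near_eq_is_diff h d.
apply/matrixP => i j; apply:etrans (jac_entry _ _ _ _) (etrans _ (esym (jac_entry _ _ _ _))).
exact:(congr1 (fun G : E1n -> E1n => G (delta_mx 0 i) 0 j) E).
Qed.

(** The degrees of S and S' over a small value would be equal as the maps agree off K, but they are
    counted at z0 with opposite signs. The sum [f] is the difference of the two pulled back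
    densities; it is the divergence of a field supported where T and T' differ, it is nonnegative,
    and it is positive at [x1]. *)
Theorem degree_contra : False.
have aux0 (a b d1 d2 : R) : a = 0 -> b = 0 -> 0 <= a * d1 - b * d2.
 by move=> -> ->; rewrite !mul0r subrr.
have [K2 [K3 [[cK2 K2U] [cK3 K32] B4 H]]] := deg_smoothing.
pose KK := K2 `&` ~` Br (r / 4).
have cKK : compact KK.
 by apply:compact_closedI => //; apply:open_closedC; exact:open_ball.
have KKz x : KK x -> x <> z0.
 by move=> [_ nB] xz; apply:nB; rewrite /Br /= xz subrr normr0.
have [h1 h10 Hh1] : exists2 e : R, 0 < e & forall x, KK x -> e < `|S x|.
 apply:pos_lower => // x Kx; have Ux := K2U _ Kx.1.
  exact:(cvg_norm (cS Ux)).
 by rewrite normr_gt0; apply/eqP => Sx; apply:KKz Kx (S0 Ux Sx).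
have [h2 h20 Hh2] : exists2 e : R, 0 < e & forall x, KK x -> e < `|S' x|.
 apply:pos_lower => // x Kx; have Ux := K2U _ Kx.1.
  exact:(cvg_norm (cS' Ux)).
 by rewrite normr_gt0; apply/eqP => Sx; apply:KKz Kx (S0' Ux Sx).
(* Away from z0 both maps have norm above eta. With a slab of radius eta/4 around a value of norm
   below eta/4, and errors of at most eta/4, the density [ph] vanishes on T and T' outside the small
   ball. *)
pose eta := Num.min h1 h2.
have eta0 : 0 < eta by rewrite lt_min h10.
have [Q2 [T [T' [[oO2 KO2] [sT sT'] TT' TS Terr]]]] := H (eta / 8) (divr_gt0 eta0 (ltr0n R 8)).
have Uz : U z0 by apply:rU; rewrite /Br /= subrr normr0.
have [x1 [x1B Sx1 dx1]] : exists x1, [/\ Br (r / 4) x1, `|S x1| < eta / 4 & 0 < \det (jac S x1)].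
 have e4 : 0 < eta / 4 by rewrite divr_gt0.
 have : \forall x \near z0, `|S x| < eta / 4.
  by apply:(cvgr_norm_lt _ (cS Uz)); rewrite Sz0 normr0.
 move=> /nbhs_ballE[rho rho0 Hrho].
 have mr : 0 < Num.min rho (r / 4) by rewrite lt_min rho0.
 have [x xB dx] := dSpos mr.
 move: xB; rewrite /Br /= lt_min => /andP[xr x4].
 by exists x; split => //; exact:Hrho.
have e4 : 0 < eta / 4 by rewrite divr_gt0.
have [Phi [sPhi Phi0 Phic Phis]] := @slab n (S x1) (eta / 4) e4.
pose A T (s : {perm 'I_n.+1}) y := (-1) ^+ s *
   (Phi (T y) * \prod_(i | i != ord0) jac T y (s i) i).
pose W s x := if `[< Q2 x >] then A T s x - A T' s x else 0.
have sA T1 s : smooth_on Q2 T1 -> Ck_on 1 Q2 (A T1 s).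
 move=>sT1; apply:CkM => //.
 apply:CkM => //.
  apply:(@Ck_comp _ _ _ _ _ _ setT T1 Phi) => //.
  - exact:has_basis_mx.
 apply:Ck_prod => // i _; apply:Ck_entry => //; apply:Ck_jac => //; exact:sT1.
have clK3 : closed K3 by apply:compact_closed => //; exact:norm_hausdorff.
have oK3 : open (~` K3) by exact:closed_openC.
have W0 s x : ~ K3 x -> W s x = 0.
 move=>nK; rewrite /W; case:asboolP => // Ox.
 have TT : \forall y \near x, T y = T' y.
  have h : nbhs x (Q2 `&` ~` K3) by apply:open_nbhs_nbhs; split => //; exact:openI.
  by apply:filterS h => y [Oy nKy]; exact:TT'.
 have dT' : differentiable T' x by have [+ _] := sT' 1; apply.
 by rewrite /A (jac_near TT dT') TT'// subrr.
have sW s : Ck_on 1 setT (W s).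
 apply:Ck_loc => x _; have [Ox|nOx] := pselect (Q2 x).
  exists Q2; split => //; apply:(@Ck_ext _ _ _ _ _ _ (fun y => A T s y - A T' s y)) => //.
   by move=>y Oy; rewrite /W asboolT.
  by apply:CkB => //; exact:sA.
 exists (~` K3); split; first by move=> /K32 /KO2.
 by apply:(@Ck_ext _ _ _ _ _ _ (cst 0)) => //; exact:W0.
pose f x := \sum_s 'd (W s) x (delta_mx 0 (s ord0)).
pose ph y := 'd Phi y (delta_mx 0 ord0).
have fE x : Q2 x -> f x = ph (T x) * \det (jac T x) - ph (T' x) * \det (jac T' x).
 move=>Ox; apply:etrans _ (congr2 (fun a b : R => a - b) (det_div oO2 sT (sPhi 1) Ox)
  (det_div oO2 sT' (sPhi 1) Ox)).
 apply:etrans _ (sumrB _ _ _ _); apply:eq_bigr => s _.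
 have dA : differentiable (A T s) x by have [+ _] := sA _ s sT; apply.
 have dA' : differentiable (A T' s) x by have [+ _] := sA _ s sT'; apply.
 have h : \forall y \near x, W s y = (A T s - A T' s) y.
  by apply:filterS (open_nbhs_nbhs (conj oO2 Ox)) => y Oy; rewrite /W asboolT.
 have [_ E] := near_eq_is_diff h (differentiableB dA dA').
 apply:etrans (congr1 (fun F : E1n -> R => F (delta_mx 0 (s ord0))) E) _.
 exact:(congr1 (fun F : E1n -> R => F (delta_mx 0 (s ord0))) (diffB dA dA')).
have B4E x : Br (r / 4) x -> [/\ T x = S x, T' x = S' x, jac T x = jac S x & jac T' x = jac S' x].
 move=>Bx; have [-> ->] := TS x Bx.
 have Brx : Br r x.
  by move: Bx; rewrite /Br /= => h; rewrite (lt_trans h)// ltr_pdivrMr// ltr_pMr// ltr1n.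
 have h : nbhs x (Br (r / 4)) by apply:open_nbhs_nbhs; split => //; exact:open_ball.
 split; [exact:erefl|exact:erefl|apply:jac_near|apply:jac_near].
 - by apply:filterS h => y /TS[].
 - by have [+ _] := sS 1; apply.
 - by apply:filterS h => y /TS[].
 - by have [+ _] := sS' 1; apply.
have Brr x : Br (r / 4) x -> Br r x.
 by rewrite /Br /= => h; rewrite (lt_trans h)// ltr_pdivrMr// ltr_pMr// ltr1n.
have phfar (v a : E1n) : `|a - v| <= eta / 4 -> eta < `|v| -> ph a = 0.
 move=>h1' h2'; apply/eqP/negPn/negP => /Phis h3'.
 have : `|v| <= `|a - v| + (`|a - S x1| + `|S x1|).
  have vE : v = - (a - v) + ((a - S x1) + S x1) by apply/rowP => j; rewrite !mxE; ring.
  rewrite {1}vE (le_trans (ler_normD _ _))// normrN lerD//; exact:ler_normD.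
 move=>h4'; lra.
have ph0 y : 0 <= ph y by exact:Phi0.
have phc : 0 < ph (S x1) by exact:Phic.
clearbody ph.
have f0 x : 0 <= f x.
 have [Kx|nKx] := pselect (K3 x); last first.
  rewrite /f big1// => s _.
  have h : \forall y \near x, W s y = cst 0 y.
   by apply:filterS (open_nbhs_nbhs (conj oK3 nKx)) => y; exact:W0.
  have [_ E] := near_eq_is_diff h (differentiable_cst 0 x).
  apply:etrans (congr1 (fun F : E1n -> R => F (delta_mx 0 (s ord0))) E) _.
  exact:(congr1 (fun F : E1n -> R => F (delta_mx 0 (s ord0))) (diff_cst 0 x)).
 rewrite fE; last exact/KO2/K32.
 have [Bx|nBx] := pselect (Br (r / 4) x).
  have [-> -> -> ->] := B4E x Bx.
  by rewrite subr_ge0 (@le_trans _ _ 0)// ?mulr_ge0_le0 ?mulr_ge0 ?dS ?dS'//; exact:Brr.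
 have KKx : KK x by split => //; exact:K32.
 have [e1 e2] := Terr x (K32 x Kx).
 have p1 : ph (T x) = 0.
  apply:(phfar (S x)); first by rewrite (le_trans e1)//; lra.
  by rewrite (le_lt_trans _ (Hh1 x KKx))// ge_min lexx.
 have p2 : ph (T' x) = 0.
  apply:(phfar (S' x)); first by rewrite (le_trans e2)//; lra.
  by rewrite (le_lt_trans _ (Hh2 x KKx))// ge_min lexx orbT.
 exact:aux0.
have [L L0 HL] := compact_bound cK3 (fun x _ => (@cvg_id _ (nbhs x) : {for x, continuous id})).
have f1 : f x1 = 0.
 apply:(@div_zero R n.+1 _ W (fun s => s ord0) (L + 1)) => //; first by rewrite ltr_wpDr.
 move=>s x Lx; apply:W0 => /HL; rewrite leNgt => /negP; apply.
 by rewrite (lt_le_trans _ Lx)// ltrDl.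
move: f1; rewrite fE; last exact/KO2/K32/B4.
have [-> -> -> ->] := B4E x1 x1B.
apply/eqP; rewrite gt_eqF// ltr_wpDr ?mulr_gt0// oppr_ge0 mulr_ge0_le0//.
by apply:dS'; exact:Brr.
Qed.
End Contra.
End DegreeContra.

(** * Continuity rules on a whole space *)

Section Cont.
Context {R : realType} {T : topologicalType}.

Lemma cont_cst (W : topologicalType) (a : W) : continuous (fun _ : T => a).
by move=>x; exact:cvg_cst. Qed.

Lemma cont_pair (U V : topologicalType) (f : T -> U) (g : T -> V) :
 continuous f -> continuous g -> continuous (fun x => (f x, g x)).
by move=>cf cg x; exact:(cvg_pair (cf x) (cg x)). Qed.
Section Normed.
Variable (V : normedModType R).
Implicit Types (f g : T -> V) (a b : T -> R).

Lemma contD f g : continuous f -> continuous g -> continuous (fun x => f x + g x).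
by move=>cf cg x; exact:(cvgD (cf x) (cg x)). Qed.
Lemma contB f g : continuous f -> continuous g -> continuous (fun x => f x - g x).
by move=>cf cg x; exact:(cvgB (cf x) (cg x)). Qed.
Lemma contN f : continuous f -> continuous (fun x => - f x).
by move=>cf x; exact:(cvgN (cf x)). Qed.
Lemma contZ a f : continuous a -> continuous f -> continuous (fun x => a x *: f x).
by move=>ca cf x; exact:(cvgZ (ca x) (cf x)). Qed.
Lemma cont_norm f : continuous f -> continuous (fun x => `|f x|).
by move=>cf x; exact:(cvg_norm (cf x)). Qed.

Lemma cont_sum (I : eqType) (s : seq I) (F : I -> T -> V) :
 (forall i, i \in s -> continuous (F i)) -> continuous (fun x => \sum_(i <- s) F i x).
move=>cF; elim:s cF => [|i s IH] cF.
 by rewrite (_ : (fun x => _) = fun _ => 0); [exact:cont_cst|apply/funext => x; rewrite big_nil].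
rewrite (_ : (fun x => _) = fun x => F i x + \sum_(j <- s) F j x).
 apply:contD; first by apply:cF; rewrite mem_head.
 by apply:IH => j js; apply:cF; rewrite in_cons js orbT.
by apply/funext => x; rewrite big_cons.
Qed.
End Normed.

Implicit Types (a b : T -> R).
Lemma contM a b : continuous a -> continuous b -> continuous (fun x => a x * b x).
by move=>ca cb x; exact:(cvgM (ca x) (cb x)). Qed.
Lemma contV a : (forall x, a x != 0) -> continuous a -> continuous (fun x => (a x)^-1).
by move=>a0 ca x; exact:(cvgV (a0 x) (ca x)). Qed.
Lemma cont_min a b : continuous a -> continuous b -> continuous (fun x => Num.min (a x) (b x)).
by move=>ca cb x; exact:(continuous_min (ca x) (cb x)). Qed.
Lemma cont_max a b : continuous a -> continuous b -> continuous (fun x => Num.max (a x) (b x)).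
by move=>ca cb x; exact:(continuous_max (ca x) (cb x)). Qed.
Lemma cont_clamp a : continuous a -> continuous (fun x => clamp (a x)).
by move=>ca; exact:(compc ca (@clamp_cont R)). Qed.

Lemma cont_mulmx m n p (A : T -> 'M[R]_(m, n)) (B : T -> 'M[R]_(n, p)) :
 continuous A -> continuous B -> continuous (fun x => A x *m B x).
by move=>cA cB x; exact:(cvg_mulmx (cA x) (cB x)). Qed.

Lemma cont_trmx m n (A : T -> 'M[R]_(m, n)) :
 continuous A -> continuous (fun x => (A x)^T).
by move=>cA x; exact:(cvg_trmx (cA x)). Qed.

Lemma cont_row_mx m n p (A : T -> 'M[R]_(m, n)) (B : T -> 'M[R]_(m, p)) :
 continuous A -> continuous B -> continuous (fun x => row_mx (A x) (B x)).
by move=>cA cB x; exact:(cvg_row_mx (cA x) (cB x)). Qed.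

Lemma cont_col_mx m n p (A : T -> 'M[R]_(m, n)) (B : T -> 'M[R]_(p, n)) :
 continuous A -> continuous B -> continuous (fun x => col_mx (A x) (B x)).
by move=>cA cB x; exact:(cvg_col_mx (cA x) (cB x)). Qed.

Lemma cont_coord m n (A : T -> 'M[R]_(m, n)) i j :
 continuous A -> continuous (fun x => A x i j).
by move=>cA x; apply:cvg_coord; exact:cA. Qed.

Lemma cont_mx m n (A : T -> 'M[R]_(m, n)) :
 (forall i j, continuous (fun x => A x i j)) -> continuous A.
by move=>cA x; apply:cvg_mx => i j; exact:cA. Qed.

Lemma cont_lsubmx m n p (A : T -> 'M[R]_(m, n + p)) :
 continuous A -> continuous (fun x => lsubmx (A x)).
move=>cA; apply:cont_mx => i j.
rewrite (_ : (fun x => _) = fun x => A x i (lshift p j)); first exact:cont_coord.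
by apply/funext => x; rewrite mxE.
Qed.

Lemma cont_rsubmx m n p (A : T -> 'M[R]_(m, n + p)) :
 continuous A -> continuous (fun x => rsubmx (A x)).
move=>cA; apply:cont_mx => i j.
rewrite (_ : (fun x => _) = fun x => A x i (rshift n j)); first exact:cont_coord.
by apply/funext => x; rewrite mxE.
Qed.

Lemma cont_scalar_mx n a : continuous a -> continuous (fun x => (a x)%:M : 'M[R]_n).
move=>ca; rewrite (_ : (fun x => _) = fun x => a x *: (1%:M : 'M[R]_n)).
 by apply:contZ => //; exact:cont_cst.
by apply/funext => x; rewrite scale_scalar_mx mulr1.
Qed.

Lemma cont_det n (A : T -> 'M[R]_n) : continuous A -> continuous (fun x => \det (A x)).
by move=>cA x; exact:(cvg_det (cA x)). Qed.

Lemma cont_invmx n (A : T -> 'M[R]_n) : (forall x, A x \in unitmx) ->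
 continuous A -> continuous (fun x => invmx (A x)).
by move=>uA cA x; exact:(cvg_invmx (uA x) (cA x)). Qed.

Lemma cont_snd (W S : topologicalType) (f : T -> W) : continuous f ->
 continuous (fun z : S * T => f z.2).
by move=>cf [s t]; exact:(@cvg_snd_comp S T W f s t (cf t)). Qed.

Lemma cont_fst (W S : topologicalType) (f : T -> W) : continuous f ->
 continuous (fun z : T * S => f z.1).
by move=>cf [t s]; exact:(@cvg_fst_comp T S W f t s (cf t)). Qed.

Lemma cont_slice (W S : topologicalType) (f : S -> T -> W) (s : S) :
 continuous (fun z : S * T => f z.1 z.2) -> continuous (f s).
move=>cf; apply:(@compc _ _ _ (fun t : T => (s, t)) (fun z : S * T => f z.1 z.2)) => //.
by apply:cont_pair; [exact:cont_cst|move=>x; exact:cvg_id].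
Qed.

Lemma cont_id : continuous (fun x : T => x).
by move=>x; exact:cvg_id. Qed.
End Cont.

Lemma cont_comp2 (T U V W : topologicalType) (H : U -> V -> W) (f : T -> U) (g : T -> V) :
 continuous (fun z : U * V => H z.1 z.2) -> continuous f -> continuous g ->
 continuous (fun x => H (f x) (g x)).
move=>cH cf cg.
exact:(@compc _ _ _ (fun x => (f x, g x)) (fun z : U * V => H z.1 z.2) (cont_pair cf cg) cH).
Qed.

#[local] Hint Extern 0 (continuous_at _ _) => (exact:cont_cst || exact:cont_id) : core.

(** * Compactly supported maps into R^(1+m) minus 0 *)

Section Chomot.
Context {R : realType} {m : nat}.
Local Notation V := 'rV[R]_m.
Local Notation W := 'rV[R]_(1 + m).

(** The prescribed value far away: up to scaling, maps equal to [south] outside a ball are pointed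
    maps from the m-sphere to the m-sphere. *)
Definition south : W := row_mx (-1)%:M 0.

Lemma south_neq0 : south != 0.
apply/eqP => /(congr1 lsubmx); rewrite row_mxKl linear0 => /matrixP /(_ 0 0).
by rewrite !mxE eqxx => /eqP; rewrite oppr_eq0 oner_eq0.
Qed.

Definition csupp (k : V -> W) := exists2 r : R, 0 < r & forall x, r <= `|x| -> k x = south.

Definition chomot (k l : V -> W) := exists H : R -> V -> W,
 [/\ continuous (fun z : R * V => H z.1 z.2), forall t x, H t x != 0,
   forall x, H 0 x = k x, forall x, H 1 x = l x &
   exists2 r : R, 0 < r & forall t x, r <= `|x| -> H t x = south].

Lemma chomotI (k l : V -> W) (H : R -> V -> W) (r : R) :
 continuous (fun z : R * V => H z.1 z.2) -> (forall t x, 0 <= t <= 1 -> H t x != 0) ->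
 (forall x, H 0 x = k x) -> (forall x, H 1 x = l x) ->
 (forall t x, 0 <= t <= 1 -> r <= `|x| -> H t x = south) -> chomot k l.
move=>cH H0 Hk Hl Hr; exists (fun t x => H (clamp t) x); split.
- by apply:reparam_cont => //; exact:clamp_cont.
- by move=>t x; apply:H0; exact:clamp01.
- by move=>x; rewrite clamp_le0.
- by move=>x; rewrite clamp_ge1.
- exists (`|r| + 1); first by rewrite ltr_wpDl.
 move=>t x rx; apply:Hr; first exact:clamp01.
 by rewrite (le_trans _ rx)// (le_trans (ler_norm r))// lerDl.
Qed.

Lemma chomot_sym k l : chomot k l -> chomot l k.
move=> [H [cH H0 Hk Hl [r r0 Hr]]]; exists (fun t x => H (1 - t) x); split.
- apply:(@reparam_cont _ _ (fun t : R => 1 - t)) => // t.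
 exact:(cvgB (cvg_cst _) (@cvg_id _ (nbhs t))).
- by move=>t x; exact:H0.
- by move=>x; rewrite subr0.
- by move=>x; rewrite subrr.
- by exists r => // t x; exact:Hr.
Qed.

Lemma chomot_cont k l : chomot k l -> continuous l.
move=> [H [cH _ _ Hl _]].
by have -> : l = (fun x => H 1 x); [apply/funext => y; rewrite Hl|exact:cont_slice].
Qed.

Lemma chomot_trans l k p : chomot k l -> chomot l p -> chomot k p.
move=>kl lp; have cl := chomot_cont kl.
have [H [cH H0 Hk Hl [r r0 Hr]]] := kl; have [G [cG G0 Gl Gp [s s0 Gs]]] := lp.
have [t0 tl] : Num.max r s >= r /\ Num.max r s >= s by rewrite !le_max !lexx orbT.
apply:(@chomotI k p (fun t x => H (clamp (2 * t)) x + G (clamp (2 * t - 1)) x - l x) (Num.max r s)).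
- have c1 : continuous (fun z : R * V => clamp (2 * z.1)).
  by apply:cont_clamp; apply:contM => //; exact:cont_fst (@cont_id _).
 have c2 : continuous (fun z : R * V => clamp (2 * z.1 - 1)).
  apply:cont_clamp; apply:contB => //.
  by apply:contM => //; exact:cont_fst (@cont_id _).
 have cs : continuous (fun z : R * V => z.2) by exact:cont_snd (@cont_id _).
 apply:contB; last exact:cont_snd.
 by apply:contD; [exact:cont_comp2 cH c1 cs|exact:cont_comp2 cG c2 cs].
- move=>t x /andP[t0' t1']; have [th|th] := leP (2 * t) 1.
  rewrite (@clamp_le0 _ (2 * t - 1)) ?subr_le0// Gl addrK; exact:H0.
 rewrite (@clamp_ge1 _ (2 * t)) ?ltW// Hl [l x + _]addrC addrK; exact:G0.
- move=>x; rewrite mulr0 sub0r !clamp_le0//// Hk Gl addrK//.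
- move=>x; have e1 : clamp (2 * 1) = 1 :> R by apply:clamp_ge1; lra.
 have e2 : clamp (2 * 1 - 1) = 1 :> R by apply:clamp_ge1; lra.
 by rewrite e1 e2 Hl Gp [l x + _]addrC addrK.
- move=>t x _ rx; rewrite (Hr _ x (le_trans t0 rx)) (Gs _ x (le_trans tl rx)).
 by rewrite -(Hl x) (Hr _ x (le_trans t0 rx)) addrK.
Qed.

Lemma chomot_line k l : continuous k -> continuous l -> csupp k -> csupp l ->
 (forall x t, 0 <= t <= 1 -> (1 - t) *: k x + t *: l x != 0) -> chomot k l.
move=>ck cl [r r0 kr] [s s0 ls] H.
apply:(@chomotI k l (fun t x => (1 - t) *: k x + t *: l x) (Num.max r s)).
- have ct : continuous (fun z : R * V => z.1) by exact:cont_fst (@cont_id _).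
 apply:contD; apply:contZ; try exact:cont_snd; last exact:ct.
 exact:contB; exact:ct.
- by move=>t x; exact:H.
- by move=>x; rewrite subr0 scale1r scale0r addr0.
- by move=>x; rewrite subrr scale1r scale0r add0r.
- move=>t x _; rewrite ge_max => /andP[rx sx].
 by rewrite kr// ls// -scalerDl subrK scale1r.
Qed.

Lemma chomot_ext k k' l l' : k =1 k' -> l =1 l' -> chomot k l -> chomot k' l'.
by move=> /funext <- /funext <-. Qed.

Lemma chomot_lin (L : 'M[R]_m) k l : L \in unitmx -> chomot k l ->
 chomot (fun x => k (x *m L)) (fun x => l (x *m L)).
move=>uL [H [cH H0 Hk Hl [r r0 Hr]]]; exists (fun t x => H t (x *m L)); split.
- apply:(cont_comp2 cH); first exact:cont_fst (@cont_id _).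
 by apply:cont_mulmx => //; exact:cont_snd (@cont_id _).
- by move=>t x; exact:H0.
- by move=>x; exact:Hk.
- by move=>x; exact:Hl.
- have C0 : 0 < m%:R * `|invmx L| + 1 by rewrite ltr_wpDl// mulr_ge0.
 exists ((m%:R * `|invmx L| + 1) * r); first by rewrite mulr_gt0.
 move=>t x rx; apply:Hr; rewrite -(ler_pM2l C0) (le_trans rx)//.
 have -> : `|x| = `|x *m L *m invmx L| by rewrite mulmxK.
 rewrite (le_trans (norm_mulmx _ _))// mulrDl mul1r mulrCA mulrC -mulrA.
 by rewrite mulrCA lerDl.
Qed.

Definition hq (w : W) : R := lsubmx w 0 0.
Lemma hqE (w : W) : w = row_mx (hq w)%:M (rsubmx w).
by rewrite -{1}[w]hsubmxK; congr row_mx; rewrite /hq -mx11_scalar. Qed.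

Lemma row_eq0 (a : R) (v : V) : (row_mx a%:M v == 0) = (a == 0) && (v == 0).
apply/eqP/andP => [h|[/eqP -> /eqP ->]]; last by rewrite raddf0 row_mx0.
split; apply/eqP; last by rewrite -[v](row_mxKr (a%:M : 'M[R]_1)) h linear0.
have := congr1 lsubmx h; rewrite row_mxKl linear0 => /matrixP /(_ 0 0).
by rewrite !mxE eqxx mulr1n.
Qed.

Definition be (s : R) : R := Num.max (-1) (Num.min 1 (3 - 2 * s)).
Definition ta (s : R) : R := clamp (2 - s).

Lemma be_cont : continuous be.
apply:cont_max => //.
apply:cont_min => //.
apply:contB => //.
exact:contM.
Qed.

Lemma ta_cont : continuous ta.
by apply:cont_clamp; apply:contB. Qed.

Lemma be1 s : s <= 1 -> be s = 1.
by move=>s1; rewrite /be min_l ?max_r//; lra. Qed.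
Lemma be2 s : 2 <= s -> be s = -1.
by move=>s2; rewrite /be min_r ?max_l//; lra. Qed.
Lemma ta1 s : s <= 1 -> ta s = 1.
by move=>s1; rewrite /ta clamp_ge1//; lra. Qed.
Lemma ta2 s : 2 <= s -> ta s = 0.
by move=>s2; rewrite /ta clamp_le0//; lra. Qed.
Lemma ta_gt0 s : s < 2 -> 0 < ta s.
move=>s2; have [s1|s1] := leP s 1; first by rewrite ta1.
by rewrite /ta clampE; [lra|apply/andP; split; lra].
Qed.

(** Collapse around z, as in the Pontryagin construction: (1, P x) on the ball of radius d, [south]
    beyond 2 d, so only zeros of P within the ball lie over the positive first axis. *)
Definition Eb (z : V) (d : R) (P : V -> V) (x : V) : W :=
 row_mx (be (`|x - z| / d))%:M (ta (`|x - z| / d) *: P x).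
Lemma Eb_far z d P x : 0 < d -> 2 * d <= `|x - z| -> Eb z d P x = south.
by move=>d0 h; rewrite /Eb be2 ?ta2 ?scale0r// ler_pdivlMr. Qed.
Lemma Eb_near z d P x : 0 < d -> `|x - z| <= d -> Eb z d P x = row_mx 1%:M (P x).
by move=>d0 h; rewrite /Eb be1 ?ta1 ?scale1r// ler_pdivrMr// mul1r. Qed.

Lemma Eb_neq0 z d P x : 0 < d ->
 (d <= `|x - z| -> `|x - z| < 2 * d -> P x != 0) -> Eb z d P x != 0.
move=>d0 h; have [h1|h1] := leP `|x - z| d.
 by rewrite Eb_near// row_eq0 oner_eq0.
have [h2|h2] := leP (2 * d) `|x - z|; first by rewrite Eb_far// south_neq0.
have t0 : ta (`|x - z| / d) != 0 by rewrite gt_eqF// ta_gt0// ltr_pdivrMr.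
by rewrite row_eq0 scaler_eq0 (negPf t0) (negPf (h (ltW h1) h2)) andbF.
Qed.

Lemma Eb_cont z d (P : R -> V -> V) : continuous (fun w : R * V => P w.1 w.2) ->
 continuous (fun w : R * V => Eb z d (P w.1) w.2).
move=>cP.
have cd : continuous (fun w : R * V => `|w.2 - z| / d).
 apply:contM => //.
 apply:cont_norm; apply:contB => //.
 exact:cont_snd (@cont_id _).
apply:cont_row_mx; first by apply:cont_scalar_mx; exact:compc cd be_cont.
by apply:contZ => //; exact:compc cd ta_cont.
Qed.

Definition Em (zs : seq V) (d : R) (P : V -> V -> V) (x : V) : W :=
 south + \sum_(z <- zs) (Eb z d (P z) x - south).
Definition sep (zs : seq V) (d : R) :=
 uniq zs /\ forall z z', z \in zs -> z' \in zs -> z != z' -> 4 * d <= `|z - z'|.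

Lemma sep_near zs d z z' x : sep zs d -> z \in zs -> z' \in zs -> z' != z ->
 `|x - z| < 2 * d -> 2 * d <= `|x - z'|.
move=> [_ h] zz zz' zz'n xz; have h1 := h z' z zz' zz zz'n.
have h2 : `|z' - z| <= `|x - z| + `|x - z'|.
 have -> : z' - z = (x - z) - (x - z') by apply/rowP => j; rewrite !mxE; ring.
 exact:ler_normB.
lra.
Qed.

Lemma Em_near zs d P z x : 0 < d -> sep zs d -> z \in zs -> `|x - z| < 2 * d ->
 Em zs d P x = Eb z d (P z) x.
move=>d0 sz zz xz; rewrite /Em (bigD1_seq z)//=; last by case:sz.
rewrite big_seq_cond big1 ?addr0; first by rewrite addrC subrK.
move=>z' /andP[zz' z'z]; rewrite Eb_far ?subrr//.
exact:sep_near sz zz zz' z'z xz.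
Qed.

Lemma Em_far zs d P x : 0 < d -> (forall z, z \in zs -> 2 * d <= `|x - z|) ->
 Em zs d P x = south.
move=>d0 h; rewrite /Em big_seq big1 ?addr0// => z zz.
by rewrite Eb_far ?subrr//; exact:h.
Qed.

Lemma Em_case (zs : seq V) (d : R) (x : V) : (exists2 z, z \in zs & `|x - z| < 2 * d) \/
 (forall z, z \in zs -> 2 * d <= `|x - z|).
have [h|h] := pselect (exists2 z, z \in zs & `|x - z| < 2 * d); [by left|right].
by move=>z zz; rewrite leNgt; apply/negP => h'; apply:h; exists z.
Qed.

Lemma Em_homot zs d (P : R -> V -> V -> V) : 0 < d -> sep zs d ->
 (forall z, z \in zs -> continuous (fun w : R * V => P w.1 z w.2)) ->
 (forall t z x, 0 <= t <= 1 -> z \in zs -> d <= `|x - z| -> `|x - z| < 2 * d -> P t z x != 0) ->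
 chomot (Em zs d (P 0)) (Em zs d (P 1)).
move=>d0 sz cP nP.
apply:(@chomotI _ _ (fun t => Em zs d (P t)) (2 * d + \sum_(z <- zs) `|z|)) => //.
- apply:contD => //.
 apply:cont_sum => z zz; apply:contB => //.
 exact:(@Eb_cont z d (fun t => P t z) (cP z zz)).
- move=>t x t01; have [[z zz xz]|h] := Em_case zs d x.
  rewrite (Em_near _ d0 sz zz xz); apply:Eb_neq0 => // h1 h2.
  exact:(nP t z x t01 zz h1 h2).
 by rewrite Em_far// south_neq0.
- move=>t x _ h; apply:Em_far => // z zz.
 have h1 : `|z| <= \sum_(z <- zs) `|z|.
  by rewrite (big_rem z)//= lerDl sumr_ge0.
 have h2 : `|x| <= `|x - z| + `|z| by rewrite -{1}[x](subrK z) ler_normD.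
 lra.
Qed.

(** The points mapped to the positive first axis, opposite to [south]; they play the role of the
    preimages of a regular value. *)
Definition zeros (k : V -> W) (zs : seq V) :=
 forall x, rsubmx (k x) = 0 -> 0 < hq (k x) -> x \in zs.

(** The segment meets 0 only where the vector parts vanish and the first coordinates have opposite
    signs or vanish. Near a centre both first coordinates are positive wherever that matters, and
    away from the centres k avoids the positive axis. *)
Lemma chomot_Em k zs d : continuous k -> csupp k -> (forall x, k x != 0) -> zeros k zs ->
 0 < d -> sep zs d ->
 (forall z x, z \in zs -> `|x - z| < 2 * d -> 0 < hq (k x)) ->
 chomot k (Em zs d (fun _ x => rsubmx (k x))).
move=>ck sk k0 zk d0 sz posk.
have ck' : continuous (fun x => rsubmx (k x)) by exact:cont_rsubmx.
have cP : continuous (fun w : R * V => (fun _ x => rsubmx (k x)) w.1 w.2).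
 exact:(@cont_snd _ _ R (fun x => rsubmx (k x)) ck').
apply:chomot_line => //.
- apply:contD => //.
 apply:cont_sum => z zz; apply:contB => //.
 exact:(@cont_slice V W R (fun _ => Eb z d (fun x => rsubmx (k x))) 0
  (@Eb_cont z d (fun _ x => rsubmx (k x)) cP)).
- exists (2 * d + \sum_(z <- zs) `|z|).
  by rewrite ltr_pwDl ?mulr_gt0// sumr_ge0.
 move=>x h; apply:Em_far => // z zz.
 have h1 : `|z| <= \sum_(z <- zs) `|z|.
  by rewrite (big_rem z)//= lerDl sumr_ge0.
 have h2 : `|x| <= `|x - z| + `|z| by rewrite -{1}[x](subrK z) ler_normD.
 lra.
move=>x t /andP[t0 t1].
have rowE (a b u : R) (v w : V) : (1 - u) *: row_mx a%:M v + u *: row_mx b%:M w =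
  row_mx ((1 - u) * a + u * b)%:M ((1 - u) *: v + u *: w).
 by rewrite !scale_row_mx add_row_mx !scale_scalar_mx raddfD.
have [[z zz xz]|h] := Em_case zs d x.
 rewrite (Em_near _ d0 sz zz xz) {1}[k x]hqE /Eb rowE row_eq0 scalerA -scalerDl.
 have kq := posk z x zz xz; apply/negP => /andP[/eqP h1].
 rewrite scaler_eq0 => /orP[/eqP h2|/eqP h2].
  have tt : 0 < ta (`|x - z| / d) by rewrite ta_gt0// ltr_pdivrMr.
  have [t10|t10] := eqVneq t 1; first by move: h2; rewrite t10; lra.
  have t1' : 0 < 1 - t by rewrite subr_gt0 lt_neqAle t10.
  have : 0 <= t * ta (`|x - z| / d) by rewrite mulr_ge0// ltW.
  lra.
 have xzs := zk x h2 kq.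
 have [xz0|xz0] := eqVneq x z; last first.
  have := sep_near sz zz xzs xz0 xz; rewrite subrr normr0; lra.
 move: h1; rewrite xz0 subrr normr0 mul0r be1// mulr1 => h1.
 rewrite xz0 in kq.
 have [t10|t10] := eqVneq t 1; first by move: h1; rewrite t10; lra.
 have t1' : 0 < 1 - t by rewrite subr_gt0 lt_neqAle t10.
 have : 0 < (1 - t) * hq (k z) by rewrite mulr_gt0.
 lra.
rewrite Em_far// {1}[k x]hqE /south rowE row_eq0; apply/negP => /andP[/eqP h1].
rewrite scaler0 addr0 scaler_eq0 => /orP[/eqP h2|/eqP h2].
 have t1' : t = 1 by lra.
 by move: h1; rewrite t1'; lra.
have kq : hq (k x) <= 0.
 rewrite leNgt; apply/negP => h3; have := h x (zk x h2 h3).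
 by rewrite subrr normr0 leNgt mulr_gt0.
have kq0 : hq (k x) != 0.
 by apply:contraNneq (k0 x) => h3; rewrite [k x]hqE h3 h2 raddf0 row_mx0.
have : (1 - t) * hq (k x) <= 0 by rewrite mulr_ge0_le0 ?subr_ge0.
have [t10|t10] := eqVneq t 0; first by move: h1; rewrite t10; lra.
lra.
Qed.

Definition ndeg (k : V -> W) z := differentiable (fun x => rsubmx (k x)) z /\
 jac (fun x => rsubmx (k x)) z \in unitmx.

Lemma unit_lower (A : 'M[R]_m) : A \in unitmx -> exists2 mu : R, 0 < mu & forall v : V, mu * `|v| <= `|v *m A|.
move=>uA; have C0 : 0 < m%:R * `|invmx A| + 1 by rewrite ltr_wpDl// mulr_ge0.
exists ((m%:R * `|invmx A| + 1)^-1); first by rewrite invr_gt0.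
move=>v; rewrite ler_pdivrMl//.
have -> : `|v| = `|v *m A *m invmx A| by rewrite mulmxK.
rewrite (le_trans (norm_mulmx _ _))// mulrDl mul1r mulrCA mulrC -mulrA.
by rewrite mulrCA lerDl.
Qed.

(** The lower bound mu of the invertible derivative beats the remainder mu / 2 of the linearisation,
    so the segment between the map and its linear part vanishes at z only. *)
Lemma local_lin (k : V -> W) (z : V) : continuous k -> ndeg k z -> 0 < hq (k z) ->
 \forall d \near (0 : R)^'+, forall x, `|x - z| < 2 * d -> 0 < hq (k x) /\
  (rsubmx (k z) = 0 -> x != z -> forall t, 0 <= t <= 1 ->
   (1 - t) *: rsubmx (k x) + t *: ((x - z) *m jac (fun x => rsubmx (k x)) z) != 0).
move=>ck [dk uA] kz; set A := jac _ z in uA *.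
have [mu mu0 Hmu] := unit_lower uA.
have cq : {for z, continuous (fun x => hq (k x))}.
 by apply:cont_coord; exact:cont_lsubmx.
have /nbhs_ballE[r1 r10 Hr1] : \forall x \near z, 0 < hq (k x) by exact:(cvgr_gt _ cq).
have mu2 : 0 < mu / 2 by rewrite divr_gt0.
have /nbhs_ballE[r2 r20 Hr2] := diff_eps dk mu2.
have r0 : 0 < Num.min r1 r2 / 2 by rewrite divr_gt0// lt_min r10.
have := nbhs_right_lt r0; apply:filterS => d dr x xz.
have xr : `|x - z| < Num.min r1 r2.
 by rewrite (lt_trans xz)// mulrC -ltr_pdivlMr.
move: xr; rewrite lt_min => /andP[xr1 xr2]; split; first exact:Hr1.
move=>kz0 xzn t /andP[t0 t1]; set u := x - z.
have := Hr2 u; rewrite subr0 => /(_ xr2).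
rewrite subrK kz0 subr0 jacE -/A => h.
apply/eqP => e.
have h2 : u *m A = - ((1 - t) *: (rsubmx (k x) - u *m A)).
 apply/eqP; rewrite -subr_eq0; apply/eqP; rewrite -[RHS]e; apply/rowP => j; rewrite !mxE; ring.
have u0 : 0 < `|u| by rewrite normr_gt0 subr_eq0.
have : mu * `|u| <= mu / 2 * `|u|.
 apply:le_trans (Hmu u) _; rewrite h2 normrN normrZ; apply:le_trans h.
 by rewrite ler_piMl// ger0_norm ?subr_ge0// lerBlDr lerDl.
rewrite ler_pM2r//; lra.
Qed.

Lemma near_seq (I : eqType) (S : Type) (F : set_system S) {FF : Filter F} (s : seq I)
  (P : I -> S -> Prop) : (forall z, z \in s -> \forall d \near F, P z d) ->
 \forall d \near F, forall z, z \in s -> P z d.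
elim:s => [|a s IH] H; first by apply:filterE => d z; rewrite in_nil.
have h1 := H a (mem_head _ _).
have h2 : \forall d \near F, forall z, z \in s -> P z d.
 by apply:IH => z zs; apply:H; rewrite in_cons zs orbT.
apply:filterS2 h1 h2 => d h1 h2 z; rewrite in_cons => /orP[/eqP -> //|]; exact:h2.
Qed.

Lemma near_sep (zs : seq V) : uniq zs -> \forall d \near (0 : R)^'+, sep zs d.
move=>uz; have : \forall d \near 0^'+, forall z, z \in zs ->
  forall z', z' \in zs -> z != z' -> 4 * d <= `|z - z'|.
 apply:near_seq => z _; apply:near_seq => z' _.
 have [->|zz] := eqVneq z z'; first exact:filterE.
 have h0 : 0 < `|z - z'| / 4 by rewrite divr_gt0// normr_gt0 subr_eq0.
 have := nbhs_right_lt h0; apply:filterS => d h _.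
 by rewrite mulrC -ler_pdivlMr// ltW.
by apply:filterS => d h; split => // z z' zz zz'; exact:h.
Qed.

Lemma Em_ext (zs : seq V) (d : R) (P Q : V -> V -> V) : (forall z x, P z x = Q z x) -> Em zs d P = Em zs d Q.
by move=>PQ; rewrite (_ : P = Q)//; apply/funext => z; apply/funext => x. Qed.

Definition good (k : V -> W) (zs : seq V) := [/\ continuous k, csupp k,
 forall x, k x != 0, zeros k zs &
 forall z, z \in zs -> [/\ rsubmx (k z) = 0, 0 < hq (k z) & ndeg k z]].
Definition jk (k : V -> W) (z : V) := jac (fun x => rsubmx (k x)) z.

Lemma good_lin (k : V -> W) (zs : seq V) : uniq zs -> good k zs ->
 \forall d \near (0 : R)^'+, chomot k (Em zs d (fun z x => (x - z) *m jk k z)).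
move=>uz [ck sk k0 zk Hk].
have h1 := near_sep uz.
have h2 : \forall d \near 0^'+, forall z, z \in zs -> forall x, `|x - z| < 2 * d -> 0 < hq (k x) /\
  (rsubmx (k z) = 0 -> x != z -> forall t, 0 <= t <= 1 ->
   (1 - t) *: rsubmx (k x) + t *: ((x - z) *m jk k z) != 0).
 by apply:near_seq => z zz; have [_ kz nd] := Hk z zz; exact:local_lin.
have h3 := nbhs_right_gt (0 : R).
apply:filterS3 h1 h2 h3 => d sd hd d0.
have c1 := chomot_Em ck sk k0 zk d0 sd (fun z x zz xz => (hd z zz x xz).1).
pose P t z x := (1 - t) *: rsubmx (k x) + t *: ((x - z) *m jk k z).
have c2 : chomot (Em zs d (P 0)) (Em zs d (P 1)).
 apply:Em_homot => //.
  move=>z zz; have ct : continuous (fun w : R * V => w.1) by exact:cont_fst (@cont_id _).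
  apply:contD; apply:contZ => //.
  - exact:contB.
  - by apply:(@cont_snd _ _ R (fun x => rsubmx (k x))); exact:cont_rsubmx.
  - apply:cont_mulmx => //.
   by apply:contB => //; exact:cont_snd (@cont_id _).
 move=>t z x t01 zz dx xd; have [_ /(_ (let: And3 a _ _ := Hk z zz in a)) H] := hd z zz x xd.
 apply:H => //; apply:contraTneq dx => ->.
 by rewrite subrr normr0 -ltNge.
apply:chomot_trans c1 _; rewrite (_ : Em zs d (fun _ x => rsubmx (k x)) = Em zs d (P 0)); last first.
 by apply:Em_ext => z x; rewrite /P subr0 scale1r scale0r addr0.
rewrite (_ : Em zs d (fun z x => (x - z) *m jk k z) = Em zs d (P 1))//.
by apply:Em_ext => z x; rewrite /P subrr scale0r scale1r add0r.
Qed.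

(** Both maps deform to sums of linear collapses at the same points; when the determinants have
    equal signs, [glc_det] joins the linear parts. *)
Theorem chomot_local (k l : V -> W) (zs : seq V) : uniq zs -> good k zs -> good l zs ->
 (forall z, z \in zs -> 0 < \det (jk k z) * \det (jk l z)) -> chomot k l.
move=>uz gk gl Hd.
have h1 := good_lin uz gk; have h2 := good_lin uz gl; have h3 := near_sep uz.
have h4 := nbhs_right_gt (0 : R).
have [d [[d0 sd] c1 c2]] : exists d : R, [/\ 0 < d /\ sep zs d, chomot k (Em zs d (fun z x => (x - z) *m jk k z)) &
  chomot l (Em zs d (fun z x => (x - z) *m jk l z))].
 have [d [[d0 sd] [c1 c2]]] := filter_ex (filterI (filterI h4 h3) (filterI h1 h2)).
 by exists d; split.
have hG z : exists G : R -> 'M[R]_m, z \in zs -> [/\ continuous G, forall t, G t \in unitmx, G 0 = jk k z & G 1 = jk l z].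
 have [zz|zz] := boolP (z \in zs); last by exists (fun=> 0).
 by have [G HG] := glc_det (Hd z zz); exists G.
have [G HG] := choice hG.
pose P t z x := (x - z) *m G z t.
have c3 : chomot (Em zs d (P 0)) (Em zs d (P 1)).
 apply:Em_homot => //.
  move=>z zz; have [cG _ _ _] := HG z zz; apply:cont_mulmx.
   by apply:contB => //; exact:cont_snd (@cont_id _).
  exact:cont_fst.
 move=>t z x _ zz dx _; have [_ uG _ _] := HG z zz.
 have xz : x - z != 0 by rewrite -normr_gt0 (lt_le_trans d0).
 apply:contraNneq xz => h; have h' : (x - z) *m G z t = 0 by exact:h.
 by rewrite -(mulmxK (uG t) (x - z)) h' mul0mx.
apply:chomot_trans c1 _; apply:chomot_trans _ (chomot_sym c2).
have e A t : (forall z, z \in zs -> G z t = A z) ->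
  Em zs d (fun z x => (x - z) *m A z) = Em zs d (P t).
 move=>h; apply/funext => x; rewrite /Em; congr (_ + _); rewrite big_seq [RHS]big_seq.
 by apply:eq_bigr => z zz; rewrite /Eb /P h.
have e1 := e (jk k) 0 (fun z zz => let: And4 _ _ a _ := HG z zz in a).
have e2 := e (jk l) 1 (fun z zz => let: And4 _ _ _ a := HG z zz in a).
by move: c3; rewrite -e1 -e2.
Qed.
End Chomot.

(** * Differentiation at a zero *)

Section DiffVanish.
Context {R : realType}.

(** If f x = (x - z) A(x), continuity of A at z suffices for differentiability there: the remainder
    is (x - z) (A(x) - A(z)). *)
Lemma diff_vanish n p (f : 'rV[R]_n -> 'rV_p) (A : 'rV_n -> 'M[R]_(n, p)) z :
 {for z, continuous A} -> (\forall x \near z, f x = (x - z) *m A x) ->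
 differentiable f z /\ jac f z = A z.
move=>cA fA; have fz : f z = 0 by rewrite (nbhs_singleton fA) subrr mul0mx.
pose L : {linear 'rV_n -> 'rV_p} := mulmxr (A z).
have cL : continuous L by exact:mul_mx_cont.
have [df E] : differentiable f z /\ 'd f z = L :> ('rV_n -> 'rV_p).
 apply:diff_epsI => // e e0.
 have en : 0 < e / n.+1%:R by rewrite divr_gt0// ltr0n.
 have h1 : \forall x \near z, `|A z - A x| < e / n.+1%:R by exact:(cvgrPdist_lt _ _).1 cA _ en.
 have /nbhs_ballE[r r0 Hr] : \forall x \near z, f x = (x - z) *m A x /\ `|A z - A x| < e / n.+1%:R.
  exact:filterI fA h1.
 apply/nbhs_ballE; exists r => // h; rewrite subr0 => hr.
 have [/= e1 e2] : f (h + z) = (h + z - z) *m A (h + z) /\ `|A z - A (h + z)| < e / n.+1%:R.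
  by apply:(Hr (h + z)); rewrite addrK.
 rewrite e1 addrK fz subr0 -mulmxBr.
 rewrite (le_trans (norm_mulmx _ _))// mulrCA [e * _]mulrC ler_wpM2l//.
 rewrite -normrN opprB; apply:(@le_trans _ _ (n%:R * (e / n.+1%:R))).
  by rewrite ler_wpM2l// ltW.
 by rewrite mulrCA ler_piMr ?ltW// ltr_pdivrMr// mul1r ltr_nat.
split => //; apply/row_matrixP => i; rewrite !rowE.
exact:etrans (esym (jacE _ _ _)) (congr1 (fun F : 'rV_n -> 'rV_p => F (delta_mx 0 i)) E).
Qed.
End DiffVanish.

(** * Complex numbers as real 2 by 2 matrices *)

Section Complex.
Context {R : realType}.

Definition cJ : 'M[R]_2 := \matrix_(i, j) (if i == j then 0 else if i == 0 then 1 else -1).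
(** Multiplication by the complex number with coordinates v if s = 1, by its conjugate if s = -1. *)
Definition cZ (s : R) (v : 'rV[R]_2) : 'M[R]_2 := (v 0 0)%:M + (s * v 0 1) *: cJ.

Lemma cJJ : cJ *m cJ = (-1)%:M.
apply/matrixP => i j; rewrite !mxE !big_ord_recl big_ord0 !mxE.
case:i => -[|[|//]] hi; case:j => -[|[|//]] hj; rewrite ?mulr0 ?mul0r ?mulr1 ?mul1r ?addr0 ?add0r//.
Qed.

Lemma cZC s t v w : cZ s v *m cZ t w = cZ t w *m cZ s v.
rewrite /cZ !mulmxDl !mulmxDr !mul_scalar_mx !mul_mx_scalar -!scalemxAl -!scalemxAr cJJ.
rewrite !scalerA; apply/matrixP => i j; rewrite !mxE; ring.
Qed.

Lemma cZ_conj s v : s ^+ 2 = 1 -> cZ s v *m cZ (- s) v = (dot v v)%:M.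
move=>s1; rewrite /cZ !mulmxDl !mulmxDr !mul_scalar_mx !mul_mx_scalar -!scalemxAl -!scalemxAr cJJ.
rewrite dotE !big_ord_recl big_ord0 /= addr0.
have -> : lift ord0 ord0 = 1 :> 'I_2 by apply/val_inj.
have -> : ord0 = 0 :> 'I_2 by apply/val_inj.
apply/matrixP => i j; rewrite !mxE.
have : s * s = 1 by rewrite -expr2.
case:(i == j); rewrite ?mulr1n ?mulr0n => ss; last by ring.
rewrite mulrN1.
transitivity (v 0 0 * v 0 0 + (s * s) * (v 0 1 * v 0 1)); first by ring.
by rewrite ss mul1r.
Qed.

Lemma cZ_det s v : s ^+ 2 = 1 -> \det (cZ s v) = dot v v.
move=>s1; have ss : s * s = 1 by rewrite -expr2.
rewrite (expand_det_row _ 0) !big_ord_recl big_ord0 addr0 /cofactor !det_mx11 /cZ !mxE /= dotE !big_ord_recl big_ord0 /= addr0.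
have -> : lift ord0 ord0 = 1 :> 'I_2 by apply/val_inj.
have -> : ord0 = 0 :> 'I_2 by apply/val_inj.
transitivity (v 0 0 * v 0 0 + (s * s) * (v 0 1 * v 0 1)); first by ring.
by rewrite ss mul1r.
Qed.

Definition e0C : 'rV[R]_2 := delta_mx 0 0.
Definition cD (s : R) : 'M[R]_2 := diag_mx (\row_j (if j == 0 then 1 else s)).

Lemma e0C_cZ s v : e0C *m cZ s v = v *m cD s.
rewrite -rowE; apply/rowP => j; rewrite !mxE big_ord_recl big_ord_recl big_ord0 !mxE.
case:j => -[|[|//]] hj; rewrite ?mulr0 ?mulr1 ?addr0 ?add0r.
 by congr (v _ _); apply/val_inj.
by rewrite mulrC; congr (v _ _ * _); apply/val_inj.
Qed.

Lemma cD_det s : \det (cD s) = s.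
by rewrite det_diag !big_ord_recl big_ord0 !mxE /= mul1r mulr1. Qed.

Lemma dot_eq0 k (v : 'rV[R]_k) : (dot v v == 0) = (v == 0).
apply/idP/idP => [|/eqP ->]; last by rewrite dot0l.
by apply:contraLR => v0; rewrite gt_eqF// dot_gt0.
Qed.

Lemma e0C_neq0 (N : 'M[R]_2) : N \in unitmx -> e0C *m N != 0.
move=>uN; have h : e0C != 0 by apply/rV0Pn; exists 0; rewrite mxE !eqxx oner_eq0.
by apply:contraNneq h => h'; rewrite -(mulmxK uN e0C) h' mul0mx.
Qed.

Definition cprod (I : Type) (s : I -> R) (v : I -> 'rV[R]_2) (r : seq I) : 'M[R]_2 :=
 foldr (fun i N => cZ (s i) (v i) *m N) 1%:M r.

Lemma cprodC (I : Type) (s : I -> R) v (r : seq I) t w :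
 cprod s v r *m cZ t w = cZ t w *m cprod s v r.
elim:r => [|i r IH]; first by rewrite mul1mx mulmx1.
by rewrite -mulmxA IH !mulmxA cZC.
Qed.

Lemma cprod_cat (I : Type) (s : I -> R) v (r1 r2 : seq I) :
 cprod s v (r1 ++ r2) = cprod s v r1 *m cprod s v r2.
by elim:r1 => [|i r IH] /=; [rewrite mul1mx|rewrite IH mulmxA]. Qed.

Lemma cprod_det (I : eqType) (s : I -> R) v (r : seq I) :
 (forall i, i \in r -> s i ^+ 2 = 1) -> (forall i, i \in r -> v i != 0) -> 0 < \det (cprod s v r).
elim:r => [|i r IH] hs hv; first by rewrite det1.
rewrite det_mulmx mulr_gt0//.
 by rewrite cZ_det ?dot_gt0 ?hv ?hs ?mem_head.
by apply:IH => j jr; [apply:hs|apply:hv]; rewrite in_cons jr orbT.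
Qed.

Lemma cont_cZ (T : topologicalType) s (v : T -> 'rV_2) : continuous v -> continuous (fun x => cZ s (v x)).
move=>cv; apply:contD; first by apply:cont_scalar_mx; exact:cont_coord.
apply:contZ => //.
by apply:contM => //; exact:cont_coord.
Qed.

Lemma cont_cprod (T : topologicalType) (I : Type) (s : I -> R) (v : I -> T -> 'rV_2) (r : seq I) :
 (forall i, continuous (v i)) -> continuous (fun x => cprod s (fun i => v i x) r).
move=>cv; elim:r => [|i r IH]; first exact:cont_cst.
by apply:cont_mulmx => //; exact:cont_cZ.
Qed.

(** Each pair of a factor and a conjugate factor collapses to the scalar |v|^2, leaving a power of v
    alone or of its conjugate alone. *)
Lemma cprod_cst (I : eqType) (s : I -> R) (r : seq I) : (forall i, i \in r -> s i = 1 \/ s i = -1) ->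
 exists (b d : nat) (t : R), [/\ t = 1 \/ t = -1 & forall v,
  cprod s (fun=> v) r = (dot v v ^+ b) *: (cZ t v ^+ d : 'M[R]_2)].
elim:r => [|i r IH] hs /=.
 by exists 0%N, 0%N, 1; split; [left|move=>v; rewrite expr0 scale1r].
have [|b [d [t [t1 H]]]] := IH; first by move=>j jr; apply:hs; rewrite in_cons jr orbT.
have si := hs i (mem_head _ _).
have [ti|ti] := eqVneq t (s i).
 exists b, d.+1, t; split => // v; rewrite H -scalemxAr ti exprS.
 by congr (_ *: _); rewrite -ti.
case:d H => [|d] H.
 exists b, 1%N, (s i); split => // v; rewrite H -scalemxAr; congr (_ *: _).
 by rewrite expr0 expr1 mulmx1.
have ts : s i = - t by case:si t1 ti => -> [] ->; rewrite ?opprK ?eqxx.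
have s1 : s i ^+ 2 = 1 by case:si => ->; rewrite ?sqrrN expr1n.
exists b.+1, d, t; split => // v; rewrite H -scalemxAr exprS.
have -> : cZ (s i) v *m (cZ t v * cZ t v ^+ d) = (dot v v) *: (cZ t v ^+ d : 'M[R]_2).
 have -> : t = - s i by rewrite ts opprK.
 rewrite mulmxA cZ_conj// mul_scalar_mx; by congr (_ *: _); rewrite ts opprK.
by rewrite scalerA exprSr.
Qed.
End Complex.

(** * Deformation to a power map *)

Section LocalModel.
Context {R : realType} {m' : nat}.
Local Notation m := (2 + m')%N.
Local Notation V := 'rV[R]_m.
Local Notation W := 'rV[R]_(1 + m).

(** The power map z -> z^d, conjugated if s = -1, on the first two coordinates and the identity on
    the others. *)
Definition Pd (s : R) (d : nat) (x : V) : V :=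
 row_mx (e0C *m (cZ s (lsubmx x) ^+ d : 'M[R]_2)) (rsubmx x).

Lemma csupp_Eb (z : V) d P : 0 < d -> csupp (Eb z d P).
move=>d0; exists (2 * d + `|z|); first by rewrite ltr_pwDl// mulr_gt0.
move=>x h; apply:Eb_far => //.
have h2 : `|x| <= `|x - z| + `|z| by rewrite -{1}[x](subrK z) ler_normD.
lra.
Qed.

Lemma Em1 (d : R) (P : V -> V) : Em [:: 0] d (fun _ => P) = Eb 0 d P.
by apply/funext => x; rewrite /Em big_seq1 addrC subrK. Qed.

Lemma Eb_homot (d : R) (P : R -> V -> V) : 0 < d ->
 continuous (fun w : R * V => P w.1 w.2) ->
 (forall t x, 0 <= t <= 1 -> d <= `|x| -> P t x != 0) ->
 chomot (Eb 0 d (P 0)) (Eb 0 d (P 1)).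
move=>d0 cP nP; rewrite -!Em1.
apply:(@Em_homot _ _ [:: 0] d (fun t _ => P t)) => //.
- split => // z z'; rewrite !inE => /eqP -> /eqP ->.
 by rewrite eqxx.
- by move=>t z x t01; rewrite inE => /eqP ->; rewrite subr0 => h _; exact:nP.
Qed.

Lemma row2_eq0 (a : 'rV_2) (b : 'rV_m') : (row_mx a b == 0 :> V) = (a == 0) && (b == 0).
apply/eqP/andP => [h|[/eqP -> /eqP ->]]; last by rewrite row_mx0.
by split; apply/eqP; [rewrite -[a](row_mxKl a b)|rewrite -[b](row_mxKr a b)]; rewrite h linear0.
Qed.

Lemma lsub_norm (x : V) : `|lsubmx x| <= `|x|.
by apply:mx_norm_le => // i j; rewrite mxE; exact:entry_le. Qed.
Lemma rsub_norm (x : V) : `|rsubmx x| <= `|x|.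
by apply:mx_norm_le => // i j; rewrite mxE; exact:entry_le. Qed.

Lemma row_norm (a : 'rV_2) (b : 'rV_m') (r : R) : 0 <= r -> `|a| <= r -> `|b| <= r -> `|row_mx a b : V| <= r.
move=>r0 ar br; apply:mx_norm_le => // i j; rewrite mxE; case:fintype.splitP => k _.
 by rewrite (le_trans (entry_le _ _ _)).
by rewrite (le_trans (entry_le _ _ _)).
Qed.

Lemma cont_cpow (T : topologicalType) (s : R) (v : T -> 'rV_2) d : continuous v ->
 continuous (fun x => cZ s (v x) ^+ d : 'M[R]_2).
move=>cv; elim:d => [|d IH]; first exact:cont_cst.
rewrite (_ : (fun x => _) = fun x => cZ s (v x) *m (cZ s (v x) ^+ d : 'M[R]_2)).
 by apply:cont_mulmx => //; exact:cont_cZ.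
by apply/funext => x; rewrite exprS.
Qed.

Lemma cont_Pd s d : continuous (Pd s d).
apply:cont_row_mx; last exact:cont_rsubmx.
apply:cont_mulmx => //.
by apply:cont_cpow; apply:cont_lsubmx.
Qed.

Lemma cpow_unit (s : R) (v : 'rV_2) d : s ^+ 2 = 1 -> v != 0 -> (cZ s v ^+ d : 'M[R]_2) \in unitmx.
move=>s1 v0; have u : cZ s v \in unitmx by rewrite unitmxE cZ_det// unitfE dot_eq0.
elim:d => [|d IH]; first by rewrite expr0 unitmx1.
by rewrite exprS unitmx_mul u.
Qed.

Lemma cprod_mid (I : Type) (s : I -> R) v (r1 r2 : seq I) z :
 cprod s v (r1 ++ z :: r2) = cZ (s z) (v z) *m cprod s v (r1 ++ r2).
by rewrite !cprod_cat /= mulmxA cprodC mulmxA. Qed.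
Section Model.
Variables (k : V -> W) (zs : seq V).
Hypotheses (uz : uniq zs) (gk : good k zs).
Hypothesis zinj : {in zs &, injective (fun z : V => lsubmx z : 'rV[R]_2)}.
Let sg (z : V) : R := Num.sg (\det (jk k z)).
Let C (z : V) : 'rV[R]_2 := lsubmx z.
Let B := \sum_(z <- zs) `|z|.
Let sg1 z : z \in zs -> sg z = 1 \/ sg z = -1.
move=>zz; have [_ _ _ _ /(_ z zz)[_ _ [_ u]]] := gk.
have d0 : \det (jk k z) != 0 by rewrite -unitfE -unitmxE.
rewrite /sg; case:(ltrgtP (\det (jk k z)) 0) d0 => // h _.
 by right; rewrite ltr0_sg.
by left; rewrite gtr0_sg.
Qed.
Let sg2 z : z \in zs -> sg z ^+ 2 = 1.
by move=> /sg1[] ->; rewrite ?sqrrN expr1n. Qed.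
Let zB z : z \in zs -> `|z| <= B.
by move=>zz; rewrite /B (big_rem z)//= lerDl sumr_ge0. Qed.

Variable e : R.
Hypothesis e0 : 0 < e.
Hypothesis eC : forall z z', z \in zs -> z' \in zs -> z != z' -> 4 * e <= `|C z - C z'|.
(** Interpolates the last coordinates of the points of zs as a function of the first two, and is
    constant near each of them; it relies on the first two coordinates separating the points. *)
Let gam (c : 'rV[R]_2) : 'rV[R]_m' := \sum_(z <- zs) ta (`|c - C z| / e) *: rsubmx z.
Let gamE z c : z \in zs -> `|c - C z| <= e -> gam c = rsubmx z.
move=>zz ce; rewrite /gam (bigD1_seq z)//= ta1; last by rewrite ler_pdivrMr// mul1r.
rewrite scale1r big_seq_cond big1 ?addr0// => z' /andP[zz' z'z].
rewrite ta2 ?scale0r// ler_pdivlMr//; have h := eC zz' zz z'z.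
have h2 : `|C z' - C z| <= `|c - C z| + `|c - C z'|.
 have -> : C z' - C z = (c - C z) - (c - C z') by apply/rowP => j; rewrite !mxE; ring.
 exact:ler_normB.
have k1 : 4 * e <= e + `|c - C z'| by apply:le_trans h (le_trans h2 _); rewrite lerD2r.
have k2 : 4 * e - e <= `|c - C z'| by rewrite lerBlDl.
apply:le_trans k2; have -> : 4 * e - e = 3 * e by ring.
by rewrite ler_pM2r// ler_nat.
Qed.
Let gamB c : `|gam c| <= B.
rewrite /gam /B (le_trans (ler_norm_sum _ _ _))//; apply:ler_sum => z _.
rewrite normrZ; apply:le_trans; last exact:rsub_norm.
have /andP[t0 t1] := clamp01 (2 - `|c - C z| / e).
by rewrite ler_piMl// ger0_norm.
Qed.
Let gam_cont : continuous gam.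
apply:cont_sum => z _; apply:contZ => //.
apply:compc; last exact:ta_cont.
apply:contM => //.
by apply:cont_norm; apply:contB.
Qed.
(** A product of linear complex factors, conjugated at the negative zeros, whose roots t C z move
    with t. At t = 1 its zeros are exactly the points of zs, at t = 0 they have all merged at the
    origin, and in between they stay in the ball of radius B. *)
Let P (t : R) (x : V) : V :=
 row_mx (e0C *m cprod sg (fun z => lsubmx x - t *: C z) zs) (rsubmx x - t *: gam (lsubmx x)).
Let cP : continuous (fun w : R * V => P w.1 w.2).
have c1 : continuous (fun w : R * V => lsubmx w.2 : 'rV_2).
 exact:(@cont_snd _ _ R (fun x : V => lsubmx x) (cont_lsubmx (@cont_id _))).
have c2 : continuous (fun w : R * V => rsubmx w.2 : 'rV_m').
 exact:(@cont_snd _ _ R (fun x : V => rsubmx x) (cont_rsubmx (@cont_id _))).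
have ct : continuous (fun w : R * V => w.1) by exact:cont_fst (@cont_id _).
apply:cont_row_mx.
 apply:cont_mulmx => //.
 have cz z : continuous (fun w : (R * V)%type => lsubmx w.2 - w.1 *: C z).
  by apply:contB => //; apply:contZ.
 exact:cont_cprod.
by apply:contB => //; apply:contZ => //; exact:compc c1 gam_cont.
Qed.
Let P0 t x : P t x = 0 -> exists2 z, z \in zs & lsubmx x = t *: C z /\ rsubmx x = t *: gam (lsubmx x).
move=> /eqP; rewrite row2_eq0 => /andP[h1 h2].
have [h|h] := pselect (exists2 z, z \in zs & lsubmx x - t *: C z = 0).
 have [z zz zE] := h; exists z => //; split; apply/eqP; rewrite -subr_eq0 ?zE//.
have : 0 < \det (cprod sg (fun z => lsubmx x - t *: C z) zs).
 apply:cprod_det => z zz; first exact:sg2.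
 by apply/eqP => zE; apply:h; exists z.
move=>d0; have u : cprod sg (fun z => lsubmx x - t *: C z) zs \in unitmx.
 by rewrite unitmxE unitfE gt_eqF.
by move: h1; rewrite (negPf (e0C_neq0 u)).
Qed.
Let P0B t x : 0 <= t <= 1 -> P t x = 0 -> `|x| <= B.
move=> /andP[t0 t1] /P0[z zz [h1 h2]]; have B0 : 0 <= B by apply:sumr_ge0.
rewrite -[x]hsubmxK; apply:row_norm => //.
 rewrite h1 normrZ ger0_norm// (le_trans _ (zB zz))//.
 by rewrite (le_trans _ (lsub_norm z))// ler_piMl.
rewrite h2 normrZ ger0_norm// (le_trans _ (gamB (lsubmx x)))//.
by rewrite ler_piMl.
Qed.
Let rho : R := B + 1.
Let rho0 : 0 < rho. Proof. by rewrite ltr_wpDl// sumr_ge0. Qed.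
Let P1z z : z \in zs -> P 1 z = 0.
move=>zz; apply/eqP; rewrite row2_eq0 !scale1r; apply/andP; split; apply/eqP.
 have [r1 [r2 ->]] : exists r1 r2, zs = r1 ++ z :: r2.
  by case/splitPr: zz => r1 r2; exists r1, r2.
 have zE : cZ (sg z) (lsubmx z - 1 *: C z) = 0.
  by rewrite scale1r subrr /cZ !mxE mulr0 scale0r addr0 raddf0.
 by rewrite cprod_cat /= zE mul0mx !mulmx0.
have h : `|lsubmx z - C z| <= e by rewrite /C subrr normr0 ltW.
by rewrite (gamE zz h) subrr.
Qed.
(** At z one factor vanishes, contributing its conjugation matrix of determinant [sg z]; the other
    factors have positive determinant. The local sign of [P 1] at z is therefore that of k, as
    [chomot_local] requires. *)
Let good_P1 : good (Eb 0 rho (P 1)) zs /\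
 (forall z, z \in zs -> 0 < \det (jk k z) * \det (jk (Eb 0 rho (P 1)) z)).
have cP1 : continuous (P 1) by exact:cont_slice.
have PB x : P 1 x = 0 -> `|x| <= B by apply:P0B; rewrite ler01 lexx.
have cE : continuous (Eb 0 rho (P 1)).
 have c : continuous (fun w : R * V => Eb 0 rho (P 1) w.2).
  exact:(@Eb_cont _ _ 0 rho (fun _ => P 1) (@cont_snd _ _ R _ cP1)).
 exact:(@cont_slice V W R (fun _ => Eb 0 rho (P 1)) 0 c).
have nP x : rho <= `|x| -> P 1 x != 0.
 by move=>h; apply/eqP => /PB; rewrite leNgt (lt_le_trans _ h)// ltrDl.
have Ez z : z \in zs -> \forall x \near z, Eb 0 rho (P 1) x = row_mx 1%:M (P 1 x).
 move=>zz; have h : nbhs z [set x : V | `|x - 0| < rho].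
  apply:open_nbhs_nbhs; split; first exact:open_ball.
  by rewrite /= subr0 (le_lt_trans (zB zz))// ltrDl.
 by apply:filterS h => x /ltW h; exact:Eb_near.
have nd z : z \in zs -> exists2 A : 'M[R]_m, 0 < sg z * \det A &
  differentiable (fun x => rsubmx (Eb 0 rho (P 1) x)) z /\ jk (Eb 0 rho (P 1)) z = A.
 move=>zz; have [r1 [r2 zsE]] : exists r1 r2, zs = r1 ++ z :: r2.
  by case/splitPr: (zz) => r1 r2; exists r1, r2.
 pose N (x : V) : 'M[R]_2 := cprod sg (fun z => lsubmx x - 1 *: C z) (r1 ++ r2).
 pose A x : 'M[R]_(2 + m') := block_mx (cD (sg z) *m N x) 0 0 1%:M.
 have cA : continuous A.
  rewrite /A /block_mx; apply:cont_col_mx => //.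
  apply:cont_row_mx => //.
  apply:cont_mulmx => //.
  apply:cont_cprod => y.
  by apply:contB => //; apply:cont_lsubmx.
 have near_e : \forall x \near z, `|lsubmx x - C z| <= e.
  have h : nbhs z [set x : V | `|x - z| < e].
   by apply:open_nbhs_nbhs; split; [exact:open_ball|rewrite /= subrr normr0].
  apply:filterS h => x /ltW; apply:le_trans.
  by rewrite /C -linearB; exact:lsub_norm.
 have PE : \forall x \near z, rsubmx (Eb 0 rho (P 1) x) = (x - z) *m A x.
  apply:filterS2 (Ez z zz) near_e => x E xe; rewrite E row_mxKr /P scale1r (gamE zz xe).
  rewrite -[x - z]hsubmxK /A mul_row_block !mulmx0 addr0 add0r mulmx1.
  rewrite [rsubmx (x - z)]linearB; congr row_mx.
  rewrite zsE cprod_mid mulmxA e0C_cZ scale1r [lsubmx (x - z)]linearB /= /C.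
  by rewrite -mulmxA.
 have [dA jA] := diff_vanish (@cA z) PE.
 exists (A z) => //.
 rewrite /A det_ublock det1 mulr1 det_mulmx cD_det mulrA -expr2 sg2// mul1r.
 have rz y : y \in r1 ++ r2 -> y \in zs.
  by rewrite zsE !mem_cat inE => /orP[] ->; rewrite ?orbT.
 apply:cprod_det => y yr; first exact:sg2 (rz _ yr).
 have yz := rz _ yr.
 rewrite scale1r subr_eq0; apply/eqP => h; have := zinj zz yz h => zy.
 move: uz yr; rewrite zsE -zy cat_uniq /= negb_or mem_cat => /and3P[_ /andP[zr1 _] /andP[zr2 _]].
 by rewrite (negPf zr1) (negPf zr2).
split; last first.
 move=>z zz; have [A dA [_ ->]] := nd z zz.
 move: dA; rewrite /sg; set dk := \det (jk k z) => h.
 have dE : dk = Num.sg dk * `|dk| by rewrite mulr_sg_norm.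
 rewrite [X in 0 < X * _]dE.
 rewrite mulrAC pmulr_lgt0// normr_gt0.
 by apply:contraTneq h => ->; rewrite sgr0 mul0r ltxx.
split => //.
- exact:csupp_Eb.
- move=>x; apply:Eb_neq0 => //; rewrite subr0 => h _; exact:nP.
- move=>x; rewrite /hq row_mxKr row_mxKl mxE eqxx mulr1n subr0 => /eqP.
 rewrite scaler_eq0 => h hb.
 have x2 : `|x| / rho < 2.
  by rewrite ltNge; apply/negP => h2; move: hb; rewrite be2// ltr0N1.
 move: h; rewrite gt_eqF ?ta_gt0//= => /eqP /P0[z zz [h1 h2]].
 have h3 : x = z.
  rewrite -[x]hsubmxK -[z]hsubmxK h1 scale1r; congr row_mx.
  have h4 : `|C z - C z| <= e by rewrite subrr normr0 ltW.
  by rewrite h2 h1 !scale1r (gamE zz h4).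
 by rewrite h3.
- move=>z zz; have [A dA [dz jz]] := nd z zz.
 have Ezz := nbhs_singleton (Ez z zz).
 split.
 + by rewrite Ezz row_mxKr P1z.
 + by rewrite Ezz /hq row_mxKl mxE eqxx mulr1n ltr01.
 + split => //; change (jk (Eb 0 rho (P 1)) z \in unitmx); rewrite jz unitmxE unitfE.
  by apply:contraTneq dA => ->; rewrite mulr0 ltxx.
Qed.

Lemma local_model_aux : chomot k (fun _ => south) \/
 exists (s : R) (d : nat), (s = 1 \/ s = -1) /\ chomot k (Eb 0 rho (Pd s d.+1)).
have [gP dP] := good_P1.
have c1 := chomot_local uz gk gP dP.
have c2 : chomot (Eb 0 rho (P 0)) (Eb 0 rho (P 1)).
 apply:(@Eb_homot rho P rho0 cP) => t x t01 h; apply/eqP => /(P0B t01).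
 by rewrite leNgt (lt_le_trans _ h)// ltrDl.
have c3 := chomot_trans c1 (chomot_sym c2).
have [b [d [s [s1 H]]]] := cprod_cst (fun z zz => sg1 zz).
have s2 : s ^+ 2 = 1 by case:s1 => ->; rewrite ?sqrrN expr1n.
(* Deforms the positive scalar |v|^(2b) left by [cprod_cst] to 1. *)
pose Q t x : V :=
 row_mx (((1 - t) * dot (lsubmx x) (lsubmx x) ^+ b + t) *: (e0C *m (cZ s (lsubmx x) ^+ d : 'M[R]_2))) (rsubmx x).
have c1x : continuous (fun w : R * V => lsubmx w.2 : 'rV_2).
 exact:(@cont_snd _ _ R (fun x : V => lsubmx x) (cont_lsubmx (@cont_id _))).
have ct : continuous (fun w : R * V => w.1) by exact:cont_fst (@cont_id _).
have c4 : chomot (Eb 0 rho (Q 0)) (Eb 0 rho (Q 1)).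
 apply:Eb_homot => //.
  apply:cont_row_mx; last exact:(@cont_snd _ _ R (fun x : V => rsubmx x) (cont_rsubmx (@cont_id _))).
  apply:contZ.
   apply:contD => //; apply:contM; first exact:contB.
   have cd : continuous (fun w : R * V => dot (lsubmx w.2) (lsubmx w.2)).
    by move=>w; exact:(cvg_dot (c1x w) (c1x w)).
   exact:(compc cd (@exprn_continuous R b)).
  by apply:cont_mulmx => //; exact:cont_cpow.
 move=>t x /andP[t0 t1] h; apply/negP; rewrite row2_eq0 scaler_eq0 => /andP[h1 h2].
 have l0 : lsubmx x != 0 :> 'rV_2.
  apply:contraTneq h => l0; rewrite -[x]hsubmxK l0 (eqP h2) row_mx0 normr0 -ltNge//.
 move: h1; rewrite (negPf (e0C_neq0 (cpow_unit d s2 l0))) orbF => /eqP h1.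
 have dp : 0 < dot (lsubmx x) (lsubmx x) ^+ b by rewrite exprn_gt0// dot_gt0.
 have h3 : 0 <= (1 - t) * dot (lsubmx x) (lsubmx x) ^+ b by rewrite mulr_ge0 ?subr_ge0// ltW.
 have t00 : t = 0 by lra.
 by move: h1; rewrite t00 subr0 mul1r addr0 => h1; move: dp; rewrite h1 ltxx.
have e1 : P 0 = Q 0.
 apply/funext => x; rewrite /P /Q subr0 mul1r addr0 !scale0r subr0; congr row_mx.
 have -> : cprod sg (fun z => lsubmx x - 0 *: C z) zs = cprod sg (fun=> lsubmx x) zs.
  by congr (cprod _ _ _); apply/funext => z; rewrite scale0r subr0.
 by rewrite H -scalemxAr.
have e2 : Q 1 = Pd s d by apply/funext => x; rewrite /Q subrr mul0r add0r scale1r.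
have c5 : chomot k (Eb 0 rho (Pd s d)).
 by apply:chomot_trans c3 _; rewrite -e2 e1.
(* In degree 0 the model never vanishes on its vector part, so a segment leads to [south]. *)
case:d c5 {Q c4 e1 e2 H} => [|d] c5; last by right; exists s, d.
left; apply:chomot_trans c5 _; apply:chomot_line.
- have c : continuous (fun w : R * V => Eb 0 rho (Pd s 0) w.2).
  exact:(@Eb_cont _ _ 0 rho (fun _ => Pd s 0) (@cont_snd _ _ R _ (@cont_Pd s 0))).
 exact:(@cont_slice V W R (fun _ => Eb 0 rho (Pd s 0)) 0 c).
- exact:cont_cst.
- exact:csupp_Eb.
- by exists 1.
move=>x t /andP[t0 t1]; rewrite /Eb /south !scale_row_mx add_row_mx !scale_scalar_mx -raddfD.
rewrite row_eq0 scaler0 addr0 scalerA; apply/negP => /andP[/eqP h1].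
rewrite row2_eq0 scaler_eq0 mulf_eq0 => /andP[/orP[/orP[/eqP h2|/eqP h2]|h2] _].
- by move: h1; rewrite h2 mul0r; lra.
- have [h3|h3] := ltP (`|x - 0| / rho) 2; first by have := ta_gt0 h3; rewrite h2 ltxx.
 by move: h1; rewrite be2//; lra.
- by move: h2; apply/negP; apply:e0C_neq0; rewrite expr0; exact:unitmx1.
Qed.
End Model.
End LocalModel.

(** * Jacobians of composites; separating points by a shear *)

Section JacComp.
Context {R : realType}.

Lemma jac_comp a b c (f : 'rV[R]_a -> 'rV_b) (g : 'rV_b -> 'rV_c) h x y :
 f x = y -> (\forall z \near x, h z = g (f z)) -> differentiable f x -> differentiable g y ->
 differentiable h x /\ jac h x = jac f x *m jac g y.
move=>fx E df dg.
have dgf : differentiable (g \o f) x by apply:differentiable_comp => //; rewrite fx.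
have [dh _] := near_eq_is_diff E dgf.
split => //; apply/row_matrixP => i; rewrite !rowE [RHS]mulmxA.
apply:etrans (esym (jacE h x _)) _; apply:etrans (diff_near_comp fx E df dg _) _.
apply:etrans (jacE g y _) _; congr (_ *m _); exact:jacE.
Qed.

Lemma jac_lin n p (L : 'M[R]_(n, p)) x :
 differentiable (fun v : 'rV_n => v *m L) x /\ jac (fun v : 'rV_n => v *m L) x = L.
have cL : continuous (mulmxr L : 'rV_n -> 'rV_p).
 exact:cont_mulmx.
have dL := linear_differentiable x cL.
split; first exact:dL.
apply/row_matrixP => i; rewrite !rowE.
exact:etrans (esym (jacE _ _ _)) (congr1 (fun F : 'rV_n -> 'rV_p => F (delta_mx 0 i)) (diff_lin x cL)).
Qed.

Lemma nonroot (p : {poly R}) : p != 0 -> exists t, p.[t] != 0.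
move=>p0; apply:contrapT => h.
have a : all (root p) [seq i%:R | i <- iota 0 (size p)].
 apply/allP => x _; rewrite /root; apply/negPn/negP => hx; apply:h; by exists x.
have u : uniq [seq i%:R : R | i <- iota 0 (size p)].
 by rewrite map_inj_uniq ?iota_uniq// => i j /eqP; rewrite eqr_nat => /eqP.
by have := max_poly_roots p0 a u; rewrite size_map size_iota ltnn.
Qed.

(** With first column (1, t, t^2, ...), the first coordinate of (z - z') L is the polynomial with
    coefficients z - z' evaluated at t. Any t off the roots of these finitely many polynomials
    separates the points, and L is unitriangular. *)
Lemma shear m (zs : seq 'rV_(2 + m)) : uniq zs -> exists2 L : 'M[R]_(2 + m), \det L = 1 &
 {in zs &, injective (fun z : 'rV_(2 + m) => lsubmx (z *m L) : 'rV_2)}.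
move=>uz; pose q (z z' : 'rV_(2 + m)) := if z == z' then 1 else (rVpoly (z - z') : {poly R}).
have q0 z z' : q z z' != 0.
 rewrite /q; case:(eqVneq z z') => [_|zz]; first exact:oner_neq0.
 apply/eqP => h; case/eqP: zz; apply/eqP; rewrite -subr_eq0; apply/eqP.
 by rewrite -[LHS]rVpolyK h linear0.
have [t ht] : exists t, (\prod_(z <- zs) \prod_(z' <- zs) q z z').[t] != 0.
 apply:nonroot; rewrite prodf_seq_neq0; apply/allP => z _.
 by rewrite prodf_seq_neq0; apply/allP => z' _ /=.
pose L : 'M[R]_(2 + m) := \matrix_(i, j) (if val j == 0%N then t ^+ i else (i == j)%:R).
exists L.
 rewrite det_trig; last first.
  apply/is_trig_mxP => i j ij; rewrite mxE; case:eqP => [j0|_]; first by rewrite j0 in ij.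
  by case:eqP ij => // ->; rewrite ltnn.
 rewrite big1// => i _; rewrite mxE eqxx; case:eqP => // ->; by rewrite expr0.
move=>z z' zz zz' /= h; apply/eqP; apply:contrapT => /negP nz.
have : q z z' != 0 /\ (q z z').[t] != 0.
 split => //; move: ht; rewrite horner_prod prodf_seq_neq0 => /allP/(_ z zz).
 by rewrite horner_prod prodf_seq_neq0 => /allP/(_ z' zz').
case=> _; rewrite /q (negPf nz); apply/negP; rewrite negbK.
have -> : (rVpoly (z - z')).[t] = (lsubmx ((z - z') *m L) : 'rV_2) 0 0.
 rewrite /rVpoly horner_poly !mxE; apply:eq_bigr => i _; rewrite valK !mxE /=; ring.
by rewrite mulmxBl linearB /= h subrr mxE.
Qed.

Lemma local_model m' (k : 'rV_(2 + m') -> 'rV_(1 + (2 + m'))) zs : uniq zs -> good k zs ->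
 chomot k (fun _ => south) \/ exists (s : R) (d : nat) (rho : R) (L : 'M[R]_(2 + m')),
  [/\ s = 1 \/ s = -1, 0 < rho, 0 < \det L & chomot k (fun x => Eb 0 rho (Pd s d.+1) (x *m L))].
move=>uz gk; have [L L1 Linj] := shear uz.
have uL : L \in unitmx by rewrite unitmxE L1 unitr1.
have uLi : invmx L \in unitmx by rewrite unitmx_inv.
have [mu mu0 Hmu] := unit_lower uLi.
pose k2 x := k (x *m invmx L); pose zs2 := [seq z *m L | z : 'rV_(2 + m') <- zs].
have [ck [r r0 kr] nk kz gz] := gk.
have uz2 : uniq zs2 by rewrite map_inj_uniq// => x y /(congr1 (fun v => v *m invmx L)); rewrite !mulmxK.
have cL : continuous (fun x : 'rV[R]_(2 + m') => x *m invmx L).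
 exact:cont_mulmx.
have g2 : good k2 zs2.
 split.
 - exact:(compc cL ck).
 - exists (r / mu); first by rewrite divr_gt0.
  move=>x; rewrite ler_pdivrMr// mulrC => h; apply:kr; exact:le_trans h (Hmu x).
 - by move=>x; exact:nk.
 - by move=>x h1 h2; apply/mapP; exists (x *m invmx L); [exact:kz|rewrite mulmxKV].
 - move=> _ /mapP[z zz ->]; rewrite /k2 mulmxK//; have [h1 h2 [d1 j1]] := gz z zz.
  split; [exact:h1|exact:h2|].
  have [dl jl] := jac_lin (invmx L) (z *m L).
  have E : (z *m L) *m invmx L = z by rewrite mulmxK.
  have near_e : \forall x \near (z *m L), rsubmx (k2 x) = rsubmx (k (x *m invmx L)).
   by exact:filterE.
  have [d2 j2] := jac_comp E near_e dl d1.
  split; first exact:d2.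
  change (jac (fun x => rsubmx (k2 x)) (z *m L) \in unitmx).
  by rewrite j2 jl unitmx_mul uLi.
have zinj2 : {in zs2 &, injective (fun z : 'rV_(2 + m') => lsubmx z : 'rV_2)}.
 move=> _ _ /mapP[z zz ->] /mapP[z' zz' ->] h; by rewrite (Linj z z' zz zz' h).
have He : \forall e \near 0^'+, forall z, z \in zs2 -> forall z', z' \in zs2 ->
  z != z' -> 4 * e <= `|(lsubmx z) - lsubmx z'|.
 apply:near_seq => z zz; apply:near_seq => z' zz'.
 have [->|zn] := eqVneq z z'; first exact:filterE.
 have h0 : 0 < `|(lsubmx z) - lsubmx z'| / 4.
  rewrite divr_gt0// normr_gt0 subr_eq0; apply/eqP => h; case/eqP: zn; exact:zinj2.
 have := nbhs_right_lt h0; apply:filterS => e h _.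
 by rewrite mulrC -ler_pdivlMr// ltW.
have [e [e0 eC]] := filter_ex (filterI (nbhs_right_gt 0) He).
have eC' z z' : z \in zs2 -> z' \in zs2 -> z != z' -> 4 * e <= `|(lsubmx z) - lsubmx z'|.
 by move=>h1 h2; exact:eC.
have back l : chomot k2 l -> chomot k (fun x => l (x *m L)).
 move=> /(chomot_lin uL); apply:chomot_ext => // x.
 by rewrite /k2 mulmxK.
have [h|[s [d [s1 h]]]] := local_model_aux uz2 g2 zinj2 e0 eC'.
 by left; exact:(back _ h).
right; exists s, d, (\sum_(z <- zs2) `|z| + 1), L; split => //.
- by rewrite ltr_wpDl// sumr_ge0.
- by rewrite L1 ltr01.
exact:(back _ h).
Qed.
End JacComp.

Lemma unitmx_prod (R : realType) n (A B C : 'M[R]_n) : C = A *m B -> A \in unitmx ->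
 B \in unitmx -> C \in unitmx.
by move=> -> uA uB; rewrite unitmx_mul uA. Qed.

(** * Pointwise local diffeomorphisms of the manifold *)

Section LocalDiffeo.
Context {R : realType} {m : nat} {M : manifold R m}.
Local Notation V := 'rV[R]_m.

(** Stated at a single point, since the radial compressions below may fail to be differentiable on a
    sphere. Independence of the chart is [nd_any]. *)
Definition nd (u : M -> V) (w : M) := exists i, [/\ dom i w,
 differentiable (fun x => u (chart_inv i x)) (chart i w) &
 jac (fun x => u (chart_inv i x)) (chart i w) \in unitmx].
Definition ld (g : M -> M) (w : M) := exists j, dom j (g w) /\ nd (fun p => chart j (g p)) w.

Lemma transition_unit i j (p : M) : dom i p -> dom j p ->
 jac (fun x => chart j (chart_inv i x)) (chart i p) \in unitmx.
move=>ip jp.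
have d1 := transition_differentiable ip jp.
have d2 := transition_differentiable jp ip.
have E : \forall x \near chart i p, x *m 1%:M = (chart i \o chart_inv j) ((chart j \o chart_inv i) x).
 have h1 := near_chartK ip; have h2 := near_chart_inv ip (near_dom jp).
 by apply:filterS2 h1 h2 => x e1 e2; rewrite mulmx1 /= chart_invK.
have E0 : (chart j \o chart_inv i) (chart i p) = chart j p by rewrite /= chart_invK.
have [_ H] := jac_comp E0 E d1 d2.
have [_ H2] := jac_lin (1%:M : 'M[R]_m) (chart i p).
have H3 : jac (chart j \o chart_inv i) (chart i p) *m jac (chart i \o chart_inv j) (chart j p) = 1%:M.
 exact:etrans (esym H) H2.
exact:(mulmx1_unit H3).1.
Qed.

Lemma nd_any u w j : nd u w -> dom j w -> differentiable (fun x => u (chart_inv j x)) (chart j w) /\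
 jac (fun x => u (chart_inv j x)) (chart j w) \in unitmx.
move=> [i [iw du uu]] jw.
have d1 := transition_differentiable jw iw.
have E0 : (chart i \o chart_inv j) (chart j w) = chart i w by rewrite /= chart_invK.
have E : \forall x \near chart j w, u (chart_inv j x) = (fun x => u (chart_inv i x)) ((chart i \o chart_inv j) x).
 have := near_chart_inv jw (near_dom iw); apply:filterS => x ix.
 by rewrite chart_invK.
have [d2 H] := jac_comp E0 E d1 du.
split; first exact:d2.
exact:(unitmx_prod H (transition_unit jw iw) uu).
Qed.

Lemma nd_near u v w : (\forall p \near w, u p = v p) -> nd v w -> nd u w.
move=>E [i [iw dv uv]]; exists i.
have E2 : \forall x \near chart i w, u (chart_inv i x) = (fun x => v (chart_inv i x)) (x *m 1%:M).
 by have := near_chart_inv iw E; apply:filterS => x h; rewrite mulmx1.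
have [dl jl] := jac_lin (1%:M : 'M[R]_m) (chart i w).
have [d2 H] := jac_comp (mulmx1 (chart i w)) E2 dl dv.
split; [exact:iw|exact:d2|refine (unitmx_prod H _ uv)].
apply:etrans (congr1 (fun A => A \in unitmx) jl) _; exact:unitmx1.
Qed.

Lemma nd_comp (g : M -> M) u w : {for w, continuous g} -> ld g w -> nd u (g w) ->
 nd (fun p => u (g p)) w.
move=>cg [j [jg [i [iw dg ug]]]] nu; have [du uu] := nd_any nu jg.
exists i.
have E : \forall x \near chart i w, u (g (chart_inv i x)) =
  (fun x => u (chart_inv j x)) ((fun x => chart j (g (chart_inv i x))) x).
 have := near_chart_inv iw (cg _ (near_dom jg)); apply:filterS => x jx.
 by rewrite chart_invK.
have E0 : (fun x => chart j (g (chart_inv i x))) (chart i w) = chart j (g w).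
 by rewrite chart_invK.
have [d2 H] := jac_comp E0 E dg du.
split; [exact:iw|exact:d2|exact:(unitmx_prod H ug uu)].
Qed.

Lemma ld_comp (g h : M -> M) w : {for w, continuous g} -> ld g w -> ld h (g w) ->
 ld (fun p => h (g p)) w.
by move=>cg lg [j [jh nh]]; exists j; split; [exact:jh|exact:(nd_comp cg lg nh)].
Qed.

Lemma ld_near (g h : M -> M) w : (\forall p \near w, g p = h p) -> ld h w -> ld g w.
move=>E [j [jh nh]]; exists j; rewrite (nbhs_singleton E); split; first exact:jh.
apply:nd_near nh; apply:filterS E => p ->; reflexivity.
Qed.

Lemma ld_id w : ld id w.
have [i iw] := dom_cover w; exists i; split => //; exists i.
have E : \forall x \near chart i w, chart i (chart_inv i x) = (fun x => x *m 1%:M) x.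
 by have := near_chartK iw; apply:filterS => x ->; rewrite mulmx1.
have [dl jl] := jac_lin (1%:M : 'M[R]_m) (chart i w).
have [d H] := near_eq_is_diff E dl.
split; [exact:iw|exact:d|].
have [_ H2] := jac_comp (mulmx1 (chart i w)) (filterS (fun x e => etrans e (esym (mulmx1 _))) E) dl dl.
by apply:(unitmx_prod H2); apply:etrans (congr1 (fun A => A \in unitmx) jl) _; exact:unitmx1.
Qed.
End LocalDiffeo.

(** * Radial compressions of a ball *)

Section Compress.
Context {R : realType} {m : nat}.
Local Notation V := 'rV[R]_m.

(** Scaling by [lam c] acts on the normalised squared norm as the Moebius map s -> s / (c + (1 - c)
    s), which fixes 0 and 1 and has inverse of parameter c^-1; beyond s = 1 it is the identity. *)
Definition lam (c s : R) : R := (Num.sqrt (c + (1 - c) * Num.min s 1))^-1.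

Lemma lam_arg (c s : R) : 0 < c -> 0 <= s -> 0 < c + (1 - c) * Num.min s 1.
move=>c0 s0; have [s1|s1] := leP s 1; last by rewrite mulr1 addrC subrK ltr01.
nra.
Qed.

Lemma lam_gt0 (c s : R) : 0 < c -> 0 <= s -> 0 < lam c s.
by move=>c0 s0; rewrite invr_gt0 sqrtr_gt0 lam_arg. Qed.
Lemma lam_far (c s : R) : 1 <= s -> lam c s = 1.
by move=>s1; rewrite /lam min_r// mulr1 addrC subrK sqrtr1 invr1. Qed.

Lemma lam_sq (c s : R) : 0 < c -> 0 <= s -> s <= 1 -> lam c s ^+ 2 = (c + (1 - c) * s)^-1.
move=>c0 s0 s1; have := lam_arg c0 s0; rewrite /lam min_l// => h.
by rewrite exprVn sqr_sqrtr// ltW.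
Qed.

Lemma lam_lt1 (c s : R) : 0 < c -> 0 <= s -> s <= 1 -> s * lam c s ^+ 2 <= 1.
move=>c0 s0 s1; rewrite lam_sq//; have := lam_arg c0 s0; rewrite min_l// => h.
by rewrite ler_pdivrMr// mul1r; nra.
Qed.

Lemma lamK (c s : R) : 0 < c -> 0 <= s -> lam c^-1 (s * lam c s ^+ 2) * lam c s = 1.
move=>c0 s0; have [s1|s1] := ltP 1 s.
 by rewrite (lam_far c (ltW s1)) expr1n !mulr1 lam_far// ltW.
have h := lam_lt1 c0 s0 s1; have ci : 0 < c^-1 by rewrite invr_gt0.
have h0 : 0 <= s * lam c s ^+ 2 by rewrite mulr_ge0// exprn_ge0// ltW// lam_gt0.
have p1 := lam_gt0 c0 s0; have p2 := lam_gt0 ci h0.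
have a0 := lam_arg c0 s0; rewrite min_l// in a0.
have H : (lam c^-1 (s * lam c s ^+ 2) * lam c s) ^+ 2 = 1.
 rewrite exprMn (lam_sq ci h0 h) (lam_sq c0 s0 s1).
 have e1 : c^-1 + (1 - c^-1) * (s / (c + (1 - c) * s)) = (c + (1 - c) * s)^-1.
  by field; rewrite ?gt_eqF.
 by rewrite e1 invrK mulfV// gt_eqF.
by move/eqP: H; rewrite sqrf_eq1 => /orP[/eqP //|/eqP h2]; move: (mulr_gt0 p2 p1); rewrite h2; lra.
Qed.

(** Large c pushes everything below level r < 1 close to the centre; the value of c solves (r + 1) =
    c e (1 - r). *)
Lemma lam_small (r e : R) : 0 <= r -> r < 1 -> 0 < e -> exists2 c : R, 0 < c &
 forall s, 0 <= s -> s <= r -> s * lam c s ^+ 2 < e.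
move=>r0 r1 e0; have d0 : 0 < e * (1 - r) by rewrite mulr_gt0// subr_gt0.
have c0 : 0 < (r + 1) / (e * (1 - r)) by rewrite divr_gt0// ltr_wpDl.
exists ((r + 1) / (e * (1 - r))) => // s s0 sr.
have s1 : s <= 1 by lra.
rewrite lam_sq//; have := lam_arg c0 s0; rewrite min_l// => h.
rewrite ltr_pdivrMr//; set c := _ / _ in c0 h *.
have e1 : c * (e * (1 - r)) = r + 1 by rewrite /c divfK// gt_eqF.
have h1 : c * (e * (1 - r)) <= c * (e * (1 - s)) by rewrite ler_pM2l// ler_pM2l// lerB.
have h2 : 0 <= e * s by rewrite mulr_ge0// ltW.
have -> : e * (c + (1 - c) * s) = c * (e * (1 - s)) + e * s by ring.
by move: (c * (e * (1 - r))) (c * (e * (1 - s))) (e * s) e1 h1 h2 => a b d; lra.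
Qed.

Variables (b : R).
Hypothesis b0 : 0 < b.
Definition nrm (x : V) : R := dot x x / b.
Definition cmp (c : R) (x : V) : V := lam c (nrm x) *: x.

Lemma nrm_ge0 x : 0 <= nrm x. Proof. by rewrite divr_ge0 ?dot_ge0// ltW. Qed.
Lemma nrm_cmp c x : nrm (cmp c x) = nrm x * lam c (nrm x) ^+ 2.
by rewrite {1}/nrm /cmp dotZl dotZr /nrm; ring. Qed.
Lemma cmpK c x : 0 < c -> cmp c^-1 (cmp c x) = x.
by move=>c0; rewrite {1}/cmp nrm_cmp /cmp scalerA lamK ?scale1r// nrm_ge0. Qed.
Lemma cmp_far c x : 1 <= nrm x -> cmp c x = x.
by move=>h; rewrite /cmp lam_far// scale1r. Qed.
Lemma nrm_cmp_le1 c x : 0 < c -> nrm x <= 1 -> nrm (cmp c x) <= 1.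
by move=>c0 x1; rewrite nrm_cmp lam_lt1// nrm_ge0. Qed.

Lemma nrm_cmp_lt1 c x : 0 < c -> nrm x < 1 -> nrm (cmp c x) < 1.
move=>c0 x1; rewrite lt_neqAle nrm_cmp_le1 ?ltW// andbT; apply/eqP => h.
have h3 : 1 <= nrm (cmp c x) by rewrite h.
have h2 := cmp_far c^-1 h3.
by move: h2; rewrite cmpK// => h2; move: x1; rewrite h2 h ltxx.
Qed.

Lemma nrm_cont : continuous nrm.
apply:contM => //.
move=>x; have h : (fun y : V => y) y @[y --> x] --> x by exact:cont_id.
exact:(cvg_dot h h).
Qed.

Lemma nrm_differentiable x : differentiable nrm x.
have -> : nrm = fun x => (x *m x^T) 0 0 * b^-1 by [].
apply:differentiableM; last exact:differentiable_cst.
have di : differentiable (fun y : V => y) x by exact:ex_diff.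
have ct : continuous (fun y : V => y^T) by apply:cont_trmx.
have dt : differentiable (fun y : V => y^T) x.
 exact:linear_differentiable.
have [d1 _] := diff_mulmx di dt.
exact:(differentiable_comp d1 (differentiable_coord _ 0 0)).
Qed.

Lemma cmp_diff c x : 0 < c -> nrm x != 1 -> differentiable (cmp c) x.
move=>c0; rewrite neq_lt => /orP[h|h].
 have E : \forall y \near x, cmp c y = (Num.sqrt (c + (1 - c) * nrm y))^-1 *: y.
  have : \forall y \near x, nrm y < 1 by exact:(cvgr_lt _ (@nrm_cont x)).
  by apply:filterS => y /ltW y1; rewrite /cmp /lam min_l.
 have a0 : 0 < c + (1 - c) * nrm x by have := lam_arg c0 (nrm_ge0 x); rewrite min_l// ltW.
 have d1 : differentiable (fun y => c + (1 - c) * nrm y) x.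
  apply:differentiableD; first exact:differentiable_cst.
  by apply:differentiableM; [exact:differentiable_cst|exact:nrm_differentiable].
 have d2 : differentiable (@Num.sqrt R) (c + (1 - c) * nrm x).
  by apply/derivable1_diffP; have [] := is_derive1_sqrt a0.
 have d3 : differentiable (fun y => (Num.sqrt (c + (1 - c) * nrm y))^-1) x.
  apply:differentiableV; first exact:(differentiable_comp d1 d2).
  by rewrite gt_eqF// sqrtr_gt0.
 have di : differentiable (fun y : V => y) x by exact:ex_diff.
 have d4 : differentiable (fun y => ((Num.sqrt (c + (1 - c) * nrm y))^-1)%:M : 'M[R]_1) x.
  have -> : (fun y => ((Num.sqrt (c + (1 - c) * nrm y))^-1)%:M : 'M[R]_1) =
   fun y => (Num.sqrt (c + (1 - c) * nrm y))^-1 *: (1%:M : 'M[R]_1).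
   by apply/funext => y; rewrite scale_scalar_mx mulr1.
  exact:differentiableZl.
 have [d5 _] := diff_mulmx d4 di.
 apply:(proj1 (near_eq_is_diff _ d5)); apply:filterS E => y ->.
 by rewrite mul_scalar_mx.
have E : \forall y \near x, cmp c y = id y.
 have : \forall y \near x, 1 < nrm y by exact:(cvgr_gt _ (@nrm_cont x)).
 by apply:filterS => y /ltW y1; rewrite cmp_far.
exact:(proj1 (near_eq_is_diff E (ex_diff))).
Qed.

Lemma cmp_jac c x : 0 < c -> nrm x != 1 -> jac (cmp c) x \in unitmx.
move=>c0 x1; have ci : 0 < c^-1 by rewrite invr_gt0.
have x2 : nrm (cmp c x) != 1.
 apply/eqP => h; have h3 : 1 <= nrm (cmp c x) by rewrite h.
 have := cmp_far c^-1 h3; rewrite cmpK// => h2.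
 by move: x1; rewrite h2 h eqxx.
have E : \forall y \near x, (fun v => v *m 1%:M) y = cmp c^-1 (cmp c y).
 by exact:(@filterE _ (nbhs x) _ _ (fun y => etrans (mulmx1 y) (esym (cmpK y c0)))).
have [_ H] := jac_comp erefl E (cmp_diff c0 x1) (cmp_diff ci x2).
have [_ H2] := jac_lin (1%:M : 'M[R]_m) x.
have H3 : jac (cmp c) x *m jac (cmp c^-1) (cmp c x) = 1%:M by exact:etrans (esym H) H2.
exact:(mulmx1_unit H3).1.
Qed.
End Compress.
Section JacShift.
Context {R : realType}.

Lemma unitmx_eq n (A B : 'M[R]_n) : A = B -> B \in unitmx -> A \in unitmx.
by move=> ->. Qed.

Lemma jac_shift n p (f : 'rV[R]_n -> 'rV_p) (a : 'rV_p) x : differentiable f x ->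
 differentiable (fun y => f y + a) x /\ jac (fun y => f y + a) x = jac f x.
move=>df; have dc : differentiable (fun _ : 'rV_n => a) x by exact:differentiable_cst.
split; first exact:differentiableD.
apply/row_matrixP => i; apply:etrans (rowE _ _) _; apply:etrans _ (esym (rowE _ _)).
apply:etrans (esym (jacE _ x _)) _; apply:etrans _ (jacE f x _).
apply:etrans (congr1 (fun F : 'rV_n -> 'rV_p => F (delta_mx 0 i)) (diffD df dc)) _.
have E := diff_cst a x.
apply:etrans (congr1 (fun F : 'rV_n -> 'rV_p => 'd f x (delta_mx 0 i) + F (delta_mx 0 i)) E) _.
exact:addr0.
Qed.

Lemma jac_sub n (a x : 'rV[R]_n) : jac (fun y : 'rV_n => y - a) x = 1%:M.
have [d1 j1] := jac_lin (1%:M : 'M[R]_n) x.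
have [_ j2] := jac_shift (- a) d1.
have E : (fun y : 'rV_n => y - a) = (fun y => y *m 1%:M + - a).
 by apply/funext => y; rewrite mulmx1.
by rewrite E j2.
Qed.

Lemma cont_sub (V : normedModType R) (a : V) : continuous (fun x : V => x - a).
exact:contB. Qed.

Lemma cont_cmp (T : topologicalType) n (f : T -> 'rV_n) (b c : R) : 0 < b -> 0 < c ->
 continuous f -> continuous (fun x => cmp b c (f x)).
move=>b0 c0 cf; apply:contZ => //; apply:contV.
 by move=>x; rewrite gt_eqF// sqrtr_gt0 lam_arg// nrm_ge0.
have cn : continuous (fun x => nrm b (f x)).
 apply:contM => //.
 by move=>x; exact:(cvg_dot (cf x) (cf x)).
have ca : continuous (fun x => c + (1 - c) * Num.min (nrm b (f x)) 1).
 apply:contD => //.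
 apply:contM => //.
 exact:cont_min.
exact:(compc ca (@sqrt_continuous R)).
Qed.

Lemma nrm_sub_cont n (b : R) (a : 'rV_n) : continuous (fun x : 'rV_n => nrm b (x - a)).
apply:contM => //.
have c := @cont_sub 'rV_n a.
by move=>x; exact:(cvg_dot (c x) (c x)).
Qed.
End JacShift.

Lemma near_pull (T S : topologicalType) (g : T -> S) q (A : S -> Prop) : {for q, continuous g} ->
 (\forall y \near g q, A y) -> \forall x \near q, A (g x).
by move=>cg h; exact:cg. Qed.

(** * Compressions extended from a chart to the manifold *)

Section ChartFar.
Context {R : realType} {m : nat} {M : manifold R m}.
Local Notation V := 'rV[R]_m.

(** A compact part of a chart has closed image because M is Hausdorff, so points off the chart have
    neighbourhoods missing it. This is what makes extensions by a constant or by the identity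
    continuous. *)
Lemma chart_far (i : index M) (K : set V) (p : M) : compact K -> K `<=` chart i @` dom i ->
 ~ dom i p -> \forall q \near p, dom i q -> ~ K (chart i q).
move=>cK Ki np.
have cI : compact (chart_inv i @` K).
 apply:continuous_compact; last exact:cK.
 apply:continuous_in_subspaceT => x /set_mem Kx.
 by apply:chart_inv_continuous; exact:Ki.
have clI := compact_closed (@mfd_hausdorff _ _ M) cI.
have : nbhs p (~` (chart_inv i @` K)).
 apply:open_nbhs_nbhs; split; first exact:closed_openC.
 move=> [x Kx xp]; apply:np; have [q iq qx] := Ki _ Kx.
 by rewrite -xp -qx chart_invK.
apply:filterS => q nq iq Kq; apply:nq; exists (chart i q) => //.
by rewrite chart_invK.
Qed.
End ChartFar.
Section Lift.
Context {R : realType} {m : nat} {M : manifold R m}.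
Local Notation V := 'rV[R]_m.
Variables (i : index M) (x0 : V) (b : R).
Hypothesis b0 : 0 < b.
Hypothesis bi : forall x, nrm b (x - x0) <= 1 -> (chart i @` dom i) x.

Definition glift (c : R) (x : V) : V := x0 + cmp b c (x - x0).
Definition lift (c : R) (p : M) : M :=
 if `[< dom i p >] then chart_inv i (glift c (chart i p)) else p.
Let gsub c x : glift c x - x0 = cmp b c (x - x0).
by rewrite /glift addrC addKr. Qed.
Let glift_far c x : 1 <= nrm b (x - x0) -> glift c x = x.
by move=>h; rewrite /glift cmp_far// addrC subrK. Qed.
Let glift_im c p : 0 < c -> dom i p -> (chart i @` dom i) (glift c (chart i p)).
move=>c0 ip; have [h|h] := leP (nrm b (chart i p - x0)) 1.
 by apply:bi; rewrite gsub nrm_cmp_le1.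
by rewrite glift_far ?ltW//; exists p.
Qed.

Lemma lift_dom c p : 0 < c -> dom i p -> dom i (lift c p) /\ chart i (lift c p) = glift c (chart i p).
move=>c0 ip; have [q iq qE] := glift_im c0 ip.
by rewrite /lift asboolT// -qE chart_invK.
Qed.

Lemma lift_ndom c p : ~ dom i p -> lift c p = p.
by move=>np; rewrite /lift asboolF. Qed.

Lemma lift_far c p : (dom i p -> 1 <= nrm b (chart i p - x0)) -> lift c p = p.
move=>h; have [ip|np] := pselect (dom i p); last exact:lift_ndom.
by rewrite /lift asboolT// glift_far ?chart_invK//; exact:h.
Qed.

Lemma liftK c p : 0 < c -> lift c^-1 (lift c p) = p.
move=>c0; have [ip|np] := pselect (dom i p); last by rewrite !lift_ndom.
have [il lE] := lift_dom c0 ip.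
by rewrite {1}/lift asboolT// lE /glift gsub cmpK// addrC subrK chart_invK.
Qed.

Lemma nrm_lift c p : 0 < c -> dom i p -> nrm b (chart i (lift c p) - x0) = nrm b (cmp b c (chart i p - x0)).
by move=>c0 ip; rewrite (lift_dom c0 ip).2 gsub. Qed.

Lemma nrm_bound (u : V) (e : R) : 0 < e -> dot u u < e ^+ 2 -> `|u| < e.
move=>e0 h; rewrite -(@ltr_pXn2r _ 2)// ?nnegrE ?(ltW e0)//.
exact:le_lt_trans (norm_le_dot u) h.
Qed.

Lemma ball_compact : compact [set x | nrm b (x - x0) <= 1].
have cn : continuous (fun x : V => nrm b (x - x0)).
 exact:nrm_sub_cont.
apply:(@subclosed_compact _ _ [set x : V | `|x - x0| <= b + 1]).
- apply:closed_comp (@closed_le _ 1); by move=>x _; exact:cn.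
- exact:cball_compact.
move=>x /= h; apply:ltW; apply:nrm_bound; first by rewrite ltr_wpDl// ltW.
move: h; rewrite /nrm ler_pdivrMr// mul1r => h; apply:le_lt_trans h _.
by rewrite expr2; nra.
Qed.

Lemma ball_far p : ~ dom i p -> \forall q \near p, dom i q -> 1 < nrm b (chart i q - x0).
move=>np; have := chart_far ball_compact bi np.
by apply:filterS => q h iq; have /negP := h iq; rewrite -ltNge.
Qed.

Lemma glift_cont c : 0 < c -> continuous (glift c).
move=>c0; apply:contD => //.
apply:cont_cmp => //; apply:contB => //.
Qed.

Lemma lift_cont c : 0 < c -> continuous (lift c).
move=>c0 p; have [ip|np] := pselect (dom i p).
 have E : \forall q \near p, chart_inv i (glift c (chart i q)) = lift c q.
  by have := near_dom ip; apply:filterS => q iq; rewrite /lift asboolT.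
 have h1 : chart_inv i (glift c (chart i q)) @[q --> p] --> chart_inv i (glift c (chart i p)).
  apply:cvg_comp.
   apply:cvg_comp; first exact:chart_continuous.
   exact:glift_cont.
  by apply:chart_inv_continuous; exact:glift_im.
 have e : lift c p = chart_inv i (glift c (chart i p)) by rewrite /lift asboolT.
 rewrite /continuous_at e; apply:cvg_trans h1.
 exact:near_eq_cvg.
rewrite /continuous_at lift_ndom//.
have E : \forall q \near p, q = lift c q.
 by have := ball_far np; apply:filterS => q h; rewrite lift_far// => iq; exact:ltW (h iq).
exact:cvg_trans (near_eq_cvg E) _; exact:cvg_id.
Qed.

Lemma lift_ld c p : 0 < c -> (dom i p -> nrm b (chart i p - x0) != 1) -> ld (lift c) p.
move=>c0 hp; have [ip|np] := pselect (dom i p); last first.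
 apply:(ld_near) (ld_id p).
 by have := ball_far np; apply:filterS => q h; rewrite lift_far// => iq; exact:ltW (h iq).
exists i; split; first exact:(lift_dom c0 ip).1.
exists i.
have E : \forall x \near chart i p, chart i (lift c (chart_inv i x)) = (fun y => cmp b c y + x0) (x - x0).
 have h1 := near_chartK ip; have h2 := near_chart_inv ip (near_dom ip).
 by apply:filterS2 h1 h2 => x e1 ix; rewrite (lift_dom c0 ix).2 e1 /glift addrC.
have ds : differentiable (fun x : V => x - x0) (chart i p).
 by apply:differentiableB; [exact:ex_diff|exact:differentiable_cst].
have js := jac_sub x0 (chart i p).
have [dc jc] := jac_shift x0 (cmp_diff b0 c0 (hp ip)).
have [d H] := jac_comp erefl E ds dc.
split; [exact:ip|exact:d|].
exact:(unitmx_prod H (unitmx_eq js (unitmx1 _ _)) (unitmx_eq jc (cmp_jac b0 c0 (hp ip)))).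
Qed.
End Lift.

(** * Moving finitely many points into one open set *)

Section Collect.
Context {R : realType} {m : nat} {M : manifold R m}.
Local Notation V := 'rV[R]_m.

Lemma avoid (s : seq R) (a b : R) : a < b -> exists2 c, a < c < b & c \notin s.
elim:s a b => [|x s IH] a b ab.
 by exists ((a + b) / 2); rewrite// !midf_lt.
have [h|h] := ltP a x.
 have [|c /andP[c1 c2] cs] := IH a (Num.min x b); first by rewrite lt_min h.
 move: c2; rewrite lt_min => /andP[cx cb]; exists c; first by rewrite c1.
 by rewrite inE negb_or cs andbT lt_eqF.
have [c /andP[c1 c2] cs] := IH a b ab; exists c; first by rewrite c1.
by rewrite inE negb_or cs andbT gt_eqF// (le_lt_trans h).
Qed.

Lemma gap (I : eqType) (s : seq I) (f : I -> R) : exists2 r : R, 0 <= r < 1 &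
 forall x, x \in s -> f x < 1 -> f x <= r.
elim:s => [|x s [r /andP[r0 r1] IH]]; first by exists 0 => //; rewrite lexx ltr01.
have [h|h] := ltP (f x) 1.
 exists (Num.max r (f x)); first by rewrite le_max r0 gt_max r1.
 move=>y; rewrite inE => /orP[/eqP -> _|ys y1]; first by rewrite le_max lexx orbT.
 by rewrite le_max IH.
exists r; first by rewrite r0.
move=>y; rewrite inE => /orP[/eqP ->|]; first by rewrite ltNge h.
exact:IH.
Qed.

Variables (B0 : set M) (b0 : M).
Hypothesis oB : open B0.
Hypothesis Bb : B0 b0.
(** The differentiability clause is required on a neighbourhood of q, which makes the condition open
    in q ([P_near]). *)
Let P (ps ps' : M -> M) (q : M) := B0 (ps q) /\ \forall x \near q, ld ps' (ps x).
Let Sol (C : seq M) := exists ps ps', [/\ continuous ps, continuous ps', cancel ps ps',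
 cancel ps' ps & forall q, q \in C -> P ps ps' q].
Let P_near ps ps' q : continuous ps -> P ps ps' q -> \forall x \near q, P ps ps' x.
move=>cp [h1 h2].
have n1 : \forall x \near q, B0 (ps x) by apply:cp; apply:open_nbhs_nbhs.
exact:filterS2 n1 (near_join h2) => x a c.
Qed.
(** The set of points that can be added to the list is open and closed. For closedness, let y be a
    limit and y' a nearby solvable point: compressing a chart ball around y' carries y and all
    listed points inside the ball into the region where the solution for y' works, and fixes the
    others. *)
Let Sol_step z C : b0 \in C -> Sol C ->
 (forall A : set M, open A -> closed A -> A b0 -> A z) -> Sol (z :: C).
move=>bC sC H; apply:(H [set z | Sol (z :: C)]).
- rewrite openE => y [ps [ps' [c1 c2 k1 k2 hp]]].
 have := P_near c1 (hp y (mem_head _ _)); apply:filterS => x Px.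
 exists ps, ps'; split => // q; rewrite in_cons => /orP[/eqP -> //|qC].
 by apply:hp; rewrite in_cons qC orbT.
- move=>y cly; have [i iy] := dom_cover y.
 have : nbhs (chart i y) (chart i @` dom i).
  by apply:open_nbhs_nbhs; split; [exact:codom_open|exists y].
 move=> /nbhs_ballE[r r0 hr].
 pose d := r / (4 * m.+1%:R).
 have m1 : 1 <= m.+1%:R :> R by rewrite ler1n.
 have d0 : 0 < d by rewrite divr_gt0// mulr_gt0.
 have dE : m.+1%:R * d = r / 4 by rewrite /d; field; rewrite gt_eqF.
 have nd : nbhs y [set q | dom i q /\ `|chart i q - chart i y| < d].
  have h1 := near_dom iy.
  have h2 : \forall q \near y, `|chart i q - chart i y| < d.
   have : nbhs (chart i y) [set x | `|x - chart i y| < d].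
    by apply:open_nbhs_nbhs; split; [exact:open_ball|rewrite /= subrr normr0].
   exact:(chart_continuous iy).
  exact:filterS2 h1 h2.
 have [y' [[ps [ps' [c1 c2 k1 k2 hp]]] [iy' dy']]] := cly _ nd.
 set x0 := chart i y' in dy'.
 pose dd q := dot (chart i q - x0) (chart i q - x0).
 have r8 : r ^+ 2 / 8 < r ^+ 2 / 4.
  by rewrite ltr_pM2l ?exprn_gt0// ltf_pV2 ?posrE// ltr_nat.
 (* The squared radius avoids the finitely many values at the listed points, so none of them lies on
    the sphere where the compression fails to be differentiable. *)
 have [b /andP[b1 b2] bC'] := avoid [seq dd q | q <- y :: C] r8.
 have bp : 0 < b by apply:lt_trans b1; rewrite divr_gt0// exprn_gt0.
 have bi x : nrm b (x - x0) <= 1 -> (chart i @` dom i) x.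
  rewrite /nrm ler_pdivrMr// mul1r => h; apply:hr.
  have h1 : `|x - x0| < r / 2.
   apply:nrm_bound; first by rewrite divr_gt0.
   apply:le_lt_trans h (lt_le_trans b2 _); by rewrite expr_div_n -natrX.
  have h2 : d <= r / 4 by rewrite -dE ler_pMl.
  have h3 : `|x - chart i y| <= `|x - x0| + `|x0 - chart i y|.
   by apply:le_trans (ler_normD _ _); rewrite addrA subrK.
  apply:(le_lt_trans h3); rewrite [r]splitr; apply:ltrD => //.
  apply:lt_le_trans dy' (le_trans h2 _); by rewrite ler_pM2l// lef_pV2 ?posrE// ler_nat.
 have yb : nrm b (chart i y - x0) < 1.
  rewrite /nrm ltr_pdivrMr// mul1r; apply:lt_trans b1.
  apply:le_lt_trans (dot_le _) _; rewrite distrC.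
  have h1 : `|x0 - chart i y| ^+ 2 <= d ^+ 2 by rewrite ler_pXn2r ?nnegrE ?(ltW d0)// ltW.
  have h2 : m%:R * `|x0 - chart i y| ^+ 2 <= (m.+1%:R * d) * (m.+1%:R * d).
   apply:(@le_trans _ _ (m.+1%:R * d ^+ 2)).
    by rewrite ler_pM//// ler_nat.
   have -> : m.+1%:R * d * (m.+1%:R * d) = m.+1%:R * (m.+1%:R * d ^+ 2) by ring.
   by rewrite ler_peMl// mulr_ge0 ?ltW// exprn_gt0.
  apply:le_lt_trans h2 _; rewrite dE.
  have -> : r / 4 * (r / 4) = r ^+ 2 / 16 by field.
  by rewrite ltr_pM2l ?exprn_gt0// ltf_pV2 ?posrE// ltr_nat.
 have W0 := P_near c1 (hp y' (mem_head _ _)).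
 have /nbhs_ballE[e e0 We] := near_chart_inv iy' W0.
 have e1 : 0 < e ^+ 2 / b by rewrite divr_gt0// exprn_gt0.
 have [rr /andP[rr0 rr1] hrr] := gap (y :: C) (fun q => nrm b (chart i q - x0)).
 (* By [gap], the listed points inside the ball stay below a level rr < 1; c is chosen to bring them
    within e of y'. *)
 have [c c0 hc] := lam_small rr0 rr1 e1.
 have ci : 0 < c^-1 by rewrite invr_gt0.
 pose th := lift i x0 b c; pose th' := lift i x0 b c^-1.
 have cth : continuous th by exact:lift_cont.
 have cth' : continuous th' by exact:lift_cont.
 have Wth q : q \in y :: C -> P ps ps' (th q).
  move=>qC; have [[iq qb]|nq] := pselect (dom i q /\ nrm b (chart i q - x0) < 1).
   have [il lE] := lift_dom bp bi c0 iq.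
   rewrite /th -(chart_invK il); apply:We; apply:nrm_bound => //.
   have := hc _ (nrm_ge0 bp (chart i q - x0)) (hrr q qC qb).
   rewrite -nrm_cmp -(nrm_lift bp bi c0 iq) {1}/nrm ltr_pM2r ?invr_gt0//.
  have far : dom i q -> 1 <= nrm b (chart i q - x0).
   by move=>iq; rewrite leNgt; apply/negP => h; apply:nq.
  rewrite /th lift_far//; apply:hp; move: qC; rewrite in_cons => /orP[/eqP qy|qC].
   by exfalso; apply:nq; rewrite qy.
  by apply/orP; right.
 have nb q : q \in y :: C -> \forall x \near q, dom i x -> nrm b (chart i x - x0) != 1.
  move=>qC; have [iq|nq] := pselect (dom i q); last first.
   by have := ball_far bp bi nq; apply:filterS => x h /h; rewrite neq_lt => ->; rewrite orbT.
  have q1 : nrm b (chart i q - x0) != 1.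
   apply:contra bC'; rewrite /nrm => /eqP h; apply/mapP; exists q => //.
   by rewrite /dd -[LHS]mul1r -h divfK// gt_eqF.
  have cn : {for q, continuous (fun x => nrm b (chart i x - x0))}.
   have cg : continuous (fun x : V => nrm b (x - x0)).
    exact:nrm_sub_cont.
   have h : chart i x @[x --> q] --> chart i q by exact:chart_continuous.
   exact:(cvg_comp _ _ h (cg (chart i q))).
  have : \forall x \near q, nrm b (chart i x - x0) != 1.
   move: q1; rewrite neq_lt => /orP[q1|q1].
    have h : \forall x \near q, nrm b (chart i x - x0) < 1 by exact:(cvgr_lt _ cn).
    by apply:filterS h => x h; rewrite neq_lt h.
   have h : \forall x \near q, 1 < nrm b (chart i x - x0) by exact:(cvgr_gt _ cn).
   by apply:filterS h => x h; rewrite neq_lt h orbT.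
  exact:filterS.
 exists (fun q => ps (th q)), (fun q => th' (ps' q)); split.
 + exact:(compc cth c1).
 + exact:(compc c2 cth').
 + by move=>q; rewrite k1 /th /th' liftK.
 + move=>q; rewrite /th /th' -{1}[c]invrK liftK//.
 move=>q qC; have [P1 P2] := Wth q qC; split; first exact:P1.
 have n1 : \forall x \near q, ld ps' (ps (th x)) by exact:(@near_pull _ _ th q (fun y => ld ps' (ps y)) (cth q) P2).
 apply:filterS2 n1 (nb q qC) => x l1 l2.
 apply:(ld_comp (g := ps') (h := th')); [exact:c2|exact:l1|].
 rewrite k1; apply:(lift_ld bp bi ci) => ith.
 have [ix|nx] := pselect (dom i x); last by have := l2; rewrite /th lift_ndom in ith *.
 rewrite (nrm_lift bp bi c0 ix); have := l2 ix; rewrite !neq_lt => /orP[h|h].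
  by rewrite nrm_cmp_lt1.
 by rewrite cmp_far ?ltW// h orbT.
- case:sC => ps [ps' [c1 c2 k1 k2 hp]]; exists ps, ps'; split => // q.
 by rewrite in_cons => /orP[/eqP ->|]; exact:hp.
Qed.

(** Connectedness is used through open and closed sets: every point of C lies in all those that
    contain b0. Including b0 itself in the list starts the induction. *)
Theorem collect (C : seq M) :
 (forall z, z \in C -> forall A : set M, open A -> closed A -> A b0 -> A z) ->
 exists ps ps' : M -> M, [/\ continuous ps, continuous ps', cancel ps ps', cancel ps' ps &
  forall q, q \in C -> B0 (ps q) /\ ld ps' (ps q)].
move=>H; have : Sol (rcons C b0).
 elim:C H => [|z C IH] H.
  exists id, id; split => //; try by move=> ? ?; exact.
  move=>q; rewrite mem_seq1 => /eqP ->; split => //.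
  by apply:filterE => x; exact:ld_id.
 rewrite rcons_cons; apply:Sol_step.
 - by rewrite mem_rcons mem_head.
 - by apply:IH => y yC; apply:H; rewrite in_cons yC orbT.
 - by apply:H; exact:mem_head.
case=> ps [ps' [c1 c2 k1 k2 hp]]; exists ps, ps'; split => // q qC.
have [h1 h2] := hp q (eq_ind_r is_true (predU1r _ _ qC) (mem_rcons _ _ _)).
split => //; exact:nbhs_singleton h2.
Qed.
End Collect.

(** * Transplanting maps from a chart to the manifold *)

Section Ext.
Context {R : realType} {m : nat} {M : manifold R m}.
Local Notation V := 'rV[R]_m.
Local Notation W := 'rV[R]_(1 + m).
Variables (i : index M) (x0 : V) (rho : R).
Hypothesis rho0 : 0 < rho.
Hypothesis bi : forall x, `|x - x0| <= rho -> (chart i @` dom i) x.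

Definition ext (k : V -> W) (p : M) : W :=
 if `[< dom i p >] then k (rho^-1 *: (chart i p - x0)) else south.

Lemma ext_cont (S : topologicalType) (K : S -> V -> W) :
 continuous (fun z : S * V => K z.1 z.2) -> (forall s x, 1 <= `|x| -> K s x = south) ->
 continuous (fun z : S * M => ext (K z.1) z.2).
move=>cK sK [s p]; have [ip|np] := pselect (dom i p).
 have cs : continuous (fun x : V => rho^-1 *: (x - x0)).
  by apply:contZ => //; apply:contB.
 have c1 : rho^-1 *: (chart i z.2 - x0) @[z --> (s, p)] --> rho^-1 *: (chart i p - x0).
  apply:(@cvg_snd_comp _ _ _ (fun q => rho^-1 *: (chart i q - x0))).
  have h : chart i q @[q --> p] --> chart i p by exact:chart_continuous.
  exact:(cvg_comp _ _ h (cs (chart i p))).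
 have c2 : z.1 @[z --> (s, p)] --> s by exact:cvg_fst.
 have c3 : (z.1, rho^-1 *: (chart i z.2 - x0)) @[z --> (s, p)] --> (s, rho^-1 *: (chart i p - x0)).
  exact:cvg_pair c2 c1.
 have c4 := cvg_comp _ _ c3 (cK (s, rho^-1 *: (chart i p - x0))).
 have E : \forall z \near (s, p), K z.1 (rho^-1 *: (chart i z.2 - x0)) = ext (K z.1) z.2.
  have h : \forall z \near (s, p), dom i z.2 by exact:(cvg_snd (near_dom ip)).
  by apply:filterS h => z iz; rewrite /ext asboolT.
 have e : ext (K s) p = K s (rho^-1 *: (chart i p - x0)) by rewrite /ext asboolT.
 rewrite /continuous_at /= e; apply:cvg_trans c4.
 exact:near_eq_cvg.
have far : \forall q \near p, dom i q -> rho < `|chart i q - x0|.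
 have := chart_far (@cball_compact R m x0 rho) bi np.
 by apply:filterS => q h iq; have /negP := h iq; rewrite -ltNge.
have E : \forall z \near (s, p), south = ext (K z.1) z.2.
 have h : \forall z \near (s, p), dom i z.2 -> rho < `|chart i z.2 - x0| by exact:(cvg_snd far).
 apply:filterS h => z hz; rewrite /ext; case:asboolP => // iz.
 rewrite sK// normrZ gtr0_norm ?invr_gt0// ler_pdivlMl// mulr1 ltW//; exact:hz.
have e : ext (K s) p = south by rewrite /ext asboolF.
rewrite /continuous_at /= e.
by apply:cvg_trans (@near_eq_cvg _ _ (nbhs (s, p)) _ _ _ E) _; exact:cvg_cst.
Qed.

Lemma ext_neq0 k p : (forall x, k x != 0) -> ext k p != 0.
by move=>h; rewrite /ext; case:ifP => // _; exact:south_neq0. Qed.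

(** A compactly supported homotopy may leave the unit ball. Rescaling by c puts its support inside;
    k is first deformed to its rescaling, which stays [south] off the unit ball as the factor is at
    least 1. *)
Lemma ext_homot (k l : V -> W) : (forall x, 1 <= `|x| -> k x = south) -> chomot k l ->
 exists2 c : R, 0 < c & (forall x, 1 <= `|x| -> l (c *: x) = south) /\
  homot (ext k) (ext (fun x => l (c *: x))).
move=>k1 [H [cH nH H0 H1 [r r0 Hr]]]; pose c := Num.max 1 r.
have c1 : 1 <= c by rewrite le_max lexx.
have c0 : 0 < c by exact:lt_le_trans c1.
have cr : r <= c by rewrite le_max lexx orbT.
exists c => //.
have far t x : 1 <= `|x| -> H t (c *: x) = south.
 move=>h; apply:Hr; rewrite normrZ gtr0_norm//; apply:le_trans cr _.
 by rewrite ler_peMr// ltW.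
split; first by move=>x h; rewrite -H1 far.
have ck : continuous k.
 have kE : k = H 0 by apply/funext => x; rewrite H0.
 rewrite kE; exact:cont_slice.
have nk x : k x != 0 by rewrite -H0.
have a1 s : 1 <= 1 + clamp s * (c - 1).
 have /andP[h0 h1] := clamp01 s.
 by rewrite lerDl mulr_ge0// subr_ge0.
apply:(@homot_trans _ _ _ (ext (fun x => k (c *: x)))).
 pose K s x := k ((1 + clamp s * (c - 1)) *: x).
 exists (fun s p => ext (K s) p); split.
 - apply:ext_cont.
   apply:compc ck; apply:contZ; last exact:cont_snd (@cont_id _).
   apply:contD => //.
   apply:contM => //.
   by apply:cont_clamp; exact:cont_fst (@cont_id _).
  move=>s x h; apply:k1; rewrite normrZ ger0_norm; last exact:le_trans (a1 s).
  apply:le_trans h _; rewrite ler_peMl//.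
 - by move=>t p; apply:ext_neq0 => x; exact:nk.
 - move=>p; congr (ext _ p); apply/funext => x.
  by rewrite /K clamp_le0// mul0r addr0 scale1r.
 - move=>p; congr (ext _ p); apply/funext => x.
  by rewrite /K clamp_ge1// mul1r addrC subrK.
exists (fun s p => ext (fun x => H s (c *: x)) p); split.
- apply:(@ext_cont R (fun s x => H s (c *: x))); last exact:far.
 apply:cont_comp2 => //.
  exact:cont_fst (@cont_id _).
 by apply:contZ => //; exact:cont_snd (@cont_id _).
- by move=>t p; apply:ext_neq0 => x; exact:nH.
- by move=>p; congr (ext _ p); apply/funext => x; rewrite H0.
- by move=>p; congr (ext _ p); apply/funext => x; rewrite H1.
Qed.
End Ext.

(** * Common regular values of finitely many maps *)

Section SardSeq.
Context {R : realType}.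

(** The critical values of each map form a closed set, so a value avoiding the earlier ones can be
    moved slightly to avoid the next; the radius d keeps this room. *)
Lemma sard_seq n (I : eqType) (s : seq I) (U K : I -> set 'rV_n) (g : I -> 'rV_n -> 'rV_n) :
 (forall i, i \in s -> [/\ open (U i), compact (K i), K i `<=` U i, Ck_on 1 (U i) (g i) &
  forall x, K i x -> jac (g i) x \notin unitmx]) ->
 forall (c : 'rV_n) (rho : R), 0 < rho -> exists2 y, `|y - c| < rho &
  exists2 d : R, 0 < d & forall y', `|y' - y| < d -> forall i, i \in s -> ~ (g i @` K i) y'.
elim:s => [|i s IH] H c rho r0.
 by exists c; [rewrite subrr normr0|exists 1 => // y' _ i; rewrite in_nil].
have Hs j : j \in s -> j \in i :: s by rewrite in_cons => ->; rewrite orbT.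
have [y yc [d d0 yd]] := IH (fun j js => H j (Hs j js)) c rho r0.
have [oU cK KU C1 crit] := H i (mem_head _ _).
pose e := Num.min d (rho - `|y - c|).
have e0 : 0 < e by rewrite lt_min d0 subr_gt0.
have [y2 y2y ny2] := Sard oU cK KU C1 crit y e0.
have cI : compact (g i @` K i).
 apply:continuous_compact; last exact:cK.
 apply:continuous_in_subspaceT => x /set_mem Kx.
 exact:(Ck_on0 (Ck_onS C1) (KU _ Kx)).
have clI := compact_closed (@norm_hausdorff _ _) cI.
have : nbhs y2 (~` (g i @` K i)) by apply:open_nbhs_nbhs; split; [exact:closed_openC|].
move=> /nbhs_ballE[d2 d20 hd2]; move: y2y; rewrite lt_min => /andP[h1 h2].
exists y2.
 have -> : y2 - c = (y2 - y) + (y - c) by rewrite addrA subrK.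
 by apply:le_lt_trans (ler_normD _ _) _; rewrite -ltrBrDr.
exists (Num.min d2 (d - `|y2 - y|)); first by rewrite lt_min d20 subr_gt0.
move=>y'; rewrite lt_min => /andP[h3 h4] j; rewrite in_cons => /orP[/eqP ->|js].
 exact:hd2.
apply:yd => //.
have -> : y' - y = (y' - y2) + (y2 - y) by rewrite addrA subrK.
by apply:le_lt_trans (ler_normD _ _) _; rewrite -ltrBrDr.
Qed.

Lemma near_neq0 n (g : 'rV[R]_n -> R) y : {for y, continuous g} -> g y != 0 ->
 \forall x \near y, g x != 0.
move=>cg g0; have cg' : g x @[x --> y] --> g y by exact:cg.
exact:(cvgr_neq0 _ cg').
Qed.

Lemma cone_diff n m k (sg : 'cV_n) (L : 'M[R]_(n, m)) (h : 'rV_m -> 'rV_k) (y : 'rV_n) :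
 differentiable h (y *m L) ->
 forall u : 'rV_n, u *m jac (fun y : 'rV_n => (y *m sg) *m h (y *m L)) y =
  (y *m sg) *m (u *m L *m jac h (y *m L)) + (u *m sg) *m h (y *m L).
move=>dh u.
have [dL jL] := jac_lin L y.
have cs : continuous (mulmxr sg : 'rV_n -> 'M[R]_1).
 exact:cont_mulmx.
have ds : differentiable (mulmxr sg) y := linear_differentiable y cs.
have E1 : \forall z \near y, h (z *m L) = h (z *m L) by exact:filterE.
have [dhL jhL] := jac_comp erefl E1 dL dh.
have [_ H] := diff_mulmx ds dhL.
apply:etrans (esym (jacE _ _ _)) _; apply:etrans (H u) _.
apply:etrans (congr2 (fun a b => (y *m sg) *m a + b *m h (y *m L)) (jacE (fun z => h (z *m L)) y u)
 (congr1 (fun F : 'rV_n -> 'M[R]_1 => F u) (diff_lin y cs))) _.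
have E2 : u *m jac (fun z => h (z *m L)) y = u *m L *m jac h (y *m L).
 by apply:etrans (congr1 (fun A => u *m A) jhL) _; rewrite jL mulmxA.
exact:(congr1 (fun A => (y *m sg) *m A + (u *m sg) *m h (y *m L)) E2).
Qed.
End SardSeq.

(** * Smooth maps on M and regular directions *)

Section Generic.
Context {R : realType} {m D : nat} {M : manifold R m}.
Variables (f : smooth_map M (euclidean R D)) (fE : smooth_embedding f) (Mc : closed_manifold M) (p_ : M).
Let F : M -> 'rV[R]_D := f.

(** Finite covers of M, obtained from balls around points of f(M) by [F_near]. *)
Lemma compact_list (P : M -> set M) : (forall z, nbhs z (P z)) ->
 exists s : seq M, forall p, exists2 z, z \in s & P z p.
move=>nP; have H z : exists r : R, 0 < r /\ forall q, `|F q - F z| < r -> P z q.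
 by have [r r0 hr] := F_near fE (nP z); exists r.
have [r hr] := choice H.
have cc := range_compact (f := f) Mc; rewrite compact_cover in cc.
pose B z := [set y : 'rV_D | `|y - F z| < r z].
have oF z : [set: M] z -> open (B z) by move=> _; exact:open_ball.
have KF : range f `<=` cover [set: M] B.
 by move=> _ [z _ <-]; exists z => //; rewrite /B /= subrr normr0; have [] := hr z.
have [E EK cov] := cc _ [set: M] B oF KF.
exists (finmap.enum_fset E) => p; have [|z /= zE zp] := cov (f p); first by exists p.
by exists z; have [_] := hr z; exact.
Qed.

Definition csm k (h : M -> 'rV[R]_k) :=
 forall i : index M, smooth_on (chart i @` dom i) (fun x => h (chart_inv i x)).

(** The map is extended to the tube by composing with the nearest point projection, then
    approximated in R^D. *)
Lemma smooth_approx_M p q (h : M -> 'M[R]_(p, q)) (e : R) : continuous h -> 0 < e ->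
 exists (O : set 'rV_D) (g' : 'rV_D -> 'M[R]_(p, q)),
  [/\ open O, range F `<=` O, smooth_on O g' & forall x, `|g' (F x) - h x| <= e].
move=>ch e0; pose g y := h (tubpi f Mc p_ y).
have cg x : range F x -> {for x, continuous g}.
 move=> [p1 _ <-]; have c1 := tubpi_cont (tubU_F fE p1).
 have c1' : tubpi f Mc p_ y @[y --> F p1] --> tubpi f Mc p_ (F p1) by exact:c1.
 exact:(cvg_comp _ _ c1' (ch _)).
have [Q [g' [oO KO sg hg]]] := smooth_approx (range_compact Mc) cg e0.
exists Q, g'; split => // p0; have := hg (F p0); rewrite /g tubpiK//; apply; by exists p0.
Qed.

Lemma norm_lower k (h : M -> 'rV[R]_k) : continuous h -> (forall p, h p != 0) ->
 exists2 e : R, 0 < e & forall p, e < `|h p|.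
move=>ch nh; pose g y := `|h (tubpi f Mc p_ y)|.
have cg x : range F x -> {for x, continuous g}.
 move=> [p1 _ <-]; have c1 := tubpi_cont (tubU_F fE p1).
 have c1' : tubpi f Mc p_ y @[y --> F p1] --> tubpi f Mc p_ (F p1) by exact:c1.
 have cn := cont_norm ch.
 exact:(@cvg_comp _ _ _ (tubpi f Mc p_) (fun p => `|h p|) _ _ _ c1' (cn _)).
have g0 x : range F x -> 0 < g x by move=> _; rewrite normr_gt0.
have [e e0 he] := pos_lower (range_compact Mc) cg g0.
exists e => // p; have := he (F p); rewrite /g tubpiK//; apply; by exists p.
Qed.

Lemma csm_comp k (O : set 'rV_D) (g : 'rV_D -> 'rV_k) : open O -> range F `<=` O ->
 smooth_on O g -> csm (fun p => g (F p)) /\ continuous (fun p => g (F p)).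
move=>oO FO sg; split.
 move=>i r; apply:(@Ck_comp _ _ _ _ r (chart i @` dom i) O (fun x => F (chart_inv i x)) g) => //.
 - exact:has_basis_mx.
 - exact:codom_open.
 - by move=>x _; apply:FO; exists (chart_inv i x).
 - exact:F_smooth.
move=>p; have c1 : F q @[q --> p] --> F p by exact:F_cont.
have Op : O (F p) by apply:FO; exists p.
exact:(cvg_comp _ _ c1 (Ck_on0 (sg 0%N) Op)).
Qed.

Lemma smooth_homot k (h : M -> 'rV_k) : continuous h -> (forall p, h p != 0) ->
 exists h' : M -> 'rV_k, [/\ csm h', continuous h', forall p, h' p != 0 & homot h h'].
move=>ch nh; have [e e0 he] := norm_lower ch nh.
have [Q [g [oO FO sg hg]]] := smooth_approx_M ch e0.
have [s c] := csm_comp oO FO sg.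
have H : homot h (fun p => g (F p)).
 apply:homot_line => // p t /andP[t0 t1]; apply/eqP => E.
 have E2 : h p = - (t *: (g (F p) - h p)).
  by apply/eqP; rewrite -subr_eq0; apply/eqP; rewrite -[RHS]E; apply/rowP => j; rewrite !mxE; ring.
 have := he p; rewrite E2 normrN normrZ ger0_norm// ltNge => /negP; apply.
 by apply:le_trans (hg p); rewrite ler_piMl.
exists (fun p => g (F p)); split => // p.
exact:homot_neq0l (homot_sym H) p.
Qed.

Lemma chart_cover : exists (s : seq M) (i : M -> index M) (r : M -> R),
 [/\ forall z x, `|x - chart (i z) z| <= r z -> (chart (i z) @` dom (i z)) x, forall z, dom (i z) z &
  forall p, exists2 z, z \in s & dom (i z) p /\ `|chart (i z) p - chart (i z) z| <= r z].
have H z : exists ir : index M * R, [/\ 0 < ir.2, dom ir.1 z &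
  forall x, `|x - chart ir.1 z| <= ir.2 -> (chart ir.1 @` dom ir.1) x].
 have [i iz] := dom_cover z.
 have : nbhs (chart i z) (chart i @` dom i).
  by apply:open_nbhs_nbhs; split; [exact:codom_open|exists z].
 move=> /nbhs_ballE[r r0 hr]; exists (i, r / 2); split => //=; first by rewrite divr_gt0.
 move=>x h; apply:hr; apply:le_lt_trans h _; by rewrite ltr_pdivrMr// ltr_pMr// ltr1n.
have [ir hir] := choice H.
have nP z : nbhs z [set p | dom (ir z).1 p /\ `|chart (ir z).1 p - chart (ir z).1 z| <= (ir z).2].
 have [r0 iz _] := hir z.
 have h2 : \forall q \near z, `|chart (ir z).1 q - chart (ir z).1 z| < (ir z).2.
  have : nbhs (chart (ir z).1 z) [set x | `|x - chart (ir z).1 z| < (ir z).2].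
   by apply:open_nbhs_nbhs; split; [exact:open_ball|rewrite /= subrr normr0].
  exact:(chart_continuous iz).
 by apply:filterS2 (near_dom iz) h2 => q iq /ltW.
have [s hs] := compact_list nP.
by exists s, (fun z => (ir z).1), (fun z => (ir z).2); split => // z; have [] := hir z.
Qed.
Section ConeRegular.
Variables (n : nat) (sg : 'cV[R]_n) (L : 'M[R]_(n, m)) (sg' : 'rV[R]_n) (L' : 'M[R]_(m, n)).
Hypotheses (ss : sg' *m sg = 1%:M) (sL : sg' *m L = 0) (Ls : L' *m sg = 0) (LL : L' *m L = 1%:M).
Variable u : M -> 'rV[R]_n.
Hypotheses (su : csm u) (cu : continuous u) (nu : forall p, u p != 0).

(** The positively homogeneous extension of u in a chart: [L] reads the chart coordinate, [sg] the
    scale. It brings source and target to the same dimension n, so that Sard's theorem speaks about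
    the directions of u. *)
Definition cone (i : index M) (y : 'rV[R]_n) : 'rV[R]_n := (y *m sg) *m u (chart_inv i (y *m L)).

Lemma cone_regular : (0 < n)%N -> exists2 q, q != 0 & forall p lm, 0 < lm -> u p = lm *: q ->
 exists i y, [/\ dom i p, y *m L = chart i p, y *m sg = (lm^-1)%:M & jac (cone i) y \in unitmx].
move=>n0; have [e e0 he] := norm_lower cu nu.
have [s [i [r [hr iz hs]]]] := chart_cover.
pose U z := [set y : 'rV_n | (chart (i z) @` dom (i z)) (y *m L)].
have cL : continuous (mulmxr L : 'rV_n -> 'rV_m).
 exact:cont_mulmx.
have csg : continuous (mulmxr sg : 'rV_n -> 'M[R]_1).
 exact:cont_mulmx.
have oU z : open (U z) by have := @codom_open R m M (i z); exact:(open_comp (fun y _ => cL y)).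
have sC z : smooth_on (U z) (cone (i z)).
 move=>k; apply:Ck_mulmx => //.
  exact:(@smooth_on_linear R _ _ (U z) (mulmxr sg) csg k).
 exact:(@Ck_linr _ _ _ _ k (chart (i z) @` dom (i z)) (fun x => u (chart_inv (i z) x))
  (mulmxr L) (@codom_open R m M (i z)) cL (su (i z) k)).
pose rr z := `|sg'| + m%:R * ((r z + `|chart (i z) z|) * `|L'|).
pose B z := [set y : 'rV_n | `|y - 0| <= rr z] `&` [set y | `|y *m L - chart (i z) z| <= r z].
have cdet z y : U z y -> {for y, continuous (fun y => \det (jac (cone (i z)) y))}.
 move=>Uy.
 have h : Ck_on 0 (U z) (fun y => \det (jac (cone (i z)) y)).
  apply:Ck_det => //; apply:Ck_mxP => // a b.
  apply:(@Ck_ext _ _ _ _ _ _ (fun y => 'd (cone (i z)) y (delta_mx 0 a) 0 b)) => //.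
   by move=>x _; rewrite jac_entry.
  by apply:Ck_entry => //; have [_ h] := sC z 1%N; exact:h.
 exact:(Ck_on0 h).
pose K z := B z `&` [set y | jac (cone (i z)) y \notin unitmx].
have BU z : B z `<=` U z by move=>y [_ h]; exact:hr.
have clB z : closed (B z).
 apply:closedI.
  apply:(closed_comp _ (@closed_le _ (rr z))) => y _.
  exact:(norm_sub_cont).
 have c : continuous (fun y : 'rV[R]_n => `|y *m L - chart (i z) z|).
  by apply:cont_norm; apply:contB => //; exact:cL.
 exact:(closed_comp _ (@closed_le _ (r z))) => y _; exact:c.
have cK z : compact (K z).
 apply:(@subclosed_compact _ _ [set y : 'rV_n | `|y - 0| <= rr z]).
 - move=>y cly.
  have By : B z y.
   by apply:clB => A nA; have [x [[Bx _] Ax]] := cly A nA; exists x.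
  split => //=; apply/negP => uy.
  have d0 : \det (jac (cone (i z)) y) != 0 by rewrite -unitfE -unitmxE.
  have nA : \forall x \near y, \det (jac (cone (i z)) x) != 0.
   exact:(near_neq0 (cdet z y (BU z y By)) d0).
  have [x [[_ /= Kx] Ax]] := cly _ nA.
  by move: Kx; rewrite unitmxE unitfE => /negP; apply.
 - exact:cball_compact.
 - by move=>y [[h _] _].
have HS z : z \in s -> [/\ open (U z), compact (K z), K z `<=` U z, Ck_on 1 (U z) (cone (i z)) &
  forall x, K z x -> jac (cone (i z)) x \notin unitmx].
 move=> _; split => //.
 - by move=>y [By _]; exact:BU.
 - exact:sC.
 - by move=>y [].
(* The value q is sought near a vector of norm e / 2, hence nonzero of norm at most e < |u|. Then u
   p = lm q forces lm >= 1, and the point y of scale 1 / lm stays in the compact set [B z] to which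
   Sard's theorem was applied. *)
pose c0 : 'rV_n := const_mx (e / 2).
have nc0 : `|c0| <= e / 2.
 by apply:mx_norm_le; [rewrite divr_ge0// ltW|move=>a b; rewrite mxE ger0_norm// divr_ge0// ltW].
have e4 : 0 < e / 4 by rewrite divr_gt0.
have [q qc [d d0 hq]] := sard_seq HS c0 e4.
have q0 : q != 0.
 apply:contraTneq qc => ->; rewrite sub0r normrN -leNgt.
 apply:le_trans (entry_le c0 0 (Ordinal n0)); rewrite mxE ger0_norm ?divr_ge0 ?ltW//.
 by rewrite ltr_pM2l// ltf_pV2 ?posrE// ltr_nat.
have qe : `|q| <= e.
 have -> : q = (q - c0) + c0 by rewrite subrK.
 apply:le_trans (ler_normD _ _) _; move: qc nc0; move: (`|q - c0|) (`|c0|) => a b h1 h2; lra.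
exists q => // p lm lm0 up.
have [z zs [ip xr]] := hs p.
pose y := lm^-1 *: sg' + chart (i z) p *m L'.
have yL : y *m L = chart (i z) p.
 by rewrite /y mulmxDl -scalemxAl sL scaler0 add0r -mulmxA LL mulmx1.
have ys : y *m sg = (lm^-1)%:M.
 by rewrite /y mulmxDl -scalemxAl ss -mulmxA Ls mulmx0 addr0 scale_scalar_mx mulr1.
exists (i z), y; split => //; apply:contrapT => /negP ny.
have gy : cone (i z) y = q.
 by rewrite /cone ys yL chart_invK// up mul_scalar_mx scalerA mulVf ?scale1r// gt_eqF.
have lm1 : lm^-1 <= 1.
 rewrite invf_le1//; have := he p; rewrite up normrZ gtr0_norm// => h.
 have : `|q| < lm * `|q| by exact:le_lt_trans h.
 by rewrite ltr_pMl ?normr_gt0// => /ltW.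
have r0 : 0 <= r z by exact:le_trans xr.
apply:(hq q _ z zs); first by rewrite subrr normr0.
exists y => //; split => //; split; last by rewrite /= yL.
rewrite /= subr0 /y; apply:le_trans (ler_normD _ _) _; apply:lerD.
 by rewrite normrZ gtr0_norm ?invr_gt0// ler_piMl.
apply:le_trans (norm_mulmx _ _) _; rewrite ler_wpM2l// ler_wpM2r//.
have -> : chart (i z) p = (chart (i z) p - chart (i z) z) + chart (i z) z by rewrite subrK.
by apply:le_trans (ler_normD _ _) _; rewrite lerD2r.
Qed.
End ConeRegular.
End Generic.

(** * Maps to a sphere of larger dimension *)

Section NullHomot.
Context {R : realType} {m D : nat} {M : manifold R m}.
Variables (f : smooth_map M (euclidean R D)) (fE : smooth_embedding f) (Mc : closed_manifold M) (p_ : M).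

(** With n = m + 2 the cone ignores one coordinate, so its Jacobian is always singular and
    regularity of q means that u misses the ray through q; segments then lead to - q. *)
Lemma null_homot (h : M -> 'rV[R]_(m + 2)) : continuous h -> (forall p, h p != 0) ->
 exists2 w : 'rV_(m + 2), w != 0 & homot h (fun _ => w).
move=>ch nh; have [u [su cu nu hu]] := smooth_homot fE Mc p_ ch nh.
pose d2 : 'rV[R]_2 := delta_mx 0 0.
pose sg : 'cV_(m + 2) := col_mx 0 d2^T.
pose L : 'M[R]_(m + 2, m) := col_mx 1%:M 0.
pose sg' : 'rV_(m + 2) := row_mx 0 d2.
pose L' : 'M[R]_(m, m + 2) := row_mx 1%:M 0.
have dd : d2 *m d2^T = 1%:M.
 by rewrite /d2 trmx_delta mul_delta_mx; apply/matrixP => a b; rewrite !mxE !ord1.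
have ss : sg' *m sg = 1%:M by rewrite mul_row_col mul0mx add0r.
have sL : sg' *m L = 0 by rewrite mul_row_col mul0mx mulmx0 addr0.
have Ls : L' *m sg = 0 by rewrite mul_row_col mulmx0 mul0mx addr0.
have LL : L' *m L = 1%:M by rewrite mul_row_col mulmx1 mul0mx addr0.
have n0 : (0 < m + 2)%N by rewrite addn2.
have [q q0 hq] := cone_regular fE Mc p_ ss sL Ls LL su cu nu n0.
have no p lm : 0 < lm -> u p != lm *: q.
 move=>lm0; apply/eqP => up; have [i [y [ip yL ys uy]]] := hq p lm lm0 up.
 pose w : 'rV[R]_(m + 2) := row_mx 0 (delta_mx 0 1).
 have du : differentiable (fun x => u (chart_inv i x)) (y *m L).
  by rewrite yL; have [h1 _] := su i 1%N; apply:h1; exists p.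
 have H : w *m jac (cone sg L u i) y = 0.
  apply:etrans (cone_diff sg du w) _.
  have -> : w *m L = 0 by rewrite mul_row_col mul0mx mulmx0 addr0.
  have -> : w *m sg = 0.
   by rewrite mul_row_col mul0mx add0r /d2 trmx_delta mul_delta_mx_0.
  by rewrite !mul0mx mulmx0 addr0.
 have w0 : w = 0 by rewrite -[w](mulmxK uy) H mul0mx.
 have /matrixP/(_ 0 (rshift m 1)) := w0; rewrite row_mxEr !mxE !eqxx /= => /eqP.
 by rewrite oner_eq0.
exists (- q); first by rewrite oppr_eq0.
apply:homot_trans hu _; apply:homot_line => //.
move=>p t /andP[t0 t1]; apply/eqP => E.
have E2 : (1 - t) *: u p = t *: q by apply/eqP; rewrite -subr_eq0 -scalerN; apply/eqP.
have [t2|t2] := eqVneq t 1.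
 by move: E2; rewrite t2 subrr scale0r scale1r => /esym/eqP; rewrite (negPf q0).
have t3 : 0 < 1 - t by rewrite subr_gt0 lt_neqAle t2.
have [t4|t4] := eqVneq t 0.
 by move: E2; rewrite t4 subr0 scale1r scale0r => /eqP; rewrite (negPf (nu p)).
have t5 : 0 < t by rewrite lt_neqAle eq_sym t4.
have := no p (t / (1 - t)) (divr_gt0 t5 t3); apply/negP; rewrite negbK; apply/eqP.
by rewrite mulrC -scalerA -E2 scalerA mulVf ?scale1r// gt_eqF.
Qed.
End NullHomot.

(** * Generic zeros over the first axis *)

Section GenericZeros.
Context {R : realType} {m' D : nat}.
Local Notation m := (2 + m')%N.
Context {M : manifold R m}.
Variables (f : smooth_map M (euclidean R D)) (fE : smooth_embedding f) (Mc : closed_manifold M) (p_ : M).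
Local Notation W := 'rV[R]_(1 + m).

(** With n = 1 + m, regularity of the cone over q is transversality of u to the ray through q. A
    path of invertible matrices turns this ray into the first axis. *)
Lemma generic_zeros (h : M -> W) : continuous h -> (forall p, h p != 0) ->
 exists h2 : M -> W, [/\ continuous h2, forall p, h2 p != 0, homot h h2 &
  forall p, rsubmx (h2 p) = 0 -> 0 < hq (h2 p) -> nd (fun x => rsubmx (h2 x)) p].
move=>ch nh; have [u [su cu nu hu]] := smooth_homot fE Mc p_ ch nh.
pose sg : 'cV[R]_(1 + m) := col_mx 1%:M 0.
pose L : 'M[R]_(1 + m, m) := col_mx 0 1%:M.
pose sg' : 'rV[R]_(1 + m) := row_mx 1%:M 0.
pose L' : 'M[R]_(m, 1 + m) := row_mx 0 1%:M.
have ss : sg' *m sg = 1%:M by rewrite mul_row_col mulmx1 mulmx0 addr0.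
have sL : sg' *m L = 0 by rewrite mul_row_col mulmx0 mul0mx addr0.
have Ls : L' *m sg = 0 by rewrite mul_row_col mul0mx mulmx0 addr0.
have LL : L' *m L = 1%:M by rewrite mul_row_col mulmx1 mul0mx add0r.
have [q q0 hreg] := cone_regular fE Mc p_ ss sL Ls LL su cu nu isT.
have e0 : sg' != 0.
 by apply/eqP => /matrixP/(_ 0 0); rewrite !mxE; case:fintype.splitP => // j _; rewrite !mxE !ord1 => /eqP; rewrite oner_eq0.
have [B [G [cG uG G0 G1]] qB] := glc_row q0 e0.
have uB : B \in unitmx by rewrite -G0.
pose h2 : M -> W := fun p => u p *m B.
have ch2 : continuous h2 by apply:cont_mulmx.
have hh2 : homot h2 u.
 exists (fun t p => u p *m G t); split.
 - by apply:cont_mulmx; [exact:cont_snd cu|exact:cont_fst cG].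
 - move=>t p; apply:contra (nu p) => /eqP E.
  by rewrite -[u p](mulmxK (uG t)) E mul0mx.
 - by move=>p; rewrite G0.
 - by move=>p; rewrite G1 mulmx1.
have nh2 := homot_neq0l hh2.
exists h2; split => //; first exact:homot_trans hu (homot_sym hh2).
have rE w : rsubmx w = w *m L by rewrite -{2}[w]hsubmxK mul_row_col mulmx0 mulmx1 add0r.
move=>p r0 hq0; set lm := hq (h2 p) in hq0.
have up : u p = lm *: q.
 rewrite -[u p](mulmxK uB) -/(h2 p) [h2 p]hqE r0 -/lm.
 have -> : row_mx lm%:M 0 = lm *: sg' :> W by rewrite /sg' scale_row_mx scaler0 scale_scalar_mx mulr1.
 by rewrite qB -!scalemxAl mulmxK.
have [i [y [ip yL ys uy]]] := hreg p lm hq0 up.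
exists i.
pose k x := u (chart_inv i x).
have dk : differentiable k (chart i p).
 by have [h1 _] := su i 1%N; apply:h1; exists p.
have [dl jl] := jac_lin (B *m L) (k (chart i p)).
have E : \forall x \near chart i p, rsubmx (h2 (chart_inv i x)) = (fun v => v *m (B *m L)) (k x).
 by apply:filterE => x; rewrite rE /h2 mulmxA.
have [d2 j2] := jac_comp erefl E dk dl.
split; [exact:ip|exact:d2|].
have j3 : jac (fun x => rsubmx (h2 (chart_inv i x))) (chart i p) = jac k (chart i p) *m (B *m L).
 by apply:etrans j2 _; rewrite jl.
apply:(unitmx_eq j3); apply:inj_unitmx => v; rewrite !mulmxA => v0.
set J := jac k (chart i p) in v0.
pose tau := hq (v *m J *m B).
have vJ : v *m J = tau *: q.
 rewrite -[v *m J](mulmxK uB) [v *m J *m B]hqE rE v0 -/tau.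
 have -> : row_mx tau%:M 0 = tau *: sg' :> W by rewrite /sg' scale_row_mx scaler0 scale_scalar_mx mulr1.
 by rewrite qB -!scalemxAl mulmxK.
have dk' : differentiable k (y *m L) by rewrite yL.
(* A kernel vector v of the chart derivative moves u along q only; the scale component is chosen to
   cancel this motion, which gives a kernel vector of the cone. *)
pose w : 'rV_(1 + m) := row_mx (- (lm^-1 * tau * lm^-1))%:M v.
have wL : w *m L = v by rewrite mul_row_col mulmx0 mulmx1 add0r.
have ws : w *m sg = (- (lm^-1 * tau * lm^-1))%:M by rewrite mul_row_col mulmx1 mulmx0 addr0.
have H : w *m jac (cone sg L u i) y = 0.
 apply:etrans (cone_diff sg dk' w) _.
 rewrite wL ws ys yL -/J vJ !mul_scalar_mx /k chart_invK// up !scalerA -scalerDl.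
 rewrite (_ : _ + _ = 0) ?scale0r// mulNr mulrVK ?subrr// unitfE gt_eqF//.
have w0 : w = 0 by rewrite -[w](mulmxK uy) H mul0mx.
by rewrite -wL w0 mul0mx.
Qed.
End GenericZeros.

(** * Finiteness of nondegenerate zeros *)

Section FiniteZeros.
Context {R : realType} {m D : nat} {M : manifold R m}.
Variables (f : smooth_map M (euclidean R D)) (fE : smooth_embedding f) (Mc : closed_manifold M).
Local Notation W := 'rV[R]_(1 + m).

Definition zero_at (h : M -> W) p := rsubmx (h p) = 0 /\ 0 < hq (h p).

Lemma nd_isolated (u : M -> 'rV_m) p : nd u p -> u p = 0 -> \forall x \near p, u x = 0 -> x = p.
move=> [i [ip du uu]] up; set k := fun x => u (chart_inv i x) in du uu.
have [mu mu0 hmu] := unit_lower uu.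
have mu2 : 0 < mu / 2 by rewrite divr_gt0.
have /nbhs_ballE[r r0 hr] := diff_eps du mu2.
have n1 : \forall x \near p, `|chart i x - chart i p| < r.
 have : nbhs (chart i p) [set x | `|x - chart i p| < r].
  by apply:open_nbhs_nbhs; split; [exact:open_ball|rewrite /= subrr normr0].
 exact:(chart_continuous ip).
apply:filterS2 (near_dom ip) n1 => x ix xr ux0.
have := hr (chart i x - chart i p); rewrite subr0 => /(_ xr).
have E1 : k (chart i x - chart i p + chart i p) = 0 by rewrite subrK /k chart_invK.
have E2 : k (chart i p) = 0 by rewrite /k chart_invK.
rewrite E1 E2 subrr sub0r normrN => h.
have h2 : `|(chart i x - chart i p) *m jac k (chart i p)| <= mu / 2 * `|chart i x - chart i p|.
 by apply:le_trans h; rewrite (jacE k (chart i p)).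
have h3 := le_trans (hmu _) h2.
have h4 : `|chart i x - chart i p| = 0.
 apply/eqP; rewrite -[_ == 0]negbK -normr_gt0 normr_id; apply/negP => h5.
 by move: h3; rewrite ler_pM2r//; lra.
have h5 : chart i x = chart i p by apply/eqP; rewrite -subr_eq0 -normr_eq0 h4.
by rewrite -(chart_invK ix) h5 chart_invK.
Qed.

Lemma zeros_finite (h : M -> W) : continuous h -> (forall p, h p != 0) ->
 (forall p, zero_at h p -> nd (fun x => rsubmx (h x)) p) ->
 exists2 Z : seq M, uniq Z & forall p, p \in Z <-> zero_at h p.
move=>ch nh hz.
have cr : continuous (fun p => rsubmx (h p)) by exact:cont_rsubmx.
have cq : continuous (fun p => hq (h p)) by exact:(@cont_coord R M 1 1 (fun p => lsubmx (h p)) 0 0 (cont_lsubmx ch)).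
have nP z : nbhs z [set x | zero_at h x -> x = z].
 have [hz0|nz] := pselect (zero_at h z).
  by have := nd_isolated (hz z hz0) hz0.1; apply:filterS => x hx [x0 _]; exact:hx.
 have [r0|r0] := eqVneq (rsubmx (h z)) 0.
  have q0 : hq (h z) < 0.
   rewrite ltNge le_eqVlt; apply/negP => /orP[/eqP q0|q0]; last exact:nz.
   by have := nh z; rewrite [h z]hqE r0 -q0 row_eq0 !eqxx.
  have hn : \forall x \near z, hq (h x) < 0 by exact:(cvgr_lt _ (cq z)).
  by apply:filterS hn => x hx [_ hx2]; move: (lt_trans hx hx2); rewrite ltxx.
 have cn := cont_norm cr.
 have n0 : 0 < `|rsubmx (h z)| by rewrite normr_gt0.
 have hn : \forall x \near z, 0 < `|rsubmx (h x)| by exact:(cvgr_gt _ (cn z)).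
 by apply:filterS hn => x hx [hx2 _]; move: hx; rewrite hx2 normr0 ltxx.
have [s hs] := compact_list fE Mc nP.
exists (undup [seq z <- s | `[< zero_at h z >]]); first exact:undup_uniq.
move=>p; rewrite mem_undup mem_filter; split; first by move=> /andP[/asboolP].
move=>hp; apply/andP; split; first exact/asboolP.
by have [z zs zp] := hs p; rewrite (zp hp).
Qed.
End FiniteZeros.

Lemma scalar_unit (R : realType) n (a : R) : 0 < a -> (a%:M : 'M[R]_n) \in unitmx.
by move=>a0; rewrite unitmxE det_scalar unitfE expf_neq0// gt_eqF. Qed.

(** * Gluing homotopies over open and closed sets *)

Section Glue.
Context {R : realType} {T : topologicalType}.

Lemma cont_glue (S : topologicalType) k (A : set T) (f g : S * T -> 'rV[R]_k) : open A -> closed A ->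
 continuous f -> continuous g -> continuous (fun z => if `[< A z.2 >] then f z else g z).
move=>oA cA cf cg [s p]; have [Ap|nAp] := pselect (A p).
 have E : \forall z \near (s, p), f z = (if `[< A z.2 >] then f z else g z).
  have h : \forall z \near (s, p), A z.2 by apply:(cvg_snd (open_nbhs_nbhs (conj oA Ap))).
  by apply:filterS h => z Az; rewrite asboolT.
 rewrite /continuous_at /= asboolT//.
 exact:cvg_trans (@near_eq_cvg _ _ (nbhs (s, p)) _ _ _ E) (cf (s, p)).
have E : \forall z \near (s, p), g z = (if `[< A z.2 >] then f z else g z).
 have h : \forall z \near (s, p), (~` A) z.2.
  exact:(cvg_snd (open_nbhs_nbhs (conj (closed_openC cA) nAp))).
 by apply:filterS h => z Az; rewrite asboolF.
rewrite /continuous_at /= asboolF//.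
exact:cvg_trans (@near_eq_cvg _ _ (nbhs (s, p)) _ _ _ E) (cg (s, p)).
Qed.

Definition glue k (A : set T) (u v : T -> 'rV[R]_k) p := if `[< A p >] then u p else v p.

Lemma glue_cont k (A : set T) (u v : T -> 'rV_k) : open A -> closed A ->
 continuous u -> continuous v -> continuous (glue A u v).
move=>oA cA cu cv.
exact:(@cont_slice _ _ R (fun _ => glue A u v) 0 (cont_glue oA cA (cont_snd cu) (cont_snd cv))).
Qed.

Lemma homot_glue k (A : set T) (u v u' v' : T -> 'rV_k) : open A -> closed A ->
 homot u v -> homot u' v' -> homot (glue A u u') (glue A v v').
move=>oA cA [H [cH nH H0 H1]] [G [cG nG G0 G1]].
exists (fun t => glue A (H t) (G t)); split.
- exact:(cont_glue oA cA cH cG).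
- by move=>t p; rewrite /glue; case:ifP.
- by move=>p; rewrite /glue H0 G0.
- by move=>p; rewrite /glue H1 G1.
Qed.

Lemma homot_neg k (u v : T -> 'rV[R]_k) : homot u v -> homot (fun p => - u p) (fun p => - v p).
move=> [H [cH nH H0 H1]]; exists (fun t p => - H t p); split.
- exact:contN.
- by move=>t p; rewrite oppr_eq0.
- by move=>p; rewrite H0.
- by move=>p; rewrite H1.
Qed.
End Glue.

(** * A map homotopic to its negative is null-homotopic *)

Section Hopf.
Context {R : realType} {m' : nat}.
Local Notation m := (2 + m')%N.
Context {M : manifold R m}.
Variables (f : smooth_map M (euclidean R (m + 2))) (fE : smooth_embedding f) (Mc : closed_manifold M) (p_ : M).
Local Notation V := 'rV[R]_m.
Local Notation W := 'rV[R]_(1 + m).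
Local Notation X := 'rV[R]_(m + 2).

Definition tub_chart (i : index M) (y : X) := exists (U : set X) (xl : X -> V),
 [/\ open U, U y, U `<=` tubU f, smooth_on U xl &
  forall y', U y' -> dom i (tubpi f Mc p_ y') /\ chart i (tubpi f Mc p_ y') = xl y'].

(** To be supplied by the degree argument on a tube: a transplanted power map of nonzero exponent is
    not homotopic to its negative. *)
Hypothesis no_model : forall (i : index M) (x0 : V) (rho s r : R) (d : nat) (L : 'M[R]_m),
 0 < rho -> (forall x, `|x - x0| <= rho -> (chart i @` dom i) x) ->
 tub_chart i (f (chart_inv i x0)) -> s ^+ 2 = 1 -> 0 < r -> L \in unitmx ->
 (forall x, 1 <= `|x| -> Eb 0 r (Pd s d.+1) (x *m L) = south) ->
 ~ homot (ext i x0 rho (fun x => Eb 0 r (Pd s d.+1) (x *m L)))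
     (fun p => - ext i x0 rho (fun x => Eb 0 r (Pd s d.+1) (x *m L)) p).

Lemma south_line (w : W) (a : R) : w != 0 -> 0 <= a <= 1 ->
 (rsubmx w = 0 -> 0 < hq w -> a = 0) -> (1 - a) *: w + a *: south != 0.
move=>w0 /andP[a0 a1] h; apply/eqP; rewrite {1}[w]hqE /south !scale_row_mx add_row_mx scaler0 addr0.
rewrite !scale_scalar_mx -raddfD /= => /eqP; rewrite row_eq0 => /andP[/eqP h1 h2].
have [a2|a2] := eqVneq a 1; first by move: h1; rewrite a2; lra.
have a3 : 0 < 1 - a by rewrite subr_gt0 lt_neqAle a2.
move: h2; rewrite scaler_eq0 gt_eqF//= => /eqP r0.
have q0 : hq w != 0.
 by apply:contra w0 => /eqP q0; rewrite [w]hqE r0 q0 row_eq0 !eqxx.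
have [q1|q1] := ltP 0 (hq w).
 by move: h1; rewrite (h r0 q1) => h1; move: q0; rewrite (_ : hq w = 0)//; lra.
have q2 : hq w < 0 by rewrite lt_neqAle q0.
have : (1 - a) * hq w < 0 by rewrite pmulr_rlt0.
by move=>h3; lra.
Qed.

Lemma hopf_no_zero (h : M -> W) : continuous h -> (forall p, h p != 0) ->
 (forall p, ~ zero_at h p) -> homot h (fun _ => south).
move=>ch nh hz; apply:homot_line => //.
move=>p t t01; apply:south_line => // h1 h2; by case:(hz p).
Qed.
Let gd (h : M -> W) := [/\ continuous h, forall p, h p != 0 &
 forall p, zero_at h p -> nd (fun x => rsubmx (h x)) p].
Section Local.
Variables (h : M -> W) (i : index M) (x0 : V) (rho : R).
Hypothesis rho0 : 0 < rho.
Hypothesis bi : forall x, `|x - x0| <= rho -> (chart i @` dom i) x.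
Hypothesis gh : gd h.
Hypothesis hz : forall p, zero_at h p -> dom i p /\ `|chart i p - x0| < rho / 2.
Let tau (x : V) : R := clamp (2 * `|x| - 1).
Let aff (x : V) : V := x *m rho%:M + x0.
(** The map h read in the chart and damped to [south] between the radii 1/2 and 1, where h has no
    zero; its transplant [ext] is therefore homotopic to h. *)
Let k (x : V) : W := (1 - tau x) *: h (chart_inv i (aff x)) + tau x *: south.
Let co (p : M) : V := rho^-1 *: (chart i p - x0).
Let coK p : dom i p -> chart_inv i (aff (co p)) = p.
move=>ip; rewrite /aff /co mul_mx_scalar scalerA mulfV ?scale1r ?subrK ?chart_invK// gt_eqF//.
Qed.
Let affK p : aff (co p) = chart i p.
by rewrite /aff /co mul_mx_scalar scalerA mulfV ?scale1r ?subrK// gt_eqF. Qed.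
Let aff_jac x : differentiable aff x /\ jac aff x \in unitmx.
have [d1 j1] := jac_lin (rho%:M : 'M[R]_m) x; have [d2 j2] := jac_shift x0 d1.
split; first exact:d2.
apply:(unitmx_eq j2); apply:(unitmx_eq j1).
exact:(scalar_unit _ rho0).
Qed.
Let aff_sub x : `|aff x - x0| = rho * `|x|.
by rewrite /aff addrK mul_mx_scalar normrZ gtr0_norm. Qed.
Let coE x p : chart i p = aff x -> co p = x.
by move=>E; rewrite /co E /aff addrK mul_mx_scalar scalerA mulVf ?scale1r// gt_eqF. Qed.
Let tau_cont : continuous tau.
apply:cont_clamp; apply:contB => //.
by apply:contM => //; apply:cont_norm.
Qed.
Let aff_im x : `|x| <= 1 -> exists p, dom i p /\ chart i p = aff x.
move=>x1; have [|p ip pE] := @bi (aff x); last by exists p.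
by rewrite aff_sub ler_piMr// ltW.
Qed.
Let k_far x : 1 <= `|x| -> k x = south.
move=>x1; have t1 : tau x = 1 by apply:clamp_ge1; lra.
by rewrite /k t1 subrr scale0r scale1r add0r.
Qed.
Let k_cont : continuous k.
move=>x; have [x1|x1] := leP `|x| 1; last first.
 have E : \forall y \near x, south = k y.
  have c : continuous (fun y : V => `|y|) by apply:cont_norm.
  have h2 : \forall y \near x, 1 < `|y| by exact:(cvgr_gt _ (c x)).
  by apply:filterS h2 => y /ltW y1; rewrite k_far.
 rewrite /continuous_at (k_far (ltW x1)).
 by apply:cvg_trans (@near_eq_cvg _ _ (nbhs x) _ _ _ E) _; exact:cvg_cst.
have [p [ip pE]] := aff_im x1.
have ca : continuous aff.
 apply:contD => //.
 exact:cont_mulmx.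
have c1 : chart_inv i (aff y) @[y --> x] --> chart_inv i (aff x).
 apply:(@cvg_comp _ _ _ aff (chart_inv i) _ _ _ (ca x)).
 by apply:chart_inv_continuous; exists p.
have [ch _ _] := gh.
have c2 : h (chart_inv i (aff y)) @[y --> x] --> h (chart_inv i (aff x)).
 exact:(@cvg_comp _ _ _ (fun y => chart_inv i (aff y)) h _ _ _ c1 (ch _)).
have c3 : (1 - tau y) @[y --> x] --> 1 - tau x.
 have cc : continuous (fun y : V => 1 - tau y) by apply:contB => //; exact:tau_cont.
 exact:cc.
have c4 : tau y *: south @[y --> x] --> tau x *: (south : W).
 have cc : continuous (fun y : V => tau y *: (south : W)) by apply:contZ => //; exact:tau_cont.
 exact:cc.
exact:(cvgD (cvgZ c3 c2) c4).
Qed.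
Let k_co p : dom i p -> k (co p) = (1 - tau (co p)) *: h p + tau (co p) *: south.
by move=>ip; rewrite /k coK. Qed.
Let tau_zero p : zero_at h p -> tau (co p) = 0 /\ `|co p| < 2^-1.
move=> /hz[ip pr]; have h1 : `|co p| < 2^-1.
 by rewrite /co normrZ gtr0_norm ?invr_gt0// ltr_pdivrMl.
by split => //; apply:clamp_le0; lra.
Qed.
Let h_ext : homot h (ext i x0 rho k).
have [ch nh nz] := gh.
apply:homot_line => //.
 have c : continuous (fun z : R * V => k z.2) by exact:cont_snd k_cont.
 have cE := @ext_cont R m M i x0 rho rho0 bi R (fun _ => k) c (fun _ => k_far).
 exact:(@cont_slice _ _ R (fun _ => ext i x0 rho k) 0 cE).
move=>p t /andP[t0 t1]; rewrite /ext; case:asboolP => ip; last first.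
 by apply:south_line; rewrite ?t0// => z1 z2; have [] := hz (conj z1 z2).
rewrite -/(co p) k_co//.
have /andP[a0 a1] := clamp01 (2 * `|co p| - 1); rewrite -/(tau (co p)) in a0 a1.
have -> : (1 - t) *: h p + t *: ((1 - tau (co p)) *: h p + tau (co p) *: south) =
 (1 - t * tau (co p)) *: h p + (t * tau (co p)) *: south.
 by apply/rowP => j; rewrite !mxE; ring.
apply:south_line => //.
 by rewrite mulr_ge0// mulr_ile1.
by move=>z1 z2; rewrite (tau_zero (conj z1 z2)).1 mulr0.
Qed.
Let k_good (Z : seq M) : (forall p, p \in Z <-> zero_at h p) -> good k [seq co p | p <- Z].
move=>hZ; have [ch nh nz] := gh.
have tx x : `|x| < 1 -> 0 < 1 - tau x.
 move=>x1; rewrite subr_gt0 /tau /clamp gt_max ltr01 /= gt_min.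
 by apply/orP; right; lra.
have k_cases x : `|x| < 1 -> exists p, [/\ dom i p, co p = x & k x = (1 - tau x) *: h p + tau x *: south].
 move=>x1; have [p [ip pE]] := aff_im (ltW x1).
 by exists p; split => //; [exact:coE|rewrite -{1}(coE pE) k_co// (coE pE)].
have kz x : rsubmx (k x) = 0 -> 0 < hq (k x) -> x \in [seq co p | p <- Z].
 move=>r0 q0; have [x1|x1] := ltP `|x| 1; last first.
  by move: q0; rewrite k_far// /hq /south row_mxKl !mxE ltr0N1.
 have [p [ip cp kE]] := k_cases x x1; apply/mapP; exists p => //; apply/hZ.
 have t0 := tx x x1; have /andP[a0 a1] := clamp01 (2 * `|x| - 1); rewrite -/(tau x) in a0 a1.
 move: r0 q0; rewrite kE /hq /south !linearD !linearZ /= row_mxKr row_mxKl scaler0 addr0 => /eqP.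
 rewrite scaler_eq0 gt_eqF//= => /eqP r0; rewrite !mxE mulrN1 => q0; split => //.
 have : 0 < (1 - tau x) * hq (h p) by move: q0; rewrite /hq mxE; lra.
 by rewrite pmulr_rgt0.
split; [exact:k_cont|by exists 1| |exact:kz|].
 move=>x; have [x1|x1] := ltP `|x| 1; last by rewrite k_far// south_neq0.
 have [p [ip cp kE]] := k_cases x x1; rewrite kE; apply:south_line => //; first exact:clamp01.
 by move=>z1 z2; rewrite -cp (tau_zero (conj z1 z2)).1.
move=> _ /mapP[p /hZ pz ->]; have [ip pr] := hz pz; have [t0 c2] := tau_zero pz.
have kE := k_co ip; rewrite t0 subr0 scale1r scale0r addr0 in kE.
have [r0 q0] := pz; split; [by rewrite kE|by rewrite kE|].
have [dh uh] := nd_any (nz p pz) ip.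
have E : \forall x \near co p, rsubmx (k x) = (fun y => rsubmx (h (chart_inv i y))) (aff x).
 have c : continuous (fun y : V => `|y|) by apply:cont_norm.
 have h2 : \forall y \near co p, `|y| < 2^-1 by exact:(cvgr_lt _ (c (co p))).
 apply:filterS h2 => y y1; have ty : tau y = 0 by apply:clamp_le0; lra.
 by rewrite /k ty subr0 scale1r scale0r addr0.
have [da ua] := aff_jac (co p).
have [d3 j3] := jac_comp (affK p) E da dh.
split; first exact:d3.
exact:(unitmx_prod j3 ua uh).
Qed.

Lemma hopf_local : tub_chart i (f (chart_inv i x0)) -> homot h (fun p => - h p) ->
 homot h (fun _ => south).
move=>tc hh; have [ch nh nz] := gh.
have [Z uZ hZ] := zeros_finite fE Mc ch nh nz.
have gk := k_good hZ.
have uz : uniq [seq co p | p <- Z].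
 rewrite map_inj_in_uniq// => p q /hZ /hz[ip _] /hZ /hz[iq _] E.
 by rewrite -(coK ip) E coK.
have [H|[s [d [r [L [s1 r0 dL H]]]]]] := local_model uz gk.
 have [c c0 [_ h2]] := ext_homot rho0 bi k_far H.
 apply:homot_trans h_ext _; apply:homot_ext h2 => // p.
 by rewrite /ext; case:ifP.
have [c c0 [far h2]] := ext_homot rho0 bi k_far H.
have E : (fun x : V => Eb 0 r (Pd s d.+1) ((c *: x) *m L)) = fun x => Eb 0 r (Pd s d.+1) (x *m (c *: L)).
 by apply/funext => x; rewrite -scalemxAl scalemxAr.
rewrite E in h2; have h3 := homot_trans h_ext h2.
exfalso; apply:(@no_model i x0 rho s r d (c *: L)) => //.
- by case:s1 => ->; rewrite ?sqrrN expr1n.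
- by rewrite unitmxE detZ unitrM unitrX ?unitfE ?gt_eqF.
- by move=>x x1; have := far x x1; rewrite -scalemxAl scalemxAr.
apply:homot_trans (homot_sym h3) _; apply:homot_trans hh _.
exact:homot_neg h3.
Qed.
End Local.
(** Induction on the number of zeros. If an open and closed set separates two zeros, h is replaced
    by [south] on either side, leaving fewer zeros each time, and the two homotopies are glued.
    Otherwise all zeros can be collected in a small chart ball. *)
Let hopf_gd N (h : M -> W) (Z : seq M) : (size Z <= N)%N -> gd h -> (forall p, zero_at h p -> p \in Z) ->
 homot h (fun p => - h p) -> homot h (fun _ => south).
elim:N h Z => [|N IH] h Z sZ gh hZ hh.
 have [ch nh _] := gh; apply:hopf_no_zero => // p /hZ.
 by move: sZ; rewrite leqn0 size_eq0 => /eqP ->.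
have [ch nh nz] := gh.
have [[b0 b0z]|nz0] := pselect (exists p, zero_at h p); last first.
 by apply:hopf_no_zero => // p pz; apply:nz0; exists p.
have [[A [oA cA Ab [z zz nAz]]]|con] := pselect (exists A : set M, [/\ open A, closed A, A b0 &
  exists2 z, zero_at h z & ~ A z]).
 (* Needed to keep the hypothesis that the map is homotopic to its negative after gluing with
    [south]. *)
 have sneg : homot (fun _ : M => south : W) (fun _ => - south).
  by apply:homot_cst; rewrite ?oppr_eq0 south_neq0.
 have zs p (u v : M -> W) : zero_at (glue A u v) p ->
   (A p /\ zero_at u p) \/ (~ A p /\ zero_at v p).
  by rewrite /zero_at /glue; case:asboolP => Ap; [left|right].
 have nsouth p : ~ zero_at (fun _ : M => south : W) p.
  by case=> _; rewrite /hq /south row_mxKl mxE eqxx ltr0N1.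
 have lt_size B z1 : z1 \in Z -> ~ B z1 -> (size [seq p <- Z | `[< B p >]] <= N)%N.
  move=>z1Z nB; rewrite -ltnS; apply:leq_trans sZ.
  rewrite size_filter -(count_predC (fun p => `[< B p >]) Z) -addn1 leq_add2l -has_count.
  by apply/hasP; exists z1 => //=; apply/asboolP.
 have nearA p (B : set M) : open B -> B p -> \forall x \near p, B x by move=>oB Bp; exact:open_nbhs_nbhs.
 have H1 : homot (glue A h (fun _ => south)) (fun _ => south).
  apply:(IH _ [seq p <- Z | `[< A p >]]).
  - exact:(lt_size A z (hZ z zz) nAz).
  - split; first exact:glue_cont.
    by move=>p; rewrite /glue; case:ifP => // _; exact:south_neq0.
   move=>p /zs[[Ap pz]|[_ /nsouth//]].
   apply:nd_near (nz p pz); have := nearA p A oA Ap; apply:filterS => x Ax.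
   by rewrite /glue asboolT.
  - move=>p /zs[[Ap pz]|[_ /nsouth//]]; rewrite mem_filter hZ// andbT; exact/asboolP.
  have := homot_glue oA cA hh sneg; apply:homot_ext => // p; by rewrite /glue; case:ifP.
 have H2 : homot (glue A (fun _ => south) h) (fun _ => south).
  apply:(IH _ [seq p <- Z | `[< ~ A p >]]).
  - exact:(lt_size _ b0 (hZ b0 b0z)).
  - split; first exact:glue_cont.
    by move=>p; rewrite /glue; case:ifP => // _; exact:south_neq0.
   move=>p /zs[[_ /nsouth//]|[Ap pz]].
   apply:nd_near (nz p pz); have := nearA p (~` A) (closed_openC cA) Ap; apply:filterS => x Ax.
   by rewrite /glue asboolF.
  - move=>p /zs[[_ /nsouth//]|[Ap pz]]; rewrite mem_filter hZ// andbT; exact/asboolP.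
  have := homot_glue oA cA sneg hh; apply:homot_ext => // p; by rewrite /glue; case:ifP.
 have := homot_glue oA cA H1 H2; apply:homot_ext => p; rewrite /glue; by case:ifP => E; rewrite ?E.
have [i [U [xl [oU Uy UU sxl Hxl]]]] := tubpi_chart Mc p_ (tubU_F fE b0).
have [ib xb] := Hxl _ Uy; rewrite tubpiK// in ib xb.
set x0 := chart i b0 in xb.
have : nbhs x0 (chart i @` dom i) by apply:open_nbhs_nbhs; split; [exact:codom_open|exists b0].
move=> /nbhs_ballE[r r0 hr].
have r20 : 0 < r / 2 by rewrite divr_gt0.
have bi x : `|x - x0| <= r / 2 -> (chart i @` dom i) x.
 move=>hx; apply:hr; apply:le_lt_trans hx _; by rewrite ltr_pdivrMr// ltr_pMr// ltr1n.
pose B0 := [set p | dom i p /\ `|chart i p - x0| < r / 2 / 2].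
have oB : open B0.
 rewrite openE => p [ip pr]; have : nbhs (chart i p) [set x | `|x - x0| < r / 2 / 2].
  by apply:open_nbhs_nbhs; split; [exact:open_ball|].
 by move=> /(chart_continuous ip); apply:filterS2 (near_dom ip) => q.
have Bb : B0 b0 by split => //; rewrite subrr normr0 divr_gt0.
have [Z2 uZ2 hZ2] := zeros_finite fE Mc ch nh nz.
(* The map is conjugated to h composed with ps', whose zeros lie in B0; they remain nondegenerate
   since ps' is a local diffeomorphism there. *)
have [|ps [ps' [cp cp' k1 k2 hps]]] := @collect R m M B0 b0 oB Bb Z2.
 move=>z /hZ2 zz A oA cA Ab; apply:contrapT => nA; apply:con.
 by exists A; split => //; exists z.
have zps p : zero_at (fun q => h (ps' q)) p -> B0 p /\ ld ps' p.
 move=>pz; have h1 : ps' p \in Z2 by apply/hZ2.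
 by have := hps _ h1; rewrite k2.
have g2 : gd (fun q => h (ps' q)).
 split; [exact:compc cp' ch|by move=>p; exact:nh|].
 move=>p pz; have [_ lp] := zps p pz.
 exact:(nd_comp (cp' p) lp (nz _ pz)).
have H2 : homot (fun q => h (ps' q)) (fun _ => south).
 apply:(hopf_local r20 bi g2).
 - by move=>p /zps[].
 - by exists U, xl; rewrite chart_invK.
 - exact:(homot_comp cp' hh).
have := homot_comp cp H2; apply:homot_ext => // p /=; by rewrite k1.
Qed.

Theorem hopf (h : M -> W) : continuous h -> (forall p, h p != 0) ->
 homot h (fun p => - h p) -> homot h (fun _ => south).
move=>ch nh hh; have [h2 [ch2 nh2 hh2 nz2]] := generic_zeros fE Mc p_ ch nh.
have nz p : zero_at h2 p -> nd (fun x => rsubmx (h2 x)) p by move=> [z1 z2]; exact:nz2.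
have [Z uZ hZ] := zeros_finite fE Mc ch2 nh2 nz.
apply:(homot_trans hh2); apply:(@hopf_gd (size Z) h2 Z) => //.
 by move=>p /hZ.
apply:(homot_trans (homot_sym hh2)); apply:(homot_trans hh).
exact:homot_neg hh2.
Qed.
End Hopf.

(** * Jacobian of the power map *)

Section JacRules.
Context {R : realType}.

Lemma jac_row n p q (f : 'rV[R]_n -> 'rV_p) (g : 'rV_n -> 'rV_q) x :
 differentiable f x -> differentiable g x ->
 differentiable (fun y => row_mx (f y) (g y)) x /\
 jac (fun y => row_mx (f y) (g y)) x = row_mx (jac f x) (jac g x).
move=>df dg.
pose P1 : 'M[R]_(p, p + q) := row_mx 1%:M 0.
pose P2 : 'M[R]_(q, p + q) := row_mx 0 1%:M.
have E y : row_mx (f y) (g y) = f y *m P1 + g y *m P2.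
 by rewrite /P1 /P2 !mul_mx_row !mulmx0 !mulmx1 add_row_mx addr0 add0r.
have [d1 j1] := jac_lin P1 (f x); have [d2 j2] := jac_lin P2 (g x).
have n1 : \forall z \near x, f z *m P1 = f z *m P1 by exact:filterE.
have n2 : \forall z \near x, g z *m P2 = g z *m P2 by exact:filterE.
have [d3 j3] := jac_comp erefl n1 df d1; have [d4 j4] := jac_comp erefl n2 dg d2.
have -> : (fun y => row_mx (f y) (g y)) = (fun y => f y *m P1) + (fun y => g y *m P2).
 by apply/funext => y; rewrite E.
split; first exact:differentiableD.
have -> : row_mx (jac f x) (jac g x) = jac f x *m P1 + jac g x *m P2.
 by rewrite /P1 /P2 !mul_mx_row !mulmx0 !mulmx1 add_row_mx addr0 add0r.
apply/row_matrixP => i; apply:etrans (rowE _ _) _; apply:etrans _ (esym (rowE _ _)).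
apply:etrans (esym (jacE _ x _)) _.
apply:etrans (congr1 (fun F : 'rV_n -> 'rV_(p + q) => F (delta_mx 0 i)) (diffD d3 d4)) _.
apply:etrans (congr2 (fun a b => a + b) (jacE (fun z => f z *m P1) x _) (jacE (fun z => g z *m P2) x _)) _.
apply:etrans (congr2 (fun a b => delta_mx 0 i *m a + delta_mx 0 i *m b) j3 j4) _.
by rewrite j1 j2 mulmxDr.
Qed.
End JacRules.
Section JacPd.
Context {R : realType} {m' : nat}.
Local Notation m := (2 + m')%N.
Local Notation V := 'rV[R]_m.

Lemma cZB (s : R) (u z : 'rV_2) : cZ s u - cZ s z = cZ s (u - z).
by apply/matrixP => i j; rewrite !mxE; ring. Qed.

Lemma sum_pow (A : 'M[R]_2) k :
 \sum_(i < k) (A ^+ (k.-1 - i) * A ^+ i) = k%:R *: (A ^+ k.-1 : 'M[R]_2).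
transitivity (\sum_(i < k) (A ^+ k.-1 : 'M[R]_2)).
 apply:eq_bigr => i _; rewrite -exprD; congr (_ ^+ _); apply:subnK.
 case:k i => [|k'] i; first by case:i.
 by rewrite -ltnS; exact:(ltn_ord i).
by rewrite sumr_const card_ord scaler_nat.
Qed.

(** The factorisation u^k - z^k = (u - z) (sum of mixed powers), made possible by commutativity,
    together with [diff_vanish]. *)
Lemma jac_cpow (s : R) k (z : 'rV_2) :
 differentiable (fun u : 'rV_2 => e0C *m (cZ s u ^+ k : 'M[R]_2)) z /\
 jac (fun u : 'rV_2 => e0C *m (cZ s u ^+ k : 'M[R]_2)) z =
  cD s *m (k%:R *: (cZ s z ^+ k.-1 : 'M[R]_2)).
pose Q u : 'M[R]_2 := \sum_(i < k) ((cZ s u ^+ (k.-1 - i) : 'M[R]_2) *m (cZ s z ^+ i : 'M[R]_2)).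
have cQ : continuous (fun u => cD s *m Q u).
 apply:cont_mulmx => //.
 apply:cont_sum => i _.
 have c1 : continuous (fun u : 'rV_2 => cZ s u ^+ (k.-1 - i) : 'M[R]_2).
  exact:cont_cpow.
 exact:cont_mulmx; exact:c1.
have E : \forall u \near z, e0C *m (cZ s u ^+ k : 'M[R]_2) - e0C *m (cZ s z ^+ k : 'M[R]_2) =
  (u - z) *m (cD s *m Q u).
 apply:filterE => u.
 rewrite -mulmxBr (@subrXX_comm _ (cZ s u) (cZ s z)); last exact:cZC.
 transitivity (e0C *m (cZ s (u - z) *m Q u)); first by rewrite -cZB.
 by rewrite mulmxA e0C_cZ mulmxA.
have [d1 j1] := diff_vanish (cQ z) E.
have [d2 j2] := jac_shift (e0C *m (cZ s z ^+ k : 'M[R]_2)) d1.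
have e : (fun u : 'rV_2 => e0C *m (cZ s u ^+ k : 'M[R]_2)) =
  fun u => (e0C *m (cZ s u ^+ k : 'M[R]_2) - e0C *m (cZ s z ^+ k : 'M[R]_2)) + e0C *m (cZ s z ^+ k : 'M[R]_2).
 by apply/funext => u; rewrite subrK.
have j3 : jac (fun u : 'rV[R]_2 => e0C *m (cZ s u ^+ k : 'M[R]_2)) z = cD s *m Q z.
 exact:etrans (congr1 (fun F => jac F z) e) (etrans j2 j1).
split; first by rewrite e.
apply:etrans j3 _; congr (_ *m _); exact:sum_pow.
Qed.

(** The complex derivative (d + 1) z^d acts with determinant (d + 1)^2 |z|^(2d), so the sign is s
    wherever the determinant is nonzero. *)
Lemma jac_Pd (s : R) d (x : V) : s ^+ 2 = 1 -> differentiable (Pd s d.+1) x /\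
 \det (jac (Pd s d.+1) x) = s * (d.+1%:R ^+ 2 * dot (lsubmx x : 'rV_2) (lsubmx x) ^+ d).
move=>s2.
pose P1 : 'M[R]_(m, 2) := col_mx 1%:M 0; pose P2 : 'M[R]_(m, m') := col_mx 0 1%:M.
have lE y : lsubmx y = y *m P1 :> 'rV_2 by rewrite -{2}[y]hsubmxK mul_row_col mulmx1 mulmx0 addr0.
have rE y : rsubmx y = y *m P2 :> 'rV_m' by rewrite -{2}[y]hsubmxK mul_row_col mulmx1 mulmx0 add0r.
have [d1 j1] := jac_lin P1 x; have [d2 j2] := jac_lin P2 x.
have [d3 j3] := jac_cpow s d.+1 (x *m P1).
have n1 : \forall z \near x, e0C *m (cZ s (z *m P1) ^+ d.+1 : 'M[R]_2) =
  (fun u => e0C *m (cZ s u ^+ d.+1 : 'M[R]_2)) (z *m P1) by exact:filterE.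
have [d4 j4] := jac_comp erefl n1 d1 d3.
have [d5 j5] := jac_row d4 d2.
have e : Pd s d.+1 = fun y => row_mx (e0C *m (cZ s (y *m P1) ^+ d.+1 : 'M[R]_2)) (y *m P2).
 by apply/funext => y; rewrite /Pd lE rE.
split; first by rewrite e.
have -> : jac (Pd s d.+1) x = block_mx (cD s *m (d.+1%:R *: (cZ s (lsubmx x) ^+ d : 'M[R]_2))) 0 0 1%:M.
 rewrite e lE; apply:etrans j5 _.
 apply:etrans (congr2 (fun A B => row_mx A B) (etrans j4 (congr2 (fun A B => A *m B) j1 j3)) j2) _.
 by rewrite /P1 /P2 mul_col_mx mul1mx mul0mx -block_mxEh.
rewrite det_ublock det1 mulr1 det_mulmx cD_det detZ.
have -> : \det (cZ s (lsubmx x) ^+ d : 'M[R]_2) = dot (lsubmx x) (lsubmx x) ^+ d.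
 elim:d {d3 j3 n1 d4 j4 d5 j5 e} => [|d IH]; first by rewrite !expr0 det1.
 by rewrite !exprS -IH det_mulmx cZ_det.
by [].
Qed.

Lemma Pd_eq0 (s : R) d (x : V) : s ^+ 2 = 1 -> Pd s d.+1 x = 0 -> x = 0.
move=>s2 /eqP; rewrite /Pd row2_eq0 => /andP[h1 /eqP h2].
have h3 : lsubmx x = 0 :> 'rV_2.
 by apply/eqP; apply:contraLR h1 => h; apply:e0C_neq0; exact:cpow_unit.
by rewrite -[x]hsubmxK h3 h2 row_mx0.
Qed.

Lemma Pd0 (s : R) d : Pd s d.+1 0 = 0 :> V.
have z0 : cZ s 0 = 0 by apply/matrixP => i j; rewrite !mxE; ring.
by rewrite /Pd !linear0 z0 expr0n /= mulmx0 row_mx0.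
Qed.
End JacPd.

(** * Continuity at a point; compact tubes *)

Section PointCont.
Context {R : realType} {T : topologicalType}.

Lemma pt_comp (U W : topologicalType) (f : T -> U) (g : U -> W) x : {for x, continuous f} ->
 {for f x, continuous g} -> {for x, continuous (fun z => g (f z))}.
by move=>cf cg; exact:(@cvg_comp _ _ _ f g _ _ _ cf cg). Qed.
Lemma pt_id (x : T) : {for x, continuous (fun z : T => z)}.
exact:cont_id. Qed.
Lemma pt_cst (W : topologicalType) (a : W) (x : T) : {for x, continuous (fun _ : T => a)}.
exact:cont_cst. Qed.

Lemma pt_pair (U W : topologicalType) (f : T -> U) (g : T -> W) x : {for x, continuous f} ->
 {for x, continuous g} -> {for x, continuous (fun z => (f z, g z))}.
by move=>cf cg; exact:(cvg_pair cf cg). Qed.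

Lemma ptB (V : normedModType R) (f g : T -> V) x : {for x, continuous f} ->
 {for x, continuous g} -> {for x, continuous (fun z => f z - g z)}.
by move=>cf cg; exact:(cvgB cf cg). Qed.

Lemma ptD (V : normedModType R) (f g : T -> V) x : {for x, continuous f} ->
 {for x, continuous g} -> {for x, continuous (fun z => f z + g z)}.
by move=>cf cg; exact:(cvgD cf cg). Qed.
Lemma ptNR (f : T -> R) x : {for x, continuous f} -> {for x, continuous (fun z => - f z)}.
exact:cvgN. Qed.

Lemma ptM (f g : T -> R) x : {for x, continuous f} -> {for x, continuous g} ->
 {for x, continuous (fun z => f z * g z)}.
by move=>cf cg; exact:(cvgM cf cg). Qed.
Lemma ptV (f : T -> R) x : f x != 0 -> {for x, continuous f} -> {for x, continuous (fun z => (f z)^-1)}.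
by move=>f0 cf; exact:(cvgV f0 cf). Qed.

Lemma pt_norm (V : normedModType R) (f : T -> V) x : {for x, continuous f} ->
 {for x, continuous (fun z => `|f z|)}.
by move=>cf; exact:(cvg_norm cf). Qed.

Lemma pt_mulmx m n p (A : T -> 'M[R]_(m, n)) (B : T -> 'M[R]_(n, p)) x : {for x, continuous A} ->
 {for x, continuous B} -> {for x, continuous (fun z => A z *m B z)}.
by move=>cA cB; exact:(cvg_mulmx cA cB). Qed.

Lemma pt_row_mx m n p (A : T -> 'M[R]_(m, n)) (B : T -> 'M[R]_(m, p)) x : {for x, continuous A} ->
 {for x, continuous B} -> {for x, continuous (fun z => row_mx (A z) (B z))}.
by move=>cA cB; exact:(cvg_row_mx cA cB). Qed.
Lemma pt_lt (f : T -> R) x b : {for x, continuous f} -> f x < b -> \forall z \near x, f z < b.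
by move=>cf; exact:(cvgr_lt _ cf). Qed.
Lemma pt_gt (f : T -> R) x b : {for x, continuous f} -> b < f x -> \forall z \near x, b < f z.
by move=>cf; exact:(cvgr_gt _ cf). Qed.

Lemma near_and (x : T) (A B : T -> Prop) : (\forall z \near x, A z) -> (\forall z \near x, B z) ->
 \forall z \near x, A z /\ B z.
by move=>nA nB; apply:filterS2 nA nB. Qed.
End PointCont.
Section TubeCompact.
Context {R : realType} {m D : nat} {M : manifold R m}.
Variable f : smooth_map M (euclidean R D).
Hypothesis Mc : closed_manifold M.

Lemma tube_compact (r : R) : compact [set y : 'rV_D | exists p, `|y - (f p : 'rV_D)| <= r].
have c := compact_setX (range_compact (f := f) Mc) (@cball_compact R D 0 r).
have cadd : continuous (fun z : 'rV_D * 'rV[R]_D => z.1 + z.2).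
 by apply:contD; [exact:cont_fst (@cont_id _)|exact:cont_snd (@cont_id _)].
have := continuous_compact (continuous_subspaceT cadd) c; congr compact.
apply/seteqP; split => [_ [[x v] [[p _ <-] /= h] <-]|y [p h]].
 by exists p; rewrite addrC addKr -[v]subr0.
exists ((f p), y - f p); last by rewrite addrC subrK.
by split; [exists p|rewrite /= subr0].
Qed.
End TubeCompact.

(** * A power map is not homotopic to its negative *)

Section NoModel.
Context {R : realType} {m' : nat}.
Local Notation m := (2 + m')%N.
Context {M : manifold R m}.
Variables (f : smooth_map M (euclidean R (m + 2))) (fE : smooth_embedding f) (Mc : closed_manifold M) (p_ : M).
Local Notation V := 'rV[R]_m.
Local Notation W := 'rV[R]_(1 + m).
Local Notation X := 'rV[R]_(m + 2).
Let F : M -> X := f.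
Let pi : X -> M := tubpi f Mc p_.
Hypothesis em : ~~ odd m'.
Variables (nn : M -> 'M[R]_(m + 2, 2)) (ww : M -> 'M[R]_(2, m + 2)).
Hypotheses (cn : continuous nn) (cw : continuous ww) (nw : forall p, nn p *m ww p = Qn f p).

Variables (i : index M) (x0 : V) (rho s r : R) (d : nat) (L : 'M[R]_m).
Hypotheses (rho0 : 0 < rho) (bi : forall x, `|x - x0| <= rho -> (chart i @` dom i) x).
Variables (U0 : set X) (xl : X -> V).
Hypotheses (oU0 : open U0) (U0p : U0 (F (chart_inv i x0))) (sxl : smooth_on U0 xl).
Hypothesis xlE : forall y, U0 y -> dom i (pi y) /\ chart i (pi y) = xl y.
Hypotheses (s2 : s ^+ 2 = 1) (r0 : 0 < r) (uL : L \in unitmx).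
Let l (x : V) : W := Eb 0 r (Pd s d.+1) (x *m L).
Hypothesis lfar : forall x, 1 <= `|x| -> l x = south.
Let g : M -> W := ext i x0 rho l.
Hypothesis gneg : homot g (fun p => - g p).
Let p0 : M := chart_inv i x0.
Let y0 : X := F p0.
Let p0E : dom i p0 /\ chart i p0 = x0.
have [|q iq qE] := @bi x0; first by rewrite subrr normr0 ltW.
by rewrite /p0 -qE chart_invK.
Qed.
Let piF p : pi (F p) = p. Proof. exact:tubpiK. Qed.
Let g_zero p : rsubmx (g p) = 0 -> 0 < hq (g p) -> p = p0.
rewrite /g /ext; case:asboolP => [ip|_]; last by rewrite /hq /south row_mxKl mxE eqxx ltr0N1.
rewrite /l /Eb row_mxKr /hq row_mxKl mxE eqxx mulr1n subr0; set x := _ *m L => /eqP.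
rewrite scaler_eq0 => h hb.
have x2 : `|x| / r < 2 by rewrite ltNge; apply/negP => h2; move: hb; rewrite be2// ltr0N1.
move: h; rewrite gt_eqF ?ta_gt0//= => /eqP /(Pd_eq0 s2) x00.
have : rho^-1 *: (chart i p - x0) = 0 by rewrite -[LHS](mulmxK uL) -/x x00 mul0mx.
move=> /eqP; rewrite scaler_eq0 invr_eq0 gt_eqF//= subr_eq0 => /eqP h.
by rewrite /p0 -h chart_invK.
Qed.
Let g_near p : dom i p -> `|rho^-1 *: (chart i p - x0) *m L| <= r ->
 g p = row_mx 1%:M (Pd s d.+1 (rho^-1 *: (chart i p - x0) *m L)).
by move=>ip h; rewrite /g /ext asboolT// /l Eb_near// subr0.
Qed.
Let g_cont : continuous g := homot_continuousl gneg.
Let g_neq0 p : g p != 0 := homot_neq0l gneg p.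
Let Rm : 'M[R]_m := diag_mx (\row_j (if j == 0 then -1 else 1)).
Let Rf : 'M[R]_(1 + m) := block_mx 1%:M 0 0 Rm.
Let detRm : \det Rm = -1.
rewrite det_diag (bigD1 0)//= mxE eqxx big1 ?mulr1// => j j0.
by rewrite mxE (negPf j0).
Qed.
(** Since 1 + m is odd, - Rf has determinant 1 and is joined to 1. So g Rf = (- g) (- Rf) is
    homotopic to - g, hence to g: a reflection in the target changes nothing up to homotopy. *)
Let homotR : exists G : R -> M -> W, [/\ continuous (fun z : R * M => G z.1 z.2),
 forall t p, G t p != 0, forall p, G 0 p = g p *m Rf & forall p, G 1 p = g p].
have dR : \det (- Rf) = 1.
 rewrite -scaleN1r detZ det_ublock det1 mul1r detRm mulrN1.
 by rewrite -signr_odd (_ : odd (1 + m) = true) ?opprK// !oddD (negPf em).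
have [Gm [cG uG G0 G1]] : glc (- Rf) 1%:M by apply:gl_path; rewrite dR ltr01.
have H : homot (fun p => g p *m Rf) (fun p => - g p).
 exists (fun t p => - g p *m Gm t); split.
 - apply:cont_mulmx; last exact:cont_fst cG.
  by apply:contN; exact:cont_snd g_cont.
 - move=>t p; apply:contra (g_neq0 p) => /eqP E; rewrite -oppr_eq0.
  by rewrite -[- g p](mulmxK (uG t)) E mul0mx.
 - by move=>p; rewrite G0 mulNmx mulmxN opprK.
 - by move=>p; rewrite G1 mulmx1.
exact:homot_trans H (homot_sym gneg).
Qed.
Let C_bound : exists2 C : R, 0 < C & forall p, `|ww p| <= C.
have cg x : range F x -> {for x, continuous (fun y => ww (pi y))}.
 move=> [p _ <-]; apply:(pt_comp); last exact:cw.
 exact:(tubpi_cont (tubU_F fE p)).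
have [C C0 HC] := compact_bound (range_compact Mc) cg.
by exists C => // p; have := HC (F p); rewrite piF; apply; exists p.
Qed.
Let a (y : X) : X := y - F (pi y).
Section WithConstants.
Variables (C r2 e : R) (O1 : set X) (N : X -> 'M[R]_(m + 2, 2)).
Hypotheses (C0 : 0 < C) (wC : forall p, `|ww p| <= C).
Hypothesis (r20 : 0 < r2).
Let K2 := [set y : X | exists p, `|y - F p| <= r2].
Hypotheses (K2c : compact K2) (K2U : K2 `<=` tubU f).
Hypotheses (oO1 : open O1) (K2O : K2 `<=` O1) (sN : smooth_on O1 N).
Hypothesis eE : e = (4 * C * (m + 2)%:R)^-1.
Hypothesis NE : forall y, K2 y -> `|N y - nn (pi y)| <= e.
Let dim0 : 0 < (m + 2)%:R :> R. Proof. by rewrite ltr0n. Qed.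
Let e0 : 0 < e. Proof. by rewrite eE invr_gt0 mulr_gt0// mulr_gt0. Qed.
Let Fv (y : X) : 'rV[R]_2 := a y *m N y.
Let kap : R := (4 * C)^-1.
Let kap0 : 0 < kap. Proof. by rewrite invr_gt0 mulr_gt0. Qed.
(** On normal vectors [nn] is bounded below by 1 / (2 C) because [ww] recovers the vector. The
    tolerance e is set so that replacing [nn] by an approximation costs half of this bound, leaving
    [kap]. *)
Let normal_lower (v : X) p (A : 'M[R]_(m + 2, 2)) : v *m Qn f p = v -> `|A - nn p| <= e ->
 kap * `|v| <= `|v *m A|.
move=>vQ Ae.
have h1 : `|v| <= 2 * C * `|v *m nn p|.
 rewrite -{1}vQ -nw mulmxA; apply:le_trans (norm_mulmx _ _) _.
 by rewrite -mulrA ler_wpM2l// [C * _]mulrC ler_wpM2l.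
have h2 : `|v *m (A - nn p)| <= (m + 2)%:R * (`|v| * e).
 by apply:le_trans (norm_mulmx _ _) _; rewrite ler_wpM2l// ler_wpM2l.
have h3 : (m + 2)%:R * (`|v| * e) = kap * `|v|.
 rewrite eE /kap; field; rewrite ?gt_eqF//.
have h4 : `|v *m nn p| <= `|v *m A| + kap * `|v|.
 rewrite -h3; apply:le_trans (lerD (lexx _) h2).
 have -> : v *m nn p = v *m A - v *m (A - nn p) by rewrite mulmxBr opprB addrC subrK.
 exact:ler_normB.
have h5 : 2 * kap * `|v| <= `|v *m nn p|.
 have -> : 2 * kap = (2 * C)^-1 by rewrite /kap; field; rewrite gt_eqF.
 by rewrite ler_pdivrMl// mulr_gt0.
have h6 : 2 * kap * `|v| = kap * `|v| + kap * `|v| by ring.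
rewrite h6 in h5; rewrite -(lerD2r (kap * `|v|)); exact:le_trans h5 h4.
Qed.
Let a_normal y : a y *m Qn f (pi y) = a y. Proof. exact:tub_normal. Qed.
Let Fv_lower y : K2 y -> kap * `|a y| <= `|Fv y|.
by move=>Ky; apply:normal_lower; [exact:a_normal|exact:NE]. Qed.
Let pi_cont y : tubU f y -> {for y, continuous pi}.
by move=>Uy; exact:(tubpi_cont Uy). Qed.
Let a_cont y : tubU f y -> {for y, continuous a}.
move=>Uy; exact (ptB (@pt_id _ y) (pt_comp (pi_cont Uy) (@F_cont _ _ _ _ f (pi y)))).
Qed.
Let Fv_cont y : K2 y -> {for y, continuous Fv}.
move=>Ky; apply:(pt_mulmx (a_cont (K2U Ky))).
exact:(Ck_on0 (sN 0%N) (K2O Ky)).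
Qed.
Let Fv_bound : exists2 La : R, 0 < La & forall y, K2 y -> `|Fv y| < La.
have [B B0 HB] := compact_bound K2c (fun y Ky => Fv_cont Ky).
exists (B + 1); first by rewrite addr_gt0.
by move=>y Ky; rewrite (le_lt_trans (HB y Ky))// ltrDl.
Qed.
Let rho1 : R := r2 / 2.
Let rho10 : 0 < rho1. Proof. by rewrite divr_gt0. Qed.
(** Homotopy time as a function of the normal coordinate: 0 around f(M), and 1 off [K1] thanks to
    [Fv_lower]. *)
Let t (y : X) : R := clamp (2 * (`|Fv y| / (kap * rho1)) - 1).
Let U := [set y : X | exists p, `|y - F p| < r2].
Let K1 := [set y : X | exists p, `|y - F p| <= rho1].
Let UK y : U y -> K2 y. Proof. by move=> [p h]; exists p; exact:ltW. Qed.
Let KU : K1 `<=` U.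
by move=>y [p h]; exists p; apply:le_lt_trans h _; rewrite ltr_pdivrMr// ltr_pMr// ltr1n. Qed.
Let oU : open U.
rewrite (_ : U = \bigcup_p [set y : X | `|y - F p| < r2]).
 by apply:bigcup_open => p _; exact:open_ball.
by apply/seteqP; split => y [p h]; [exists p|exists p].
Qed.
Let t_far y : U y -> ~ K1 y -> t y = 1.
move=>Uy nK; have h1 : rho1 < `|a y| by rewrite ltNge; apply/negP => h; apply:nK; exists (pi y).
have h2 := Fv_lower (UK Uy).
apply:clamp_ge1; have : 1 <= `|Fv y| / (kap * rho1).
 rewrite ler_pdivlMr ?mul1r ?mulr_gt0//; apply:le_trans h2.
 by rewrite ler_pM2l// ltW.
lra.
Qed.
Let t_near y : `|Fv y| <= kap * rho1 / 2 -> t y = 0.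
move=>h; apply:clamp_le0; have : `|Fv y| / (kap * rho1) <= 1 / 2.
 rewrite ler_pdivrMr ?mulr_gt0//; apply:le_trans h _; by rewrite mul1r mulrC.
lra.
Qed.
Let t_cont y : K2 y -> {for y, continuous t}.
move=>Ky; have c1 := pt_norm (Fv_cont Ky).
have cc : continuous (fun u : R => clamp (2 * (u / (kap * rho1)) - 1)).
 apply:cont_clamp; apply:contB => //.
 apply:contM => //.
 exact:contM.
exact (pt_comp c1 (@cc _)).
Qed.
Section WithLambda.
Variables (La : R) (G : R -> M -> W).
Hypotheses (La0 : 0 < La) (FLa : forall y, K2 y -> `|Fv y| < La).
Hypotheses (cG : continuous (fun z : R * M => G z.1 z.2)) (nG : forall u p, G u p != 0).
Hypotheses (G0 : forall p, G 0 p = g p *m Rf) (G1 : forall p, G 1 p = g p).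
(** Combines w in R^(1+m) and v in R^2 into R^(m+2). The first coordinate of w acts only when
    negative, by pushing v along an axis by up to La, which exceeds |v|; hence zeros occur only with
    hq w positive. *)
Let T (w : W) (v : 'rV[R]_2) : X :=
 row_mx (rsubmx w) (v + (La * Num.max 0 (- hq w / `|w|)) *: delta_mx 0 0).
Let T_zero w v : w != 0 -> `|v| < La -> T w v = 0 -> [/\ rsubmx w = 0, 0 < hq w & v = 0].
move=>w0 vL E; have rw : rsubmx w = 0 by rewrite -[rsubmx w](row_mxKl _ (v + (La * Num.max 0 (- hq w / `|w|)) *: delta_mx 0 0)) -/(T w v) E linear0.
have E2 : v + (La * Num.max 0 (- hq w / `|w|)) *: delta_mx 0 0 = 0.
 by rewrite -[LHS](row_mxKr (rsubmx w)) -/(T w v) E linear0.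
have [q0|q0] := ltP 0 (hq w).
 split => //; move: E2; rewrite max_l ?mulr0 ?scale0r ?addr0//.
 by rewrite mulNr oppr_le0 divr_ge0// ltW.
exfalso; have q1 : hq w != 0.
 by apply:contra w0 => /eqP q1; rewrite [w]hqE rw q1 row_eq0 !eqxx.
have wE : `|w| = - hq w.
 have qn : 0 <= - hq w by rewrite oppr_ge0.
 apply/eqP; rewrite eq_le; apply/andP; split.
  apply:mx_norm_le => // a1 b1; rewrite {1}[w]hqE rw mxE; case:fintype.splitP => j _.
   by rewrite !mxE !ord1 eqxx mulr1n ler0_norm.
  by rewrite mxE normr0.
 by rewrite -(ler0_norm q0); have := entry_le w 0 (lshift m 0); rewrite {1}[w]hqE row_mxEl mxE eqxx.
move: E2; rewrite wE divff ?oppr_eq0// max_r// mulr1 => /rowP/(_ 0).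
rewrite !mxE !eqxx mulr1 => E2; have := entry_le v 0 0.
have -> : v 0 0 = - La by apply/eqP; rewrite -addr_eq0; apply/eqP.
by rewrite normrN gtr0_norm// leNgt vL.
Qed.
Let T_cont (w : X -> W) (y : X) : K2 y -> w y != 0 -> {for y, continuous w} ->
 {for y, continuous (fun y => T (w y) (Fv y))}.
move=>Ky w0 cwy.
have cr : continuous (fun w : W => rsubmx w : V) by apply:cont_rsubmx.
have cq : continuous (fun w : W => hq w).
 by apply:cont_coord; apply:cont_lsubmx.
have c1 := pt_comp cwy (cr (w y)); have c2 := pt_comp cwy (cq (w y)).
have n0 : `|w y| != 0 by rewrite normr_eq0.
have c4 := ptM (ptNR c2) (ptV (f := fun y => `|w y|) n0 (pt_norm cwy)).
have cm : continuous (fun u : R => (La * Num.max 0 u) *: (delta_mx 0 0 : 'rV_2)).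
 apply:contZ => //.
 apply:contM => //.
 exact:cont_max.
exact (pt_row_mx c1 (ptD (Fv_cont Ky) (pt_comp c4 (@cm _)))).
Qed.
Let S (y : X) : X := T (g (pi y)) (Fv y).
(** The homotopy from g Rf to g is run across the tube: S' equals S off [K1], but near f(M) it is S
    with one coordinate reflected. *)
Let S' (y : X) : X := T (G (t y) (pi y)) (Fv y).
Let S_cont y : U y -> {for y, continuous S}.
move=> /UK Ky; apply:(@T_cont (fun y => g (pi y)) y Ky (g_neq0 _)).
exact (pt_comp (pi_cont (K2U Ky)) (@g_cont (pi y))).
Qed.
Let S'_cont y : U y -> {for y, continuous S'}.
move=> /UK Ky; apply:(@T_cont (fun y => G (t y) (pi y)) y Ky (nG _ _)).
exact (pt_comp (pt_pair (t_cont Ky) (pi_cont (K2U Ky))) (@cG (t y, pi y))).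
Qed.
Let SS' y : U y -> ~ K1 y -> S y = S' y.
by move=>Uy nK; rewrite /S /S' t_far// G1. Qed.
Let at_zero y : U y -> Fv y = 0 -> y = F (pi y).
move=>Uy Fy0; have := Fv_lower (UK Uy); rewrite Fy0 normr0 pmulr_rle0// normr_le0 => /eqP.
by rewrite /a => /eqP; rewrite subr_eq0 => /eqP.
Qed.
Let S_zero y : U y -> S y = 0 -> y = y0.
move=>Uy /(T_zero (g_neq0 _) (FLa (UK Uy)))[h1 h2 h3].
by rewrite (at_zero Uy h3) (g_zero h1 h2).
Qed.
Let Rf_parts (w : W) : hq (w *m Rf) = hq w /\ rsubmx (w *m Rf) = rsubmx w *m Rm.
have E : w *m Rf = row_mx (hq w)%:M (rsubmx w *m Rm).
 by rewrite {1}[w]hqE /Rf mul_row_block !mulmx0 !mulmx1 addr0 add0r.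
by rewrite E row_mxKr {1}/hq row_mxKl mxE eqxx mulr1n.
Qed.
Let S'_zero y : U y -> S' y = 0 -> y = y0.
move=>Uy /(T_zero (nG _ _) (FLa (UK Uy)))[h1 h2 h3].
have t0 : t y = 0 by apply:t_near; rewrite h3 normr0 divr_ge0// mulr_ge0// ltW.
move: h1 h2; rewrite t0 G0; have [-> ->] := Rf_parts (g (pi y)) => h1 h2.
have uR : Rm \in unitmx by rewrite unitmxE detRm unitrN1.
rewrite (at_zero Uy h3) (g_zero _ h2)// -[rsubmx _](mulmxK uR) h1 mul0mx//.
Qed.
Let xi (y : X) : V := (rho^-1 *: (xl y - x0)) *m L.
Let T_pos w v : 0 < hq w -> T w v = row_mx (rsubmx w) v.
move=>q0; rewrite /T max_l ?mulr0 ?scale0r ?addr0//.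
by rewrite mulNr oppr_le0 divr_ge0// ltW.
Qed.
Let piy0 : pi y0 = p0. Proof. exact:piF. Qed.
Let Uy0 : U y0. Proof. by exists p0; rewrite /y0 subrr normr0. Qed.
Let a0 : a y0 = 0. Proof. by rewrite /a piy0 subrr. Qed.
Let xl0 : xl y0 = x0.
by have [_ <-] := xlE U0p; rewrite piF p0E.2. Qed.
Let near_model : exists2 q : R, 0 < q & forall y, `|y - y0| < q ->
 [/\ U y, U0 y, S y = row_mx (Pd s d.+1 (xi y)) (Fv y) & S' y = row_mx (Pd s d.+1 (xi y) *m Rm) (Fv y)].
have n1 : nbhs y0 U by exact:open_nbhs_nbhs.
have n2 : nbhs y0 U0 by exact:open_nbhs_nbhs.
have n3 : \forall y \near y0, `|xi y| < r.
 have c1 : {for y0, continuous xl} by exact:(Ck_on0 (sxl 0%N)).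
 have cc : continuous (fun v : V => `|(rho^-1 *: (v - x0)) *m L|).
  apply:cont_norm; apply:cont_mulmx => //.
  apply:contZ => //.
  exact:contB.
 have h : `|xi y0| < r by rewrite /xi xl0 subrr scaler0 mul0mx normr0.
 exact (pt_lt (pt_comp c1 (@cc _)) h).
have n4 : \forall y \near y0, `|Fv y| < kap * rho1 / 2.
 have h : `|Fv y0| < kap * rho1 / 2 by rewrite /Fv a0 mul0mx normr0 divr_gt0// mulr_gt0.
 exact (pt_lt (pt_norm (Fv_cont (UK Uy0))) h).
have /nbhs_ballE[q q0 hq'] := near_and (near_and n1 n2) (near_and n3 n4).
exists q => // y /hq'[[Uy U0y] [xr Fr]]; have [ip pE] := xlE U0y.
have gE : g (pi y) = row_mx 1%:M (Pd s d.+1 (xi y)).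
 by rewrite g_near// ?pE// ltW.
have q1 : 0 < hq (g (pi y)) by rewrite gE /hq row_mxKl mxE eqxx ltr01.
split => //.
 by rewrite /S T_pos// gE row_mxKr.
have [q2 q3] := Rf_parts (g (pi y)).
by rewrite /S' t_near ?ltW// G0 T_pos ?q2// q3 gE row_mxKr.
Qed.
Let Fl (x : V) : X := F (chart_inv i x).
Let U0im y : U0 y -> (chart i @` dom i) (xl y).
by move=> /xlE[ip <-]; exists (pi y). Qed.
Let aE y : U0 y -> a y = y - Fl (xl y).
by move=> /xlE[ip pE]; rewrite /a /Fl -pE chart_invK. Qed.
Let sFl : smooth_on U0 (fun y => Fl (xl y)).
move=>k; apply:(@Ck_comp _ _ _ _ k U0 (chart i @` dom i) xl Fl) => //.
- exact:has_basis_mx.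
- exact:codom_open.
- exact:F_smooth.
Qed.
Let sa : smooth_on U0 (fun y => y - Fl (xl y)).
by move=>k; apply:CkB; [exact:oU0|exact:smooth_on_id|exact:sFl]. Qed.
Let sFv : smooth_on (U0 `&` O1) Fv.
have o2 : open (U0 `&` O1) by exact:openI.
move=>k; apply:(@Ck_ext _ _ _ _ _ _ (fun y => (y - Fl (xl y)) *m N y)) => //.
 by move=>y [U0y _]; rewrite /Fv aE.
apply:Ck_mulmx => //; first exact:Ck_sub (sa k) => y [].
exact:Ck_sub (sN k) => y [].
Qed.
Let sxi : smooth_on U0 xi.
move=>k; apply:Ck_mulmx => //.
apply:CkZ => //.
exact:CkB.
Qed.
Let M0 (y : X) : 'M[R]_(m + 2) := row_mx (jac xi y) (jac Fv y).
(** A kernel vector v does not move the projection, so y - Fl (xl y) moves by v itself.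
    Differentiating the normality of this difference shows that v is normal; its normal coordinates
    v N vanish too, so v = 0 by [normal_lower]. *)
Let M0_unit : M0 y0 \in unitmx.
have O1y : O1 y0 := K2O (UK Uy0).
have dxl : differentiable xl y0 by have [h _] := sxl 1; exact:h.
have [_ jxi] : differentiable xi y0 /\ jac xi y0 = jac xl y0 *m (rho^-1 *: L).
 have d1 := dxl; have [d2 j2] := jac_lin (rho^-1 *: L) (xl y0).
 have [d3 j3] := jac_shift (- (x0 *m (rho^-1 *: L))) d2.
 have E : \forall y \near y0, xi y = (fun v => v *m (rho^-1 *: L) + - (x0 *m (rho^-1 *: L))) (xl y).
  apply:filterE => y; rewrite /xi -mulmxBl -scalemxAl scalemxAr//.
 have [d4 j4] := jac_comp erefl E d1 d3.
 split; [exact:d4|exact:(etrans j4 (congr1 (fun A => jac xl y0 *m A) (etrans j3 j2)))].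
apply:inj_unitmx => v; rewrite mul_mx_row => /eqP vM.
have v1 : v *m jac xi y0 = 0.
 by move/eqP: vM => /(congr1 lsubmx); rewrite row_mxKl linear0.
have v2 : v *m jac Fv y0 = 0.
 by move/eqP: vM => /(congr1 rsubmx); rewrite row_mxKr linear0.
have vxl : v *m jac xl y0 = 0.
 have uL2 : rho^-1 *: L \in unitmx.
  by rewrite unitmxZ// unitfE invr_eq0 gt_eqF.
 by rewrite -[LHS](mulmxK uL2) -[v *m _ *m _]mulmxA -jxi v1 mul0mx.
have dFl : differentiable Fl x0.
 by have [h _] := F_smooth f i 1; apply:h; exists p0; [exact:p0E.1|exact:p0E.2].
have Ef : \forall y \near y0, Fl (xl y) = Fl (xl y) by exact:filterE.
have [dFx jFx] := jac_comp xl0 Ef dxl dFl.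
have di : differentiable (fun y : X => y) y0 by exact:ex_diff.
have da : differentiable (fun y => y - Fl (xl y)) y0 by exact:differentiableB.
have dav : 'd (fun y => y - Fl (xl y)) y0 v = v.
 apply:etrans (congr1 (fun H : X -> X => H v) (diffB di dFx)) _.
 have e1 : 'd (fun y : X => y) y0 v = v by rewrite (@diff_val _ _ _ _ _ _ _ (is_diff_id y0)).
 have e2 : 'd (fun y => Fl (xl y)) y0 v = 0.
  by apply:etrans (jacE _ _ _) _; rewrite jFx mulmxA vxl mul0mx.
 by apply:etrans (congr2 (fun b c => b - c) e1 e2) _; rewrite subr0.
have aa0 : y0 - Fl (xl y0) = 0 by rewrite -aE// a0.
have n0 : nbhs y0 U0 by exact:open_nbhs_nbhs.
(* product rule at a zero of y - Fl (xl y) *)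
have prod p (A : X -> 'M[R]_(m + 2, p)) : differentiable A y0 ->
  'd (fun y => (y - Fl (xl y)) *m A y) y0 v = v *m A y0.
 move=>dA; have [_ H] := diff_mulmx da dA.
 apply:etrans (H v) _; rewrite aa0 mul0mx add0r; exact:(congr1 (fun w => w *m A y0) dav).
have vN : v *m N y0 = 0.
 have dN : differentiable N y0 by have [h _] := sN 1; exact:h.
 have EF : \forall y \near y0, Fv y = (y - Fl (xl y)) *m N y.
  by apply:filterS n0 => y U0y; rewrite /Fv aE.
 have dp := (diff_mulmx da dN).1.
 have [_ H] := near_eq_is_diff EF dp.
 rewrite -(prod _ N dN); apply:etrans (esym (congr1 (fun H : X -> 'rV_2 => H v) H)) _.
 exact:etrans (jacE Fv y0 v) _.
have vJ : v *m (jac Fl x0)^T = 0.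
 pose J y := (jac Fl (xl y))^T.
 have sJ : Ck_on 1 U0 J.
  apply:Ck_trmx => //.
  apply:(@Ck_comp _ _ _ _ 1 U0 (chart i @` dom i) xl (jac Fl)) => //.
  - exact:has_basis_mx.
  - exact:codom_open.
    - by apply:Ck_jac; [exact:codom_open|exact:F_smooth].
 have dJ : differentiable J y0 by have [h _] := sJ; exact:h.
 have EJ : \forall y \near y0, (y - Fl (xl y)) *m J y = (fun _ => 0) y.
  apply:filterS n0 => y U0y; have [ip pE] := xlE U0y.
  have := nearest_normal ip (tubpiP f Mc p_ y); rewrite /locjac pE => h.
  by rewrite -aE//.
 have [_ H] := near_eq_is_diff EJ (differentiable_cst 0 y0).
 have := prod _ J dJ; rewrite /J xl0 => <-.
 apply:etrans (congr1 (fun H : X -> 'rV_m => H v) H) _.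
 by rewrite diff_cst.
have vQ : v *m Qn f p0 = v.
 rewrite (QnE fE p0E.1); apply:nproj_fix.
 by rewrite /locjac p0E.2.
have := @normal_lower v p0 (N y0) vQ; rewrite vN normr0 -{1}piy0 => /(_ (NE (UK Uy0))).
by rewrite pmulr_rle0// normr_le0 => /eqP.
Qed.
Let M0_cont : {for y0, continuous (fun y => \det (M0 y))}.
have o2 : open (U0 `&` O1) by exact:openI.
have h : Ck_on 0 (U0 `&` O1) (fun y => \det (M0 y)).
 apply:Ck_det => //; apply:Ck_row_mx => //.
  by apply:Ck_jac => //; apply:Ck_sub (sxi 1) => y [].
 exact:Ck_jac; exact:sFv.
by apply:(Ck_on0 h); split => //; exact:K2O (UK Uy0).
Qed.
Let block_id : 'M[R]_(m + 2) := block_mx Rm 0 0 1%:M.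
Let det_S y : U0 y -> O1 y -> (\forall z \near y, S z = row_mx (Pd s d.+1 (xi z)) (Fv z)) ->
 \det (jac S y) = \det (M0 y) * (s * (d.+1%:R ^+ 2 * dot (lsubmx (xi y) : 'rV_2) (lsubmx (xi y)) ^+ d)).
move=>U0y O1y E.
have dx : differentiable xi y by have [h _] := sxi 1; exact:h.
have dF : differentiable Fv y by have [h _] := sFv 1; apply:h.
have [dP jP] := jac_Pd d (xi y) s2.
have E1 : \forall z \near y, Pd s d.+1 (xi z) = Pd s d.+1 (xi z) by exact:filterE.
have [d1 j1] := jac_comp erefl E1 dx dP.
have [d2 j2] := jac_row d1 dF.
have -> : jac S y = M0 y *m block_mx (jac (Pd s d.+1) (xi y)) 0 0 1%:M.
 have j3 := jac_near E d2.
 have j4 := etrans j3 (etrans j2 (congr1 (fun A => row_mx A (jac Fv y)) j1)).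
 apply:etrans j4 _.
 by rewrite /M0 mul_row_block !mulmx0 mulmx1 addr0 add0r.
by rewrite det_mulmx det_ublock det1 mulr1 jP.
Qed.
Let det_S' y : U0 y -> O1 y -> (\forall z \near y, S z = row_mx (Pd s d.+1 (xi z)) (Fv z)) ->
 (\forall z \near y, S' z = row_mx (Pd s d.+1 (xi z) *m Rm) (Fv z)) ->
 differentiable S y -> \det (jac S' y) = - \det (jac S y).
move=>U0y O1y E E' dS.
have [d1 j1] := jac_lin block_id (S y).
have E2 : \forall z \near y, S' z = (fun v => v *m block_id) (S z).
 apply:filterS2 E E' => z -> ->.
 by rewrite /block_id mul_row_block !mulmx0 mulmx1 addr0 add0r.
have [_ j2] := jac_comp erefl E2 dS d1.
have -> : jac S' y = jac S y *m block_id by apply:etrans j2 _; rewrite j1.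
by rewrite det_mulmx det_ublock det1 mulr1 detRm mulrN1.
Qed.
Let smooth_S (k : nat) (A : set X) : open A -> A `<=` U0 `&` O1 -> Ck_on k A (fun z => row_mx (Pd s d.+1 (xi z)) (Fv z)).
move=>oA AU; apply:Ck_row_mx => //; last exact:Ck_sub (sFv k).
have Cx : Ck_on k A xi by apply:Ck_sub (sxi k) => y /AU[].
apply:Ck_row_mx => //; last exact:Ck_rsubmx.
apply:Ck_mulmx => //.
have Cl : Ck_on k A (fun z => lsubmx (xi z) : 'rV_2) by exact:Ck_lsubmx.
have CZ : Ck_on k A (fun z => cZ s (lsubmx (xi z)) : 'M[R]_2).
 apply:Ck_mxP => // b c.
 apply:(@Ck_ext _ _ _ _ _ _ (fun z => (lsubmx (xi z) : 'rV_2) 0 0 * (b == c)%:R + (lsubmx (xi z) : 'rV_2) 0 1 * (s * cJ b c))) => //.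
  by move=>z _; rewrite /cZ !mxE mulr_natr; ring.
 apply:CkD => //; apply:CkM => //; try exact:Ck_cst; exact:Ck_entry.
elim:(d.+1) => [|n IH] => //.
apply:(@Ck_ext _ _ _ _ _ _ (fun z => cZ s (lsubmx (xi z)) *m (cZ s (lsubmx (xi z)) ^+ n : 'M[R]_2))) => //.
 by move=>z _; rewrite exprS.
exact:Ck_mulmx.
Qed.
(** The Jacobian of the power map may vanish at y0 itself; moving along f(M) in a direction seen by
    the first two coordinates reaches points where it does not. *)
Let nonzero_near (e1 : R) : 0 < e1 -> exists2 y, `|y - y0| < e1 & (lsubmx (xi y) : 'rV_2) != 0 /\ U0 y.
move=>e10; pose w : V := row_mx (const_mx 1) 0.
have w0 : (lsubmx w) != 0.
 by rewrite row_mxKl; apply/eqP => /rowP/(_ 0); rewrite !mxE => /eqP; rewrite oner_eq0.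
have im0 : (chart i @` dom i) x0 by exists p0; [exact:p0E.1|exact:p0E.2].
have c2 : {for x0, continuous Fl}.
 by apply:(pt_comp (chart_inv_continuous im0)); exact:F_cont.
have n1 : \forall x \near x0, `|Fl x - y0| < e1.
 have n : \forall y \near Fl x0, `|y - y0| < e1.
  by apply:open_nbhs_nbhs; split; [exact:open_ball|rewrite subrr normr0].
 exact (near_pull c2 n).
have n2 : \forall x \near x0, U0 (Fl x) := near_pull c2 (open_nbhs_nbhs (conj oU0 U0p)).
have n3 : \forall x \near x0, (chart i @` dom i) x by apply:open_nbhs_nbhs; split; [exact:codom_open|].
have /nbhs_ballE[q q0 hq'] := near_and (near_and n1 n2) n3.
pose v := rho *: (w *m invmx L).
pose u := q / (2 * (`|v| + 1)).
have u0 : 0 < u by rewrite divr_gt0// mulr_gt0.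
have := hq' (u *: v + x0); rewrite addrK normrZ gtr0_norm//.
have uv : u * `|v| < q.
 rewrite /u mulrAC ltr_pdivrMr// ltr_pM2l//; have := normr_ge0 v; lra.
move=> /(_ uv)[[h1 h2] [p ip pE]].
exists (Fl (u *: v + x0)) => //; split => //.
have [_ e2] := xlE h2; rewrite /xi -e2 /Fl -pE chart_invK// piF pE addrK.
have -> : (rho^-1 *: (u *: v)) *m L = u *: w.
 rewrite /v !scalerA -scalemxAl mulmxKV//; congr (_ *: _); field; by rewrite gt_eqF.
by rewrite linearZ /= scaler_eq0 negb_or w0 gt_eqF.
Qed.

Lemma no_model_aux : False.
have [q q0 hq'] := near_model.
have O1y : O1 y0 := K2O (UK Uy0).
have d0 : \det (M0 y0) * s != 0.
 rewrite mulf_neq0//; first by have := M0_unit; rewrite unitmxE unitfE.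
 by apply/eqP => s0; move: s2; rewrite s0 expr0n /= => /eqP; rewrite eq_sym oner_eq0.
pose sgn := Num.sg (\det (M0 y0) * s).
have nsg : \forall y \near y0, 0 < sgn * (\det (M0 y) * s).
 have h : 0 < sgn * (\det (M0 y0) * s).
  by rewrite /sgn -normrEsg normr_gt0.
 exact (pt_gt (ptM (@pt_cst _ _ sgn y0) (ptM M0_cont (@pt_cst _ _ s y0))) h).
have nO : nbhs y0 O1 by exact:open_nbhs_nbhs.
have nq : nbhs y0 [set y : X | `|y - y0| < q].
 by apply:open_nbhs_nbhs; split; [exact:open_ball|rewrite /= subrr normr0].
have /nbhs_ballE[b b0 hb] := near_and (near_and nsg nO) nq.
pose Br := [set y : X | `|y - y0| < b].
have oBr : open Br by exact:open_ball.
have BrU : Br `<=` U by move=>y /hb[_ /hq'[]].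
have BrUO : Br `<=` U0 `&` O1 by move=>y /hb[[_ ?] /hq'[]].
have ES y : Br y -> \forall z \near y, S z = row_mx (Pd s d.+1 (xi z)) (Fv z).
 move=>By; have : nbhs y Br by exact:open_nbhs_nbhs.
 by apply:filterS => z /hb[_ /hq'[]].
have ES' y : Br y -> \forall z \near y, S' z = row_mx (Pd s d.+1 (xi z) *m Rm) (Fv z).
 move=>By; have : nbhs y Br by exact:open_nbhs_nbhs.
 by apply:filterS => z /hb[_ /hq'[]].
have sS : smooth_on Br S.
 move=>k; apply:(@Ck_ext _ _ _ _ _ _ (fun z => row_mx (Pd s d.+1 (xi z)) (Fv z))) => //.
  by move=>z /hb[_ /hq'[]].
 exact:smooth_S.
have sS' : smooth_on Br S'.
 move=>k; apply:(@Ck_ext _ _ _ _ _ _ (fun z => S z *m block_id)) => //.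
  move=>z /hb[_ /hq'[_ _ -> ->]].
  by rewrite /block_id mul_row_block !mulmx0 mulmx1 addr0 add0r.
 exact:Ck_mulmx.
have dSy y : Br y -> differentiable S y by have [h _] := sS 1; exact:h.
pose dd y := d.+1%:R ^+ 2 * dot (lsubmx (xi y) : 'rV_2) (lsubmx (xi y)) ^+ d.
have dd0 y : 0 <= dd y by rewrite mulr_ge0 ?exprn_ge0// dot_ge0.
have jS y : Br y -> \det (jac S y) = (\det (M0 y) * s) * dd y.
 by move=>By; have [U0y O1y'] := BrUO y By; apply:etrans (det_S U0y O1y' (ES y By)) _; exact:mulrA.
have jS' y : Br y -> \det (jac S' y) = - ((\det (M0 y) * s) * dd y).
 by move=>By; have [U0y O1y'] := BrUO y By; rewrite (det_S' U0y O1y' (ES y By) (ES' y By) (dSy y By)) jS.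
have pos e1 : 0 < e1 -> exists2 y, `|y - y0| < e1 /\ Br y & 0 < dd y.
 move=>e10; have [|y] := @nonzero_near (Num.min e1 b); first by rewrite lt_min e10.
 rewrite lt_min => /andP[h1 h2] [nz _]; exists y => //.
 by rewrite mulr_gt0 ?exprn_gt0 ?dot_gt0// ltr0n.
have K1c : compact K1 by exact:tube_compact.
have S00 : S y0 = 0.
 have [|_ _ -> _] := hq' y0; first by rewrite subrr normr0.
 by rewrite /xi xl0 subrr scaler0 mul0mx Pd0 /Fv a0 mul0mx row_mx0.
have S'00 : S' y0 = 0.
 have [|_ _ _ ->] := hq' y0; first by rewrite subrr normr0.
 by rewrite /xi xl0 subrr scaler0 mul0mx Pd0 /Fv a0 !mul0mx row_mx0.
have SS2 y : U y -> ~ K1 y -> S' y = S y by move=>Uy nK; rewrite SS'.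
(* Depending on the orientation of the chart and on s, either S or S' has the nonnegative Jacobian;
   the two maps exchange roles in [degree_contra]. *)
have [sp|sp] := ltP 0 (\det (M0 y0) * s).
 have s1 : sgn = 1 by rewrite /sgn gtr0_sg.
 have M0p y : Br y -> 0 < \det (M0 y) * s by move=> /hb[[]]; rewrite s1 mul1r.
 have H1 y : Br y -> 0 <= \det (jac S y) by move=>By; rewrite (jS y By); apply:mulr_ge0; [exact:ltW (M0p y By)|exact:dd0].
 have H2 y : Br y -> \det (jac S' y) <= 0 by move=>By; rewrite (jS' y By) oppr_le0; apply:mulr_ge0; [exact:ltW (M0p y By)|exact:dd0].
 have H3 e1 : 0 < e1 -> exists2 y, `|y - y0| < e1 & 0 < \det (jac S y).
  by move=> /pos[y [h1 h2] h3]; exists y; [exact:h1|rewrite (jS y h2); apply:mulr_gt0; [exact:M0p|exact:h3]].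
 exact (@degree_contra R (1 + m' + 2)%N U K1 S S' y0 b oU K1c KU S_cont S'_cont SS' S_zero S'_zero
  S00 b0 BrU sS sS' H1 H2 H3).
have s1 : sgn = -1 by rewrite /sgn ltr0_sg// lt_neqAle d0 sp.
have M0p y : Br y -> 0 < - (\det (M0 y) * s) by move=> /hb[[]]; rewrite s1 mulN1r.
have H1 y : Br y -> 0 <= \det (jac S' y) by move=>By; rewrite (jS' y By) -mulNr; apply:mulr_ge0; [exact:ltW (M0p y By)|exact:dd0].
have H2 y : Br y -> \det (jac S y) <= 0.
 by move=>By; rewrite (jS y By) -oppr_ge0 -mulNr; apply:mulr_ge0; [exact:ltW (M0p y By)|exact:dd0].
have H3 e1 : 0 < e1 -> exists2 y, `|y - y0| < e1 & 0 < \det (jac S' y).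
 by move=> /pos[y [h1 h2] h3]; exists y; [exact:h1|rewrite (jS' y h2) -mulNr; apply:mulr_gt0; [exact:M0p|exact:h3]].
exact (@degree_contra R (1 + m' + 2)%N U K1 S' S y0 b oU K1c KU S'_cont S_cont SS2 S'_zero S_zero
 S'00 b0 BrU sS' sS H1 H2 H3).
Qed.
End WithLambda.

Lemma no_model_const : False.
have [La La0 FLa] := Fv_bound; have [G [cG nG G0 G1]] := homotR.
exact:(@no_model_aux La G La0 FLa cG nG G0 G1).
Qed.
End WithConstants.

Lemma no_model : False.
have [C C0 wC] := C_bound.
have [r1 r10 hr1] := tub_radius fE Mc p_.
pose r2 := r1 / 2; have r20 : 0 < r2 by rewrite divr_gt0.
have K2c := @tube_compact R m (m + 2) M f Mc r2.
set K2 := [set y : X | exists p, `|y - (f p)| <= r2] in K2c.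
have K2U : K2 `<=` tubU f.
 move=>y [p h]; apply:(hr1 y p); apply:le_lt_trans h _.
 by rewrite /r2 ltr_pdivrMr// ltr_pMr// ltr1n.
pose e := (4 * C * (m + 2)%:R)^-1.
have e0 : 0 < e by rewrite invr_gt0 mulr_gt0 ?mulr_gt0// ltr0n.
have cnp y : K2 y -> {for y, continuous (fun y => nn (pi y))}.
 move=>Ky; exact (pt_comp (tubpi_cont (K2U y Ky)) (@cn (pi y))).
have [Q1 [N [oQ KQ sN NE]]] := smooth_approx K2c cnp e0.
exact:(@no_model_const C r2 e Q1 N C0 wC r20 K2c K2U oQ KQ sN erefl NE).
Qed.
End NoModel.

(** * Tangent vectors in coordinates *)

Section TangentCoord.
Context {R : realType} {m : nat} {M : manifold R m}.

Definition base_index (p : M) : index M := projT1 (cid (dom_cover p)).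
Lemma base_indexP p : dom (base_index p) p.
exact:(projT2 (cid (dom_cover p))). Qed.
Lemma tcoordD (p : M) (a : R) (v w : tangent p) i : (a *: v + w) i = a *: v i + w i.
by []. Qed.
Lemma tcoordN (p : M) (v : tangent p) i : (- v) i = - v i.
by []. Qed.
Definition tan_fun k (A : M -> 'M[R]_(m, k)) (p : M) (v : tangent p) : 'rV[R]_k :=
 v (base_index p) *m A p.
Fact tan_fun_linear k (A : M -> 'M[R]_(m, k)) p : linear (@tan_fun k A p).
by move=>a v w; rewrite /tan_fun tcoordD mulmxDl scalemxAl. Qed.
Definition tan_lin k (A : M -> 'M[R]_(m, k)) p : {linear tangent p -> 'rV[R]_k} :=
 HB.pack (@tan_fun k A p) (GRing.isLinear.Build _ _ _ _ _ (@tan_fun_linear k A p)).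
Lemma tan_linE k (A : M -> 'M[R]_(m, k)) p v : tan_lin A p v = tan_fun A v.
by []. Qed.
Lemma tan_ex (p : M) i (u : 'rV_m) : dom i p -> exists v : tangent p, v i = u.
by move=>ip; have [v [vi _]] := tangent_coord_unique u ip; exists v. Qed.

Lemma tan_eq (p : M) i (v w : tangent p) : dom i p -> v i = w i -> v = w.
move=>ip E; have [t [_ H]] := tangent_coord_unique (w i) ip.
by rewrite -(H v E) (H w erefl).
Qed.

Definition tan_of (p : M) (u : 'rV[R]_m) : tangent p :=
 projT1 (cid (tan_ex u (base_indexP p))).

Lemma tan_ofE p u : tan_of p u (base_index p) = u.
exact:(projT2 (cid (tan_ex u (base_indexP p)))). Qed.
End TangentCoord.
Section SmoothProd.
Context {R : realType}.

Lemma Ck_fst (V W U : normedModType R) k (A : set V) (g : V -> U) : open A -> Ck_on k A g ->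
 Ck_on k (A `*` [set: W]) (fun z : V * W => g z.1).
move=>oA Cg.
have -> : A `*` [set: W] = (fst : {linear (V * W)%type -> V}) @^-1` A.
 by apply/seteqP; split => [z []|z].
by apply:Ck_linr => // z; exact:cvg_fst.
Qed.

Lemma Ck_snd (V W : normedModType R) k (A : set V) : Ck_on k (A `*` [set: W]) (fun z : V * W => z.2).
have c : continuous (snd : (V * W)%type -> W) by move=>z; exact:cvg_snd.
exact:smooth_on_linear.
Qed.

Lemma open_fst (V W : normedModType R) (A : set V) : open A -> open (A `*` [set: W]).
move=>oA; have -> : A `*` [set: W] = (fun z : V * W => z.1) @^-1` A.
 by apply/seteqP; split => [z []|z].
by apply:open_comp => // z _; exact:cvg_fst.
Qed.

Lemma Ck_mulfst n k p q r (A : set 'rV_n) (B : 'rV_n -> 'M[R]_(q, r)) : open A -> Ck_on k A B ->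
 Ck_on k (A `*` [set: 'M[R]_(p, q)]) (fun z : 'rV_n * 'M[R]_(p, q) => z.2 *m B z.1).
move=>oA CB; apply:Ck_mulmx.
- exact:open_fst.
- exact:Ck_snd.
- exact:Ck_fst.
Qed.
End SmoothProd.

(** * Parallelizability from a map injective on tangent spaces *)

Section Parallel.
Context {R : realType} {m D : nat} {M : manifold R m}.
Variables (f : smooth_map M (euclidean R D)) (fE : smooth_embedding f) (Mc : closed_manifold M) (p_ : M).
Let F : M -> 'rV[R]_D := f.

Lemma tangent_normal (p : M) (v : 'rV_D) i : dom i p -> v *m Qn f p = 0 ->
 exists u, v = u *m locjac f i p.
by move=>ip; rewrite (QnE fE ip) => /nproj_ker. Qed.
Lemma locjac_Qn (p : M) i : dom i p -> locjac f i p *m Qn f p = 0.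
by move=>ip; rewrite (QnE fE ip) nprojA//; exact:(locjac_inj fE ip). Qed.

Lemma M_bound p q (h : M -> 'M[R]_(p, q)) : continuous h -> exists2 C : R, 0 < C & forall x, `|h x| <= C.
move=>ch; have cg x : range F x -> {for x, continuous (fun y => h (tubpi f Mc p_ y))}.
 move=> [p1 _ <-].
 exact (pt_comp (tubpi_cont (tubU_F fE p1)) (@ch (tubpi f Mc p_ (f p1)))).
have [C C0 HC] := compact_bound (range_compact Mc) cg.
by exists C => // x; have := HC (F x); rewrite tubpiK//; apply; exists x.
Qed.
Section Theta.
Variable Th : M -> 'M[R]_(D, m).
Hypothesis cTh : continuous Th.
Hypothesis iTh : forall p (v : 'rV[R]_D), v *m Qn f p = 0 -> v *m Th p = 0 -> v = 0.
Let P (p : M) : 'M[R]_D := 1%:M - Qn f p.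
Let MM (p : M) : 'M[R]_D := P p *m Th p *m (Th p)^T *m P p + Qn f p.
Let cQ : continuous (Qn f). Proof. exact:Qn_cont. Qed.
Let cP : continuous P. Proof. exact:contB. Qed.
Let Ptr p : (P p)^T = P p.
by rewrite /P linearB /= trmx1 Qn_tr. Qed.
Let PQ p : P p *m Qn f p = 0.
by rewrite /P mulmxBl mul1mx (Qn_idem fE) subrr. Qed.
(** The quadratic form of [MM] is |v P Th|^2 + |v Q|^2, positive definite because Th is injective on
    tangent vectors. Hence [Xi], a continuous left inverse of Th on tangent spaces. *)
Let MM_unit p : MM p \in unitmx.
apply:inj_unitmx => v vM.
have E : dot (v *m P p *m Th p) (v *m P p *m Th p) + dot (v *m Qn f p) (v *m Qn f p) = 0.
 have : v *m MM p *m v^T = 0 by rewrite vM mul0mx.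
 rewrite /MM mulmxDr mulmxDl => /matrixP/(_ 0 0); rewrite !mxE /dot => <-.
 congr (_ + _).
  by rewrite !trmx_mul Ptr !mulmxA mxE.
 by rewrite trmx_mul Qn_tr// mulmxA -[v *m _ *m _]mulmxA Qn_idem// mxE.
have h1 := dot_ge0 (v *m P p *m Th p); have h2 := dot_ge0 (v *m Qn f p).
have d1 : v *m P p *m Th p = 0 by apply/eqP; rewrite -dot_eq0; apply/eqP; lra.
have d2 : v *m Qn f p = 0 by apply/eqP; rewrite -dot_eq0; apply/eqP; lra.
by apply:(iTh d2); move: d1; rewrite /P mulmxBr mulmx1 d2 subr0.
Qed.
Let Xi p : 'M[R]_(m, D) := (Th p)^T *m P p *m invmx (MM p).
Let cXi : continuous Xi.
have cM : continuous MM.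
 exact (contD (cont_mulmx (cont_mulmx (cont_mulmx (@cP) (@cTh)) (cont_trmx (@cTh))) (@cP)) (@cQ)).
apply:cont_mulmx; last exact:cont_invmx.
by apply:cont_mulmx => //; exact:cont_trmx.
Qed.
Let XiE p (v : 'rV_D) : v *m Qn f p = 0 -> v = v *m Th p *m Xi p.
move=>vQ; have vP : v *m P p = v by rewrite /P mulmxBr mulmx1 vQ subr0.
have E : v *m MM p = v *m Th p *m (Th p)^T *m P p by rewrite /MM mulmxDr vQ addr0 !mulmxA vP.
by rewrite /Xi !mulmxA -E mulmxK.
Qed.

(** The bound on [Xi] turns closeness of T to Th into injectivity: a tangent vector killed by T
    would have norm at most half of itself. *)
Lemma smooth_theta : exists (Q1 : set 'rV_D) (T : 'rV_D -> 'M[R]_(D, m)),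
 [/\ open Q1, range F `<=` Q1, smooth_on Q1 T &
  forall i p, dom i p -> locjac f i p *m T (F p) \in unitmx].
have [C C0 HC] := M_bound cXi.
have d0 : 0 < 2 * (m.+1%:R * (D.+1%:R * C)) by rewrite !mulr_gt0// ltr0n.
have e0 : 0 < (2 * (m.+1%:R * (D.+1%:R * C)))^-1 by rewrite invr_gt0.
have [Q1 [T [oQ FQ sT HT]]] := smooth_approx_M fE Mc p_ cTh e0.
exists Q1, T; split => // i p ip; apply:inj_unitmx => u; rewrite mulmxA => uT.
set v := u *m _ in uT.
have vQ : v *m Qn f p = 0 by rewrite /v -mulmxA locjac_Qn// mulmx0.
have vE := XiE vQ.
have E : v = v *m (Th p - T (F p)) *m Xi p by rewrite mulmxBr uT subr0.
set e := _^-1 in e0 HT.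
have b1 : `|v *m (Th p - T (F p))| <= D.+1%:R * (`|v| * e).
 apply:le_trans (norm_mulmx _ _) _; apply:ler_pM => //; first by rewrite ler_nat.
 by rewrite ler_wpM2l// distrC; exact:HT.
have b2 : `|v| <= m.+1%:R * (D.+1%:R * (`|v| * e) * C).
 rewrite {1}E; apply:le_trans (norm_mulmx _ _) _; apply:ler_pM => //; first by rewrite ler_nat.
 exact:ler_pM.
have b3 : m.+1%:R * (D.+1%:R * (`|v| * e) * C) = `|v| / 2.
 rewrite /e; field; rewrite ?gt_eqF////.
have v0 : v = 0 by apply/eqP; rewrite -normr_le0; rewrite b3 in b2; lra.
exact:(locjac_inj fE ip).
Qed.

Lemma parallelizable_theta : parallelizable M.
have [Q1 [T [oQ FQ sT uT]]] := smooth_theta.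
pose A i p := locjac f i p *m T (F p).
pose A0 p : 'M[R]_m := A (base_index p) p.
have uA i p : dom i p -> A i p \in unitmx by exact:uT.
have PhiE p (v : tangent p) i : dom i p -> tan_fun A0 v = v i *m A i p.
 move=>ip; rewrite /tan_fun /A0 /A !mulmxA.
 by rewrite -(tangent_mapJ f v ip) -(tangent_mapJ f v (base_indexP p)).
have sA i : smooth_on (chart i @` dom i) (fun x => jac (loc f i) x *m T (loc f i x)).
 move=>k; apply:Ck_mulmx; first exact:codom_open.
  by apply:Ck_jac; [exact:codom_open|exact:F_smooth].
 apply:(@Ck_comp _ _ _ _ k (chart i @` dom i) Q1 (loc f i) T) => //.
 - exact:has_basis_mx.
 - exact:codom_open.
 - by move=>x _; apply:FQ; exists (chart_inv i x).
 - exact:F_smooth.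
have sAE i p : dom i p -> jac (loc f i) (chart i p) *m T (loc f i (chart i p)) = A i p.
 by move=>ip; rewrite locK.
exists (tan_lin A0).
exists (fun p u => tan_of p (u *m invmx (A0 p))); split.
- move=>p v; apply:(tan_eq (base_indexP p)); rewrite tan_ofE tan_linE /tan_fun mulmxK//.
 exact:uA (base_indexP p).
- by move=>p u; rewrite tan_linE /tan_fun tan_ofE mulmxKV//; exact:uA (base_indexP p).
- move=>i; exists (fun z => z.2 *m (jac (loc f i) z.1 *m T (loc f i z.1))).
  by move=>k; exact (@Ck_mulfst R m k 1 m m _ (fun x => jac (loc f i) x *m T (loc f i x)) (@codom_open _ _ M i) (sA i k)).
 by move=>p ip v; rewrite /trivial_coord tan_linE (PhiE p v i ip) /= sAE.
- move=>i; exists (fun z => z.2 *m invmx (jac (loc f i) z.1 *m T (loc f i z.1))).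
  move=>k; apply:(@Ck_mulfst R m k 1 m m _ (fun x => invmx (jac (loc f i) x *m T (loc f i x)))).
   exact:codom_open.
  apply:Ck_invmx; [exact:codom_open| |exact:sA].
  by move=>x [p ip <-]; rewrite sAE//; exact:uA.
 move=>p ip u; rewrite /tangent_coord /trivial_coord /= sAE//.
 have := PhiE p (tan_of p (u *m invmx (A0 p))) i ip.
 rewrite /tan_fun tan_ofE mulmxKV; last exact:uA (base_indexP p).
 by move=> {2}->; rewrite mulmxK//; exact:uA.
Qed.
End Theta.
End Parallel.

Lemma parallelizable_empty (R : realType) m (M : manifold R m) : ~ (exists p : M, True) -> parallelizable M.
move=>nM; have no (p : M) : False by apply:nM; exists p.
exists (fun p => \0), (fun p _ => 0); split.
- by move=>p; case:(no p).
- by move=>p; case:(no p).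
- move=>i; exists (cst 0); first exact:smooth_on_cst.
 by move=>p; case:(no p).
- move=>i; exists (cst 0); first exact:smooth_on_cst.
 by move=>p; case:(no p).
Qed.

(** * Almost-complex structures from matrix fields *)

Section AcsOfField.
Context {R : realType} {m : nat} {M : manifold R m}.
Variable A : index M -> M -> 'M[R]_m.

(** Computed in one chosen chart at p; the compatibility hypothesis [Ac] gives the same formula in
    every chart. *)
Definition field_fun (p : M) (v : tangent p) : tangent p :=
 tan_of p (v (base_index p) *m A (base_index p) p).

Fact field_fun_linear p : linear (@field_fun p).
move=>a v w; apply:(tan_eq (base_indexP p)).
by rewrite tcoordD !tan_ofE tcoordD mulmxDl scalemxAl.
Qed.

Definition field_lin p : {linear tangent p -> tangent p} :=
 HB.pack (@field_fun p) (GRing.isLinear.Build _ _ _ _ _ (@field_fun_linear p)).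

Hypothesis AA : forall i p, dom i p -> A i p *m A i p = - 1%:M.
Hypothesis sA : forall i, smooth_on (chart i @` dom i) (fun x => A i (chart_inv i x)).
Hypothesis Ac : forall i j p (v w : tangent p), dom i p -> dom j p -> w i = v i *m A i p -> w j = v j *m A j p.
Lemma field_linE p (v : tangent p) i : dom i p -> field_lin p v i = v i *m A i p.
by move=>ip; apply:(Ac (base_indexP p) ip); rewrite [LHS]tan_ofE. Qed.

Lemma acs_of_field : exists J : almost_complex M, forall p (v : tangent p) i, dom i p -> J p v i = v i *m A i p.
have sJ : smooth_fibrewise (@tangent_coord R m M) (@tangent_coord R m M) field_lin.
 move=>i; exists (fun z => z.2 *m A i (chart_inv i z.1)).
  move=>k; exact (@Ck_mulfst R m k 1 m m _ (fun x => A i (chart_inv i x)) (@codom_open _ _ M i) (sA i k)).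
 by move=>p ip v; rewrite /tangent_coord (field_linE v ip) /= chart_invK.
have JJ p v : field_lin p (field_lin p v) = - v.
 apply:(tan_eq (base_indexP p)).
 by rewrite !(field_linE _ (base_indexP p)) tcoordN -mulmxA AA ?mulmxN ?mulmx1//; exact:base_indexP.
by exists (AlmostComplex sJ JJ) => p v i ip; exact:(field_linE v ip).
Qed.
End AcsOfField.

(** * Holomorphic embeddings from a flattening field *)

Section HolomorphicOfFlat.
Context {R : realType} {m d : nat} {M : manifold R m}.
Local Notation D := (m + d)%N.
Variable f : smooth_map M (euclidean R D).
Hypothesis fE : smooth_embedding f.
Let F : M -> 'rV[R]_D := f.
Variable S : 'rV[R]_D -> 'M[R]_D.
Hypotheses (sS : smooth_on setT S) (uS : forall y, S y \in unitmx).
Hypothesis flat : forall i p, dom i p -> rsubmx (locjac f i p *m S (F p)) = 0.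
Variables (Jm : 'M[R]_m) (Jd : 'M[R]_d).
Hypotheses (JmE : Jm *m Jm = - 1%:M) (JdE : Jd *m Jd = - 1%:M).
Let J0 : 'M[R]_D := block_mx Jm 0 0 Jd.
Let Jh y : 'M[R]_D := S y *m J0 *m invmx (S y).
Let X i p : 'M[R]_m := lsubmx (locjac f i p *m S (F p)).
Let J0E : J0 *m J0 = - 1%:M.
by rewrite /J0 mulmx_block !(mulmx0, mul0mx, addr0, add0r) JmE JdE scalar_mx_block opp_block_mx !oppr0.
Qed.
Let XE i p : dom i p -> locjac f i p *m S (F p) = row_mx (X i p) 0.
by move=>ip; rewrite -(flat ip) hsubmxK. Qed.
Let X_unit i p : dom i p -> X i p \in unitmx.
move=>ip; apply:inj_unitmx => v vX; apply:(locjac_inj fE ip).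
rewrite -[RHS](mul0mx _ (invmx (S (F p)))) -[LHS](mulmxK (uS (F p))).
by congr (_ *m _); rewrite -mulmxA XE// mul_mx_row vX mulmx0 row_mx0.
Qed.
Let XJ i p : dom i p -> X i p *m Jm *m invmx (X i p) *m locjac f i p = locjac f i p *m Jh (F p).
move=>ip; rewrite /Jh !mulmxA XE// -[LHS](mulmxK (uS (F p))); congr (_ *m _).
rewrite -[LHS]mulmxA XE// !mul_mx_row mulmx0 mulmxKV; last exact:X_unit.
by rewrite /J0 mul_row_block !(mulmx0, mul0mx, addr0).
Qed.

(** S carries each tangent space onto the first m coordinates, which the block matrix [J0]
    preserves. So [Jh], the conjugate of [J0] by S, preserves the tangent spaces, and J on M is its
    restriction, written in charts through X. *)
Lemma holomorphic_of_flat : exists (JM : almost_complex M) (J : almost_complex (euclidean R D)),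
 pseudo_holomorphic_embedding JM J f.
have [J JE] : exists J : almost_complex (euclidean R D),
  forall y v i, dom i y -> J y v i = v i *m Jh y.
 apply:acs_of_field.
 - move=>i y _; rewrite /Jh !mulmxA mulmxKV// -[_ *m J0 *m J0]mulmxA J0E.
  by rewrite mulmxN mulmx1 mulNmx mulmxV.
 - move=>i k; have s1 : Ck_on k [set: 'rV_D] Jh.
   apply:Ck_mulmx; first exact:openT.
    apply:Ck_mulmx; [exact:openT|exact:sS|exact:Ck_cst].
   by apply:Ck_invmx; [exact:openT| |exact:sS].
  exact:Ck_sub s1.
 - by move=> [] [].
have [JM JME] : exists JM : almost_complex M, forall p v i,
  dom i p -> JM p v i = v i *m (X i p *m Jm *m invmx (X i p)).
 apply:acs_of_field.
 - move=>i p ip; rewrite !mulmxA mulmxKV; last exact:X_unit.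
  by rewrite -[X i p *m Jm *m Jm]mulmxA JmE mulmxN mulmx1 mulNmx mulmxV//; exact:X_unit.
 - move=>i k.
  have sX : Ck_on k (chart i @` dom i) (fun x => lsubmx (jac (loc f i) x *m S (loc f i x))).
   apply:Ck_lsubmx; first exact:codom_open.
   apply:Ck_mulmx; first exact:codom_open.
    by apply:Ck_jac; [exact:codom_open|exact:F_smooth].
   apply:Ck_comp => //.
   - exact:has_basis_mx.
   - exact:codom_open.
   - exact:F_smooth.
  have XL x : (chart i @` dom i) x -> X i (chart_inv i x) = lsubmx (jac (loc f i) x *m S (loc f i x)).
   by move=> [p ip <-]; rewrite /X /locjac chart_invK// locK.
  apply:(@Ck_ext _ _ _ _ _ _ (fun x => lsubmx (jac (loc f i) x *m S (loc f i x)) *m Jm *m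
    invmx (lsubmx (jac (loc f i) x *m S (loc f i x))))); first exact:codom_open.
   by move=>x /XL ->.
  apply:Ck_mulmx; first exact:codom_open.
   apply:Ck_mulmx; [exact:codom_open|exact:sX|exact:Ck_cst].
  apply:Ck_invmx; [exact:codom_open| |exact:sX].
  by move=>x xi; rewrite -XL//; case:xi => p ip <-; rewrite chart_invK//; exact:X_unit.
 - move=>i j p v w ip jp wi.
  have E : w j *m locjac f j p = v j *m (X j p *m Jm *m invmx (X j p)) *m locjac f j p.
   rewrite -[RHS]mulmxA (XJ jp) mulmxA -(tangent_mapJ f v jp) (tangent_mapJ f v ip).
   by rewrite -mulmxA -(XJ ip) mulmxA -wi -(tangent_mapJ f w jp) (tangent_mapJ f w ip).
  apply/eqP; rewrite -subr_eq0; apply/eqP; apply:(locjac_inj fE jp).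
  by rewrite mulmxBl E subrr.
exists JM, J; split => // p v; apply:tan_eq => //.
have ip := base_indexP p.
rewrite JE//; apply:etrans (tangent_mapJ f _ ip) _; rewrite JME// -mulmxA XJ// mulmxA.
by congr (_ *m _); exact:esym (tangent_mapJ f v ip).
Qed.
End HolomorphicOfFlat.

(** * The area form on a normal plane *)

Section NormalVolume.
Context {R : realType} {m : nat}.
Local Notation D := (m + 2)%N.

Lemma mx22P (A B : 'M[R]_2) : A 0 0 = B 0 0 -> A 0 1 = B 0 1 -> A 1 0 = B 1 0 -> A 1 1 = B 1 1 -> A = B.
move=>h00 h01 h10 h11; apply/matrixP => i j.
have P (k : 'I_2) : k = 0 \/ k = 1 by case:k => [[|[|k]] hk] //; [left|right]; exact:val_inj.
by case:(P i) => ->; case:(P j) => ->.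
Qed.

Lemma rV2P (u v : 'rV[R]_2) : u 0 0 = v 0 0 -> u 0 1 = v 0 1 -> u = v.
move=>h0 h1; apply/rowP => j.
have : j = 0 \/ j = 1 by case:j => [[|[|k]] hk] //; [left|right]; exact:val_inj.
by case=> ->.
Qed.

Lemma mulmx22 k l (A : 'M[R]_(k, 2)) (B : 'M[R]_(2, l)) i j : (A *m B) i j = A i 0 * B 0 j + A i 1 * B 1 j.
rewrite mxE big_ord_recl big_ord1; congr (_ + A i _ * B _ j); exact:val_inj.
Qed.

Lemma det22 (A : 'M[R]_2) : \det A = A 0 0 * A 1 1 - A 0 1 * A 1 0.
have e1 : fintype.lift ord0 ord0 = 1 :> 'I_2 by exact:val_inj.
have e2 : fintype.lift 1 ord0 = 0 :> 'I_2 by exact:val_inj.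
rewrite (expand_det_row A 0) big_ord_recl big_ord1 e1 /cofactor !det_mx11 !mxE e1 e2.
by rewrite expr0 expr1; ring.
Qed.

Definition duo k (x y : 'rV[R]_k) : 'M[R]_(2, k) := \matrix_(i, j) (if i == 0 then x 0 j else y 0 j).

Lemma duo_mul k l (x y : 'rV_k) (A : 'M[R]_(k, l)) : duo x y *m A = duo (x *m A) (y *m A).
apply/matrixP => i j; rewrite !mxE; case:ifP => h; apply:eq_bigr => l' _;
 by rewrite !mxE h.
Qed.

Lemma mul_duo k (x y : 'rV_k) (w : 'rV_2) : w *m duo x y = w 0 0 *: x + w 0 1 *: y.
by apply/rowP => j; rewrite mulmx22 !mxE. Qed.

(** Multiplying a v + b v K by a - b K gives (a^2 + b^2) v. *)
Lemma rot_indep k (v : 'rV_k) (K : 'M[R]_k) a b : v *m K *m K = - v -> v != 0 ->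
 a *: v + b *: (v *m K) = 0 -> a = 0 /\ b = 0.
move=>vK v0 h; have : (a *: v + b *: (v *m K)) *m (a%:M - b *: K) = 0 by rewrite h mul0mx.
rewrite mulmxBr mulmxDl !mul_mx_scalar -!scalemxAr mulmxDl -!scalemxAl vK => E2.
have /eqP : (a ^+ 2 + b ^+ 2) *: v = 0 by rewrite -E2; apply/rowP => j; rewrite !mxE; ring.
rewrite scaler_eq0 (negPf v0) orbF paddr_eq0 ?sqr_ge0// !sqrf_eq0 => /andP[/eqP -> /eqP ->].
by split.
Qed.

Lemma duo_inj k (v : 'rV_k) (K : 'M[R]_k) (w : 'rV_2) : v *m K *m K = - v -> v != 0 ->
 w *m duo v (v *m K) = 0 -> w = 0.
move=>vK v0; rewrite mul_duo => /(rot_indep vK v0)[h0 h1].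
by apply:rV2P; rewrite mxE.
Qed.

Lemma duo_free k (v : 'rV_k) (K : 'M[R]_k) : v *m K *m K = - v -> v != 0 -> row_free (duo v (v *m K)).
by move=>vK v0; apply:inj_row_free => w; exact:duo_inj. Qed.

(** Coordinates along a complement of the row space of A: the first columns of the inverse of a
    completed basis. *)
Lemma row_kernel k l (A : 'M[R]_(l, k + l)) : row_free A ->
 exists C : 'M[R]_(k + l, k), forall v : 'rV_(k + l), v *m C = 0 -> exists w, v = w *m A.
move=>rA; have h : \rank (A^C)%MS = k by rewrite mxrank_compl (eqP rA) addnK.
pose w := castmx (h, erefl) (row_base A^C)%MS.
have uW : col_mx w A \in unitmx.
 rewrite -row_full_unit -sub1mx -addsmxE; have := addsmx_compl_full A.
 rewrite -sub1mx addsmxC => /submx_trans; apply; apply:addsmxS => //.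
 by rewrite eqmx_cast eq_row_base.
exists (lsubmx (invmx (col_mx w A))) => v vC; exists (rsubmx (v *m invmx (col_mx w A))).
by rewrite -[LHS](mulmxKV uW) -[v *m invmx _]hsubmxK mul_row_col -mulmx_lsub vC mul0mx add0r ?row_mxKr.
Qed.

Definition rot2 : 'M[R]_2 := \matrix_(i, j) (if i == j then 0 else if i == 0 then 1 else -1).
Lemma rot2_sandwich (A : 'M[R]_2) : A *m rot2 *m A^T = \det A *: rot2.
by apply:mx22P; rewrite !mulmx22 !mxE det22 /=; ring. Qed.

Lemma rot2_sym (A : 'M[R]_2) : A^T = A -> rot2 *m A *m rot2 *m A = - (\det A)%:M.
move=>At; have e : A 1 0 = A 0 1 by rewrite -{1}At mxE.
by apply:mx22P; rewrite !mulmx22 !mxE det22 /= e; ring.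
Qed.

Variables (E : 'M[R]_(m, D)) (Q : 'M[R]_D).
Hypotheses (iE : forall v : 'rV_m, v *m E = 0 -> v = 0) (EQ : E *m Q = 0) (QQ : Q *m Q = Q) (Qt : Q^T = Q).
Hypothesis Qk : forall v : 'rV_D, v *m Q = 0 -> exists u, v = u *m E.

Lemma normal_basis : exists n0 : 'M[R]_(2, D), [/\ n0 *m Q = n0, n0 *m n0^T \in unitmx,
 Q = n0^T *m invmx (n0 *m n0^T) *m n0 & (col_mx E n0 : 'M[R]_D) \in unitmx].
have /eqP rE : row_free E by exact:inj_row_free.
have [Cm EE] : exists Cm : 'M[R]_(m, m), Cm \in unitmx /\ E = Cm *m usubmx (row_ebase E).
 exists (col_ebase E); split; first exact:col_ebase_unit.
 have := mulmx_ebase E; rewrite rE pid_mx_row -{1}(vsubmxK (row_ebase E)) -mulmxA mul_row_col mul0mx addr0 mul1mx.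
 exact:esym.
have [uC {}EE] := EE.
have [B [uB EB]] : exists B : 'M[R]_D, B \in unitmx /\ E = Cm *m usubmx B by exists (row_ebase E); split => //; exact:row_ebase_unit.
pose w := dsubmx B.
have winj v1 (v2 : 'rV_2) : v1 *m E + v2 *m w = 0 -> v1 = 0 /\ v2 = 0.
 rewrite EB mulmxA -mul_row_col vsubmxK => h.
 have : row_mx (v1 *m Cm) v2 = 0 :> 'rV_D by rewrite -[LHS](mulmxK uB) h mul0mx.
 rewrite -[RHS]row_mx0 => /eq_row_mx[h1 h2]; split => //.
 by rewrite -[v1](mulmxK uC) h1 mul0mx.
have [n0 n0E] : exists n0, n0 = w *m Q by exists (w *m Q).
have n0Q : n0 *m Q = n0 by rewrite n0E -mulmxA QQ.
have ninj v1 (v2 : 'rV_2) : v1 *m E + v2 *m n0 = 0 -> v1 = 0 /\ v2 = 0.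
 move=>h; have h2 : v2 *m n0 = 0.
  by move: (congr1 (mulmx^~ Q) h); rewrite mulmxDl -!mulmxA EQ n0Q mulmx0 add0r mul0mx.
 split; first by apply:iE; move: h; rewrite h2 addr0.
 have [u hu] : exists u, v2 *m w = u *m E by apply:Qk; rewrite -mulmxA -n0E.
 by have [] := winj (- u) v2; rewrite // mulNmx hu addNr.
have gu : n0 *m n0^T \in unitmx.
 by apply:gram_unit => v hv; have [] := ninj 0 v; rewrite // mul0mx add0r.
have n0t : n0^T = Q *m w^T by rewrite n0E trmx_mul Qt.
have Wu : (col_mx E w : 'M[R]_D) \in unitmx.
 apply:inj_unitmx => v; rewrite -[v]hsubmxK mul_row_col => /winj[-> ->]; exact:row_mx0.
exists n0; split => //.
 rewrite -[LHS](mulKmx Wu) -[RHS](mulKmx Wu); congr (_ *m _).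
 rewrite !mul_col_mx EQ !mulmxA; congr col_mx.
  by rewrite [in E *m n0^T]n0t [E *m (Q *m _)]mulmxA EQ !mul0mx.
 have -> : w *m n0^T = n0 *m n0^T by rewrite n0t mulmxA -n0E mulmxA n0Q.
 by rewrite mulmxV// mul1mx -n0E.
apply:inj_unitmx => v; rewrite -[v]hsubmxK mul_row_col => /ninj[-> ->]; exact:row_mx0.
Qed.

(** The area form of the normal plane oriented by the frame E, evaluated on the projected basis
    vectors. As a matrix it is a positive or negative multiple of the rotation by a quarter turn. *)
Definition vol : 'M[R]_D :=
 \matrix_(a, b) \det (col_mx E (duo (row a Q) (row b Q)) : 'M[R]_D).

(** In a basis n0 of the normal plane, [vol] is c' n0^T rot2 n0, and [rot2_sym] gives its square.
    The trace clause recovers the scale a from [vol] by a continuous formula. *)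
Lemma volE : exists a : R, [/\ 0 < a, vol *m vol = - a *: Q, Q *m vol = vol, vol *m Q = vol & \tr (vol *m vol) = - a * 2].
have [n0 [n0Q gu QE cu]] := normal_basis.
set G := n0 *m n0^T in gu QE; set g := invmx G in QE.
have Gt : G^T = G by rewrite /G trmx_mul trmxK.
pose c := \det (col_mx E n0 : 'M[R]_D).
pose be := n0^T *m g.
have rowE' a : row a Q = row a be *m n0 by rewrite -row_mul -QE.
have volE1 : vol = c *: (be *m rot2 *m be^T).
 apply/matrixP => a b; rewrite [LHS]mxE [RHS]mxE !rowE'.
 have -> : col_mx E (duo (row a be *m n0) (row b be *m n0)) =
   (block_mx 1%:M 0 0 (duo (row a be) (row b be)) : 'M[R]_D) *m col_mx E n0.
  by rewrite mul_block_col !mul0mx mul1mx addr0 add0r duo_mul.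
 rewrite det_mulmx det_ublock det1 mul1r mulrC; congr (_ * _).
 have beT j : be^T j b = be b j by rewrite mxE.
 rewrite det22 mulmx22 2!(mulmx22 be) !beT !mxE /=; ring.
have beE : be *m rot2 *m be^T = \det g *: (n0^T *m rot2 *m n0).
 have -> : be *m rot2 *m be^T = n0^T *m (g *m rot2 *m g^T) *m n0.
  by rewrite /be trmx_mul trmxK !mulmxA.
 by rewrite rot2_sandwich -scalemxAr -scalemxAl.
pose c' := c * \det g.
have volE2 : vol = c' *: (n0^T *m rot2 *m n0) by rewrite volE1 beE scalerA.
have c'0 : c' != 0 by rewrite mulf_neq0// -unitfE -unitmxE// unitmx_inv.
have vv : vol *m vol = - (c' ^+ 2 * \det G) *: Q.
 have e : rot2 *m G *m rot2 = - (\det G *: g).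
  rewrite -[LHS](mulmxK gu) rot2_sym// mulNmx; congr (- _).
  by rewrite mul_scalar_mx.
 rewrite volE2 -scalemxAr -scalemxAl scalerA.
 have -> : n0^T *m rot2 *m n0 *m (n0^T *m rot2 *m n0) = n0^T *m (rot2 *m G *m rot2) *m n0.
  by rewrite /G !mulmxA.
 by rewrite e mulmxN mulNmx -scalemxAr -scalemxAl -QE scalerN scalerA scaleNr expr2.
have Qn : Q *m n0^T = n0^T by rewrite -{1}Qt -trmx_mul n0Q.
have Qv : Q *m vol = vol by rewrite volE2 -scalemxAr !mulmxA Qn.
have vQ : vol *m Q = vol by rewrite volE2 -scalemxAl -!mulmxA n0Q.
set a := c' ^+ 2 * \det G in vv.
have trQ : \tr Q = 2 by rewrite QE mxtrace_mulC mulmxA mulmxV// mxtrace1.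
have a0 : a != 0.
 by rewrite /a mulf_neq0// ?expf_neq0// -unitfE -unitmxE.
have vt : vol^T = - vol.
 rewrite volE2 linearZ /= !trmx_mul trmxK mulmxA.
 have -> : rot2^T = - rot2 by apply:mx22P; rewrite !mxE /= ?oppr0 ?opprK.
 by rewrite mulmxN mulNmx scalerN.
exists a; split => //; last by rewrite vv linearZ /= trQ.
pose v := row 0 n0.
have vQ' : v *m Q = v by rewrite /v -row_mul n0Q.
have v0 : v != 0.
 apply/eqP => h; have : G 0 0 = 0.
  have -> : G 0 0 = dot v v by rewrite dotE /G mxE; apply:eq_bigr => j _; rewrite !mxE.
  by rewrite h dot0l.
 move=>G00; have : row 0 G = 0 by rewrite /G row_mul -/v h mul0mx.
 move=>r0; have : row 0 (1%:M : 'M[R]_2) = 0 by rewrite -(mulmxV gu) row_mul r0 mul0mx.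
 by move=> /matrixP/(_ 0 0); rewrite !mxE eqxx => /eqP; rewrite oner_eq0.
(* [vol] is skew, so the squared length of v [vol] is a |v|^2, which fixes the sign of a. *)
have E1 : dot (v *m vol) (v *m vol) = a * dot v v.
 rewrite /dot trmx_mul vt mulmxA -[v *m vol *m _]mulmxA mulmxN vv scaleNr opprK -scalemxAr.
 by rewrite vQ' -scalemxAl mxE.
have := dot_ge0 (v *m vol); rewrite E1 => h.
by rewrite lt_neqAle eq_sym a0 /= -(pmulr_lge0 a (dot_gt0 v0)).
Qed.
End NormalVolume.

(** * Tangent and normal frames along the embedding *)

Section TangentFrame.
Context {R : realType} {m D : nat} {M : manifold R m}.
Variable f : smooth_map M (euclidean R D).

Lemma linear_rowE k l (g : 'rV[R]_k -> 'rV[R]_l) : (forall a u v, g (a *: u + v) = a *: g u + g v) ->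
 forall u, g u = u *m \matrix_(i, j) g (delta_mx 0 i) 0 j.
move=>gl u; have g0 : g 0 = 0 by have := gl (-1) 0 0; rewrite scaler0 addr0 scaleN1r addNr.
rewrite {1}(row_sum_delta u) [RHS]mulmx_sum_row.
transitivity (\sum_j u 0 j *: g (delta_mx 0 j)).
 by elim/big_rec2: _ => [|j a b _ <-].
by apply:eq_bigr => j _; congr (_ *: _); apply/rowP => l'; rewrite !mxE.
Qed.

Lemma tangent_frame : parallelizable M -> exists E : M -> 'M[R]_(m, D),
 continuous E /\ forall i p, dom i p -> exists2 A, A \in unitmx & E p = A *m locjac f i p.
move=> [Phi [Psi [PhiK PsiK _ sPsi]]].
pose A i p : 'M[R]_m := \matrix_(a, b) Psi p (delta_mx 0 a) i 0 b.
pose E p : 'M[R]_(m, D) := \matrix_(a, b) tangent_map f (Psi p (delta_mx 0 a)) tt 0 b.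
have EA i p : dom i p -> E p = A i p *m locjac f i p.
 move=>ip; apply/row_matrixP => a; rewrite row_mul.
 have -> : row a (E p) = tangent_map f (Psi p (delta_mx 0 a)) tt by apply/rowP => b; rewrite !mxE.
 rewrite (tangent_mapJ f _ ip); congr (_ *m _).
 by apply/rowP => b; rewrite !mxE.
have Plin p a u v : Psi p (a *: u + v) = a *: Psi p u + Psi p v.
 by rewrite -{1}(PsiK p u) -{1}(PsiK p v) -linearP PhiK.
have PA i p v : Psi p v i = v *m A i p.
 by apply:(linear_rowE (g := fun v => Psi p v i)) => a u w; rewrite Plin tcoordD.
have uA i p : dom i p -> A i p \in unitmx.
 move=>ip; apply:inj_unitmx => v h; rewrite -[LHS](PsiK p) -[RHS](PsiK p); congr (Phi p _).
 by apply:(tan_eq ip); rewrite !PA h mul0mx.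
exists E; split; last by move=>i p ip; exists (A i p); [exact:uA|exact:EA].
move=>p; have ip := base_indexP p; set i := base_index p in ip.
have [G sG GE] := sPsi i.
have GE' q : dom i q -> A i q = \matrix_(a, b) G (chart i q, delta_mx 0 a) 0 b.
 move=>iq; apply/matrixP => a b; rewrite !mxE.
 by rewrite -[Psi q _ i]/(tangent_coord i (Psi q (delta_mx 0 a))) GE.
have cA : A i q @[q --> p] --> A i p.
 apply:cvg_mx => a b.
 have c1 : {for p, continuous (fun q => G (chart i q, delta_mx 0 a))}.
  have Gc : {for (chart i p, delta_mx 0 a : 'rV[R]_m), continuous G}.
   by apply:(Ck_on0 (sG 0%N)); split => //; exists p.
  exact (pt_comp (pt_pair (chart_continuous ip) (@pt_cst _ _ (delta_mx 0 a : 'rV[R]_m) p)) Gc).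
 apply:(@cvg_trans _ (G (chart i q, delta_mx 0 a) 0 b @[q --> p])).
  apply:near_eq_cvg; near=> q.
  have iq : dom i q by near: q; exact:near_dom.
  by rewrite (GE' q iq) mxE.
 rewrite (GE' p ip) mxE; exact:cvg_coord c1.
rewrite /continuous_at (EA i p ip).
apply:(@cvg_trans _ (A i q *m locjac f i q @[q --> p])).
 apply:near_eq_cvg; near=> q.
 have iq : dom i q by near: q; exact:near_dom.
 exact:esym (EA i q iq).
by apply:cvg_mulmx => //; exact:locjac_cvg.
Unshelve. all: by end_near. Qed.
End TangentFrame.
Section NormalFrame.
Context {R : realType} {m : nat} {M : manifold R m}.
Local Notation D := (m + 2)%N.
Variables (f : smooth_map M (euclidean R D)) (fE : smooth_embedding f) (Mc : closed_manifold M) (p_ : M).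
Variable E : M -> 'M[R]_(m, D).
Hypothesis cE : continuous E.
Hypothesis EA : forall i p, dom i p -> exists2 A, A \in unitmx & E p = A *m locjac f i p.

Lemma frame_inj p (v : 'rV_m) : v *m E p = 0 -> v = 0.
have ip := base_indexP p; have [A uA ->] := EA ip; rewrite mulmxA => /(locjac_inj fE ip) h.
by rewrite -[v](mulmxK uA) h mul0mx.
Qed.

Lemma frame_Qn p : E p *m Qn f p = 0.
by have ip := base_indexP p; have [A uA ->] := EA ip; rewrite -mulmxA locjac_Qn// mulmx0.
Qed.

Lemma frame_ker p (v : 'rV_D) : v *m Qn f p = 0 -> exists u, v = u *m E p.
have ip := base_indexP p; have [A uA EE] := EA ip => /(tangent_normal fE ip)[u ->].
by exists (u *m invmx A); rewrite EE mulmxA mulmxKV.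
Qed.

(** The area form divided by the square root of its scale; that scale is read off the trace, as the
    normal plane has dimension 2. *)
Lemma normal_rotation : exists K : M -> 'M[R]_D, [/\ continuous K, forall p, K p *m K p = - Qn f p,
 forall p, K p *m Qn f p = K p & forall p, Qn f p *m K p = K p].
pose vo p := vol (E p) (Qn f p).
have voP p := volE (@frame_inj p) (frame_Qn p) (Qn_idem fE p) (Qn_tr fE p) (@frame_ker p).
pose a p : R := - \tr (vo p *m vo p) / 2.
have aP p : 0 < a p /\ vo p *m vo p = - a p *: Qn f p.
 have [b [b0 h1 _ _ h2]] := voP p; have ab : a p = b by rewrite /a /vo h2; field.
 by rewrite ab.
have cQ : continuous (Qn f) by exact:Qn_cont.
have cvo : continuous vo.
 apply:cont_mx => i j.
 have -> : (fun p => vo p i j) = (fun p => \det (col_mx (E p) (duo (row i (Qn f p)) (row j (Qn f p))) : 'M[R]_D)).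
  by apply/funext => p; rewrite mxE.
 have cd : continuous (fun p => duo (row i (Qn f p)) (row j (Qn f p))).
  apply:cont_mx => k l.
  have -> : (fun p => duo (row i (Qn f p)) (row j (Qn f p)) k l) = (fun p => Qn f p (if k == 0 then i else j) l).
   by apply/funext => p; rewrite !mxE; case:ifP.
  exact (cont_coord (@cQ)).
 exact (cont_det (n := D) (cont_col_mx (@cE) (@cd))).
have ca : continuous a.
 have -> : a = (fun p => (- 2^-1) * \sum_i (vo p *m vo p) i i).
  by apply/funext => p; rewrite /a /mxtrace; ring.
 apply:contM; first exact:cont_cst.
 apply:cont_sum => i _; exact (cont_coord (cont_mulmx (@cvo) (@cvo))).
have cs : continuous (fun p => Num.sqrt (a p)) by exact:compc ca (@sqrt_continuous R).
have s0 p : Num.sqrt (a p) != 0 by rewrite sqrtr_eq0 -ltNge; have [] := aP p.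
exists (fun p => (Num.sqrt (a p))^-1 *: vo p); split.
- exact (contZ (contV s0 (@cs)) (@cvo)).
- move=>p; have [a0 h] := aP p; rewrite -scalemxAr -scalemxAl h scalerA scalerA.
 have -> : (Num.sqrt (a p))^-1 * (Num.sqrt (a p))^-1 * - a p = -1.
  rewrite -[X in _ * - X](sqr_sqrtr (ltW a0)); by field.
 exact:scaleN1r.
- by move=>p; have [b [_ _ _ h _]] := voP p; rewrite -scalemxAl h.
- by move=>p; have [b [_ _ h _ _]] := voP p; rewrite -scalemxAr h.
Qed.

Variable K : M -> 'M[R]_D.
Hypotheses (cK : continuous K) (KK : forall p, K p *m K p = - Qn f p) (KQ : forall p, K p *m Qn f p = K p).
Hypothesis QK : forall p, Qn f p *m K p = K p.
Variable nu : M -> 'rV[R]_D.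
Hypotheses (cnu : continuous nu) (nnu : forall p, nu p != 0) (nuQ : forall p, nu p *m Qn f p = nu p).

Lemma nuKK p : nu p *m K p *m K p = - nu p.
by rewrite -mulmxA KK mulmxN nuQ. Qed.

(** The pair (nu, nu K) trivialises the normal bundle; [nn] is the pseudo-inverse of the matrix [ww]
    of this frame. *)
Lemma normal_factor : exists (nn : M -> 'M[R]_(D, 2)) (ww : M -> 'M[R]_(2, D)),
 [/\ continuous nn, continuous ww & forall p, nn p *m ww p = Qn f p].
pose ww p := duo (nu p) (nu p *m K p).
have cnK : continuous (fun p => nu p *m K p) by exact:cont_mulmx.
have cww : continuous ww.
 apply:cont_mx => i j; have [i0|i1] := eqVneq i 0.
  have -> : (fun p => ww p i j) = (fun p => nu p 0 j) by apply/funext => p; rewrite mxE i0.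
  exact (cont_coord (@cnu)).
 have -> : (fun p => ww p i j) = (fun p => (nu p *m K p) 0 j) by apply/funext => p; rewrite mxE (negPf i1).
 exact (cont_coord (@cnK)).
have wi p (v : 'rV_2) : v *m ww p = 0 -> v = 0 by exact:duo_inj (nuKK p) (nnu p).
have gu p : ww p *m (ww p)^T \in unitmx by apply:gram_unit; exact:wi.
pose nn p := (ww p)^T *m invmx (ww p *m (ww p)^T).
have cwt : continuous (fun p => (ww p)^T) by exact:cont_trmx.
exists nn, ww; split; [|exact:cww|].
 exact (cont_mulmx (@cwt) (cont_invmx gu (cont_mulmx (@cww) (@cwt)))).
move=>p; have wQ : ww p *m Qn f p = ww p by rewrite /ww duo_mul nuQ -mulmxA KQ.
have Qw : Qn f p *m (ww p)^T = (ww p)^T by rewrite -{1}(Qn_tr fE) -trmx_mul wQ.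
have e1 : Qn f p *m (nn p *m ww p) = nn p *m ww p by rewrite /nn !mulmxA Qw.
have e2 : ww p *m (nn p *m ww p) = ww p by rewrite /nn !mulmxA mulmxV// mul1mx.
rewrite -e1; apply/row_matrixP => j; rewrite !rowE !mulmxA.
have [c1 [c2 h]] : exists c1 c2, delta_mx 0 j *m Qn f p = c1 *: nu p + c2 *: (nu p *m K p).
 by apply:(normal_plane fE KK KQ (nuQ p) (nnu p)); rewrite -mulmxA Qn_idem.
pose c : 'rV[R]_2 := \row_k (if k == 0 then c1 else c2).
have -> : delta_mx 0 j *m Qn f p = c *m ww p by rewrite /ww mul_duo !mxE /= h.
by move: (congr1 (mulmx c) e2); rewrite /nn !mulmxA.
Qed.
End NormalFrame.

(** * Approximation by smooth invertible fields on R^D *)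

Section Approximable.
Context {R : realType} {m D : nat} {M : manifold R m}.
Variables (f : smooth_map M (euclidean R D)) (fE : smooth_embedding f) (Mc : closed_manifold M) (p_ : M).
Let F : M -> 'rV[R]_D := f.

Definition appr k (B : M -> 'M[R]_k) := continuous B /\ forall e : R, 0 < e ->
 exists G : 'rV[R]_D -> 'M[R]_k, [/\ smooth_on setT G, forall y, G y \in unitmx &
  forall p, `|G (F p) - B p| <= e].

Lemma cutoff_smooth p q (th : 'rV_D -> R) (U K1 : set 'rV_D) (g : 'rV_D -> 'M[R]_(p, q)) :
 smooth_on setT th -> open U -> compact K1 -> K1 `<=` U -> (forall x, ~ K1 x -> th x = 0) ->
 smooth_on U g -> smooth_on setT (fun x => th x *: g x).
move=>sth oU K1c K1U th0 sg k; have cK1 : closed K1 by exact:compact_closed K1c.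
apply:Ck_loc => x _; have [xK|xK] := pselect (K1 x).
 exists U; split; first exact:K1U.
 apply:CkZ; [exact:oU| |exact:sg].
 exact:Ck_sub (sth k).
exists (~` K1); split => //.
apply:(@Ck_ext _ _ _ _ _ _ (cst 0)) => //; [by rewrite openC| ].
by move=>y yK; rewrite th0// scale0r.
Qed.

(** A factor 1 + A with A small is where extension succeeds: cutting off a smooth approximation of A
    keeps k |A| < 1 everywhere, so the extended matrix is invertible on all of R^D. Half of the
    bound is used by A, half by the approximation. *)
Lemma appr1D k (A : M -> 'M[R]_k) : continuous A -> (forall p, `|A p| < (2 * k.+1%:R)^-1) ->
 appr (fun p => 1%:M + A p).
move=>cA sA; split; first exact:contD.
move=>e e0; have k0 : 0 < k.+1%:R :> R by rewrite ltr0n.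
have a0 : 0 < (2 * k.+1%:R)^-1 :> R by rewrite invr_gt0 mulr_gt0.
pose e2 := Num.min e (2 * k.+1%:R)^-1.
have e20 : 0 < e2 by rewrite lt_min e0 a0.
have [Q1 [A' [oQ FQ sA' hA']]] := smooth_approx_M fE Mc p_ cA e20.
have kk : (2 * k.+1%:R)^-1 + (2 * k.+1%:R)^-1 = k.+1%:R^-1 :> R.
 by field; rewrite gt_eqF.
have A'F p : k%:R * `|A' (F p)| < 1.
 have h : `|A' (F p)| <= k.+1%:R^-1.
  rewrite -kk -[A' _](subrK (A p)); apply:le_trans (ler_normD _ _) _; apply:lerD.
   by apply:le_trans (hA' p) _; rewrite /e2 ge_min lexx orbT.
  exact:ltW.
 apply:le_lt_trans (ler_wpM2l (ler0n _ _) h) _.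
 by rewrite ltr_pdivrMr// mul1r ltr_nat.
pose U := [set y | Q1 y /\ k%:R * `|A' y| < 1].
have oU : open U.
 rewrite openE => y [Qy hy]; have cy : {for y, continuous A'} by exact:Ck_on0 (sA' 0%N) _ Qy.
 apply:filterI; first by apply:open_nbhs_nbhs; split.
 exact:(pt_lt (ptM (@pt_cst _ _ (k%:R : R) y) (pt_norm cy)) hy).
have FU : range F `<=` U by move=> _ [p _ <-]; split => //; apply:FQ; exists p.
have [th [K1 [sth th01 [V oV [FV thV]] [K1c K1U] thK1]]] := cutoff (range_compact Mc) oU FU.
exists (fun y => 1%:M + th y *: A' y); split.
- move=>r; apply:CkD; [exact:openT|exact:Ck_cst|].
 apply:(cutoff_smooth sth oU K1c K1U thK1) => l; apply:Ck_sub (sA' l) => y; by case.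
- move=>y; apply:small_unitmx; have [yK|yK] := pselect (K1 y); last first.
  by rewrite thK1// scale0r normr0 mulr0 ltr01.
 have [_] := K1U _ yK; apply:le_lt_trans; rewrite ler_wpM2l// normrZ.
 by have /andP[h1 h2] := th01 y; rewrite ger0_norm// ler_piMl.
- move=>p; rewrite thV; last by apply:FV; exists p.
 rewrite scale1r opprD addrACA subrr add0r; apply:le_trans (hA' p) _.
 by rewrite /e2 ge_min lexx.
Qed.

Lemma appr_mul k (B C : M -> 'M[R]_k) : appr B -> appr C -> appr (fun p => B p *m C p).
move=> [cB aB] [cC aC]; split; first exact:cont_mulmx.
move=>e e0; have [b b0 hb] := M_bound fE Mc p_ cB; have [c c0 hc] := M_bound fE Mc p_ cC.
pose d := e / (k.+1%:R * (b + (c + 1))); pose e1 := Num.min 1 d.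
have s0 : 0 < b + (c + 1) by rewrite !addr_gt0.
have d0 : 0 < d by rewrite divr_gt0// mulr_gt0// ltr0n.
have e10 : 0 < e1 by rewrite lt_min ltr01 d0.
have [G [sG uG hG]] := aB _ e10; have [H [sH uH hH]] := aC _ e10.
exists (fun y => G y *m H y); split.
- by move=>r; apply:Ck_mulmx; [exact:openT|exact:sG|exact:sH].
- by move=>y; rewrite unitmx_mul uG uH.
- move=>p; set g := G (F p); set h := H (F p).
 have -> : g *m h - B p *m C p = (g - B p) *m h + B p *m (h - C p).
  by rewrite mulmxBl mulmxBr addrA subrK.
 have hn : `|h| <= c + 1.
  rewrite -[h](subrK (C p)) [c + 1]addrC; apply:le_trans (ler_normD _ _) _; apply:lerD => //.
  by apply:le_trans (hH p) _; rewrite /e1 ge_min lexx.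
 have e1d : e1 <= d by rewrite /e1 ge_min lexx orbT.
 have h1 : `|(g - B p) *m h| <= k.+1%:R * (d * (c + 1)).
  apply:le_trans (norm_mulmx _ _) _; apply:ler_pM => //; first by rewrite ler_nat.
  by apply:ler_pM => //; exact:le_trans (hG p) e1d.
 have h2 : `|B p *m (h - C p)| <= k.+1%:R * (b * d).
  apply:le_trans (norm_mulmx _ _) _; apply:ler_pM => //; first by rewrite ler_nat.
  by apply:ler_pM => //; exact:le_trans (hH p) e1d.
 apply:le_trans (ler_normD _ _) _; apply:le_trans (lerD h1 h2) _.
 have -> : k.+1%:R * (d * (c + 1)) + k.+1%:R * (b * d) = d * (k.+1%:R * (b + (c + 1))) by ring.
 by rewrite /d divfK// gt_eqF// mulr_gt0// ltr0n.
Qed.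

Lemma appr_eprod k (A : nat -> M -> 'M[R]_k) N : (forall i, continuous (A i)) ->
 (forall i p, (i < N)%N -> `|A i p| < (2 * k.+1%:R)^-1) -> appr (eprod A N).
move=>cA; elim:N => [|N IH] sA; rewrite /appr.
 split => //.
 move=>e e0; exists (cst 1%:M); split.
 - by move=>r.
 - by move=>y; exact:unitmx1.
 - by move=>p; rewrite subrr normr0 ltW.
apply:appr_mul.
 by apply:IH => i p iN; apply:sA; exact:ltnW.
by apply:appr1D => // p; exact:sA.
Qed.
End Approximable.

(** * Bookkeeping for the last two coordinates *)

Section LastCoordinates.
Context {R : realType} {m : nat}.
Local Notation D := (m + 2)%N.

Lemma pid_mx_last (x : 'rV[R]_D) : x *m pid_mx (1 + m) = x - x 0 (rshift m 1) *: delta_mx 0 (rshift m 1).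
apply/rowP => j; rewrite !mxE (bigD1 j)//= mxE eqxx /= big1 ?addr0; last first.
 by move=>i ij; rewrite mxE (negPf (_ : val i != val j)) ?mulr0//; apply:contra ij => /eqP h; apply/eqP; exact:val_inj.
have [->|jn] := eqVneq j (rshift m 1); first by rewrite /= addn1 ltnn mulr0 mulr1 subrr.
rewrite mulr0 subr0 (_ : (j < 1 + m)%N) ?mulr1//.
have : (j < m.+2)%N by apply:(leq_trans (ltn_ord j)); rewrite addn2.
rewrite ltnS leq_eqVlt => /orP[/eqP h|]; last by rewrite add1n.
by case/eqP: jn; apply:val_inj; rewrite /= h addn1.
Qed.

Lemma pid_mx_K : (pid_mx (1 + m) : 'M[R]_(1 + m, D)) *m (pid_mx (1 + m) : 'M[R]_(D, 1 + m)) = 1%:M.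
by rewrite pid_mx_id ?pid_mx_1// addn2. Qed.

Lemma last_pid : delta_mx 0 (rshift m 1) *m (pid_mx (1 + m) : 'M[R]_(D, 1 + m)) = 0 :> 'rV_(1 + m).
rewrite -rowE; apply/rowP => j; rewrite !mxE /=.
by case:eqP => [h|//]; have := ltn_ord j; rewrite -h addn1 ltnn andbF.
Qed.

Lemma pid_last : delta_mx 0 (ord_max : 'I_(1 + m)) *m (pid_mx (1 + m) : 'M[R]_(1 + m, D)) = delta_mx 0 (rshift m 0) :> 'rV_D.
rewrite -rowE; apply/rowP => j; rewrite !mxE /= ltnSn andbT eq_sym.
by rewrite -(inj_eq val_inj) /= addn0.
Qed.

Lemma row_mx0_last (w : 'rV[R]_2) : row_mx 0 w = w *m duo (delta_mx 0 (rshift m 0)) (delta_mx 0 (rshift m 1)) :> 'rV_D.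
rewrite mul_duo; apply/rowP => j; rewrite !mxE; case:(fintype.splitP j) => k hk.
 rewrite mxE -!(inj_eq val_inj) /= hk !ltn_eqF ?mulr0 ?addr0//.
  by rewrite addn1 ltnS ltnW.
 by rewrite addn0.
rewrite -!(inj_eq val_inj) /= hk !eqn_add2l.
case:k {hk} => [[|[|k]] hk] //=; rewrite ?mulr1 ?mulr0 ?addr0 ?add0r;
 by congr (w _ _); exact:val_inj.
Qed.
End LastCoordinates.

(** * Carrying a constant plane to the normal planes *)

Section NormalTrivialisation.
Context {R : realType} {m' : nat}.
Local Notation m := (2 + m')%N.
Local Notation D := (m + 2)%N.
Context {M : manifold R m}.
Variables (f : smooth_map M (euclidean R D)) (fE : smooth_embedding f) (Mc : closed_manifold M) (p_ : M).
Hypothesis em : ~~ odd m'.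
Variable E : M -> 'M[R]_(m, D).
Hypothesis cE : continuous E.
Hypothesis EA : forall i p, dom i p -> exists2 A, A \in unitmx & E p = A *m locjac f i p.
Local Notation eL := (delta_mx 0 (rshift m 1) : 'rV[R]_D).
Local Notation eK := (delta_mx 0 (rshift m 0) : 'rV[R]_D).
Local Notation Pi := (pid_mx (1 + m) : 'M[R]_(D, 1 + m)).
Local Notation Em := (pid_mx (1 + m) : 'M[R]_(1 + m, D)).
Section WithK.
Variable K : M -> 'M[R]_D.
Hypotheses (cK : continuous K) (KK : forall p, K p *m K p = - Qn f p) (KQ : forall p, K p *m Qn f p = K p).
Variable nu : M -> 'rV[R]_D.
Hypotheses (cnu : continuous nu) (nnu : forall p, nu p != 0) (nuQ : forall p, nu p *m Qn f p = nu p).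

(** B carries eL to nu, so dropping the last coordinate after the inverse of B amounts to working
    modulo nu. There nu K and a tangent frame vector stay independent, so segments join h to the
    image of that vector and thence to - h. *)
Lemma rotated_homot (B : M -> 'M[R]_D) : continuous B -> (forall p, B p \in unitmx) ->
  (forall p, nu p = eL *m B p) ->
 exists h : M -> 'rV_(1 + m), [/\ continuous h, forall p, h p != 0, homot h (fun p => - h p) &
  forall p, exists a, h p *m Em *m B p = nu p *m K p - a *: nu p].
move=>cB uB nuB.
have cIB : continuous (fun p => invmx (B p)) by exact:cont_invmx.
have cnK : continuous (fun p => nu p *m K p) by exact:cont_mulmx.
pose i0 : 'I_m := Ordinal (isT : (0 < m)%N).
pose t1 p : 'rV_D := row i0 (E p).
have ct : continuous t1.
 apply:cont_mx => i j; have -> : (fun p => t1 p i j) = (fun p => E p i0 j) by apply/funext => p; rewrite mxE.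
 exact (cont_coord (@cE)).
have tQ p : t1 p *m Qn f p = 0 by rewrite /t1 -row_mul (frame_Qn fE EA) row0.
have t0 p : t1 p != 0.
 apply/eqP; rewrite /t1 rowE => /(frame_inj fE EA) /matrixP/(_ 0 i0).
 by rewrite !mxE !eqxx => /eqP; rewrite oner_eq0.
pose q p u : 'rV_(1 + m) := u *m invmx (B p) *m Pi.
have cq u : continuous u -> continuous (fun p => q p (u p)).
 move=>cu; apply:cont_mulmx; last exact:cont_cst.
 exact:cont_mulmx.
have qK p u : exists a, q p u *m Em *m B p = u - a *: nu p.
 exists ((u *m invmx (B p)) 0 (rshift m 1)).
 rewrite /q -[_ *m Pi *m Em]mulmxA pid_mx_id//.
 by rewrite pid_mx_last mulmxBl mulmxKV// -scalemxAl -nuB.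
have q0 p a b : q p (a *: (nu p *m K p) + b *: t1 p) = 0 -> a = 0 /\ b = 0.
 move=>h; have [c] := qK p (a *: (nu p *m K p) + b *: t1 p); rewrite h !mul0mx => /esym h2.
 have := congr1 (mulmx^~ (Qn f p)) h2.
 rewrite mulmxBl mulmxDl -!scalemxAl -mulmxA KQ tQ scaler0 addr0 nuQ mul0mx => h3.
 have [ c0 a0] : - c = 0 /\ a = 0 by apply:(rot_indep (nuKK KK nuQ p) (nnu p)); rewrite scaleNr addrC.
 split => //; move/eqP: h2; rewrite a0 scale0r add0r -scaleNr c0 scale0r addr0 scaler_eq0 (negPf (t0 p)) orbF.
 by move/eqP.
have qlin p a b u v : q p (a *: u + b *: v) = a *: q p u + b *: q p v.
 by rewrite /q !mulmxDl -!scalemxAl.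
pose h p := q p (nu p *m K p).
have ch : continuous h by exact:cq.
have hl s : s != 0 -> homot (fun p => s *: h p) (fun p => q p (t1 p)).
 move=>s0; apply:homot_line; [exact:(contZ (@cont_cst _ _ s))|exact:cq|].
 move=>p t t01; apply/eqP => h0; have := q0 p ((1 - t) * s) t.
 rewrite qlin -scalerA h0 => /(_ erefl)[/eqP h1 h2].
 by move: h1; rewrite h2 subr0 mul1r (negPf s0).
exists h; split => //.
- move=>p; apply/eqP => h0; have [] := q0 p 1 0; last by move=> /eqP; rewrite oner_eq0.
 by rewrite scale0r addr0 scale1r.
- apply:(homot_trans).
  apply:(homot_ext _ _ (hl 1 (oner_neq0 _))) => p //; by rewrite scale1r.
 have m1 : (-1 : R) != 0 by rewrite oppr_eq0 oner_eq0.
 apply:homot_sym; apply:(homot_ext _ _ (hl (-1) m1)) => p //; by rewrite scaleN1r.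
- by move=>p; exact:qK.
Qed.

(** Products built in R^(1+m) are extended by the identity on the last coordinate: the extended
    matrix fixes eL. *)
Lemma eprod_pid (A : nat -> M -> 'M[R]_(1 + m)) N p :
 eprod (fun i p => Pi *m A i p *m Em) N p = 1%:M + Pi *m (eprod A N p - 1%:M) *m Em.
elim:N => [|N IH] /=; first by rewrite subrr mulmx0 mul0mx addr0.
rewrite IH; set X := eprod A N p; set Y := A N p.
rewrite mulmxDr mulmx1 -addrA; congr (_ + _).
rewrite mulmxDl mul1mx !mulmxA -[_ *m Em *m Pi]mulmxA pid_mx_K mulmx1.
have -> : X *m (1%:M + Y) - 1%:M = (X - 1%:M) + (Y + (X - 1%:M) *m Y).
 by rewrite mulmxDr mulmx1 mulmxBl mul1mx [Y + _]addrC subrK addrAC.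
have dist (a b c : 'M[R]_(1 + m)) : Pi *m (a + (b + c)) *m Em = Pi *m a *m Em + (Pi *m b *m Em + Pi *m c *m Em).
 by rewrite !mulmxDr !mulmxDl.
by rewrite dist !mulmxA.
Qed.

(** Two successive transports: eL to nu, then eK to nu K modulo nu by a product that fixes eL. The
    multiple of nu left over does no harm, since only the plane matters. *)
Lemma normal_split : exists B : M -> 'M[R]_D, appr f B /\
 forall p, exists a, eL *m B p = nu p /\ eK *m B p = nu p *m K p - a *: nu p.
have eL0 : eL != 0.
 by apply/eqP => /matrixP/(_ 0 (rshift m 1)); rewrite !mxE !eqxx => /eqP; rewrite oner_eq0.
have [w w0 hw] := null_homot fE Mc p_ cnu nnu.
have h1 : homot (fun _ => eL) nu.
 apply:homot_trans (homot_sym hw); exact:homot_cst.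
have d0 k : 0 < (2 * k.+1%:R)^-1 :> R by rewrite invr_gt0 mulr_gt0// ltr0n.
have [N1 [A1 [cA1 sA1 nuB]]] := transport Mc (d0 D) h1.
set B1 := eprod A1 N1 in nuB.
have aB1 : appr f B1 by apply:(appr_eprod fE Mc p_).
have uB1 p : B1 p \in unitmx.
 apply:eprod_unitmx => i iN; have a1 := sA1 i p iN.
 have : D%:R * `|A1 i p| <= D%:R * (2 * D.+1%:R)^-1 by rewrite ler_wpM2l// ltW.
 move=> /le_lt_trans; apply; rewrite ltr_pdivrMr// mul1r -natrM ltr_nat.
 by rewrite mul2n -addnn -addnS ltn_addr.
have cB1 : continuous B1 by have [] := aB1.
have [h [ch nh hN hB]] := rotated_homot cB1 uB1 nuB.
have [nn [ww [cn cw nw]]] := normal_factor fE cK KK KQ cnu nnu nuQ.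
have hS : homot h (fun _ => south).
 apply:(@hopf R m' M f fE Mc p_ _ h ch nh hN) => i x0 rho s r d L rho0 bi [U0 [xl [oU0 U0p _ sxl xlE]]] s2 r0 uL lf gn.
 exact:(no_model fE em cn cw nw rho0 bi oU0 U0p sxl xlE s2 r0 uL gn).
pose eW : 'rV[R]_(1 + m) := delta_mx 0 ord_max.
have eW0 : eW != 0.
 by apply/eqP => /matrixP/(_ 0 ord_max); rewrite !mxE !eqxx => /eqP; rewrite oner_eq0.
have h2 : homot (fun _ => eW) h.
 apply:homot_trans (homot_sym hS); apply:homot_cst => //.
 exact:homot_neq0l (homot_sym hS) p_.
(* Each of the two products with a partial identity may multiply the norm by D.+1; the bound is
   divided accordingly so that the extended factors still meet the one required by [appr_eprod]. *)
pose e2 : R := (2 * D.+1%:R)^-1 / (D.+1%:R * D.+1%:R).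
have e20 : 0 < e2 by rewrite divr_gt0// mulr_gt0// ltr0n.
have [N2 [A2 [cA2 sA2 hB2]]] := transport Mc e20 h2.
pose A3 i p := Pi *m A2 i p *m Em.
have n1 k l : `|pid_mx (1 + m) : 'M[R]_(k, l)| <= 1.
 apply:mx_norm_le => // i j; rewrite mxE; case:(_ && _); by rewrite ?normr1 ?normr0.
have sA3 i p : (i < N2)%N -> `|A3 i p| < (2 * D.+1%:R)^-1.
 move=>iN; have a2 := sA2 i p iN.
 have le1 : ((1 + m)%:R : R) <= D.+1%:R by rewrite ler_nat addn2 add1n; apply:leqW; apply:leqW.
 have b1 : `|Pi *m A2 i p| <= D.+1%:R * (1 * `|A2 i p|).
  apply:le_trans (norm_mulmx _ _) _; apply:ler_pM => //.
  exact:ler_pM; exact:n1.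
 have b2 : `|A3 i p| <= D.+1%:R * (D.+1%:R * (1 * `|A2 i p|) * 1).
  apply:le_trans (norm_mulmx _ _) _; apply:ler_pM => //.
  exact:ler_pM; exact:n1.
 apply:le_lt_trans b2 _; rewrite mulr1 mul1r mulrA mulrC -ltr_pdivlMr//.
have cA3 i : continuous (A3 i).
 by apply:cont_mulmx => //; apply:cont_mulmx.
have aB3 : appr f (eprod A3 N2) by apply:(appr_eprod fE Mc p_).
exists (fun p => eprod A3 N2 p *m B1 p); split; first exact:(appr_mul fE Mc p_ aB3 aB1).
move=>p; have [a ha] := hB p; exists a; split; rewrite mulmxA /A3 eprod_pid mulmxDr mulmx1.
 by rewrite !mulmxA last_pid !mul0mx addr0 -nuB.
rewrite -ha; congr (_ *m _); rewrite -pid_last !mulmxA -[_ *m Em *m Pi]mulmxA pid_mx_K mulmx1.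
by rewrite mulmxBr mulmxBl mulmx1 addrC subrK -hB2.
Qed.

(** G is only close to B, so it carries the constant plane not to the normal plane but to some
    complement of the tangent space, complementarity being an open condition. After the inverse of G
    the tangent space meets the last two coordinates in 0, hence is a graph over the first m. *)
Lemma adapted_splitting : exists G : 'rV_D -> 'M[R]_D, [/\ smooth_on setT G, forall y, G y \in unitmx &
 forall p, lsubmx (E p *m invmx (G (f p))) \in unitmx].
have [B [[cB aB] hB]] := normal_split.
pose Z := duo eK eL; pose W p : 'M[R]_D := col_mx (E p) (Z *m B p).
have uW p : W p \in unitmx.
 apply:inj_unitmx => v; rewrite -[v]hsubmxK mul_row_col mulmxA.
 have [v1 v1E] : exists v1, v1 = (lsubmx v) by exists (lsubmx v).
 have [v2 v2E] : exists v2, v2 = (rsubmx v) by exists (rsubmx v).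
 rewrite -v1E -v2E => h; have [a [hL hK]] := hB p.
 have ZB : v2 *m Z *m B p = (v2 0 1 - a * v2 0 0) *: nu p + v2 0 0 *: (nu p *m K p).
  rewrite /Z mul_duo mulmxDl -!scalemxAl hL hK scalerBr scalerA scalerBl [a * _]mulrC.
  by rewrite addrC addrA addrAC.
 have : v2 *m Z *m B p = 0.
  have := congr1 (mulmx^~ (Qn f p)) h; rewrite mulmxDl -[v1 *m _ *m _]mulmxA (frame_Qn fE EA) mulmx0 add0r mul0mx.
  by rewrite ZB mulmxDl -!scalemxAl nuQ -[nu p *m K p *m _]mulmxA KQ.
 move=>h2; move: h; rewrite h2 addr0 => /(frame_inj fE EA) ->.
 move: h2; rewrite ZB => /(rot_indep (nuKK KK nuQ p) (nnu p))[/eqP + h0].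
 rewrite h0 mulr0 subr0 => /eqP h1'.
 have -> : v2 = 0 by apply:rV2P; rewrite mxE.
 exact:row_mx0.
have cW : continuous W.
 have cZB : continuous (fun p => Z *m B p) by apply:cont_mulmx.
 exact (cont_col_mx (@cE) (@cZB)).
have cIW : continuous (fun p => invmx (W p)) by exact:cont_invmx.
have [C C0 hC] := M_bound fE Mc p_ cIW.
pose c := `|Z| + 1; have c0 : 0 < c by rewrite ltr_wpDl.
pose e := (2 * (D.+1%:R * (D.+1%:R * (D.+1%:R * (c * C)))))^-1.
have e0 : 0 < e by rewrite invr_gt0 !mulr_gt0// ltr0n.
have [G [sG uG hG]] := aB e e0.
exists G; split => // p.
have uW' : (col_mx (E p) (Z *m G (f p)) : 'M[R]_D) \in unitmx.
 pose P : 'M[R]_D := col_mx 0 (Z *m (G (f p) - B p)).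
 have -> : (col_mx (E p) (Z *m G (f p)) : 'M[R]_D) = (1%:M + P *m invmx (W p)) *m W p.
  rewrite mulmxDl mul1mx mulmxKV// /W /P add_col_mx addr0 mulmxBr addrC subrK//.
 rewrite unitmx_mul uW andbT; apply:small_unitmx.
 have bP : `|P| <= D.+1%:R * (c * e).
  have b0 : `|Z *m (G (f p) - B p)| <= D.+1%:R * (c * e).
   apply:le_trans (norm_mulmx _ _) _; apply:ler_pM => //; first by rewrite ler_nat.
   by apply:ler_pM => //; rewrite lerDl.
  have b00 : 0 <= D.+1%:R * (c * e) by rewrite !mulr_ge0// ltW.
  apply:mx_norm_le => // i j; rewrite mxE; case:fintype.split => k.
   by rewrite mxE normr0.
  exact:le_trans (entry_le _ _ _) b0.
 have bPW : `|P *m invmx (W p)| <= D.+1%:R * (D.+1%:R * (c * e) * C).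
  apply:le_trans (norm_mulmx _ _) _; apply:ler_pM => //; first by rewrite ler_nat.
  exact:ler_pM.
 have : D%:R * `|P *m invmx (W p)| <= D.+1%:R * (D.+1%:R * (D.+1%:R * (c * e) * C)).
  by apply:ler_pM => //; rewrite ler_nat.
 move=> /le_lt_trans; apply.
 have -> : D.+1%:R * (D.+1%:R * (D.+1%:R * (c * e) * C)) = 2^-1.
  by rewrite /e; field; rewrite !gt_eqF.
 by rewrite invf_lt1// ltr1n.
apply:inj_unitmx => v vX.
have vE : v *m (E p *m invmx (G (f p))) = rsubmx (v *m (E p *m invmx (G (f p)))) *m Z.
 rewrite -{1}[v *m _]hsubmxK -row_mx0_last; congr row_mx.
 by rewrite -mulmx_lsub.
set w := rsubmx _ in vE.
have h : row_mx v (- w) *m (col_mx (E p) (Z *m G (f p)) : 'M[R]_D) = 0.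
 rewrite mul_row_col mulNmx mulmxA -vE !mulmxA mulmxKV//.
 by rewrite subrr.
have : row_mx v (- w) = 0 :> 'rV_D by rewrite -[LHS](mulmxK uW') h mul0mx.
by rewrite -[RHS]row_mx0 => /eq_row_mx[].
Qed.
End WithK.
End NormalTrivialisation.

(** * The matrix of an almost-complex structure on R^D *)

Section EuclideanACS.
Context {R : realType} {D : nat} (J : almost_complex (euclidean R D)).
Local Notation E := (euclidean R D).
Let tanE (y : E) (u : 'rV_D) : {v : tangent y | v tt = u}.
exact:(cid (@tan_ex R D E y tt u I)). Qed.

Lemma acs_matrix : exists Jm : 'rV_D -> 'M[R]_D, [/\ smooth_on setT Jm,
 forall y, Jm y *m Jm y = - 1%:M & forall (y : E) (v : tangent y), J y v tt = v tt *m Jm y].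
have [G sG GE] := acs_smooth J tt.
have GE' y v : J y v tt = G (y, v tt) by exact:(GE y I v).
have sG' : smooth_on [set: 'rV_D * 'rV_D] G.
 move=>k; apply:Ck_sub (sG k) => -[y u] _; split => //; by exists y.
have Glin y a u v : G (y, a *: u + v) = a *: G (y, u) + G (y, v).
 have [t1 h1] := tanE y u; have [t2 h2] := tanE y v.
 by rewrite -{1}h1 -{1}h2 -tcoordD -GE' linearP tcoordD !GE' h1 h2.
pose Jm y : 'M[R]_D := \matrix_(i, j) G (y, delta_mx 0 i) 0 j.
have GM y u : G (y, u) = u *m Jm y by exact:(linear_rowE (Glin y)).
have JmE y v : J y v tt = v tt *m Jm y by rewrite GE' GM.
exists Jm; split => //.
 move=>k; apply:Ck_mxP => //.
 move=>i j; apply:(@Ck_ext _ _ _ _ _ _ (fun y => G (y, delta_mx 0 i) 0 j)) => //.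
  by move=>y _; rewrite mxE.
 apply:Ck_entry => //.
 apply:Ck_comp.
 - by apply:has_basis_prod; exact:has_basis_mx.
 - exact:openT.
 - exact:openT.
 - by [].
 - apply:Ck_pair => //.
 - exact:sG'.
move=>y; apply/row_matrixP => i; rewrite !rowE.
have [t h] := tanE y (delta_mx 0 i).
by rewrite mulmxA -h -JmE -JmE acs_sqr tcoordN mulmxN mulmx1.
Qed.
End EuclideanACS.

(** * Pseudo-holomorphic embeddings force parallelizability *)

Section PartOne.
Context {R : realType} {m : nat} {M : manifold R m}.
Variables (JM : almost_complex M) (JN : almost_complex (euclidean R (m + 2))).
Variable f : smooth_map M (euclidean R (m + 2)).
Hypothesis Mc : closed_manifold M.
Hypothesis fJ : pseudo_holomorphic_embedding JM JN f.
Variable p_ : M.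
Local Notation X := 'rV[R]_(m + 2).
Let F : M -> X := f.

Lemma parallel_of_holomorphic : parallelizable M.
have [fE hol] := fJ.
have [Jm [sJm JJ JmE]] := acs_matrix JN.
have cJm : continuous Jm by move=>y; exact:(Ck_on0 (sJm 0%N)).
pose J1 p := Jm (F p).
have cF : continuous F by exact:F_cont.
have cJ1 : continuous J1 by exact:compc cF cJm.
have inv i p : dom i p -> locjac f i p *m J1 p *m Qn f p = 0.
 move=>ip; apply/row_matrixP => a; rewrite !rowE !mulmxA mulmx0.
 have [v vi] := tan_ex (delta_mx 0 a) ip.
 have h1 : JM p v i *m locjac f i p = delta_mx 0 a *m locjac f i p *m J1 p.
  by rewrite -(tangent_mapJ f _ ip) (hol p v) JmE (tangent_mapJ f _ ip) vi.
 by rewrite -h1 -mulmxA locjac_Qn// mulmx0.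
(* Tangent spaces are stable under J, so J acts on the quotient by them; realised on normal vectors
   this action is J Q. *)
have QJQ p : Qn f p *m J1 p *m Qn f p = J1 p *m Qn f p.
 have ip := base_indexP p; have h := inv _ p ip.
 rewrite {1}(QnE fE ip) /nproj 2!mulmxBl mul1mx -!mulmxA [locjac f _ p *m (_ *m _)]mulmxA h.
 by rewrite !mulmx0 subr0.
pose K p := J1 p *m Qn f p.
have cQ : continuous (Qn f) by exact:Qn_cont.
have cK : continuous K by exact:cont_mulmx.
have KK p : K p *m K p = - Qn f p.
 by rewrite /K -mulmxA [Qn f p *m _]mulmxA QJQ !mulmxA JJ mulNmx mul1mx.
have KQ p : K p *m Qn f p = K p by rewrite /K -mulmxA Qn_idem.
have [nu [cnu nnu nuQ]] := normal_section fE Mc p_ cK KK KQ.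
have cJt : continuous (fun z : R * M => Jm (z.1 *: F z.2)).
 apply:(compc) => //.
 by apply:contZ; [exact:cont_fst (@cont_id _)|exact:cont_snd cF].
have [G [cG uG GJ]] := cplx_trivial Mc (J := fun t p => Jm (t *: F p)) cJt (fun t p => JJ _).
pose u p := nu p *m invmx (G p).
have cu : continuous u by apply:cont_mulmx => //; exact:cont_invmx.
have nu0 p : u p != 0.
 apply:contra (nnu p) => /eqP h; by rewrite -[nu p](mulmxKV (uG p)) -/(u p) h mul0mx.
have [c c0 hc] := null_homot fE Mc p_ cu nu0.
have [B [cB uB BJ uBE]] := transport_cplx Mc (JJ 0) (homot_sym hc).
pose H p := B p *m G p.
have cH : continuous H by exact:cont_mulmx.
have uH p : H p \in unitmx by rewrite unitmx_mul uB uG.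
have HJ p : Jm 0 *m H p = H p *m J1 p.
 have := GJ p; rewrite scale0r scale1r => h.
 by rewrite /H mulmxA BJ -!mulmxA h.
have nuE p : nu p = c *m H p.
 by rewrite /H mulmxA -uBE /u mulmxKV.
have fN : row_free (duo c (c *m Jm 0)).
 by apply:duo_free c0; rewrite -mulmxA JJ mulmxN mulmx1.
have [C hC] := row_kernel fN.
(* C has kernel the constant complex line of c, and H carries that line to the line of nu. A tangent
   vector killed by Th is a combination of nu and nu J whose projection, a combination of nu and nu
   K, is 0; so Th is injective on tangent vectors. *)
pose Th p := invmx (H p) *m C.
have cTh : continuous Th by apply:cont_mulmx => //; exact:cont_invmx.
apply:(parallelizable_theta fE Mc p_ cTh) => p v vQ; rewrite /Th mulmxA => /hC[w].
rewrite mul_duo => h; have vE : v = w 0 0 *: nu p + w 0 1 *: (nu p *m J1 p).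
 have : v = (v *m invmx (H p)) *m H p by rewrite mulmxKV.
 by rewrite h mulmxDl -!scalemxAl -[c *m Jm 0 *m _]mulmxA HJ mulmxA -!nuE.
have E : w 0 0 *: nu p + w 0 1 *: (nu p *m K p) = 0.
 by move: vQ; rewrite vE mulmxDl -!scalemxAl nuQ -mulmxA.
have [a0 b0] : w 0 0 = 0 /\ w 0 1 = 0.
 by apply:rot_indep E => //; rewrite -mulmxA KK mulmxN nuQ.
by rewrite vE a0 b0 !scale0r addr0.
Qed.
End PartOne.

Lemma complex_mx (R : realType) n : ~~ odd n -> exists J : 'M[R]_n, J *m J = - 1%:M.
move=>on; have -> : n = (n./2 + n./2)%N by rewrite addnn -[LHS]odd_double_half (negPf on).
exists (block_mx 0 1%:M (- 1%:M) 0).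
rewrite mulmx_block !(mulmx0, mul0mx, addr0, add0r) !(mulmx1, mul1mx).
by rewrite [in RHS]scalar_mx_block opp_block_mx !oppr0.
Qed.

(** * Flattening the tangent spaces *)

Section Shear.
Context {R : realType} {m : nat} {M : manifold R m}.
Local Notation D := (m + 2)%N.
Variables (f : smooth_map M (euclidean R D)) (fE : smooth_embedding f) (Mc : closed_manifold M) (p_ : M).
Variable E : M -> 'M[R]_(m, D).
Hypothesis EA : forall i p, dom i p -> exists2 A, A \in unitmx & E p = A *m locjac f i p.
Variable G : 'rV[R]_D -> 'M[R]_D.
Hypotheses (sG : smooth_on setT G) (uG : forall y, G y \in unitmx).
Hypothesis uE : forall p, lsubmx (E p *m invmx (G (f p))) \in unitmx.
Let F : M -> 'rV[R]_D := f.
Let X i x : 'M[R]_m := lsubmx (jac (loc f i) x *m invmx (G (loc f i x))).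
Let Y i x : 'M[R]_(m, 2) := rsubmx (jac (loc f i) x *m invmx (G (loc f i x))).
(** The slope of the tangent space as a graph over the first m coordinates, after the inverse of G.
    It is invariant under a change of tangent frame, hence smooth in every chart although E is only
    continuous. *)
Let c p : 'M[R]_(m, 2) :=
 invmx (lsubmx (E p *m invmx (G (F p)))) *m rsubmx (E p *m invmx (G (F p))).
Let X_unit i p : dom i p -> X i (chart i p) \in unitmx.
move=>ip; have [A uA EE] := EA ip.
have := uE p; rewrite EE -[A *m _ *m _]mulmxA -mulmx_lsub unitmx_mul => /andP[_].
by rewrite /X locK.
Qed.
Let cE i p : dom i p -> c p = invmx (X i (chart i p)) *m Y i (chart i p).
move=>ip; have [A uA EE] := EA ip.
rewrite /c EE -[A *m _ *m _]mulmxA -mulmx_lsub -mulmx_rsub invmx_mulmx//; last first.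
 by have := X_unit ip; rewrite /X locK.
by rewrite /X /Y locK// -!mulmxA mulKmx.
Qed.
Let c_smooth i : smooth_on (chart i @` dom i) (fun x => c (chart_inv i x)).
move=>k; have oi := @codom_open _ _ M i.
have sL : Ck_on k (chart i @` dom i) (fun x => jac (loc f i) x *m invmx (G (loc f i x))).
 apply:Ck_mulmx; first exact:oi.
  by apply:Ck_jac; [exact:oi|exact:F_smooth].
 apply:Ck_invmx; [exact:oi|by move=>x _; exact:uG|].
 apply:Ck_comp => //.
 - exact:has_basis_mx.
 - exact:F_smooth.
apply:(@Ck_ext _ _ _ _ _ _ (fun x => invmx (X i x) *m Y i x)); first exact:oi.
 by move=>x [p ip <-]; rewrite chart_invK// (cE ip).
apply:Ck_mulmx; [exact:oi| |exact:Ck_rsubmx].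
apply:Ck_invmx; [exact:oi| |exact:Ck_lsubmx].
by move=>x [p ip <-]; exact:X_unit.
Qed.

(** The slope is extended by the nearest point projection and a cutoff; the shear with slope - c' is
    invertible whatever its values are, and it lays the graph flat. *)
Lemma flat_field : exists S : 'rV_D -> 'M[R]_D, [/\ smooth_on setT S, forall y, S y \in unitmx &
 forall i p, dom i p -> rsubmx (locjac f i p *m S (F p)) = 0].
have FU : range F `<=` tubU f by move=> _ [p _ <-]; exact:tubU_F.
have oU : open (tubU f) by exact:tubU_open.
have [th [K1 [sth _ [V oV [FV thV]] [K1c K1U] thK1]]] := cutoff (range_compact Mc) oU FU.
have sc := cutoff_smooth sth oU K1c K1U thK1 (tubpi_smooth f Mc p_ c_smooth).
pose c' y := th y *: c (tubpi f Mc p_ y).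
have cF p : c' (F p) = c p.
 by rewrite /c' thV ?scale1r ?tubpiK//; apply:FV; exists p.
pose Sh y : 'M[R]_D := block_mx 1%:M (- c' y) 0 1%:M.
exists (fun y => invmx (G y) *m Sh y); split.
- move=>k; apply:Ck_mulmx => //.
  by apply:Ck_invmx; [exact:openT| |exact:sG].
 apply:Ck_col_mx; first exact:openT.
  apply:Ck_row_mx; [exact:openT|exact:Ck_cst|].
  exact:CkN; exact:sc.
 exact:Ck_cst.
- by move=>y; rewrite unitmx_mul unitmx_inv uG /= unitmxE det_ublock !det1 mulr1 unitr1.
- move=>i p ip; rewrite mulmxA /Sh cF (cE ip).
 have e : locjac f i p *m invmx (G (F p)) = row_mx (X i (chart i p)) (Y i (chart i p)).
  by rewrite /X /Y hsubmxK locK.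
 rewrite e mul_row_block row_mxKr mulmxN mulmx1 mulKVmx ?addNr//; exact:X_unit.
Qed.
End Shear.

Lemma flat_of_parallelizable (R : realType) m' (M : manifold R (2 + m')) (f : smooth_map M (euclidean R (2 + m' + 2)))
  (fE : smooth_embedding f) : closed_manifold M -> M -> ~~ odd m' -> parallelizable M ->
 exists S : 'rV_(2 + m' + 2) -> 'M[R]_(2 + m' + 2), [/\ smooth_on setT S, forall y, S y \in unitmx &
  forall i p, dom i p -> rsubmx (locjac f i p *m S (f p)) = 0].
move=>Mc p_ om par.
have [E [cE EA]] := tangent_frame f par.
have [K [cK KK KQ _]] := normal_rotation fE cE EA.
have [nu [cnu nnu nuQ]] := normal_section fE Mc p_ cK KK KQ.
have [G [sG uG uE]] := @adapted_splitting R m' M f fE Mc p_ om E cE EA K cK KK KQ nu cnu nnu nuQ.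
exact:(flat_field fE Mc p_ EA sG uG uE).
Qed.

(** Any two constant complex structures on R^m and on R^2 serve as the blocks; everything rests on
    the flattening field S. *)
Lemma holomorphic_of_parallelizable (R : realType) m (M : manifold R m) (f : smooth_map M (euclidean R (m + 2)))
  (fE : smooth_embedding f) : closed_manifold M -> ~~ odd m -> parallelizable M ->
 exists (JM : almost_complex M) (J : almost_complex (euclidean R (m + 2))), pseudo_holomorphic_embedding JM J f.
move=>Mc om par; have [Jm JmE] := complex_mx R om; have [J2 J2E] := @complex_mx R 2 isT.
suff [S [sS uS flat]] : exists S : 'rV_(m + 2) -> 'M[R]_(m + 2), [/\ smooth_on setT S, forall y, S y \in unitmx &
  forall i p, dom i p -> rsubmx (locjac f i p *m S (f p)) = 0].
 exact:(holomorphic_of_flat fE sS uS flat JmE J2E).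
have triv : (forall i p, dom i p -> rsubmx (locjac f i p) = 0) ->
  exists S : 'rV_(m + 2) -> 'M[R]_(m + 2), [/\ smooth_on setT S, forall y, S y \in unitmx &
   forall i p, dom i p -> rsubmx (locjac f i p *m S (f p)) = 0].
 move=>h; exists (cst 1%:M); split; [exact:smooth_on_cst|by move=>y; exact:unitmx1|].
 by move=>i p ip; rewrite mulmx1 h.
have [[p_ _]|nM] := pselect (exists p : M, True); last first.
 by apply:triv => i p ip; case:nM; exists p.
(* In dimension 0 the constant field 1 is flat, dimension 1 is excluded by parity, and from
   dimension 2 on there are two coordinates for the complex power map. *)
case:m => [|[|m']] //= in M f fE Mc om par Jm JmE triv p_ *.
 by apply:triv => i p ip; exact:flatmx0.
rewrite negbK in om.
exact:(flat_of_parallelizable fE Mc p_ om par).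
Qed.

Theorem theorem1 (R : realType) (n : nat) (M : manifold R (2 * n)%N)
  (M_closed : closed_manifold M) :
 ((exists (JM : almost_complex M)
      (J : almost_complex (euclidean R (2 * n + 2)%N))
      (f : smooth_map M (euclidean R (2 * n + 2)%N)),
    pseudo_holomorphic_embedding JM J f) ->
  parallelizable M)
 /\
 (parallelizable M ->
  (exists f : smooth_map M (euclidean R (2 * n + 2)%N), smooth_embedding f) ->
  exists (JM : almost_complex M)
     (J : almost_complex (euclidean R (2 * n + 2)%N))
     (f : smooth_map M (euclidean R (2 * n + 2)%N)),
   pseudo_holomorphic_embedding JM J f).
Proof.
split=> [[JM [J [f fJ]]]|par [f fE]].
 (* The constructions use a base point of M, so empty M is treated apart. *)
 have [[p_ _]|nM] := pselect (exists p : M, True); last exact:parallelizable_empty.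
 exact:parallel_of_holomorphic M_closed fJ p_.
have on : ~~ odd (2 * n) by rewrite oddM.
have [JM [J fJ]] := holomorphic_of_parallelizable fE M_closed on par.
by exists JM, J, f.
Qed.
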